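(* Let $\omega>0$. Each of the following conditions is equivalent to the statement that $\Theta_\omega(z)$ is a meromorphic inner function in $\mathbb{C}^+$: (1) $\widehat{\Theta}_\omega f=h_\omega\ast f$ for every $f\in L^2((1,\infty),dx)$, where $(h_\omega\ast f)(x)=\int_0^\infty h_\omega(x/y)f(y)\,\frac{dy}{y}$; (2) $\widehat{\Theta}_\omega f$ vanishes (almost everywhere) on $(0,1)$ for every $f\in L^2((1,\infty),dx)$; (3) $h_\omega\ast f$ belongs to $L^2((0,\infty),dx)$ for every $f\in L^2((1,\infty),dx)$.
   Context: $\xi(s)=\frac12 s(s-1)\pi^{-s/2}\Gamma(s/2)\zeta(s)$ is the Riemann xi-function, and for $\omega>0$, $\Theta_\omega(z)=\xi(\tfrac12-\omega-iz)/\xi(\tfrac12+\omega-iz)$; it is meromorphic on $\mathbb{C}$ and satisfies $|\Theta_\omega(u)|=1$ for $u\in\mathbb{R}$. $\mathbb{C}^+=\{\Im z>0\}$; a meromorphic inner function in $\mathbb{C}^+$ is a function meromorphic on $\mathbb{C}$ which is bounded and analytic in $\mathbb{C}^+$ with $\lim_{v\to0^+}|\Theta(u+iv)|=1$ for a.e. real $u$. The shifted Fourier (Mellin) transform $\mathsf{F}_{1/2}:L^2((0,\infty),dx)\to L^2(\mathbb{R})$, $(\mathsf{F}_{1/2}f)(z)=\int_0^\infty f(x)x^{\frac12+iz}\frac{dx}{x}$ (in the $L^2$ sense), is an isometry up to a constant factor with inverse $(\mathsf{F}_{1/2}^{-1}g)(x)=\frac1{2\pi}\int_{-\infty}^\infty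 g(u)x^{-\frac12-iu}du$. Let $\widehat{\Theta}_\omega=\mathsf{F}_{1/2}^{-1}\Theta_\omega\mathsf{F}_{1/2}$ on $L^2((0,\infty),dx)$, where $\Theta_\omega$ acts by multiplication by $\Theta_\omega(u)$ on $L^2(\mathbb{R})$. For $n\in\mathbb{N}$, $c_\omega(n)=n^{\omega}\sum_{d\mid n}\mu(d)d^{-2\omega}$; $g_\omega(x)=\frac{2\pi^\omega}{\Gamma(\omega)}\big(x^{2-\omega}(1-x^2)^{\omega-1}-\omega x^{\omega-1}\int_{x^2}^1 t^{\frac12-\omega}(1-t)^{\omega-1}dt\big)$ for $0<x<1$, $g_\omega(x)=0$ for $x>1$; and $h_\omega(x)=\frac1x\sum_{n=1}^{\lfloor x\rfloor}c_\omega(n)g_\omega(n/x)$ for $x>1$, $h_\omega(x)=0$ for $0<x<1$. *)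

(* Defs.v *)
Set Warnings "-all".
From HB Require Import structures.
From mathcomp Require Import all_boot all_order all_algebra.
From mathcomp Require Import all_classical all_reals all_analysis.
From mathcomp Require Import complex.
Set Warnings "default".
Import Order.TTheory GRing.Theory Num.Theory.
Import numFieldNormedType.Exports.

Set Implicit Arguments.
Unset Strict Implicit.
Unset Printing Implicit Defensive.

Local Open Scope ring_scope.
Local Open Scope complex_scope.
Local Open Scope classical_set_scope.

Section Defs.
Variable R : realType.
Local Notation C := (R[i]).
Local Notation mu := (@lebesgue_measure R).

(* x^s = exp(s log x) for x > 0 (only used for x > 0) *)
Definition cpow (x : R) (s : C) : C :=
  (x `^ complex.Re s)%:C *
  (cos (complex.Im s * ln x) +i* sin (complex.Im s * ln x)).

Definition CInt (D : set R) (f : R -> C) : C :=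
  (Rintegral mu D (fun x => complex.Re (f x))) +i*
  (Rintegral mu D (fun x => complex.Im (f x))).

Definition Gamma_c (s : C) : C :=
  CInt `]0, +oo[ (fun t => cpow t (s - 1) * (expR (- t))%:C).

Definition zeta_partial (s : C) (N : nat) : C :=
  \sum_(1 <= n < N.+1) cpow n%:R (- s).

(* Complex differentiability of f at z (derivative along 1 with complex
   scalars, i.e. the complex derivative) *)
Definition holo_at (f : C -> C) (z : C) : Prop :=
  derivable (f : C^o -> C^o) (z : C^o) (1 : C^o).

(* X is the Riemann xi-function: X is entire and for Re s > 1,
   X(s) = 1/2 s (s-1) pi^{-s/2} Gamma(s/2) zeta(s), where
   zeta(s) = sum_{n >= 1} n^{-s}.  (xi is the unique entire function with
   this property, by the identity theorem.) *)
Definition is_riemann_xi (X : C -> C) : Prop :=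
  (forall z : C, holo_at X z) /\
  (forall s : C, 1 < complex.Re s ->
     (fun N : nat => ((2^-1 * s * (s - 1) * cpow pi (- (s / 2%:R)) *
                      Gamma_c (s / 2%:R) * zeta_partial s N) : C^o))
       @ \oo --> (X s : C^o)).

Definition ThetaNum (X : C -> C) (w : R) (z : C) : C :=
  X (2^-1 - w%:C - 'i * z).
Definition ThetaDen (X : C -> C) (w : R) (z : C) : C :=
  X (2^-1 + w%:C - 'i * z).
Definition ThetaR (X : C -> C) (w : R) (u : R) : C :=
  ThetaNum X w u%:C / ThetaDen X w u%:C.

(* The meromorphic function Nm/Dn (Nm, Dn entire) is a meromorphic inner
   function in C^+: it is (i.e. extends to) a function F analytic and
   bounded in C^+, and lim_{v -> 0+} |F(u + i v)| = 1 for a.e. real u. *)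
Definition meromorphic_inner (Nm Dn : C -> C) : Prop :=
  exists F : C -> C,
    (forall z : C, 0 < complex.Im z -> holo_at F z) /\
    (exists M : R, forall z : C, 0 < complex.Im z -> Normc.normc (F z) <= M) /\
    (forall z : C, 0 < complex.Im z -> Dn z != 0 -> F z = Nm z / Dn z) /\
    (\forall u \ae mu,
        (fun v : R => Normc.normc (F (u +i* v))) @ 0^'+ --> (1 : R)).

Definition L2on (D : set R) (f : R -> C) : Prop :=
  measurable_fun D (fun x => complex.Re (f x)) /\
  measurable_fun D (fun x => complex.Im (f x)) /\
  (\int[mu]_(x in D) ((Normc.normc (f x)) ^+ 2)%:E < +oo)%E.

Definition L2lim (D : set R) (gN : nat -> R -> C) (g : R -> C) : Prop :=
  L2on D g /\
  (fun N : nat => (\int[mu]_(x in D) ((Normc.normc (gN N x - g x)) ^+ 2)%:E)%E)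
    @ \oo --> (0 : \bar R)%E.

(* f in L^2((1,oo), dx), viewed in L^2((0,oo), dx) by extension by zero *)
Definition L2_one_infty (f : R -> C) : Prop :=
  L2on `]0, +oo[ f /\ (forall x : R, x <= 1 -> f x = 0).

Definition mellin_L2 (f : R -> C) (G : R -> C) : Prop :=
  L2lim setT
    (fun (N : nat) (u : R) =>
       CInt `]N%:R^-1, N%:R[
         (fun x => f x * cpow x (2^-1 + 'i * u%:C) / x%:C)) G.

Definition inv_mellin_L2 (G : R -> C) (k : R -> C) : Prop :=
  L2lim `]0, +oo[
    (fun (N : nat) (x : R) =>
       (2 * pi)^-1%:C *
       CInt `](- N%:R), N%:R[ (fun u => G u * cpow x (- 2^-1 - 'i * u%:C)))
    k.

Definition ThetaHat (X : C -> C) (w : R) (f : R -> C) (k : R -> C) : Prop :=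
  exists G : R -> C,
    mellin_L2 f G /\ inv_mellin_L2 (fun u => ThetaR X w u * G u) k.

Definition moebius (n : nat) : int :=
  if n == 0%N then 0
  else if all (fun p => logn p n == 1%N) (primes n)
       then (-1) ^+ size (primes n) else 0.

Definition c_w (w : R) (n : nat) : R :=
  n%:R `^ w * \sum_(d <- divisors n) (moebius d)%:~R * d%:R `^ (- (2 * w)).

Definition GammaR (w : R) : R :=
  Rintegral mu `]0, +oo[ (fun t => t `^ (w - 1) * expR (- t)).

Definition g_w (w : R) (x : R) : R :=
  if (0 < x) && (x < 1) then
    2 * pi `^ w / GammaR w *
    (x `^ (2 - w) * (1 - x ^+ 2) `^ (w - 1)
     - w * x `^ (w - 1) *
       Rintegral mu `]x ^+ 2, 1[ (fun t => t `^ (2^-1 - w) * (1 - t) `^ (w - 1)))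
  else 0.

Definition h_w (w : R) (x : R) : R :=
  if 1 < x then
    x^-1 * \sum_(1 <= n < (Num.truncn x).+1) c_w w n * g_w w (n%:R / x)
  else 0.

Definition hconv (h : R -> R) (f : R -> C) (x : R) : C :=
  CInt `]0, +oo[ (fun y => (h (x / y))%:C * f y / y%:C).

Definition cond1 (X : C -> C) (w : R) : Prop :=
  forall f : R -> C, L2_one_infty f ->
  forall k : R -> C, ThetaHat X w f k ->
    \forall x \ae mu, 0 < x -> k x = hconv (h_w w) f x.

Definition cond2 (X : C -> C) (w : R) : Prop :=
  forall f : R -> C, L2_one_infty f ->
  forall k : R -> C, ThetaHat X w f k ->
    \forall x \ae mu, 0 < x < 1 -> k x = 0.

Definition cond3 (w : R) : Prop :=
  forall f : R -> C, L2_one_infty f -> L2on `]0, +oo[ (hconv (h_w w) f).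

End Defs.

(* Main.v *)
(** In the variable [t = ln x], with [f] replaced by [f (exp t) exp (t / 2)], the Mellin
    transform becomes the Fourier transform and L^2(1,oo) becomes the space of causal
    functions, those of L^2(R) vanishing for [t <= 0].  By Poisson summation, xi is the
    two-sided Laplace transform of an even kernel [PX] of super-exponential decay.  Hence the
    numerator and the denominator of Theta are Laplace transforms of two kernels [pN] and [pD]
    with Fourier transforms of equal modulus, and the operator multiplies the Fourier transform
    of [f] by their quotient.  Condition (2) says that it preserves causality.

    If Theta is inner, the integral of Theta against the Fourier transforms of a causal [f]
    and of the indicator function of an interval of the negative axis is moved to a line far up
    in the half plane, where it tends to 0; hence the image of [f] is causal.  Conversely, the
    images of the causal exponentials, which are reproducing kernels, give |Theta| <= 1 in the
    upper half plane.

    Let [eta] be the kernel [h_w] in the variable [t].  Moebius inversion for the Dirichlet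
    series of [c_w] and a Beta integral for [g_w] give [MT pD s * MT eta s = MT pN s] on the
    line [Re s = - (w + 3)].  Since causal functions are determined by their Laplace transform
    on a line in the left half plane, a causal image of [f] is the convolution of [eta] with
    [f], and this convolution, as soon as it is in L^2, is the image of [f]. *)

(* The zeros of the denominator of Theta are not controlled, so identities are kept in multiplied
   form, [MT pD s * MT k s = MT pN s * MT f s]. Cancellation rests on one fact: a kernel of
   super-exponential decay that is not null has a Laplace transform whose zeros on any vertical line
   form a null set. The kernel of xi comes from $(x^2g')'$ with $g(x)=e^{-\pi x^2}$. This function
   is even, equal to its Fourier transform and zero at the origin, so Poisson summation gives
   $\Phi(x)=\Phi(1/x)/x$ without correction terms, and its Mellin transform already contains the
   factor $s(s-1)$. Evenness of [PX] is the functional equation; with reality it gives $|\Theta|=1$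
   on the real axis. The line $\Re s=-(w+3)$ is dictated by the crude bound $|c_\omega(n)|\le
   n^{\omega+1}$: with $S=1/2-s$ the Dirichlet series converges absolutely there. Complex analysis
   is reduced to Goursat's theorem on rectangles and to the lower bound $4|f(z)|\le|\oint
   f(t)/(t-z)\,dt|$, which yields the identity theorem that identifies xi. *)
Require Import Defs.
Set Warnings "-all".
From HB Require Import structures.
From mathcomp Require Import all_boot all_order all_algebra.
From mathcomp Require Import all_classical all_reals all_analysis.
From mathcomp Require Import measurable_realfun.
From mathcomp Require Import complex ring lra.
Set Warnings "default".
Import Order.TTheory GRing.Theory Num.Theory.
Import numFieldNormedType.Exports.
Local Open Scope ring_scope.
Local Open Scope complex_scope.
Local Open Scope classical_set_scope.

Set Implicit Arguments.
Unset Strict Implicit.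
Unset Printing Implicit Defensive.

Local Notation normc := Normc.normc.
Local Notation Re := (@complex.Re _).
Local Notation Im := (@complex.Im _).
Local Notation ii := (Complex 0 1).

(** * Complex numbers and complex-valued integrals *)

Section ComplexBasics.
Variable R : realType.
Local Notation C := R[i].
Implicit Types (x y z : C) (a b : R).

Lemma ReD x y : Re (x + y) = Re x + Re y. Proof. by case: x; case: y. Qed.
Lemma ImD x y : Im (x + y) = Im x + Im y. Proof. by case: x; case: y. Qed.
Lemma ReN x : Re (- x) = - Re x. Proof. by case: x. Qed.
Lemma ImN x : Im (- x) = - Im x. Proof. by case: x. Qed.
Lemma ReB x y : Re (x - y) = Re x - Re y. Proof. by rewrite ReD ReN. Qed.
Lemma ImB x y : Im (x - y) = Im x - Im y. Proof. by rewrite ImD ImN. Qed.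
Lemma ReM x y : Re (x * y) = Re x * Re y - Im x * Im y.
Proof. by case: x; case: y. Qed.
Lemma ImM x y : Im (x * y) = Re x * Im y + Im x * Re y.
Proof. by case: x; case: y. Qed.
Lemma ReMr a x : Re (a%:C * x) = a * Re x.
Proof. by rewrite ReM /= mul0r subr0. Qed.
Lemma ImMr a x : Im (a%:C * x) = a * Im x.
Proof. by rewrite ImM /= mul0r addr0. Qed.
Lemma Re_conj x : Re (conjc x) = Re x. Proof. by case: x. Qed.
Lemma Im_conj x : Im (conjc x) = - Im x. Proof. by case: x. Qed.
Definition ReE := (ReB, ReD, ReN, ReMr, ReM, Re_conj).
Definition ImE := (ImB, ImD, ImN, ImMr, ImM, Im_conj).

Lemma complexP x y : Re x = Re y -> Im x = Im y -> x = y.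
Proof. by case: x => a b; case: y => c d /= -> ->. Qed.

Lemma rcD a b : (a + b)%:C = a%:C + b%:C :> C. Proof. exact: rmorphD. Qed.
Lemma rcN a : (- a)%:C = - a%:C :> C. Proof. exact: rmorphN. Qed.
Lemma rcB a b : (a - b)%:C = a%:C - b%:C :> C. Proof. exact: rmorphB. Qed.
Lemma rcM a b : (a * b)%:C = a%:C * b%:C :> C. Proof. exact: rmorphM. Qed.
Lemma rcV a : (a^-1)%:C = a%:C^-1 :> C. Proof. exact: fmorphV. Qed.
Lemma rcX a n : (a ^+ n)%:C = a%:C ^+ n :> C. Proof. exact: rmorphXn. Qed.
Lemma rcnat n : (n%:R : R)%:C = n%:R :> C. Proof. exact: rmorph_nat. Qed.
Lemma rc_eq0 a : (a%:C == 0 :> C) = (a == 0).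
Proof. by rewrite eq_complex /= eqxx andbT. Qed.
Lemma rc_neq0 a : a != 0 -> a%:C != 0 :> C. Proof. by rewrite rc_eq0. Qed.

Lemma normc_ge0 x : 0 <= normc x.
Proof. by case: x => a b /=; rewrite sqrtr_ge0. Qed.
Lemma normcM x y : normc (x * y) = normc x * normc y.
Proof. exact: Normc.normcM. Qed.
Lemma normcD x y : normc (x + y) <= normc x + normc y.
Proof. exact: le_normcD. Qed.
Lemma normcN x : normc (- x) = normc x. Proof. exact: normcN. Qed.
Lemma normcB x y : normc (x - y) <= normc x + normc y.
Proof. by rewrite -(normcN y) normcD. Qed.
Lemma normc_distC x y : normc (x - y) = normc (y - x).
Proof. by rewrite -normcN opprB. Qed.
Lemma normc0 : normc (0 : C) = 0. Proof. exact: Normc.normc0. Qed.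
Lemma normc1 : normc (1 : C) = 1. Proof. exact: Normc.normc1. Qed.
Lemma normcV x : normc x^-1 = (normc x)^-1. Proof. exact: Normc.normcV. Qed.
Lemma normcX x n : normc (x ^+ n) = normc x ^+ n.
Proof.
elim: n => [|n ih]; first by rewrite !expr0 normc1.
by rewrite !exprS normcM ih.
Qed.
Lemma normc_sqr x : normc x ^+ 2 = Re x ^+ 2 + Im x ^+ 2.
Proof. by case: x => a b /=; rewrite sqr_sqrtr // addr_ge0 // sqr_ge0. Qed.
Lemma normc_real a : normc a%:C = `|a|.
Proof. by rewrite /= expr0n /= addr0 sqrtr_sqr. Qed.
Lemma normc_pos a : 0 <= a -> normc a%:C = a.
Proof. by move=> a0; rewrite normc_real ger0_norm. Qed.
Lemma normc_conj x : normc (conjc x) = normc x.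
Proof. by case: x => a b /=; rewrite sqrrN. Qed.
Lemma normc_i : normc (ii : C) = 1.
Proof. by rewrite /= expr0n expr1n /= add0r sqrtr1. Qed.
Lemma normc_eq0 x : (normc x == 0) = (x == 0).
Proof. by apply/eqP/eqP => [/Normc.eq0_normc//|->]; exact: normc0. Qed.
Lemma normc_gt0 x : (0 < normc x) = (x != 0).
Proof. by rewrite lt_def normc_ge0 andbT normc_eq0. Qed.
Lemma Re_le_normc x : `|Re x| <= normc x.
Proof.
rewrite -(@ler_pXn2r _ 2) ?nnegrE ?normc_ge0 ?normr_ge0 // normc_sqr real_normK ?num_real //.
by rewrite lerDl sqr_ge0.
Qed.
Lemma Im_le_normc x : `|Im x| <= normc x.
Proof.
rewrite -(@ler_pXn2r _ 2) ?nnegrE ?normc_ge0 ?normr_ge0 // normc_sqr real_normK ?num_real //.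
by rewrite lerDr sqr_ge0.
Qed.
Lemma normc_le_ReIm x : normc x <= `|Re x| + `|Im x|.
Proof.
rewrite {1}[x]complexE; apply: le_trans (normcD _ _) _.
by rewrite normcM normc_i mul1r !normc_real.
Qed.
Lemma normc_sum (I : Type) (r : seq I) (P : pred I) (f : I -> C) :
  normc (\sum_(i <- r | P i) f i) <= \sum_(i <- r | P i) normc (f i).
Proof.
elim/big_rec2: _ => [|i u v _ h]; first by rewrite normc0.
by apply: le_trans (normcD _ _) _; rewrite lerD2l.
Qed.
Lemma conjcM x y : (conjc (x * y)) = (conjc x) * (conjc y). Proof. exact: rmorphM. Qed.
Lemma conjcD x y : (conjc (x + y)) = (conjc x) + (conjc y). Proof. exact: rmorphD. Qed.
Lemma mul_conjc x : x * (conjc x) = (normc x ^+ 2)%:C.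
Proof. by rewrite normc_sqr; case: x => a b; apply: complexP => /=; ring. Qed.
Lemma normc_dist_le x y : `|normc x - normc y| <= normc (x - y).
Proof.
rewrite ler_norml; apply/andP; split.
  rewrite lerBrDr addrC lerBlDr -{1}(subrK x y) normc_distC addrC.
  by rewrite (le_trans (normcD _ _)) // addrC.
by rewrite lerBlDr -{1}(subrK y x) normcD.
Qed.

Definition cexp z : C := (expR (Re z))%:C * (cos (Im z) +i* sin (Im z)).

Lemma cexpE z : cexp z = (expR (Re z))%:C * (cos (Im z) +i* sin (Im z)).
Proof. by []. Qed.
Lemma cexp0 : cexp 0 = 1.
Proof. by rewrite /cexp /= expR0 cos0 sin0 mul1r. Qed.
Lemma cexpD x y : cexp (x + y) = cexp x * cexp y.
Proof.
rewrite /cexp ReD ImD expRD cosD sinD; apply: complexP.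
  by rewrite ?ReE ?ImE /=; ring.
by rewrite ?ReE ?ImE /=; ring.
Qed.
Lemma cexp_real a : cexp a%:C = (expR a)%:C.
Proof. by rewrite /cexp /= cos0 sin0 mulr1. Qed.
Lemma normc_cexp z : normc (cexp z) = expR (Re z).
Proof.
rewrite /cexp normcM normc_pos ?expR_ge0 //=.
by rewrite cos2Dsin2 sqrtr1 mulr1.
Qed.
Lemma cexp_neq0 z : cexp z != 0.
Proof. by rewrite -normc_gt0 normc_cexp expR_gt0. Qed.
Lemma cexpN z : cexp (- z) = (cexp z)^-1.
Proof.
have h : cexp (- z) * cexp z = 1 by rewrite -cexpD addNr cexp0.
by rewrite -[LHS](mulfK (cexp_neq0 z)) h mul1r.
Qed.
Lemma cexp_conj z : (conjc (cexp z)) = cexp (conjc z).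
Proof.
by rewrite /cexp Re_conj Im_conj cosN sinN; apply: complexP; rewrite ?ReE ?ImE /=; ring.
Qed.
Lemma cexpMn z n : cexp (n%:R * z) = cexp z ^+ n.
Proof.
elim: n => [|n ih]; first by rewrite mul0r cexp0 expr0.
by rewrite exprS -ih -cexpD -natr1 mulrDl mul1r addrC.
Qed.

Lemma cpowE a z : 0 < a -> cpow a z = cexp ((ln a)%:C * z).
Proof.
move=> a0; rewrite /cpow /cexp ReMr ImMr /powR gt_eqF // (mulrC (Im z)).
by rewrite (mulrC (Re z)).
Qed.

Lemma sqr_normc_i (a b : R) : normc (a +i* b) ^+ 2 = a ^+ 2 + b ^+ 2.
Proof. by rewrite normc_sqr. Qed.

End ComplexBasics.

#[global] Arguments Normc.normc : simpl never.
#[global] Opaque cexp.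

(** * Measurability and integration of complex-valued functions *)

Section ComplexIntegral.
Variable R : realType.
Local Notation C := R[i].
Context d (T : measurableType d).
Implicit Types (f g : T -> C) (mu : {measure set T -> \bar R}).

Definition cmeas f := measurable_fun setT (fun x => Re (f x)) /\
                      measurable_fun setT (fun x => Im (f x)).
Definition rin mu (g : T -> R) := mu.-integrable setT (fun x => (g x)%:E).
(** Integrability is carried by the modulus, so that each domination argument is one real
    inequality; measurability is kept component by component. *)
Definition cin mu f := cmeas f /\ rin mu (fun x => normc (f x)).
(** A divergent integral takes the default value produced by [fine]; this is why additivity and
    scaling below carry integrability hypotheses. *)
Definition rI mu (g : T -> R) : R := Rintegral mu setT g.
Definition cI mu f : C := rI mu (fun x => Re (f x)) +i* rI mu (fun x => Im (f x)).

Lemma cmeas_ext f g : (forall x, f x = g x) -> cmeas f -> cmeas g.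
Proof. by move=> h; have -> : f = g by apply/funext. Qed.
Lemma cmeas_cst c : cmeas (fun=> c).
Proof. by split; exact: measurable_cst. Qed.
Lemma cmeasD f g : cmeas f -> cmeas g -> cmeas (fun x => f x + g x).
Proof.
move=> [f1 f2] [g1 g2]; split; [under eq_fun do rewrite ReD|under eq_fun do rewrite ImD];
exact: measurable_funD.
Qed.
Lemma cmeasN f : cmeas f -> cmeas (fun x => - f x).
Proof.
move=> [f1 f2]; split; [under eq_fun do rewrite ReN|under eq_fun do rewrite ImN];
exact: measurableT_comp.
Qed.
Lemma cmeasB f g : cmeas f -> cmeas g -> cmeas (fun x => f x - g x).
Proof. by move=> mf mg; apply: cmeasD => //; exact: cmeasN. Qed.
Lemma cmeasM f g : cmeas f -> cmeas g -> cmeas (fun x => f x * g x).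
Proof.
move=> [f1 f2] [g1 g2]; split; [under eq_fun do rewrite ReM|under eq_fun do rewrite ImM].
  by apply: measurable_funB; apply: measurable_funM.
by apply: measurable_funD; apply: measurable_funM.
Qed.
Lemma cmeas_conj f : cmeas f -> cmeas (fun x => (conjc (f x))).
Proof.
move=> [f1 f2]; split; [under eq_fun do rewrite Re_conj|under eq_fun do rewrite Im_conj] => //.
exact: measurableT_comp.
Qed.
Lemma cmeas_real (g : T -> R) : measurable_fun setT g -> cmeas (fun x => (g x)%:C).
Proof. by move=> mg; split => //=; exact: measurable_cst. Qed.
Lemma cmeas_normc f : cmeas f -> measurable_fun setT (fun x => normc (f x)).
Proof.
move=> [f1 f2]; rewrite (_ : (fun _ => _) = (fun x => Num.sqrt (Re (f x) ^+ 2 + Im (f x) ^+ 2))).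
  apply: (@measurableT_comp _ _ _ _ _ _ (@Num.sqrt R)).
    by apply: continuous_measurable_fun; exact: sqrt_continuous.
  by apply: measurable_funD; exact: measurable_funX.
by apply/funext => x; case: (f x).
Qed.
Lemma cmeas_sum (I : Type) (r : seq I) (F : I -> T -> C) :
  (forall i, cmeas (F i)) -> cmeas (fun x => \sum_(i <- r) F i x).
Proof.
move=> mF; elim: r => [|i r ih].
  by under eq_fun do rewrite big_nil; exact: cmeas_cst.
by under eq_fun do rewrite big_cons; exact: cmeasD.
Qed.
Lemma cmeas_cexp f : cmeas f -> cmeas (fun x => cexp (f x)).
Proof.
move=> [f1 f2]; under eq_fun do rewrite cexpE; apply: cmeasM.
  by apply: cmeas_real; apply: measurableT_comp => //; exact: measurable_expR.
split => /=.
  by apply: (@measurableT_comp _ _ _ _ _ _ (@cos R)) => //;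
    apply: continuous_measurable_fun; exact: continuous_cos.
by apply: (@measurableT_comp _ _ _ _ _ _ (@sin R)) => //;
    apply: continuous_measurable_fun; exact: continuous_sin.
Qed.
Lemma cmeas_cvg (F : nat -> T -> C) f : (forall n, cmeas (F n)) ->
  (forall x, (fun n => Re (F n x)) @ \oo --> Re (f x)) ->
  (forall x, (fun n => Im (F n x)) @ \oo --> Im (f x)) -> cmeas f.
Proof.
move=> mF h1 h2; split.
  by apply: (@measurable_fun_cvg _ _ _ setT (fun n x => Re (F n x))) => // n; case: (mF n).
by apply: (@measurable_fun_cvg _ _ _ setT (fun n x => Im (F n x))) => // n; case: (mF n).
Qed.

Variable mu : {measure set T -> \bar R}.

Lemma rin_meas (g : T -> R) : rin mu g -> measurable_fun setT g.
Proof. by move=> /measurable_int /measurable_EFinP. Qed.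

Lemma rin_le (g h : T -> R) : measurable_fun setT g -> rin mu h ->
  (forall x, `|g x| <= h x) -> rin mu g.
Proof.
move=> mg ih gh; apply: le_integrable ih => //; first exact/measurable_EFinP.
by move=> x _ /=; rewrite lee_fin; apply: le_trans (gh x) (ler_norm _).
Qed.
Lemma rinD (g h : T -> R) : rin mu g -> rin mu h -> rin mu (fun x => g x + h x).
Proof. by move=> ig ih; rewrite /rin; under eq_fun do rewrite EFinD; exact: integrableD. Qed.
Lemma rinZ a (g : T -> R) : rin mu g -> rin mu (fun x => a * g x).
Proof. by move=> ig; rewrite /rin; under eq_fun do rewrite EFinM; exact: integrableZl. Qed.
Lemma rin0 : rin mu (fun=> 0).
Proof. exact: integrable0. Qed.
Lemma rI_def (g : T -> R) : rI mu g = fine (\int[mu]_x (g x)%:E)%E.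
Proof. by []. Qed.
Lemma rID (g h : T -> R) : rin mu g -> rin mu h ->
  rI mu (fun x => g x + h x) = rI mu g + rI mu h.
Proof. by move=> ig ih; exact: RintegralD. Qed.
Lemma rIZ a (g : T -> R) : rin mu g -> rI mu (fun x => a * g x) = a * rI mu g.
Proof. by move=> ig; exact: RintegralZl. Qed.
Lemma rIN (g : T -> R) : rin mu g -> rI mu (fun x => - g x) = - rI mu g.
Proof.
move=> ig; rewrite -mulN1r -rIZ //; congr rI; apply/funext => x; by rewrite mulN1r.
Qed.
Lemma rI_le (g h : T -> R) : rin mu g -> rin mu h -> (forall x, g x <= h x) ->
  rI mu g <= rI mu h.
Proof. by move=> ig ih gh; apply: le_Rintegral => // x _; exact: gh. Qed.
Lemma rI_ge0 (g : T -> R) : (forall x, 0 <= g x) -> 0 <= rI mu g.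
Proof. by move=> g0; apply: Rintegral_ge0 => x _. Qed.
Lemma rIE (g : T -> R) : rin mu g -> (\int[mu]_x (g x)%:E)%E = (rI mu g)%:E.
Proof. by move=> ig; rewrite fineK //; exact: integrable_fin_num. Qed.
Lemma rinP (g : T -> R) : measurable_fun setT g -> (forall x, 0 <= g x) ->
  (\int[mu]_x (g x)%:E < +oo)%E -> rin mu g.
Proof.
move=> mg g0 h; apply/integrableP; split; first exact/measurable_EFinP.
by under eq_integral do rewrite gee0_abs ?lee_fin //.
Qed.
Lemma rin_lt (g : T -> R) : rin mu g -> (\int[mu]_x (g x)%:E < +oo)%E.
Proof. by move=> ig; rewrite rIE // ltry. Qed.

Lemma cin_meas f : cin mu f -> cmeas f. Proof. by case. Qed.
Lemma cin_norm f : cin mu f -> rin mu (fun x => normc (f x)). Proof. by case. Qed.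
Lemma cin_Re f : cin mu f -> rin mu (fun x => Re (f x)).
Proof. by move=> [[m1 m2] i]; apply: rin_le i _ => // x; exact: Re_le_normc. Qed.
Lemma cin_Im f : cin mu f -> rin mu (fun x => Im (f x)).
Proof. by move=> [[m1 m2] i]; apply: rin_le i _ => // x; exact: Im_le_normc. Qed.
Lemma cin_le (g : T -> R) f : cmeas f -> rin mu g -> (forall x, normc (f x) <= g x) -> cin mu f.
Proof.
move=> mf ig fg; split => //; apply: rin_le ig _; first exact: cmeas_normc.
by move=> x; rewrite ger0_norm ?normc_ge0.
Qed.
Lemma cin_ext f g : (forall x, f x = g x) -> cin mu f -> cin mu g.
Proof. by move=> h; have -> : f = g by apply/funext. Qed.
Lemma cin0 : cin mu (fun=> 0).
Proof. by apply: (cin_le (cmeas_cst 0) rin0) => x; rewrite normc0. Qed.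
Lemma cinD f g : cin mu f -> cin mu g -> cin mu (fun x => f x + g x).
Proof.
move=> [mf f1] [mg g1]; apply: (cin_le _ (rinD f1 g1)); first exact: cmeasD.
by move=> x; exact: normcD.
Qed.
Lemma cinZ c f : cin mu f -> cin mu (fun x => c * f x).
Proof.
move=> [mf f1]; apply: (cin_le _ (rinZ (normc c) f1)); first by apply: cmeasM => //; exact: cmeas_cst.
by move=> x; rewrite normcM.
Qed.
Lemma cinN f : cin mu f -> cin mu (fun x => - f x).
Proof. by move=> /(cinZ (-1)); apply: cin_ext => x; rewrite mulN1r. Qed.
Lemma cinB f g : cin mu f -> cin mu g -> cin mu (fun x => f x - g x).
Proof. by move=> h1 h2; apply: cinD => //; exact: cinN. Qed.
Lemma cin_conj f : cin mu f -> cin mu (fun x => (conjc (f x))).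
Proof.
move=> [mf f1]; split; first exact: cmeas_conj.
by under eq_fun do rewrite normc_conj.
Qed.
Lemma cin_sum (I : Type) (r : seq I) (F : I -> T -> C) :
  (forall i, cin mu (F i)) -> cin mu (fun x => \sum_(i <- r) F i x).
Proof.
move=> mF; elim: r => [|i r ih].
  by under eq_fun do rewrite big_nil; exact: cin0.
by under eq_fun do rewrite big_cons; exact: cinD.
Qed.
Lemma cin_bM (M : R) f g : cmeas f -> (forall x, normc (f x) <= M) -> cin mu g ->
  cin mu (fun x => f x * g x).
Proof.
move=> mf fM [mg ig]; apply: (cin_le _ (rinZ M ig)); first exact: cmeasM.
by move=> x; rewrite normcM ler_wpM2r ?normc_ge0.
Qed.
Lemma cin_Mb (M : R) f g : cin mu f -> cmeas g -> (forall x, normc (g x) <= M) ->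
  cin mu (fun x => f x * g x).
Proof. by move=> hf mg gM; under eq_fun do rewrite mulrC; exact: (cin_bM mg gM). Qed.
Lemma cin_real (g : T -> R) : rin mu g -> cin mu (fun x => (g x)%:C).
Proof.
move=> ig; have mg := rin_meas ig; split; first exact: cmeas_real.
under eq_fun do rewrite normc_real.
exact: integrable_norm.
Qed.

Lemma cI_ext f g : (forall x, f x = g x) -> cI mu f = cI mu g.
Proof. by move=> h; have -> : f = g by apply/funext. Qed.
Lemma cI0 : cI mu (fun=> 0) = 0.
Proof.
rewrite /cI /= /rI; have -> : (fun _ : T => 0 : R) = cst 0 by [].
by rewrite Rintegral_cst // mul0r.
Qed.
Lemma cID f g : cin mu f -> cin mu g -> cI mu (fun x => f x + g x) = cI mu f + cI mu g.
Proof.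
move=> hf hg; rewrite /cI; under eq_fun do rewrite ReD.
under [X in _ +i* rI _ X]eq_fun do rewrite ImD.
by rewrite !rID //; first [exact: cin_Re|exact: cin_Im].
Qed.
Lemma cIZ c f : cin mu f -> cI mu (fun x => c * f x) = c * cI mu f.
Proof.
move=> hf; have [h1 h2] := (cin_Re hf, cin_Im hf); rewrite /cI.
have -> : (fun x => Re (c * f x)) = (fun x => Re c * Re (f x) + (- Im c) * Im (f x)).
  by apply/funext => x; rewrite ReM mulNr.
have -> : (fun x => Im (c * f x)) = (fun x => Re c * Im (f x) + Im c * Re (f x)).
  by apply/funext => x; rewrite ImM.
rewrite !rID; try exact: rinZ.
rewrite !rIZ //; apply: complexP; rewrite ?ReM ?ImM /=; ring.
Qed.
Lemma cIZr c f : cin mu f -> cI mu (fun x => f x * c) = cI mu f * c.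
Proof. by move=> hf; rewrite mulrC -cIZ //; apply: cI_ext => x; rewrite mulrC. Qed.
Lemma cIN f : cin mu f -> cI mu (fun x => - f x) = - cI mu f.
Proof. by move=> hf; rewrite -mulN1r -cIZ //; apply: cI_ext => x; rewrite mulN1r. Qed.
Lemma cIB f g : cin mu f -> cin mu g -> cI mu (fun x => f x - g x) = cI mu f - cI mu g.
Proof. by move=> hf hg; rewrite cID ?cIN //; exact: cinN. Qed.
Lemma cI_sum (I : Type) (r : seq I) (F : I -> T -> C) : (forall i, cin mu (F i)) ->
  cI mu (fun x => \sum_(i <- r) F i x) = \sum_(i <- r) cI mu (F i).
Proof.
move=> mF; elim: r => [|i r ih].
  by rewrite big_nil -[RHS]cI0; apply: cI_ext => x; rewrite big_nil.
rewrite big_cons -ih -cID //; last exact: cin_sum.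
by apply: cI_ext => x; rewrite big_cons.
Qed.
Lemma cI_conj f : cin mu f -> cI mu (fun x => (conjc (f x))) = (conjc (cI mu f)).
Proof.
move=> hf; rewrite /cI /=; under eq_fun do rewrite Re_conj; congr (_ +i* _).
by under eq_fun do rewrite Im_conj; rewrite rIN //; exact: cin_Im.
Qed.
Lemma cI_real (g : T -> R) : cI mu (fun x => (g x)%:C) = (rI mu g)%:C.
Proof.
rewrite /cI /=; congr (_ +i* _); have -> : (fun _ : T => 0 : R) = cst 0 by [].
by rewrite /rI Rintegral_cst // mul0r.
Qed.

(* Rotating by the phase of [cI mu f] reduces the bound to the real part. *)
Lemma normc_cI f : cin mu f -> normc (cI mu f) <= rI mu (fun x => normc (f x)).
Proof.
move=> hf; have [->|n0] := eqVneq (cI mu f) 0.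
  by rewrite normc0; apply: rI_ge0 => x; exact: normc_ge0.
set I := cI mu f in n0 *; have h : cI mu (fun x => (conjc I) * f x) = (conjc I) * I by rewrite cIZ.
have h2 : normc I ^+ 2 = rI mu (fun x => Re ((conjc I) * f x)).
  by have := congr1 (@complex.Re R) h; rewrite mulrC mul_conjc /= => ->.
have h3 : normc I ^+ 2 <= normc I * rI mu (fun x => normc (f x)).
  rewrite h2 -rIZ; last by case: hf.
  apply: rI_le; first by apply: cin_Re; exact: cinZ.
    by apply: rinZ; case: hf.
  move=> x; apply: le_trans (ler_norm _) _; apply: le_trans (Re_le_normc _) _.
  by rewrite normcM normc_conj.
by move: h3; rewrite expr2 ler_pM2l // normc_gt0.
Qed.
Lemma normc_cI_le f (g : T -> R) : cin mu f -> rin mu g -> (forall x, normc (f x) <= g x) ->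
  normc (cI mu f) <= rI mu g.
Proof.
move=> hf hg fg; apply: le_trans (normc_cI hf) _; apply: rI_le => //; exact: cin_norm.
Qed.

Lemma rI_ae (g h : T -> R) : measurable_fun setT g -> measurable_fun setT h ->
  (\forall x \ae mu, g x = h x) -> rI mu g = rI mu h.
Proof.
move=> mg mh gh; congr fine; apply: ae_eq_integral => //; try exact/measurable_EFinP.
by apply: filterS gh => x /= -> _.
Qed.
Lemma cI_ae f g : cmeas f -> cmeas g -> (\forall x \ae mu, f x = g x) -> cI mu f = cI mu g.
Proof.
move=> [m1 m2] [m3 m4] h; rewrite /cI; congr (_ +i* _); apply: rI_ae => //.
  by apply: filterS h => x /= ->.
by apply: filterS h => x /= ->.
Qed.
Lemma rin_ae (g h : T -> R) : measurable_fun setT h -> (\forall x \ae mu, g x = h x) ->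
  rin mu g -> rin mu h.
Proof.
move=> mh gh ig; apply/integrableP; split; first exact/measurable_EFinP.
have /integrableP[mg] := ig; rewrite [in X in X -> _](ae_eq_integral (fun x => `|(h x)%:E|)%E) //.
- exact: measurableT_comp.
- by apply: measurableT_comp => //; exact/measurable_EFinP.
- by apply: filterS gh => x /= -> _.
Qed.
Lemma cin_ae f g : cmeas g -> (\forall x \ae mu, f x = g x) -> cin mu f -> cin mu g.
Proof.
move=> mg fg [mf hf]; split => //; apply: rin_ae hf; first exact: cmeas_normc.
by apply: filterS fg => x /= ->.
Qed.
Lemma cin_ReIm f : rin mu (fun x => Re (f x)) -> rin mu (fun x => Im (f x)) -> cin mu f.
Proof.
move=> h1 h2; have [m1 m2] := (rin_meas h1, rin_meas h2).
apply: (@cin_le (fun x => `|Re (f x)| + `|Im (f x)|)) => //.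
  by apply: rinD; exact: integrable_norm.
by move=> x; exact: normc_le_ReIm.
Qed.

End ComplexIntegral.

#[global] Arguments cI : simpl never.
#[global] Arguments rI : simpl never.

(** * Convergence of complex sequences *)

Section ComplexSequences.
Variable R : realType.
Local Notation C := R[i].
Implicit Types (u v : nat -> C) (a b : C).

(** Real distances replace the topology of [R[i]], whose radii are complex numbers, so that
    squeezing and order arguments stay in [R]. *)
Definition ccvg u a := (fun n => normc (u n - a)) @ \oo --> (0 : R).

Lemma cvg0_squeeze (x y : nat -> R) : (forall n, 0 <= x n <= y n) ->
  y @ \oo --> (0 : R) -> x @ \oo --> (0 : R).
Proof.
move=> h hy; apply: (@squeeze_cvgr _ _ _ _ (fun=> 0) y) => //; last exact: cvg_cst.
by apply: nearW => n; exact: h.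
Qed.
Lemma cvg0_const_mul (x : nat -> R) c : x @ \oo --> (0 : R) -> (fun n => c * x n) @ \oo --> (0 : R).
Proof. by move=> h; rewrite -[X in _ --> X](mulr0 c); exact: cvgMl_tmp. Qed.
Lemma cvg0_add (x y : nat -> R) : x @ \oo --> (0 : R) -> y @ \oo --> (0 : R) ->
  (fun n => x n + y n) @ \oo --> (0 : R).
Proof. by move=> h1 h2; rewrite -[X in _ --> X](addr0 0); exact: cvgD. Qed.

Lemma ccvg_le (e : nat -> R) u a : (forall n, normc (u n - a) <= e n) ->
  e @ \oo --> (0 : R) -> ccvg u a.
Proof. by move=> h; apply: cvg0_squeeze => n; rewrite normc_ge0 /=. Qed.
Lemma ccvg_cst a : ccvg (fun=> a) a.
Proof. by apply: (@ccvg_le (fun=> 0)) => [n|]; [rewrite subrr normc0|exact: cvg_cst]. Qed.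
Lemma ccvg_ext u v a : (forall n, u n = v n) -> ccvg u a -> ccvg v a.
Proof. by move=> h; have -> : u = v by apply/funext. Qed.
Lemma ccvg_eventually u a N : (forall n, (N <= n)%N -> u n = a) -> ccvg u a.
Proof.
move=> h; apply: cvg_near_cst; exists N => // n /= Nn.
by rewrite h // subrr normc0.
Qed.
Lemma ccvgD u v a b : ccvg u a -> ccvg v b -> ccvg (fun n => u n + v n) (a + b).
Proof.
move=> h1 h2; apply: (ccvg_le _ (cvg0_add h1 h2)) => n.
by rewrite opprD addrACA normcD.
Qed.
Lemma ccvgZ c u a : ccvg u a -> ccvg (fun n => c * u n) (c * a).
Proof.
move=> h1; apply: (ccvg_le _ (cvg0_const_mul (normc c) h1)) => n.
by rewrite -mulrBr normcM.
Qed.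
Lemma ccvgN u a : ccvg u a -> ccvg (fun n => - u n) (- a).
Proof. by move=> h; rewrite -mulN1r; apply: (ccvg_ext _ (ccvgZ (-1) h)) => n; rewrite mulN1r. Qed.
Lemma ccvgB u v a b : ccvg u a -> ccvg v b -> ccvg (fun n => u n - v n) (a - b).
Proof. by move=> h1 h2; apply: ccvgD => //; exact: ccvgN. Qed.
Lemma ccvg_norm u a : ccvg u a -> (fun n => normc (u n)) @ \oo --> normc a.
Proof.
move=> h; apply/subr_cvg0/norm_cvg0P; apply: (cvg0_squeeze _ h) => n.
by rewrite normr_ge0 normc_dist_le.
Qed.
Lemma ccvg_uniq u a b : ccvg u a -> ccvg u b -> a = b.
Proof.
move=> h1 h2; have := ccvgB h1 h2; under eq_fun do rewrite subrr.
move=> /ccvg_norm; rewrite normc0 => h.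
have : normc (a - b) = 0 by apply: (cvg_unique _ h (cvg_cst _)); exact: norm_hausdorff.
by move=> /eqP; rewrite normc_eq0 subr_eq0 => /eqP.
Qed.
Lemma ccvgM u v a b : ccvg u a -> ccvg v b -> ccvg (fun n => u n * v n) (a * b).
Proof.
move=> h1 h2.
have h : (fun n => normc (u n - a) * normc (v n) + normc a * normc (v n - b)) @ \oo --> (0 : R).
  apply: cvg0_add; last exact: cvg0_const_mul.
  by rewrite -[X in _ --> X](mul0r (normc b)); apply: cvgM => //; exact: ccvg_norm.
apply: (ccvg_le _ h) => n; rewrite -!normcM; apply: le_trans (normcD _ _).
by rewrite mulrBr mulrBl addrA subrK.
Qed.
Lemma ccvg_bound u a (M : R) : ccvg u a -> (forall n, normc (u n) <= M) -> normc a <= M.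
Proof.
move=> /ccvg_norm h hM; rewrite -(cvg_lim _ h) //; apply: limr_le; first by apply/cvg_ex; exists (normc a).
exact: nearW.
Qed.
Lemma ccvgP u a : ccvg u a <->
  ((fun n => Re (u n)) @ \oo --> Re a /\ (fun n => Im (u n)) @ \oo --> Im a).
Proof.
split=> [h|[h1 h2]].
  split; apply/subr_cvg0/norm_cvg0P; apply: (cvg0_squeeze _ h) => n; rewrite normr_ge0 /=.
    by rewrite -ReB; exact: Re_le_normc.
  by rewrite -ImB; exact: Im_le_normc.
have k1 : (fun n => `|Re (u n) - Re a|) @ \oo --> (0 : R).
  by apply/norm_cvg0P/subr_cvg0.
have k2 : (fun n => `|Im (u n) - Im a|) @ \oo --> (0 : R).
  by apply/norm_cvg0P/subr_cvg0.
apply: (ccvg_le _ (cvg0_add k1 k2)) => n.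
by apply: le_trans (normc_le_ReIm _) _; rewrite ReB ImB.
Qed.
End ComplexSequences.

Section Convergence.
Variable R : realType.
Local Notation C := R[i].
Context d (T : measurableType d) (mu : {measure set T -> \bar R}).

Lemma rI_dct (F : nat -> T -> R) (f g : T -> R) : (forall n, measurable_fun setT (F n)) ->
  measurable_fun setT f ->
  (\forall x \ae mu, (fun n => F n x) @ \oo --> f x) -> rin mu g ->
  (forall n x, `|F n x| <= g x) ->
  rin mu f /\ (fun n => rI mu (F n)) @ \oo --> rI mu f.
Proof.
move=> mF mf Ff ig Fg.
have [i1 _ h] : [/\ mu.-integrable setT (fun x => (f x)%:E),
  (fun n => \int[mu]_(x in setT) (`|(F n x)%:E - (f x)%:E|))%E @ \oo --> 0%E &
  (fun n => \int[mu]_(x in setT) (F n x)%:E)%E @ \oo --> (\int[mu]_(x in setT) (f x)%:E)%E].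
  apply: (@dominated_convergence _ _ _ mu setT measurableT (fun n x => (F n x)%:E)
    (fun x => (f x)%:E) (fun x => (g x)%:E)) => //.
  - by move=> n; exact/measurable_EFinP.
  - exact/measurable_EFinP.
  - by apply: filterS Ff => x h _; apply: cvg_EFin => //; exact: nearW.
  - by apply: aeW => x n _; rewrite lee_fin.
split => //; have iF n : rin mu (F n) by apply: rin_le ig _.
move: h; rewrite rIE // => h.
exact: (fine_cvg h).
Qed.

Lemma cI_dct (F : nat -> T -> C) (f : T -> C) (g : T -> R) : (forall n, cmeas (F n)) -> cmeas f ->
  (\forall x \ae mu, ccvg (fun n => F n x) (f x)) -> rin mu g ->
  (forall n x, normc (F n x) <= g x) ->
  cin mu f /\ ccvg (fun n => cI mu (F n)) (cI mu f).
Proof.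
move=> mF [m1 m2] Ff ig Fg.
have [||i1 h1] := rI_dct (fun n => proj1 (mF n)) m1 _ ig.
- by apply: filterS Ff => x /ccvgP[].
- by move=> n x; apply: le_trans (Fg n x); exact: Re_le_normc.
have [||i2 h2] := rI_dct (fun n => proj2 (mF n)) m2 _ ig.
- by apply: filterS Ff => x /ccvgP[].
- by move=> n x; apply: le_trans (Fg n x); exact: Im_le_normc.
by split; [exact: cin_ReIm|apply/ccvgP].
Qed.

End Convergence.

(** * Fubini's theorem for real and complex integrands *)

Section ComplexFubini.
Variable R : realType.
Local Notation C := R[i].
Context d1 d2 (T1 : measurableType d1) (T2 : measurableType d2).
Variables (m1 : {sigma_finite_measure set T1 -> \bar R}) (m2 : {sigma_finite_measure set T2 -> \bar R}).

(** An integrable function is finite almost everywhere, so the inner integrals of Fubini's theorem,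
    valued in the extended reals, can be replaced by their finite parts without changing the outer
    integral. *)
Lemma rI_fine (h : T1 -> \bar R) (g : T1 -> R) : m1.-integrable setT h ->
  measurable_fun setT g -> (\forall x \ae m1, g x = fine (h x)) ->
  rin m1 g /\ (\int[m1]_x h x)%E = (rI m1 g)%:E.
Proof.
move=> ih mg gh.
have e : ae_eq m1 setT h (fun x => (g x)%:E).
  have := integrable_ae measurableT ih.
  apply: filterS2 gh => x hx + _ => /(_ I) hf.
  by rewrite hx fineK.
have mh := measurable_int _ ih.
have mg' : measurable_fun setT (fun x => (g x)%:E) by exact/measurable_EFinP.
have ig : rin m1 g.
  apply/integrableP; split => //; have /integrableP[_] := ih.
  rewrite [in X in X -> _](ae_eq_integral (fun x => `|(g x)%:E|)%E) //; try exact: measurableT_comp.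
  by apply: filterS e => x /= hx /hx ->.
by split => //; rewrite (ae_eq_integral (fun x => (g x)%:E)) // rIE.
Qed.

Lemma rin_fubini (g : T1 * T2 -> R) : rin (m1 \x m2)%E g ->
  [/\ (\forall x \ae m1, rin m2 (fun y => g (x, y))),
      rin m1 (fun x => rI m2 (fun y => g (x, y))) &
      rI (m1 \x m2)%E g = rI m1 (fun x => rI m2 (fun y => g (x, y)))].
Proof.
move=> ig; split.
- by have := ae_integrable1 ig.
- have ih := integrable_fubini_F ig.
  have [||i _] := rI_fine ih (g := fun x => rI m2 (fun y => g (x, y))); last exact: i.
  + by apply: measurableT_comp; [exact: fine_measurable|exact: measurable_int ih].
  + exact: aeW.
- have ih := integrable_fubini_F ig.
  have [||_ e] := rI_fine ih (g := fun x => rI m2 (fun y => g (x, y))).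
  + by apply: measurableT_comp; [exact: fine_measurable|exact: measurable_int ih].
  + exact: aeW.
  by move: e; rewrite integral12_prod_meas1 // rIE // => -[].
Qed.

Lemma rin_prod (g : T1 * T2 -> R) : measurable_fun setT g -> (forall z, 0 <= g z) ->
  (\forall x \ae m1, rin m2 (fun y => g (x, y))) ->
  rin m1 (fun x => rI m2 (fun y => g (x, y))) -> rin (m1 \x m2)%E g.
Proof.
move=> mg g0 h1 h2; have mg' : measurable_fun setT (fun z => (g z)%:E) by exact/measurable_EFinP.
apply: rinP => //.
rewrite fubini_tonelli1 //.
have := rin_lt h2; rewrite (ae_eq_integral (fubini_F m2 (EFin \o g))) //.
- exact/measurable_EFinP/(rin_meas h2).
- by apply: measurable_fun_fubini_tonelli_F => // z; rewrite lee_fin.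
- by apply: filterS h1 => x hx _; rewrite /fubini_F rIE.
Qed.

Lemma cin_prod (f : T1 * T2 -> C) : cmeas f ->
  (\forall x \ae m1, rin m2 (fun y => normc (f (x, y)))) ->
  rin m1 (fun x => rI m2 (fun y => normc (f (x, y)))) -> cin (m1 \x m2)%E f.
Proof.
move=> mf h1 h2; split => //; apply: rin_prod => //; first exact: cmeas_normc.
by move=> z; exact: normc_ge0.
Qed.

Lemma cin_fubini (f : T1 * T2 -> C) : cin (m1 \x m2)%E f ->
  [/\ (\forall x \ae m1, cin m2 (fun y => f (x, y))),
      cin m1 (fun x => cI m2 (fun y => f (x, y))) &
      cI (m1 \x m2)%E f = cI m1 (fun x => cI m2 (fun y => f (x, y)))].
Proof.
move=> hf; have [a1 b1 e1] := rin_fubini (cin_Re hf).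
have [a2 b2 e2] := rin_fubini (cin_Im hf); split.
- by apply: filterS2 a1 a2 => x; exact: cin_ReIm.
- exact: cin_ReIm.
- by rewrite /cI e1 e2.
Qed.

End ComplexFubini.

Section FubiniSwap.
Variable R : realType.
Local Notation C := R[i].
Context d1 d2 (T1 : measurableType d1) (T2 : measurableType d2).
Variables (m1 : {sigma_finite_measure set T1 -> \bar R}) (m2 : {sigma_finite_measure set T2 -> \bar R}).

Lemma rin_swap (g : T1 * T2 -> R) : rin (m1 \x m2)%E g ->
  rin (m2 \x m1)%E (fun z => g (z.2, z.1)).
Proof.
move=> ig; have mg := measurable_int _ ig.
have mg' : measurable_fun setT (fun z : T2 * T1 => (g (z.2, z.1))%:E).
  apply/measurable_EFinP; apply: (@measurableT_comp _ _ _ _ _ _ g); last exact: measurable_swap.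
  exact: rin_meas ig.
have k1 := proj1 (@integrable21ltyP _ _ _ _ _ m1 m2 _ mg) ig.
exact: (proj2 (@integrable12ltyP _ _ _ _ _ m2 m1 _ mg') k1).
Qed.

Lemma rI_swap (g : T1 * T2 -> R) : rin (m1 \x m2)%E g ->
  rI m1 (fun x => rI m2 (fun y => g (x, y))) = rI m2 (fun y => rI m1 (fun x => g (x, y))).
Proof.
move=> ig; have e := Fubini ig.
have ih := integrable_fubini_F ig.
have [||_ e1] := rI_fine ih (g := fun x => rI m2 (fun y => g (x, y))).
- by apply: measurableT_comp; [exact: fine_measurable|exact: measurable_int ih].
- exact: aeW.
have ih' := integrable_fubini_F (rin_swap ig).
have [||_ e2] := rI_fine ih' (g := fun y => rI m1 (fun x => g (x, y))).
- by apply: measurableT_comp; [exact: fine_measurable|exact: measurable_int ih'].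
- exact: aeW.
by move: e; rewrite [LHS]e1 [RHS]e2 => -[].
Qed.

Lemma cI_swap (f : T1 * T2 -> C) : cin (m1 \x m2)%E f ->
  cI m1 (fun x => cI m2 (fun y => f (x, y))) = cI m2 (fun y => cI m1 (fun x => f (x, y))).
Proof.
move=> hf; have e1 := rI_swap (cin_Re hf); have e2 := rI_swap (cin_Im hf).
by rewrite /cI e1 e2.
Qed.

Lemma cin_swap (f : T1 * T2 -> C) : cin (m1 \x m2)%E f ->
  cin (m2 \x m1)%E (fun z => f (z.2, z.1)).
Proof.
move=> hf; have mg : cmeas (fun z : T2 * T1 => f (z.2, z.1)).
  have [[a1 a2] _] := hf.
  by split; [apply: (@measurableT_comp _ _ _ _ _ _ (fun z => Re (f z)))|
    apply: (@measurableT_comp _ _ _ _ _ _ (fun z => Im (f z)))] => //; exact: measurable_swap.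
split => //; exact: (rin_swap (proj2 hf)).
Qed.
End FubiniSwap.

(** * Substitution in Lebesgue integrals *)

Section WeightedPushforward.
Local Open Scope ereal_scope.
Context d1 d2 (T1 : measurableType d1) (T2 : measurableType d2) (R : realType).
Variables (mu : {measure set T1 -> \bar R}) (phi : T1 -> T2) (w : T1 -> R).
Hypotheses (mphi : measurable_fun setT phi) (mw : measurable_fun setT w) (w0 : forall x, (0 <= w x)%R).

(** The image under [phi] of the measure with density [w]. A substitution rule becomes the equality
    of this measure with another one. *)
Definition wpush (A : set T2) : \bar R := \int[mu]_(x in phi @^-1` A) (w x)%:E.

Lemma wpush0 : wpush set0 = 0.
Proof. by rewrite /wpush preimage_set0 integral_set0. Qed.
Lemma wpush_ge0 A : 0 <= wpush A.
Proof. by apply: integral_ge0 => x _; rewrite lee_fin. Qed.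
Lemma measurable_wpush_pre A : measurable A -> measurable (phi @^-1` A).
Proof. by move=> mA; rewrite -[X in measurable X]setTI; exact: mphi. Qed.
Lemma wpush_sigma_additive : semi_sigma_additive wpush.
Proof.
move=> F mF tF mUF; rewrite /wpush preimage_bigcup.
apply: semi_sigma_additive_nng_induced => //.
- exact/measurable_EFinP.
- by move=> i; exact: measurable_wpush_pre.
- apply/trivIsetP => i j _ _ ij; rewrite -preimage_setI.
  by move/trivIsetP : tF => /(_ _ _ I I ij) ->; rewrite preimage_set0.
- by rewrite -preimage_bigcup; exact: measurable_wpush_pre.
Qed.
Definition wpush_mixin := isMeasure.Build _ _ _ wpush wpush0 wpush_ge0 wpush_sigma_additive.
Definition wpush_measure : {measure set T2 -> \bar R} := HB.pack wpush wpush_mixin.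

Import HBNNSimple.

(** The usual passage from indicators to simple functions and then, by monotone convergence on both
    sides, to nonnegative functions. *)
Lemma integral_wpush (f : T2 -> \bar R) : measurable_fun setT f -> (forall y, 0 <= f y) ->
  \int[wpush_measure]_y f y = \int[mu]_x ((w x)%:E * f (phi x)).
Proof.
move=> mf f0; pose f_ := nnsfun_approx measurableT mf.
have mw' : measurable_fun setT (fun x => (w x)%:E) by exact/measurable_EFinP.
have mind r n : measurable_fun setT (fun x => (\1_(f_ n @^-1` [set r]) (phi x) : R)).
  have -> : (fun x => (\1_(f_ n @^-1` [set r]) (phi x) : R)) = \1_(phi @^-1` (f_ n @^-1` [set r])).
    by apply/funext => x; rewrite !indicE.
  by apply: measurable_indic; exact: measurable_wpush_pre.
have w0' x : 0 <= (w x)%:E by rewrite lee_fin.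
have cf y : (f_ n y)%:E @[n --> \oo] --> f y by apply: cvg_nnsfun_approx => // ? _.
(* Both sides split over the finitely many values [k] of the simple function; for one value the
   claim is the definition of [wpush] on a level set. *)
have e n : \int[wpush_measure]_y (f_ n y)%:E = \int[mu]_x ((w x)%:E * (f_ n (phi x))%:E).
  transitivity (\sum_(k \in range (f_ n)) \int[wpush_measure]_y (k * \1_(f_ n @^-1` [set k]) y)%:E).
    under eq_integral do rewrite fimfunE -fsumEFin//.
    rewrite ge0_integral_fsum//.
      by move=> y; exact/measurable_EFinP/measurable_funM.
    by move=> y x _; rewrite nnfun_muleindic_ge0.
  transitivity (\sum_(k \in range (f_ n)) \int[mu]_x ((w x)%:E * (k * \1_(f_ n @^-1` [set k]) (phi x))%:E)).
    apply: eq_fsbigr => r; rewrite inE => -[y _ ry].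
    have r0 : (0 <= r)%R by rewrite -ry.
    have mr : measurable (f_ n @^-1` [set r]) by [].
    rewrite integralZl_indic_nnsfun// integral_indic// setIT.
    under eq_integral do rewrite EFinM muleCA.
    rewrite ge0_integralZl//; last 2 first.
      apply: emeasurable_funM => //; apply/measurable_EFinP.
      exact: mind.
      by move=> x _; rewrite mule_ge0 // lee_fin.
    congr (_ * _); rewrite /= /wpush integral_mkcond; apply: eq_integral => x _.
    rewrite patchE indicE; case: (boolP (x \in _)) => [/set_mem h|/negP h].
      by rewrite mem_set // mule1.
    by rewrite memNset ?mule0 // => k; apply: h; exact/mem_set.
  rewrite -ge0_integral_fsum//.
  - by apply: eq_integral => x _; rewrite -ge0_mule_fsumr ?fsumEFin// -?fimfunE// => k; rewrite nnfun_muleindic_ge0.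
  - move=> r; apply: emeasurable_funM => //; apply/measurable_EFinP/measurable_funM => //.
  - by move=> r x _; rewrite mule_ge0 // nnfun_muleindic_ge0.
transitivity (limn (fun n => \int[wpush_measure]_y (f_ n y)%:E)).
  rewrite -monotone_convergence//.
  - by apply: eq_integral => y _; apply/esym/cvg_lim => //.
  - by move=> n; exact/measurable_EFinP/measurable_funP.
  - by move=> n y _; rewrite lee_fin.
  - by move=> y _ m n mn; rewrite lee_fin; exact/lefP/nd_nnsfun_approx.
under eq_fun do rewrite e; rewrite -monotone_convergence//.
- apply: eq_integral => x _; apply/cvg_lim => //.
  by apply: cvgeZl => //.
- move=> n; apply: emeasurable_funM => //; apply/measurable_EFinP.
  by apply: (@measurableT_comp _ _ _ _ _ _ (f_ n)) => //.
- by move=> n x _; rewrite mule_ge0 // lee_fin.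
- by move=> x _ m n mn; rewrite lee_wpmul2l // lee_fin; exact/lefP/nd_nnsfun_approx.
Qed.
End WeightedPushforward.

Notation lmu := (@lebesgue_measure _).
Notation lmeas := (@cmeas _ _ (measurableTypeR _)).
Notation rmeas := (@measurable_fun _ _ (measurableTypeR _) (measurableTypeR _) setT).

(** * Change of variables for the Lebesgue measure *)

Section LebesgueSubstitution.
Variable R : realType.
Local Notation C := R[i].
Local Notation mu := (@lebesgue_measure R).
Implicit Types (phi w : measurableTypeR R -> measurableTypeR R) (f : R -> C).

(** The rule is imposed on nonnegative integrands with values in the extended reals; signed and
    complex integrands follow by splitting, and since infinite values are allowed on both sides,
    integrability is transferred too. *)
Definition substitutes phi w :=
  [/\ rmeas phi, rmeas w, (forall x, (0 <= w x)%R) &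
   forall f : R -> \bar R, measurable_fun setT f -> (forall y, 0 <= f y)%E ->
   (\int[mu]_y f y = \int[mu]_x ((w x)%:E * f (phi x)))%E].

(** Half-open intervals determine the Lebesgue measure, so it is enough to compute the weighted
    preimage of each of them. *)
Lemma substitutesP phi w : rmeas phi -> rmeas w -> (forall x, (0 <= w x)%R) ->
  (forall a b : R, a < b -> (\int[mu]_(x in phi @^-1` `]a, b]%classic) (w x)%:E)%E = (b - a)%:E) ->
  substitutes phi w.
Proof.
move=> mphi mw w0 h; split=> // f mf f0.
have e : forall A, measurable A -> mu A = wpush_measure mu mphi mw w0 A.
  apply: lebesgue_measure_unique => X [[a b]] _ <-.
  rewrite /= /wpush; have [ab|ba] := ltP a b.
    by rewrite h // lebesgue_measure_itv /= lte_fin ab -EFinB.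
  by rewrite set_itv_ge ?preimage_set0 ?integral_set0 ?measure0 // bnd_simp -leNgt.
rewrite -(integral_wpush mu mphi mw w0) //.
by apply: eq_measure_integral => A mA _; exact: e.
Qed.

Section Transfer.
Variables (phi w : R -> R) (S : substitutes phi w).

Lemma subst_meas (g : R -> R) : rmeas g -> rmeas (fun x => w x * g (phi x)).
Proof.
case: S => mphi mw _ _ mg; apply: measurable_funM => //.
exact: (measurableT_comp mg mphi).
Qed.
Lemma subst_lmeas f : lmeas f -> lmeas (fun x => (w x)%:C * f (phi x)).
Proof.
move=> [m1 m2]; split; [under eq_fun do rewrite ReMr|under eq_fun do rewrite ImMr].
  exact: (subst_meas m1).
exact: (subst_meas m2).
Qed.
(** A nonnegative weight commutes with positive and negative parts, so the two integrals agree part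
    by part, whether or not they converge. *)
Lemma subst_rI (g : R -> R) : rmeas g -> rI mu g = rI mu (fun x => w x * g (phi x)).
Proof.
case: S => mphi mw w0 H mg; rewrite /rI /Rintegral; congr fine; rewrite integralE [RHS]integralE.
have mg' : measurable_fun setT (fun x : R => (g x)%:E) by exact/measurable_EFinP.
congr (_ - _)%E; rewrite H.
- apply: eq_integral => x _; rewrite !funeposE -!EFin_max -EFinM maxr_pMr //.
  by rewrite mulr0.
- exact: measurable_funepos.
- by move=> y; rewrite funepos_ge0.
- apply: eq_integral => x _; rewrite !funenegE -!EFinN -!EFin_max -EFinM maxr_pMr //.
  by rewrite mulr0 mulrN.
- exact: measurable_funeneg.
- by move=> y; rewrite funeneg_ge0.
Qed.
Lemma subst_rin (g : R -> R) : rmeas g ->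
  (rin mu g <-> rin mu (fun x => w x * g (phi x))).
Proof.
have [mphi mw w0 H] := S; move=> mg.
have mn : measurable_fun setT (fun x : R => `|(g x)%:E|)%E.
  by apply: measurableT_comp => //; exact/measurable_EFinP.
have e : (\int[mu]_x `|(g x)%:E| = \int[mu]_x `|(w x * g (phi x))%:E|)%E.
  rewrite (H _ mn) //; apply: eq_integral => x _.
  by rewrite !abse_EFin normrM (ger0_norm (w0 x)) EFinM.
split=> /integrableP[_ h]; apply/integrableP; split.
- by apply/measurable_EFinP; exact: subst_meas.
- by rewrite -e.
- exact/measurable_EFinP.
- by rewrite e.
Qed.
Lemma subst_cI f : lmeas f -> cI mu f = cI mu (fun x => (w x)%:C * f (phi x)).
Proof.
move=> [m1 m2]; rewrite /cI (subst_rI m1) (subst_rI m2); congr (_ +i* _).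
  by congr rI; apply/funext => x; rewrite ReMr.
by congr rI; apply/funext => x; rewrite ImMr.
Qed.
Lemma subst_cin f : lmeas f -> (cin mu f <-> cin mu (fun x => (w x)%:C * f (phi x))).
Proof.
have [mphi mw w0 H] := S; move=> mf; have mf' := subst_lmeas mf.
have e : (fun x => normc ((w x)%:C * f (phi x))) = (fun x => w x * normc (f (phi x))).
  by apply/funext => x; rewrite normcM normc_pos.
have [s1 s2] := subst_rin (cmeas_normc mf).
split=> -[_ h]; split => //; first by rewrite e; exact: s1.
by apply: s2; rewrite -e.
Qed.
End Transfer.

Lemma mu_itv (x y : R) b0 b1 : x < y ->
  mu [set` Interval (BSide b0 x) (BSide b1 y)] = (y - x)%:E.
Proof. by move=> xy; rewrite lebesgue_measure_itv /= lte_fin xy -EFinB. Qed.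

Lemma shift_substitutes a : substitutes (fun x => x + a) (fun=> 1).
Proof.
apply: substitutesP => //.
  by apply: measurable_funD => //; exact: measurable_cst.
move=> c b cb; rewrite integral_cst; last first.
  rewrite -[X in measurable X]setTI; apply: measurable_funD => //; exact: measurable_cst.
have -> : (fun x : R => x + a) @^-1` `]c, b] = `]c - a, b - a].
  by apply/seteqP; split => x /=; rewrite !in_itv /= ltrBlDr lerBrDr.
rewrite mul1e (_ : b - c = b - a - (c - a)); [by apply: mu_itv; rewrite ltrD2r|ring].
Qed.
Lemma opp_substitutes : substitutes (fun x => - x) (fun=> 1).
Proof.
apply: substitutesP => //.
  by apply: continuous_measurable_fun; exact: opp_continuous.
move=> c b cb; have -> : (fun x : R => - x) @^-1` `]c, b] = `[- b, - c[.
  by apply/seteqP; split => x /=; rewrite !in_itv /= lerNl ltrNr andbC.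
rewrite integral_cst; last exact: measurable_itv.
rewrite mul1e (_ : b - c = - c - - b); [by apply: mu_itv; rewrite ltrN2|ring].
Qed.
Lemma scale_substitutes k : 0 < k -> substitutes (fun x => k * x) (fun=> k).
Proof.
move=> k0; apply: substitutesP => //; last 2 first.
- by move=> _; exact: ltW.
- move=> c b cb; have -> : (fun x : R => k * x) @^-1` `]c, b] = `]c / k, b / k].
    by apply/seteqP; split => x /=; rewrite !in_itv /= ltr_pdivrMr // ler_pdivlMr // (mulrC k).
  rewrite integral_cst; last exact: measurable_itv.
  transitivity (k%:E * (b / k - c / k)%:E)%E.
    by congr (_ * _)%E; apply: mu_itv; rewrite ltr_pM2r ?invr_gt0.
  by rewrite -EFinM; congr EFin; field; exact: lt0r_neq0.
- by apply: continuous_measurable_fun; exact: mulrl_continuous.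
Qed.

(** The weight is $1/x$, with [ln] as antiderivative on []exp a, exp b]]. It is cut to 0 on the
    nonpositive axis, where [ln] has only a default value. *)
Lemma ln_substitutes : substitutes (@ln R) (fun x => if 0 < x then expR (- ln x) else 0).
Proof.
have mw : measurable_fun setT (fun x : R => expR (- ln x)).
  apply: (@measurableT_comp _ _ _ _ _ _ (@expR R)) => //.
  by apply: measurableT_comp => //; exact: measurable_ln.
apply: substitutesP => //.
- apply: measurable_fun_ifT => //.
    by apply: measurable_fun_ltr => //; exact: measurable_cst.
- by move=> x; case: ifP => // /ltW x0; rewrite expR_ge0.
move=> a b ab.
have eab : expR a < expR b by rewrite ltr_expR.
have -> : (\int[mu]_(x in (@ln R) @^-1` `]a, b]%classic) (if 0 < x then expR (- ln x) else 0)%:E)%E =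
          (\int[mu]_(x in `]expR a, expR b]) (expR (- ln x))%:E)%E.
  rewrite integral_mkcond [RHS]integral_mkcond; apply: eq_integral => x _; rewrite !patchE.
  have [x0|x0] := ltP 0 x.
    suff -> : (x \in (@ln R) @^-1` `]a, b]%classic) = (x \in `]expR a, expR b]%classic) by [].
    have [h1 h2] : (a < ln x) = (expR a < x) /\ (ln x <= b) = (x <= expR b).
      by rewrite -{2 4}(lnK x0) ltr_expR ler_expR.
    by apply/idP/idP; rewrite !inE /= !in_itv /= h1 h2.
  have -> : (x \in `]expR a, expR b]%classic) = false.
    apply/negP; rewrite inE /= in_itv /= => /andP[h _].
    by have := lt_le_trans (lt_trans (expR_gt0 a) h) x0; rewrite ltxx.
  by case: ifP.
rewrite integral_itv_obnd_cbnd; last first.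
  apply/measurable_EFinP; apply: measurable_funTS; exact: mw.
have H x : expR a <= x -> 0 < x by move=> h; exact: lt_le_trans (expR_gt0 a) h.
rewrite (@continuous_FTC2 _ _ (@ln R)) //.
- by rewrite !expRK -EFinB.
- apply: continuous_in_subspaceT => x; rewrite inE /= in_itv /= => /andP[/H x0 _].
  apply: (@continuous_comp _ _ _ (fun x => - ln x) (@expR R)); last exact: continuous_expR.
  by apply: continuousN; exact: continuous_ln.
- split.
  + by move=> x; rewrite in_itv /= => /andP[/ltW/H x0 _]; have [] := is_derive1_ln x0.
  + by apply: cvg_at_right_filter; apply: continuous_ln; exact: expR_gt0.
  + by apply: cvg_at_left_filter; apply: continuous_ln; exact: expR_gt0.
- move=> x; rewrite in_itv /= => /andP[/ltW/H x0 _]; rewrite derive1E.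
  by have [_ ->] := is_derive1_ln x0; rewrite expRN lnK.
Qed.

End LebesgueSubstitution.

(** * Square-integrable functions *)

Section SquareIntegrable.
Variable R : realType.
Local Notation C := R[i].
Context d (T : measurableType d).
Variable mu : {measure set T -> \bar R}.
Implicit Types f g : T -> C.

Definition l2 f := cmeas f /\ rin mu (fun x => normc (f x) ^+ 2).
(** The norm is kept squared, which avoids square roots; functions are not identified modulo null
    sets, so uniqueness statements hold almost everywhere. *)
Definition N2 f : R := rI mu (fun x => normc (f x) ^+ 2).
Definition l2cvg (F : nat -> T -> C) f := (fun n => N2 (fun x => F n x - f x)) @ \oo --> (0 : R).

Lemma l2_meas f : l2 f -> cmeas f. Proof. by case. Qed.
Lemma l2_le (g : T -> R) f : cmeas f -> rin mu g -> (forall x, normc (f x) ^+ 2 <= g x) -> l2 f.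
Proof.
move=> mf ig h; split => //; apply: rin_le ig _; first exact/measurable_funX/cmeas_normc.
by move=> x; rewrite ger0_norm // sqr_ge0.
Qed.
Lemma N2_ge0 f : 0 <= N2 f.
Proof. by apply: rI_ge0 => x; exact: sqr_ge0. Qed.
Lemma N2_ext f g : (forall x, f x = g x) -> N2 f = N2 g.
Proof. by move=> h; have -> : f = g by apply/funext. Qed.
Lemma l2_ext f g : (forall x, f x = g x) -> l2 f -> l2 g.
Proof. by move=> h; have -> : f = g by apply/funext. Qed.
Lemma N2_le f g : l2 f -> l2 g -> (forall x, normc (f x) <= normc (g x)) -> N2 f <= N2 g.
Proof.
move=> [_ hf] [_ hg] h; apply: rI_le => // x.
by rewrite lerXn2r ?nnegrE ?normc_ge0.
Qed.
Lemma normcD_sqr (x y : C) : normc (x + y) ^+ 2 <= 2 * normc x ^+ 2 + 2 * normc y ^+ 2.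
Proof.
have h : normc (x + y) ^+ 2 <= (normc x + normc y) ^+ 2.
  by rewrite lerXn2r ?nnegrE ?addr_ge0 ?normc_ge0 // normcD.
apply: le_trans h _; have := sqr_ge0 (normc x - normc y); lra.
Qed.
Lemma l2D f g : l2 f -> l2 g -> l2 (fun x => f x + g x).
Proof.
move=> [m1 h1] [m2 h2]; apply: (l2_le _ (rinD (rinZ 2 h1) (rinZ 2 h2))); first exact: cmeasD.
by move=> x; exact: normcD_sqr.
Qed.
Lemma N2D f g : l2 f -> l2 g -> N2 (fun x => f x + g x) <= 2 * N2 f + 2 * N2 g.
Proof.
move=> hf hg; have [_ h] := l2D hf hg; case: hf hg => [m1 h1] [m2 h2].
rewrite /N2 -!rIZ // -rID; try exact: rinZ.
apply: rI_le => //; first by apply: rinD; exact: rinZ.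
by move=> x; exact: normcD_sqr.
Qed.
Lemma l2_bM (M : R) f g : cmeas f -> (forall x, normc (f x) <= M) -> l2 g -> l2 (fun x => f x * g x).
Proof.
move=> mf fM [mg hg]; apply: (l2_le _ (rinZ (M ^+ 2) hg)); first exact: cmeasM.
move=> x; rewrite normcM exprMn ler_wpM2r ?sqr_ge0 // lerXn2r ?nnegrE ?normc_ge0 //.
by apply: le_trans (fM x); exact: normc_ge0.
Qed.
Lemma N2_bM (M : R) f g : cmeas f -> (forall x, normc (f x) <= M) -> l2 g ->
  N2 (fun x => f x * g x) <= M ^+ 2 * N2 g.
Proof.
move=> mf fM hg; have [_ h] := l2_bM mf fM hg; case: hg => mg hg.
rewrite /N2 -rIZ //; apply: rI_le => //; first exact: rinZ.
move=> x; rewrite normcM exprMn ler_wpM2r ?sqr_ge0 // lerXn2r ?nnegrE ?normc_ge0 //.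
by apply: le_trans (fM x); exact: normc_ge0.
Qed.
Lemma l2Z c f : l2 f -> l2 (fun x => c * f x).
Proof. by move=> hf; apply: (@l2_bM (normc c)) => //; exact: cmeas_cst. Qed.
Lemma N2Z c f : l2 f -> N2 (fun x => c * f x) = normc c ^+ 2 * N2 f.
Proof.
move=> [_ h]; rewrite /N2 -rIZ //; congr rI; apply/funext => x.
by rewrite normcM exprMn.
Qed.
Lemma l2N f : l2 f -> l2 (fun x => - f x).
Proof. by move=> /(l2Z (-1)); apply: l2_ext => x; rewrite mulN1r. Qed.
Lemma N2N f : N2 (fun x => - f x) = N2 f.
Proof. by congr rI; apply/funext => x; rewrite normcN. Qed.
Lemma l2B f g : l2 f -> l2 g -> l2 (fun x => f x - g x).
Proof. by move=> h1 h2; apply: l2D => //; exact: l2N. Qed.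
Lemma N2B f g : l2 f -> l2 g -> N2 (fun x => f x - g x) <= 2 * N2 f + 2 * N2 g.
Proof. by move=> h1 h2; rewrite -(N2N g); apply: N2D => //; exact: l2N. Qed.
Lemma N2_distC f g : N2 (fun x => f x - g x) = N2 (fun x => g x - f x).
Proof. by congr rI; apply/funext => x; rewrite normc_distC. Qed.
Lemma l2_conj f : l2 f -> l2 (fun x => (conjc (f x))).
Proof.
move=> [mf h]; split; first exact: cmeas_conj.
by under eq_fun do rewrite normc_conj.
Qed.
Lemma N2_conj f : N2 (fun x => (conjc (f x))) = N2 f.
Proof. by congr rI; apply/funext => x; rewrite normc_conj. Qed.
Lemma l20 : l2 (fun=> 0).
Proof. apply: (l2_le _ (rin0 mu)); [exact: cmeas_cst|by move=> x; rewrite normc0 expr0n]. Qed.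
Lemma cin_l2 f g : l2 f -> l2 g -> cin mu (fun x => f x * g x).
Proof.
move=> [m1 h1] [m2 h2]; apply: (cin_le _ (rinD h1 h2)); first exact: cmeasM.
move=> x; rewrite normcM; have := sqr_ge0 (normc (f x) - normc (g x)).
have := sqr_ge0 (normc (f x) + normc (g x)); lra.
Qed.

Lemma cauchy_schwarz_norm f g : l2 f -> l2 g ->
  (rI mu (fun x => normc (f x * g x))) ^+ 2 <= N2 f * N2 g.
Proof.
move=> hf hg; set I := rI mu _; have I0 : 0 <= I by apply: rI_ge0 => x; exact: normc_ge0.
(* Integrating $0\le t^{-1}(t|f|-|g|)^2$ gives a one-parameter family of linear bounds; a good [t]
   turns it into the quadratic one. *)
have H t : 0 < t -> 2 * I <= t * N2 f + t^-1 * N2 g.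
  move=> t0; rewrite /I /N2 -!rIZ; try (by case: hf) ; try (by case: hg); last by case: (cin_l2 hf hg).
  rewrite -rID; try (by apply: rinZ; case: hf); try (by apply: rinZ; case: hg).
  apply: rI_le.
  - by apply: rinZ; case: (cin_l2 hf hg).
  - by apply: rinD; apply: rinZ; [case: hf|case: hg].
  - move=> x; rewrite normcM; set a := normc (f x); set b := normc (g x).
    have : 0 <= t^-1 * (t * a - b) ^+ 2 by rewrite mulr_ge0 ?sqr_ge0 // invr_ge0 ltW.
    suff -> : t^-1 * (t * a - b) ^+ 2 = t * a ^+ 2 + t^-1 * b ^+ 2 - 2 * (a * b) by lra.
    by field; exact: lt0r_neq0.
have [I00|Ip] := leP I 0.
  by rewrite (le_anti (introT andP (conj I00 I0))) expr0n mulr_ge0 ?N2_ge0.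
have [A0|Ap] := leP (N2 f) 0.
  (* If [f] has norm 0, this large [t] makes the right side smaller than [2 * I], which is
     impossible for positive [I]. *)
  have := H ((N2 g + 1) / I) _; rewrite divr_gt0 // ?ltr_wpDl ?N2_ge0 // => /(_ isT).
  rewrite (le_anti (introT andP (conj A0 (N2_ge0 f)))) mulr0 add0r invf_div mulrAC => h.
  have : I / (N2 g + 1) * N2 g <= I.
    rewrite mulrAC ler_pdivrMr ?ltr_wpDl ?N2_ge0 // ler_pM2l //; lra.
  by rewrite mulrAC => h2; have := le_trans h h2; lra.
(* With this rational choice the first term becomes [I], and the inequality rearranges to the claim
   without any square root. *)
have := H (I / N2 f) (divr_gt0 Ip Ap); rewrite mulfVK ?gt_eqF // invf_div => h.
have {}h : I <= N2 f / I * N2 g by lra.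
by rewrite expr2 -ler_pdivlMr // mulrAC.
Qed.
Lemma cauchy_schwarz f g : l2 f -> l2 g ->
  normc (cI mu (fun x => f x * g x)) ^+ 2 <= N2 f * N2 g.
Proof.
move=> hf hg; apply: le_trans (cauchy_schwarz_norm hf hg).
rewrite lerXn2r ?nnegrE ?normc_ge0 ?normc_cI //; last exact: cin_l2.
by apply: rI_ge0 => x; exact: normc_ge0.
Qed.
Lemma N2_eq0 f : l2 f -> N2 f = 0 -> \forall x \ae mu, f x = 0.
Proof.
move=> [mf h] e; have /ae_eq_integral_abs : measurable_fun setT (fun x => (normc (f x) ^+ 2)%:E).
  exact/measurable_EFinP/measurable_funX/cmeas_normc.
move=> /(_ mu measurableT)[+ _].
under eq_integral do rewrite gee0_abs ?lee_fin ?sqr_ge0 //.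
rewrite rIE //; rewrite -/(N2 f) e => /(_ erefl); apply: filterS => x /= /(_ I) [] /eqP.
by rewrite sqrf_eq0 normc_eq0 => /eqP.
Qed.
Lemma N2_ae f g : cmeas f -> cmeas g -> (\forall x \ae mu, f x = g x) -> N2 f = N2 g.
Proof.
move=> mf mg h; apply: rI_ae; try exact/measurable_funX/cmeas_normc.
by apply: filterS h => x ->.
Qed.
Lemma l2_ae f g : cmeas g -> (\forall x \ae mu, f x = g x) -> l2 f -> l2 g.
Proof.
move=> mg h [mf hf]; split => //; apply: rin_ae hf; first exact/measurable_funX/cmeas_normc.
by apply: filterS h => x ->.
Qed.
Lemma cI_conj_N2 f : cI mu (fun x => f x * (conjc (f x))) = (N2 f)%:C.
Proof. by rewrite /N2 -cI_real; congr cI; apply/funext => x; rewrite mul_conjc. Qed.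

Lemma sqr_cvg0 (x : nat -> R) : (forall n, 0 <= x n) ->
  (fun n => x n ^+ 2) @ \oo --> (0 : R) -> x @ \oo --> (0 : R).
Proof.
move=> x0 h.
have h2 : (fun n => Num.sqrt (x n ^+ 2)) @ \oo --> Num.sqrt (0 : R).
  apply: (@continuous_cvg _ _ _ \oo _ (fun n => x n ^+ 2) (@Num.sqrt R)) => //.
  exact: sqrt_continuous.
rewrite sqrtr0 in h2; rewrite (_ : x = (fun n => Num.sqrt (x n ^+ 2))) //.
by apply/funext => n; rewrite sqrtr_sqr ger0_norm.
Qed.
Lemma l2cvg_cI F f g : (forall n, l2 (F n)) -> l2 f -> l2 g -> l2cvg F f ->
  ccvg (fun n => cI mu (fun x => F n x * g x)) (cI mu (fun x => f x * g x)).
Proof.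
move=> hF hf hg h; apply: sqr_cvg0; first by move=> n; exact: normc_ge0.
apply: (cvg0_squeeze _ (cvg0_const_mul (N2 g) h)) => n; rewrite sqr_ge0 /=.
have cf := cin_l2 hf hg; have cF := cin_l2 (hF n) hg.
rewrite -cIB // [X in X <= _](_ : _ = normc (cI mu (fun x => (F n x - f x) * g x)) ^+ 2); last first.
  by congr (normc _ ^+ 2); apply: cI_ext => x; rewrite mulrBl.
by rewrite mulrC; apply: cauchy_schwarz => //; exact: l2B.
Qed.
Lemma l2cvg_uniq F f g : (forall n, l2 (F n)) -> l2 f -> l2 g -> l2cvg F f -> l2cvg F g ->
  \forall x \ae mu, f x = g x.
Proof.
move=> hF hf hg h1 h2; have hfg := l2B hf hg.
suff : N2 (fun x => f x - g x) = 0.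
  by move=> /(N2_eq0 hfg); apply: filterS => x /eqP; rewrite subr_eq0 => /eqP.
apply/eqP; rewrite eq_le N2_ge0 andbT.
have h : (fun n => 2 * N2 (fun x => F n x - f x) + 2 * N2 (fun x => F n x - g x)) @ \oo --> (0 : R).
  by apply: cvg0_add; exact: cvg0_const_mul.
rewrite -(cvg_lim _ h) //; apply: limr_ge; first by apply/cvg_ex; exists 0.
apply: nearW => n; rewrite (N2_distC (F n)).
rewrite (N2_ext (g := fun x => (f x - F n x) + (F n x - g x))); last by move=> x; rewrite addrA subrK.
by apply: N2D; exact: l2B.
Qed.
(** Pairing with the conjugate of the limit gives $\|f\|^2=\lim\langle F_n,f\rangle$, and
    Cauchy-Schwarz bounds the right side by $\|F_n\|\,\|f\|$. *)
Lemma N2_limit_le F f (b : nat -> R) B : (forall n, l2 (F n)) -> l2 f -> l2cvg F f ->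
  (forall n, N2 (F n) <= b n) -> b @ \oo --> B -> N2 f <= B.
Proof.
move=> hF hf h hb bB.
have hc := l2_conj hf; have := l2cvg_cI hF hf hc h.
rewrite cI_conj_N2 => /ccvg_norm; rewrite normc_pos ?N2_ge0 // => h2.
have h3 : (fun n => normc (cI mu (fun x => F n x * (conjc (f x)))) ^+ 2) @ \oo --> N2 f ^+ 2 by exact: cvgM.
have h4 : (fun n => b n * N2 f) @ \oo --> B * N2 f by apply: cvgMr_tmp.
have : N2 f ^+ 2 <= B * N2 f.
  rewrite -(cvg_lim _ h3) // -(cvg_lim _ h4) //; apply: ler_lim.
  - by apply/cvg_ex; exists (N2 f ^+ 2).
  - by apply/cvg_ex; exists (B * N2 f).
  - apply: nearW => n; apply: le_trans (cauchy_schwarz (hF n) hc) _.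
    by rewrite N2_conj ler_wpM2r ?N2_ge0.
have [f0|fp] := leP (N2 f) 0.
  move=> _; apply: le_trans f0 _; rewrite -(cvg_lim _ bB) //; apply: limr_ge.
    by apply/cvg_ex; exists B.
  by apply: nearW => n; apply: le_trans (hb n); exact: N2_ge0.
by rewrite expr2 ler_pM2r.
Qed.
Lemma l2cvg_dom F f : (forall n, cmeas (F n)) -> l2 f -> (forall n x, normc (F n x) <= normc (f x)) ->
  (forall x, ccvg (F^~ x) (f x)) -> l2cvg F f.
Proof.
move=> mF [mf hf] dom h.
have [|||||_] := @rI_dct _ _ _ mu (fun n x => normc (F n x - f x) ^+ 2) (fun=> 0) (fun x => 4 * normc (f x) ^+ 2).
- by move=> n; apply/measurable_funX/cmeas_normc/cmeasB.
- exact: measurable_cst.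
- by apply: aeW => x; have e := cvgM (h x) (h x); rewrite mulr0 in e; exact: e.
- exact: rinZ.
- move=> n x; rewrite ger0_norm ?sqr_ge0 //.
  apply: le_trans (normcD_sqr _ _) _; rewrite normcN.
  have : normc (F n x) ^+ 2 <= normc (f x) ^+ 2 by rewrite lerXn2r ?nnegrE ?normc_ge0.
  lra.
rewrite /l2cvg /N2; have -> : rI mu (fun=> 0) = 0 :> R by rewrite /rI /Rintegral integral0.
by [].
Qed.
Lemma l2cvgM (M : R) F f g : cmeas g -> (forall x, normc (g x) <= M) -> (forall n, l2 (F n)) -> l2 f ->
  l2cvg F f -> l2cvg (fun n x => g x * F n x) (fun x => g x * f x).
Proof.
move=> mg gM hF hf h; apply: (cvg0_squeeze _ (cvg0_const_mul (M ^+ 2) h)) => n.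
rewrite N2_ge0 /= (N2_ext (g := fun x => g x * (F n x - f x))); last by move=> x; ring.
by apply: N2_bM => //; exact: l2B.
Qed.

End SquareIntegrable.

(** * Completeness of L^2 *)

Section Completeness.
Variable R : realType.
Local Notation C := R[i].

(** Adding and subtracting the geometric tail gives a nonincreasing and a nondecreasing sequence
    that bracket [u]; monotone convergence yields the limit together with the rate. *)
Lemma geometric_limit (u : nat -> R) (B : R) : (forall k, `|u k.+1 - u k| <= B / 2 ^+ k) ->
  exists l, u @ \oo --> l /\ forall k, `|u k - l| <= 2 * B / 2 ^+ k.
Proof.
move=> H; have B0 : 0 <= B by have := H 0%N; rewrite expr0 divr1; apply: le_trans.
have e2 k : 2 * B / 2 ^+ k.+1 = B / 2 ^+ k.
  by rewrite exprS; field; rewrite expf_neq0 // pnatr_eq0.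
pose v k := u k + 2 * B / 2 ^+ k; pose w k := u k - 2 * B / 2 ^+ k.
have nv : nonincreasing_seq v.
  apply/nonincreasing_seqP => k; rewrite /v e2; have := H k; rewrite ler_norml => /andP[_ h].
  by have e : 2 * B / 2 ^+ k = B / 2 ^+ k + B / 2 ^+ k; [by rewrite -mulrA mulr2n mulrDl mul1r|lra].
have nw : nondecreasing_seq w.
  apply/nondecreasing_seqP => k; rewrite /w e2; have := H k; rewrite ler_norml => /andP[h _].
  by have e : 2 * B / 2 ^+ k = B / 2 ^+ k + B / 2 ^+ k; [by rewrite -mulrA mulr2n mulrDl mul1r|lra].
have p0 k : 0 <= 2 * B / 2 ^+ k by rewrite divr_ge0 ?mulr_ge0 // exprn_ge0.
have wv m n : w m <= v n.
  apply: (@le_trans _ _ (w (maxn m n))); first exact: nw (leq_maxl m n).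
  apply: (@le_trans _ _ (v (maxn m n))); last exact: nv (leq_maxr m n).
  by rewrite /w /v; have := p0 (maxn m n); lra.
have cw : cvgn w.
  by apply: nondecreasing_is_cvgn => //; exists (v 0%N) => _ [k _ <-].
have b k : `|u k - limn w| <= 2 * B / 2 ^+ k.
  have h1 : w k <= limn w by exact: nondecreasing_cvgn_le.
  have h2 : limn w <= v k by apply: limr_le => //; exact: nearW.
  by rewrite ler_norml; move: h1 h2; rewrite /w /v => h1 h2; apply/andP; split; lra.
exists (limn w); split => //; apply/subr_cvg0/norm_cvg0P.
apply: (@cvg0_squeeze _ _ (fun k => 2 * B / 2 ^+ k)) => [k|]; first by rewrite normr_ge0 b.
apply: cvg0_const_mul; under eq_fun do rewrite -exprVn.
by apply: cvg_expr; rewrite ger0_norm ?invr_ge0 // invf_lt1 // ltr1n.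
Qed.

Context d (T : measurableType d).
Variable mu : {sigma_finite_measure set T -> \bar R}.

(** The Riesz-Fischer argument. Squared increments are weighted by $4^k$: against the assumed
    $8^{-k}$ the series of integrals still converges, and a finite sum at a point forces increments
    of order $2^{-k}$ there. *)
Lemma l2_geometric_complete (F : nat -> T -> C) : (forall n, l2 mu (F n)) ->
  (forall k, N2 mu (fun x => F k.+1 x - F k x) <= (8 ^+ k)^-1) ->
  exists f, l2 mu f /\ l2cvg mu F f.
Proof.
move=> hF H; pose D k x := 4 ^+ k * normc (F k.+1 x - F k x) ^+ 2.
have D0 k x : 0 <= D k x by apply: mulr_ge0; [exact: exprn_ge0|exact: sqr_ge0].
have iD k : rin mu (D k) by apply: rinZ; have [] := l2B (hF k.+1) (hF k).
pose S x : \bar R := (\sum_(k <oo) (D k x)%:E)%E.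
have mD k : measurable_fun setT (fun x => (D k x)%:E) by exact/measurable_EFinP/(rin_meas (iD k)).
have mS : measurable_fun setT S.
  by apply: ge0_emeasurable_sum => // k x _; rewrite lee_fin.
have S0 x : (0 <= S x)%E by apply: nneseries_ge0 => k _ _; rewrite lee_fin.
have IS : (\int[mu]_x S x < +oo)%E.
  rewrite /S integral_nneseries //; last by move=> k x _; rewrite lee_fin.
  apply: (@le_lt_trans _ _ (\sum_(k <oo) ((1 / 2 ^+ k : R))%:E)%E).
    apply: lee_nneseries => [k _ _|k _]; first by apply: integral_ge0 => x _; rewrite lee_fin.
    rewrite rIE // lee_fin rIZ; last by have [] := l2B (hF k.+1) (hF k).
    apply: (@le_trans _ _ (4 ^+ k * (8 ^+ k)^-1)); first by rewrite ler_pM2l ?exprn_gt0 //; exact: H.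
    rewrite (_ : 8 = 4 * 2); last by rewrite -natrM.
    by rewrite exprMn invfM mulrA divff ?expf_neq0 ?pnatr_eq0.
  have -> : (\sum_(k <oo) ((1 / 2 ^+ k : R))%:E)%E = 2%:E.
    apply/cvg_lim => //; rewrite (_ : (fun n => _) = EFin \o (fun n => 2 - 2 / 2 ^+ n)).
      apply: cvg_EFin; first exact: nearW.
      rewrite -[X in _ --> X]subr0; apply: cvgB; first exact: cvg_cst.
      apply: cvg0_const_mul; under eq_fun do rewrite -exprVn.
      by apply: cvg_expr; rewrite ger0_norm ?invr_ge0 // invf_lt1 // ltr1n.
    apply/funext => n /=; elim: n => [|n ih]; first by rewrite big_geq // expr0 divr1 subrr.
    rewrite big_nat_recr //= ih -EFinD; congr EFin; rewrite exprS; field.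
    by rewrite expf_neq0 // pnatr_eq0.
  exact: ltry.
have iS : mu.-integrable setT S.
  apply/integrableP; split => //; by under eq_integral do rewrite gee0_abs //.
pose s x := fine (S x).
have ms : measurable_fun setT s by apply: measurableT_comp => //; exact: fine_measurable.
have [|is_ _] := rI_fine iS ms; first exact: aeW.
(* Outside a null set the weighted series is finite; on [O] the square root of its sum controls
   every increment, hence the pointwise limit and its rate. *)
pose O := [set x | S x \is a fin_num].
have mO : measurable O.
  rewrite (_ : O = S @^-1` [set x | x \is a fin_num]) //; rewrite -[X in measurable X]setTI.
  apply: mS => //; rewrite (_ : [set _ | _] = ~` [set -oo; +oo]%E).
    by apply: measurableC; apply: measurableU; exact: emeasurable_set1.
  by apply/seteqP; split => -[r||] //=; [move=> _ []|move=> h; exfalso; apply: h; right|move=> h; exfalso; apply: h; left].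
have aO : \forall x \ae mu, O x.
  by have := integrable_ae measurableT iS; apply: filterS => x /(_ I).
have bD k x : O x -> D k x <= s x.
  move=> Ox; rewrite -lee_fin /s fineK //.
  have h : forall i, (0 <= i)%N -> true -> (0 <= (D i x)%:E)%E by move=> i _ _; rewrite lee_fin.
  apply: le_trans (nneseries_lim_ge k.+1 h).
  by rewrite big_nat_recr //= leeDr // sume_ge0 // => i _; rewrite lee_fin.
pose t x := Num.sqrt (s x).
have dF k x : O x -> normc (F k.+1 x - F k x) <= t x / 2 ^+ k.
  move=> Ox; rewrite ler_pdivlMr ?exprn_gt0 //.
  rewrite -(@ler_pXn2r _ 2) ?nnegrE ?mulr_ge0 ?normc_ge0 ?exprn_ge0 ?sqrtr_ge0 //.
  rewrite /t sqr_sqrtr; last by rewrite fine_ge0.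
  rewrite exprMn -exprM mulnC exprM (_ : 2 ^+ 2 = 4); last by rewrite -natrX.
  by rewrite mulrC; exact: bD.
have L x : exists l : C, O x -> forall k, normc (F k x - l) <= 4 * t x / 2 ^+ k.
  have [Ox|nO] := pselect (O x); last by exists 0.
  have [|l1 [_ b1]] := @geometric_limit (fun k => Re (F k x)) (t x).
    by move=> k; rewrite -ReB; apply: le_trans (Re_le_normc _) (dF k x Ox).
  have [|l2' [_ b2]] := @geometric_limit (fun k => Im (F k x)) (t x).
    by move=> k; rewrite -ImB; apply: le_trans (Im_le_normc _) (dF k x Ox).
  exists (l1 +i* l2') => _ k; apply: le_trans (normc_le_ReIm _) _; rewrite ReB ImB /=.
  have e : 4 * t x / 2 ^+ k = 2 * t x / 2 ^+ k + 2 * t x / 2 ^+ k.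
    by rewrite -mulrDl -mulrDl -natrD.
  by rewrite e lerD.
have [f0 Hf] := choice L.
(* The indicator of [O] makes [f] a pointwise limit of measurable functions at every point, which
   gives measurability. *)
pose f x := (\1_O x)%:C * f0 x.
have i01 x : \1_O x = if `[< O x >] then 1 else 0 :> R.
  rewrite indicE; case: asboolP => h; first by rewrite mem_set.
  by rewrite memNset.
have mi : cmeas (fun x => (\1_O x : R)%:C) by apply: cmeas_real; exact: measurable_indic.
have lb x k : normc ((\1_O x)%:C * F k x - f x) <= 4 * t x / 2 ^+ k.
  have t0 : 0 <= 4 * t x / 2 ^+ k by rewrite divr_ge0 ?exprn_ge0 // mulr_ge0 // sqrtr_ge0.
  rewrite /f -mulrBr normcM i01; case: asboolP => Ox; last by rewrite normc0 mul0r.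
  by rewrite normc1 mul1r; exact: Hf.
have g0 x : (fun k => 4 * t x / 2 ^+ k) @ \oo --> (0 : R).
  apply: cvg0_const_mul; under eq_fun do rewrite -exprVn.
  by apply: cvg_expr; rewrite ger0_norm ?invr_ge0 // invf_lt1 // ltr1n.
have mf : cmeas f.
  apply: (@cmeas_cvg _ _ _ (fun k x => (\1_O x)%:C * F k x)).
  - by move=> n; apply: cmeasM => //; have [] := hF n.
  - by move=> x; have [] := proj1 (ccvgP _ _) (ccvg_le (lb x) (g0 x)).
  - by move=> x; have [] := proj1 (ccvgP _ _) (ccvg_le (lb x) (g0 x)).
have lO k : l2 mu (fun x => (\1_O x)%:C * F k x).
  apply: (@l2_bM _ _ _ _ 1) => // x; rewrite i01; case: asboolP => _; first by rewrite normc1.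
  by rewrite normc0.
have sb k x : normc ((\1_O x)%:C * F k x - f x) ^+ 2 <= (16 / 4 ^+ k) * s x.
  apply: le_trans (_ : (4 * t x / 2 ^+ k) ^+ 2 <= _).
    by rewrite lerXn2r ?nnegrE ?normc_ge0 // (le_trans (normc_ge0 _) (lb x k)).
  rewrite !exprMn exprVn -exprM mulnC exprM (_ : 2 ^+ 2 = 4); last by rewrite -natrX.
  rewrite /t sqr_sqrtr; last by rewrite fine_ge0.
  by rewrite (_ : 4 ^+ 2 = 16) -?natrX // mulrAC.
have lD k : l2 mu (fun x => (\1_O x)%:C * F k x - f x).
  apply: (l2_le _ (rinZ (16 / 4 ^+ k) is_)) => //; apply: cmeasB => //; by have [] := lO k.
have lf : l2 mu f.
  apply: (l2_ext (f := fun x => (\1_O x)%:C * F 0%N x - ((\1_O x)%:C * F 0%N x - f x))).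
    by move=> x; ring.
  exact: l2B.
exists f; split => //.
have h : (fun k => 16 / 4 ^+ k * rI mu s) @ \oo --> (0 : R).
  rewrite -[X in _ --> X](mul0r (rI mu s)); apply: cvgMr_tmp; apply: cvg0_const_mul.
  under eq_fun do rewrite -exprVn.
  by apply: cvg_expr; rewrite ger0_norm ?invr_ge0 // invf_lt1 // ltr1n.
apply: (cvg0_squeeze _ h) => k; rewrite N2_ge0 /=.
rewrite (@N2_ae _ _ _ _ _ (fun x => (\1_O x)%:C * F k x - f x)).
- rewrite -rIZ //; apply: rI_le; [by have [] := lD k|exact: rinZ|exact: sb].
- by apply: cmeasB => //; have [] := hF k.
- by have [] := lD k.
- by apply: filterS aO => x Ox; rewrite i01 asboolT // mul1r.
Qed.

Lemma l2_complete (F : nat -> T -> C) : (forall n, l2 mu (F n)) ->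
  (forall e : R, 0 < e -> exists N, forall m n, (N <= m)%N -> (N <= n)%N ->
     N2 mu (fun x => F m x - F n x) <= e) ->
  exists f, l2 mu f /\ l2cvg mu F f.
Proof.
move=> hF H.
have [g Hg] : {g : nat -> nat & forall k m n, (g k <= m)%N -> (g k <= n)%N ->
     N2 mu (fun x => F m x - F n x) <= (8 ^+ k)^-1}.
  have h k : exists N, forall m n, (N <= m)%N -> (N <= n)%N ->
     N2 mu (fun x => F m x - F n x) <= (8 ^+ k)^-1 by apply: H; rewrite invr_gt0 exprn_gt0.
  by have [g hg] := choice h; exists g.
(* The indices increase strictly and stay above [g k]; strictness gives [k <= p k], so late terms of
   the subsequence are late terms of the sequence. *)
pose p := fix p k := if k is k'.+1 then maxn (p k').+1 (g k) else g 0%N.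
have pg k : (g k <= p k)%N by case: k => //= k; exact: leq_maxr.
have pS k : (p k < p k.+1)%N by exact: leq_maxl.
have pk k : (k <= p k)%N by elim: k => // k ih; exact: leq_ltn_trans (pS k).
have [||f [lf cf]] := @l2_geometric_complete (fun k => F (p k)).
- by move=> n; exact: hF.
- by move=> k; apply: Hg => //; apply: leq_trans (pg k) (ltnW (pS k)).
exists f; split => //; apply/cvgrPdist_le => e e0.
have e4 : 0 < e / 4 by rewrite divr_gt0.
have [N hN] := H _ e4.
have /cvgrPdist_le/(_ _ e4) [M _ hM] := cf.
near=> m; rewrite sub0r normrN ger0_norm ?N2_ge0 //.
set k := maxn M N.
have h1 : N2 mu (fun x => F m x - F (p k) x) <= e / 4.
  apply: hN; first by near: m; exists N.
  exact: leq_trans (leq_maxr M N) (pk _).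
have h2 : N2 mu (fun x => F (p k) x - f x) <= e / 4.
  by have := hM k (leq_maxl M N); rewrite sub0r normrN ger0_norm ?N2_ge0.
rewrite (@N2_ext _ _ _ _ _ (fun x => (F m x - F (p k) x) + (F (p k) x - f x))); last first.
  by move=> x; rewrite addrA subrK.
apply: le_trans (N2D (l2B (hF m) (hF (p k))) (l2B (hF (p k)) lf)) _; lra.
Unshelve. all: by end_near. Qed.

End Completeness.

(** * Convolution and Laplace transforms *)

Section MeasurableParameter.
Variable R : realType.
Local Notation C := R[i].
Context d1 d2 (T1 : measurableType d1) (T2 : measurableType d2).
Variable m2 : {sigma_finite_measure set T2 -> \bar R}.

(** Positive and negative parts reduce this to Tonelli's theorem; divergent sections do no harm
    because the default value comes from the measurable map [fine]. *)
Lemma measurable_rI (g : T1 * T2 -> R) : measurable_fun setT g ->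
  measurable_fun setT (fun x => rI m2 (fun y => g (x, y))).
Proof.
move=> mg; have mg' : measurable_fun setT (fun z => (g z)%:E) by exact/measurable_EFinP.
have m3 : measurable_fun setT (fubini_F m2 (fun z => (g z)%:E)).
  rewrite (_ : fubini_F _ _ = (fun x => fubini_F m2 ((fun z => (g z)%:E)^\+) x -
                                        fubini_F m2 ((fun z => (g z)%:E)^\-) x)%E).
    apply: emeasurable_funB; apply: measurable_fun_fubini_tonelli_F => //.
      exact: measurable_funepos.
    exact: measurable_funeneg.
  apply/funext => x; rewrite /fubini_F [LHS]integralE; congr (_ - _)%E.
    by apply: eq_integral => y _; rewrite !funeposE.
  by apply: eq_integral => y _; rewrite !funenegE.
by apply: measurableT_comp m3; exact: fine_measurable.
Qed.
Lemma cmeas_cI (f : T1 * T2 -> C) : cmeas f -> cmeas (fun x => cI m2 (fun y => f (x, y))).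
Proof. by move=> [h1 h2]; split; [exact: (measurable_rI h1)|exact: (measurable_rI h2)]. Qed.
End MeasurableParameter.

(** * Convolution, Young's inequality and Laplace transforms *)

Section Convolution.
Variable R : realType.
Local Notation C := R[i].
Local Notation mu := (@lebesgue_measure R).
Local Notation T := (measurableTypeR R).
Implicit Types (p f g : R -> C).

Lemma ae_mono (P Q : R -> Prop) : (forall x, P x -> Q x) ->
  (\forall x \ae mu, P x) -> (\forall x \ae mu, Q x).
Proof.
by move=> PQ; apply: filterS => //; exact: (ae_filter_ringOfSetsType mu).
Qed.
Lemma ae_mono2 (P Q S : R -> Prop) : (forall x, P x -> Q x -> S x) ->
  (\forall x \ae mu, P x) -> (\forall x \ae mu, Q x) -> (\forall x \ae mu, S x).
Proof.
by move=> PQ; apply: filterS2 => //; exact: (ae_filter_ringOfSetsType mu).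
Qed.

Lemma cmeas_comp d (S : measurableType d) f (phi : S -> R) : lmeas f ->
  measurable_fun setT (phi : S -> T) -> cmeas (fun x => f (phi x)).
Proof. by move=> [h1 h2] mp; split; [exact: (measurableT_comp h1 mp)|exact: (measurableT_comp h2 mp)]. Qed.

Lemma measurable_fst1 : measurable_fun setT (fun z : T * T => z.1 : T).
Proof. exact: measurable_fst. Qed.
Lemma measurable_snd2 : measurable_fun setT (fun z : T * T => z.2 : T).
Proof. exact: measurable_snd. Qed.
Lemma measurable_subst : measurable_fun setT (fun z : T * T => z.2 - z.1 : T).
Proof. by apply: measurable_funB; [exact: measurable_snd|exact: measurable_fst]. Qed.
Lemma measurable_subts : measurable_fun setT (fun z : T * T => z.1 - z.2 : T).
Proof. by apply: measurable_funB; [exact: measurable_fst|exact: measurable_snd]. Qed.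

Lemma lmeas_id : lmeas (fun t : R => t%:C).
Proof. by apply: (@cmeas_real _ _ T); exact: measurable_id. Qed.
Lemma lmeas_comp f (phi : R -> R) : lmeas f -> rmeas phi -> lmeas (fun x => f (phi x)).
Proof. by move=> h1 h2; exact: (@cmeas_comp _ T). Qed.
Lemma rmeas_cont (g : R -> R) : continuous g -> rmeas g.
Proof. exact: continuous_measurable_fun. Qed.
Lemma rmeas_shift a : rmeas (fun x : R => x + a).
Proof. by apply: measurable_funD => //; exact: measurable_cst. Qed.
Lemma rmeas_opp : rmeas (fun x : R => - x).
Proof. by apply: rmeas_cont; exact: opp_continuous. Qed.
Lemma rmeas_csub a : rmeas (fun x : R => a - x).
Proof. by apply: measurable_funB => //; exact: measurable_cst. Qed.

Lemma rI_shift (g : R -> R) a : rmeas g -> rI mu (fun x => g (x + a)) = rI mu g.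
Proof.
by move=> mg; rewrite (subst_rI (shift_substitutes a) mg); congr rI; apply/funext => x; rewrite mul1r.
Qed.
Lemma rin_shift (g : R -> R) a : rin mu g -> rin mu (fun x => g (x + a)).
Proof.
move=> ig; have mg := rin_meas ig; have [h _] := subst_rin (shift_substitutes a) mg.
by have := h ig; rewrite (_ : (fun x => 1 * _) = (fun x => g (x + a))) //; apply/funext => x; rewrite mul1r.
Qed.
Lemma cI_shift f a : lmeas f -> cI mu (fun x => f (x + a)) = cI mu f.
Proof.
by move=> mf; rewrite (subst_cI (shift_substitutes a) mf); congr cI; apply/funext => x; rewrite mul1r.
Qed.
Lemma cin_shift f a : cin mu f -> cin mu (fun x => f (x + a)).
Proof.
move=> [mf h]; split; first by apply: lmeas_comp => //; exact: rmeas_shift.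
exact: (@rin_shift (fun x => normc (f x))).
Qed.
Lemma rI_opp (g : R -> R) : rmeas g -> rI mu (fun x => g (- x)) = rI mu g.
Proof.
by move=> mg; rewrite (subst_rI (opp_substitutes R) mg); congr rI; apply/funext => x; rewrite mul1r.
Qed.
Lemma rin_opp (g : R -> R) : rin mu g -> rin mu (fun x => g (- x)).
Proof.
move=> ig; have mg := rin_meas ig; have [h _] := subst_rin (opp_substitutes R) mg.
by have := h ig; rewrite (_ : (fun x => 1 * _) = (fun x => g (- x))) //; apply/funext => x; rewrite mul1r.
Qed.
Lemma cI_opp f : lmeas f -> cI mu (fun x => f (- x)) = cI mu f.
Proof.
by move=> mf; rewrite (subst_cI (opp_substitutes R) mf); congr cI; apply/funext => x; rewrite mul1r.
Qed.
Lemma cin_opp f : cin mu f -> cin mu (fun x => f (- x)).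
Proof.
move=> [mf h]; split; first by apply: lmeas_comp => //; exact: rmeas_opp.
exact: (@rin_opp (fun x => normc (f x))).
Qed.
Lemma cI_csub f a : lmeas f -> cI mu (fun x => f (a - x)) = cI mu f.
Proof.
move=> mf; rewrite -[RHS](cI_shift a mf) -[RHS]cI_opp; first by apply: cI_ext => x; rewrite addrC.
by apply: lmeas_comp => //; exact: rmeas_shift.
Qed.
Lemma rin_csub (g : R -> R) a : rin mu g -> rin mu (fun x => g (a - x)).
Proof.
move=> /(rin_shift a)/rin_opp; rewrite (_ : (fun x => g (- x + a)) = (fun x => g (a - x))) //.
by apply/funext => x; rewrite addrC.
Qed.
Lemma l2_opp f : l2 mu f -> l2 mu (fun x => f (- x)).
Proof.
move=> [mf h]; split; first by apply: lmeas_comp => //; exact: rmeas_opp.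
exact: (@rin_opp (fun x => normc (f x) ^+ 2)).
Qed.
Lemma N2_opp f : lmeas f -> N2 mu (fun x => f (- x)) = N2 mu f.
Proof. by move=> mf; rewrite /N2 (@rI_opp (fun x => normc (f x) ^+ 2)) //; exact/measurable_funX/cmeas_normc. Qed.
Definition cv p f (x : R) : C := cI mu (fun t => p t * f (x - t)).

Lemma cmeas_cv_joint p f : lmeas p -> lmeas f -> cmeas (fun z : T * T => p z.1 * f (z.2 - z.1)).
Proof.
move=> mp mf; apply: cmeasM; first exact: (cmeas_comp mp measurable_fst1).
exact: (cmeas_comp mf measurable_subst).
Qed.
Lemma cmeas_cv_joint' p f : lmeas p -> lmeas f -> cmeas (fun z : T * T => p z.2 * f (z.1 - z.2)).
Proof.
move=> mp mf; apply: cmeasM; first exact: (cmeas_comp mp measurable_snd2).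
exact: (cmeas_comp mf measurable_subts).
Qed.
Lemma lmeas_cv p f : lmeas p -> lmeas f -> lmeas (cv p f).
Proof. by move=> mp mf; exact: (cmeas_cI mu (cmeas_cv_joint' mp mf)). Qed.

Lemma cin_cv_joint p f : cin mu p -> cin mu f ->
  cin (mu \x mu)%E (fun z : T * T => p z.1 * f (z.2 - z.1)).
Proof.
move=> hp hf; apply: cin_prod; first by apply: cmeas_cv_joint; [case: hp|case: hf].
  by apply: aeW => x; exact: (cin_norm (cinZ (p x) (cin_shift (- x) hf))).
rewrite (_ : (fun x => _) = (fun x => rI mu (fun t => normc (f t)) * normc (p x))).
  by apply: rinZ; case: hp.
apply/funext => x; under eq_fun do rewrite normcM /=.
rewrite rIZ; last by apply: (@rin_shift (fun t => normc (f t))); case: hf.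
by rewrite mulrC (@rI_shift (fun t => normc (f t))) //; apply: cmeas_normc; case: hf.
Qed.
Lemma cv_L1 p f : cin mu p -> cin mu f -> cin mu (cv p f) /\ cI mu (cv p f) = cI mu p * cI mu f.
Proof.
move=> hp hf; have h := cin_cv_joint hp hf; split.
  by have [_ h2 _] := cin_fubini (cin_swap h).
rewrite /cv; have /esym -> := cI_swap h.
rewrite -cIZr //; apply: cI_ext => t /=.
rewrite cIZ; last exact: cin_shift.
by rewrite cI_shift //; case: hf.
Qed.
Lemma cv_ae p f : cin mu p -> cin mu f -> \forall x \ae mu, cin mu (fun t => p t * f (x - t)).
Proof. by move=> hp hf; have [h _ _] := cin_fubini (cin_swap (cin_cv_joint hp hf)). Qed.

Lemma cvC p f x : lmeas p -> lmeas f -> cv p f x = cv f p x.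
Proof.
move=> mp mf; rewrite /cv -[RHS](@cI_csub _ x); last first.
  by apply: cmeasM => //; apply: lmeas_comp => //; exact: rmeas_csub.
by apply: cI_ext => t; rewrite subKr mulrC.
Qed.

Section Young.
Variables (p f : R -> C) (hp : cin mu p) (hf : l2 mu f).
Local Notation Np := (rI mu (fun t => normc (p t))).

Lemma young_joint : rin (mu \x mu)%E (fun z : T * T => normc (p z.1) * normc (f (z.2 - z.1)) ^+ 2).
Proof.
have [mf f2] := hf; have [mp ip] := hp.
apply: rin_prod.
- apply: measurable_funM.
    exact: (cmeas_normc (cmeas_comp mp measurable_fst1)).
  apply: measurable_funX.
  exact: (cmeas_normc (cmeas_comp mf measurable_subst)).
- by move=> z; rewrite mulr_ge0 ?normc_ge0 ?sqr_ge0.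
- by apply: aeW => x /=; apply: rinZ; exact: (@rin_shift (fun t => normc (f t) ^+ 2)).
- rewrite (_ : (fun x => _) = (fun x => N2 mu f * normc (p x))); first exact: rinZ.
  apply/funext => x /=; rewrite rIZ; last exact: (@rin_shift (fun t => normc (f t) ^+ 2)).
  by rewrite mulrC (@rI_shift (fun t => normc (f t) ^+ 2)) //; exact/measurable_funX/cmeas_normc.
Qed.

(** Cauchy-Schwarz for the splitting $|p||f|=\sqrt{|p|}\cdot(\sqrt{|p|}\,|f|)$: the first factor has
    squared norm [Np], the second is square-integrable by hypothesis. *)
Lemma young_pt x : rin mu (fun t => normc (p t) * normc (f (x - t)) ^+ 2) ->
  cin mu (fun t => p t * f (x - t)) /\
  normc (cv p f x) ^+ 2 <= Np * rI mu (fun t => normc (p t) * normc (f (x - t)) ^+ 2).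
Proof.
move=> h; have [mf f2] := hf; have [mp ip] := hp.
pose a t : C := (Num.sqrt (normc (p t)))%:C; pose b t : C := a t * f (x - t).
have ma : lmeas a.
  apply: cmeas_real; apply: (@measurableT_comp _ _ _ _ _ _ (@Num.sqrt R)).
    by apply: rmeas_cont; exact: sqrt_continuous.
  exact: cmeas_normc.
have mfx : lmeas (fun t => f (x - t)) by apply: lmeas_comp => //; exact: rmeas_csub.
have na t : normc (a t) ^+ 2 = normc (p t).
  by rewrite /a normc_pos ?sqrtr_ge0 // sqr_sqrtr // normc_ge0.
have la : l2 mu a by split => //; under eq_fun do rewrite na.
have lb : l2 mu b.
  split; first exact: cmeasM.
  by under eq_fun do rewrite /b normcM exprMn na.
have e t : normc (a t * b t) = normc (p t * f (x - t)).
  by rewrite /b mulrA !normcM -expr2 na.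
have cpf : cin mu (fun t => p t * f (x - t)).
  split; first exact: cmeasM.
  by have [_] := cin_l2 la lb; under eq_fun do rewrite e.
split => //.
have := cauchy_schwarz_norm la lb; under eq_fun do rewrite e.
have -> : N2 mu a = Np by congr rI; apply/funext => t; rewrite na.
have -> : N2 mu b = rI mu (fun t => normc (p t) * normc (f (x - t)) ^+ 2).
  by congr rI; apply/funext => t; rewrite /b normcM exprMn na.
apply: le_trans; rewrite lerXn2r ?nnegrE ?normc_ge0 //; last exact: normc_cI.
by apply: rI_ge0 => t; exact: normc_ge0.
Qed.

Lemma cv_L2 : l2 mu (cv p f) /\ N2 mu (cv p f) <= Np ^+ 2 * N2 mu f.
Proof.
have [mf f2] := hf; have [mp ip] := hp.
have [ae1 k1 _] := rin_fubini (rin_swap young_joint); rewrite /= in ae1 k1.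
have e := rI_swap young_joint; rewrite /= in e.
have mcv : lmeas (cv p f) by exact: lmeas_cv.
have e2 : rI mu (fun x => rI mu (fun t => normc (p t) * normc (f (x - t)) ^+ 2)) = Np * N2 mu f.
  rewrite -e mulrC -rIZ; [congr rI; apply/funext => t|exact: ip].
  rewrite rIZ; last exact: (@rin_shift (fun t => normc (f t) ^+ 2)).
  rewrite mulrC; congr (_ * _); apply: (@rI_shift (fun t => normc (f t) ^+ 2)); exact/measurable_funX/cmeas_normc.
have mn : rmeas (fun x => normc (cv p f x) ^+ 2) by exact/measurable_funX/cmeas_normc.
pose K x := rI mu (fun t => normc (p t) * normc (f (x - t)) ^+ 2).
have K0 x : 0 <= K x by apply: rI_ge0 => t; rewrite mulr_ge0 ?normc_ge0 ?sqr_ge0.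
(* The pointwise bound is known only where the inner integral converges. The minimum is bounded
   everywhere and equals the squared modulus almost everywhere. *)
pose m x := Num.min (normc (cv p f x) ^+ 2) (Np * K x).
have em : \forall x \ae mu, m x = normc (cv p f x) ^+ 2.
  by apply: filterS ae1 => x /young_pt[_ h]; apply/min_idPl.
have mm : rmeas m by apply: measurable_minr; [exact: mn|exact: rin_meas (rinZ Np k1)].
have Np0 : 0 <= Np by apply: rI_ge0 => t; exact: normc_ge0.
have im : rin mu m.
  apply: (rin_le mm (rinZ Np k1)).
  move=> x; have m0 : 0 <= m x by rewrite le_min sqr_ge0; exact: mulr_ge0 Np0 (K0 x).
  by rewrite (ger0_norm m0) ge_min lexx orbT.
have i2 : rin mu (fun x => normc (cv p f x) ^+ 2) by exact: (rin_ae mn em im).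
split; first by split.
rewrite /N2 -(rI_ae mm mn em) expr2 -mulrA -e2 -(rIZ Np k1).
by apply: (rI_le im (rinZ Np k1)) => x; rewrite ge_min lexx orbT.
Qed.
Lemma cv_L2_ae : \forall x \ae mu, cin mu (fun t => p t * f (x - t)).
Proof.
have [ae1 _ _] := rin_fubini (rin_swap young_joint).
by apply: filterS ae1 => x /young_pt[].
Qed.
End Young.

(* [MT f s] is the two-sided Laplace transform of [f], with the sign of the Mellin transform
   of [x |-> f (ln x)]; [FT] is its restriction to the imaginary axis. *)
Definition MT f (s : C) : C := cI mu (fun t => f t * cexp (s * t%:C)).
Definition FT f (u : R) : C := MT f (ii * u%:C).

Lemma lmeas_cexp s : lmeas (fun t : R => cexp (s * t%:C)).
Proof. by apply: cmeas_cexp; apply: cmeasM; [exact: cmeas_cst|exact: lmeas_id]. Qed.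
Lemma Re_mulr_rc (s : C) (t : R) : Re (s * t%:C) = Re s * t.
Proof. by rewrite mulrC ReMr mulrC. Qed.
Lemma Im_mulr_rc (s : C) (t : R) : Im (s * t%:C) = Im s * t.
Proof. by rewrite mulrC ImMr mulrC. Qed.
Lemma normc_cexp_st (s : C) (t : R) : normc (cexp (s * t%:C)) = expR (Re s * t).
Proof. by rewrite normc_cexp Re_mulr_rc. Qed.
Lemma normc_cexp_i (u t : R) : normc (cexp (ii * u%:C * t%:C)) = 1.
Proof. by rewrite normc_cexp_st Re_mulr_rc /= !mul0r expR0. Qed.

Lemma cin_FT f u : cin mu f -> cin mu (fun t => f t * cexp (ii * u%:C * t%:C)).
Proof.
move=> hf; apply: (cin_Mb (M := 1) hf); first exact: lmeas_cexp.
by move=> t; rewrite normc_cexp_i.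
Qed.
Lemma FT_bound f u : cin mu f -> normc (FT f u) <= rI mu (fun t => normc (f t)).
Proof.
move=> hf; apply: normc_cI_le; [exact: cin_FT|by case: hf|].
by move=> t; rewrite normcM normc_cexp_i mulr1.
Qed.
Lemma cmeas_MT_joint f : lmeas f -> cmeas (fun z : T * T => f z.2 * cexp (ii * (z.1)%:C * (z.2)%:C)).
Proof.
move=> mf; apply: cmeasM; first exact: (cmeas_comp mf measurable_snd2).
apply: cmeas_cexp; apply: cmeasM; last exact: (cmeas_comp lmeas_id measurable_snd2).
by apply: cmeasM; [exact: cmeas_cst|exact: (cmeas_comp lmeas_id measurable_fst1)].
Qed.
Lemma lmeas_FT f : lmeas f -> lmeas (FT f).
Proof. by move=> mf; exact: (cmeas_cI mu (cmeas_MT_joint mf)). Qed.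
Lemma cin_MT_joint f g : cin mu f -> cin mu g ->
  cin (mu \x mu)%E (fun z : T * T => g z.1 * (f z.2 * cexp (ii * (z.1)%:C * (z.2)%:C))).
Proof.
move=> [mf hf] [mg hg].
have e x t : normc (g x * (f t * cexp (ii * x%:C * t%:C))) = normc (g x) * normc (f t).
  by rewrite normcM (normcM (f t)) normc_cexp_i mulr1.
apply: cin_prod.
- by apply: cmeasM; [exact: (cmeas_comp mg measurable_fst1)|exact: cmeas_MT_joint].
- by apply: aeW => x /=; under eq_fun do rewrite e; exact: rinZ.
- rewrite (_ : (fun x => _) = (fun x => rI mu (fun t => normc (f t)) * normc (g x))); first exact: rinZ.
  by apply/funext => x /=; under eq_fun do rewrite e; rewrite rIZ // mulrC.
Qed.
(** Both sides are iterated integrals of $f(t)g(u)e^{iut}$, absolutely integrable on the plane. The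
    transform on L^2 is later defined by this duality. *)
Lemma FT_mult f g : cin mu f -> cin mu g ->
  cI mu (fun u => FT f u * g u) = cI mu (fun t => f t * FT g t).
Proof.
move=> hf hg; have h := cin_MT_joint hf hg.
transitivity (cI mu (fun u => cI mu (fun t => g u * (f t * cexp (ii * u%:C * t%:C))))).
  by apply: cI_ext => u; rewrite (cIZ (g u) (cin_FT u hf)) mulrC.
rewrite (cI_swap h) /=; apply: cI_ext => t; rewrite -(cIZ (f t) (cin_FT t hg)).
by apply: cI_ext => u; rewrite mulrCA; congr (_ * (_ * cexp _)); ring.
Qed.

(** The weight $e^{st}$ is multiplicative, so the weighted convolution is the convolution of the
    weighted functions, and total integrals of convolutions multiply. The two functions are compared
    where the convolution integral converges, that is almost everywhere. *)
Lemma MT_cv p f s : lmeas p -> lmeas f -> cin mu (fun t => p t * cexp (s * t%:C)) ->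
  cin mu (fun t => f t * cexp (s * t%:C)) ->
  cin mu (fun t => cv p f t * cexp (s * t%:C)) /\ MT (cv p f) s = MT p s * MT f s.
Proof.
move=> mp mf hp hf.
have [h1 h2] := cv_L1 hp hf.
have e : \forall x \ae mu, cv (fun t => p t * cexp (s * t%:C)) (fun t => f t * cexp (s * t%:C)) x =
    cv p f x * cexp (s * x%:C).
  apply: ae_mono (cv_ae hp hf) => x hx.
  have ex t : p t * cexp (s * t%:C) * (f (x - t) * cexp (s * (x - t)%:C)) =
      cexp (s * x%:C) * (p t * f (x - t)).
    have -> : cexp (s * x%:C) = cexp (s * t%:C) * cexp (s * (x - t)%:C).
      by rewrite -cexpD -mulrDr -rcD addrC subrK.
    by ring.
  have hx' : cin mu (fun t => p t * f (x - t)).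
    apply: cin_ext (cinZ (cexp (- (s * x%:C))) hx) => t.
    by rewrite ex mulrA -cexpD addNr cexp0 mul1r.
  by rewrite /cv (cI_ext mu ex) (cIZ _ hx') mulrC.
have mE : lmeas (fun x => cv p f x * cexp (s * x%:C)).
  by apply: cmeasM; [exact: lmeas_cv|exact: lmeas_cexp].
split; first exact: (cin_ae mE e h1).
by rewrite /MT -(cI_ae (cin_meas h1) mE e).
Qed.
End Convolution.

#[global] Opaque cI rI.

(** * The fundamental theorem of calculus for complex-valued functions *)

Section FundamentalTheorem.
Variable R : realType.
Local Notation C := R[i].
Local Notation mu := (@lebesgue_measure R).
Implicit Types (F f g : R -> C).

Definition crd F f := forall x : R, is_derive x (1 : R) (fun t : R => Re (F t)) (Re (f x)) /\
                                    is_derive x (1 : R) (fun t : R => Im (F t)) (Im (f x)).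
Definition ccont f := continuous (fun t : R => Re (f t)) /\ continuous (fun t : R => Im (f t)).
Definition cind (a b : R) (t : R) : C := (\1_(`]a, b]%classic) t : R)%:C.

Lemma crd_cexp s : crd (fun t => cexp (s * t%:C)) (fun t => s * cexp (s * t%:C)).
Proof.
move=> x.
have e1 (t : R) : Re (cexp (s * t%:C)) = expR (Re s * t) * cos (Im s * t).
  by rewrite cexpE ReMr Re_mulr_rc Im_mulr_rc.
have e2 (t : R) : Im (cexp (s * t%:C)) = expR (Re s * t) * sin (Im s * t).
  by rewrite cexpE ImMr Re_mulr_rc Im_mulr_rc.
have d1 : is_derive x (1 : R) (fun t : R => Re s * t) (Re s).
  by apply: is_derive_eq; rewrite /GRing.scale /= mulr1.
have d2 : is_derive x (1 : R) (fun t : R => Im s * t) (Im s).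
  by apply: is_derive_eq; rewrite /GRing.scale /= mulr1.
split.
  under eq_fun do rewrite e1.
  by apply: is_derive_eq; rewrite ReM e1 e2 /GRing.scale /=; ring.
under eq_fun do rewrite e2.
by apply: is_derive_eq; rewrite ImM e1 e2 /GRing.scale /=; ring.
Qed.
Lemma crdZ c F f : crd F f -> crd (fun t => c * F t) (fun t => c * f t).
Proof.
move=> h x; have [h1 h2] := h x; split.
  under eq_fun do rewrite ReM.
  by apply: is_derive_eq; rewrite ReM /GRing.scale /=; ring.
under eq_fun do rewrite ImM.
by apply: is_derive_eq; rewrite ImM /GRing.scale /=; ring.
Qed.
Lemma crd_cont F f : crd F f -> ccont F.
Proof.
by move=> h; split => x; have [[h1 _] [h2 _]] := h x; apply: differentiable_continuous;
   apply/derivable1_diffP.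
Qed.
Lemma ccont_lmeas f : ccont f -> lmeas f.
Proof. by move=> [h1 h2]; split; exact: rmeas_cont. Qed.

Lemma rmeas_itv (a b : R) b0 b1 : rmeas (\1_[set` Interval (BSide b0 a) (BSide b1 b)] : R -> R).
Proof. by apply: measurable_indic; exact: measurable_itv. Qed.
Lemma lmeas_cind a b : lmeas (cind a b).
Proof. by apply: cmeas_real; exact: rmeas_itv. Qed.
Lemma cindE a b t : cind a b t = if (a < t <= b) then 1 else 0.
Proof.
rewrite /cind indicE; case: ifP => h; first by rewrite mem_set //= in_itv.
by rewrite memNset //= in_itv /= h.
Qed.
Lemma normc_cind a b t : normc (cind a b t) = if (a < t <= b) then 1 else 0.
Proof. by rewrite cindE; case: ifP => _; rewrite ?normc1 ?normc0. Qed.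
Lemma normc_cind_le1 a b t : normc (cind a b t) <= 1.
Proof. by rewrite normc_cind; case: ifP. Qed.
Lemma rin_itv a b b0 b1 : rin mu (\1_[set` Interval (BSide b0 a) (BSide b1 b)] : R -> R).
Proof. exact: integrable_indic_itv. Qed.
Lemma cin_cind a b : cin mu (cind a b).
Proof. by apply: cin_real; exact: rin_itv. Qed.
Lemma l2_cind a b : l2 mu (cind a b).
Proof.
apply: (@l2_le _ _ _ mu (fun t => normc (cind a b t))); [exact: lmeas_cind|exact: (cin_norm (cin_cind a b))|].
by move=> t; rewrite normc_cind; case: ifP; rewrite ?expr1n ?expr0n.
Qed.

Lemma rI_ftc (F f : R -> R) (a b : R) : a < b -> (forall x : R, is_derive x (1 : R) F (f x)) ->
  continuous f -> rI mu (fun t => \1_(`]a, b]%classic) t * f t) = F b - F a.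
Proof.
move=> ab dF cf.
have cF : continuous F.
  by move=> x; have [h _] := dF x; apply: differentiable_continuous; apply/derivable1_diffP.
have mf : rmeas f by exact: rmeas_cont.
have := @continuous_FTC2 R f F a b ab.
move=> /(_ _ _ _) h.
have {}h : (\int[mu]_(x in `[a, b]) (f x)%:E)%E = ((F b)%:E - (F a)%:E)%E.
  apply: h; first by apply: continuous_subspaceT.
    split; first by move=> x _; have [] := dF x.
      by apply: cvg_at_right_filter; exact: cF.
    by apply: cvg_at_left_filter; exact: cF.
  by move=> x _; rewrite derive1E; have [_ ->] := dF x.
have e : (\int[mu]_x (\1_(`]a, b]%classic) x * f x)%:E = \int[mu]_(x in `]a, b]) (f x)%:E)%E.
  rewrite [RHS]integral_mkcond; apply: eq_integral => x _; rewrite patchE indicE.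
  by case: ifP => _; rewrite ?mul1r ?mul0r.
rewrite rI_def e integral_itv_obnd_cbnd; last by apply/measurable_EFinP; exact: measurable_funTS.
by rewrite h -EFinB.
Qed.
Lemma cin_cont_itv f a b : ccont f -> cin mu (fun t => cind a b t * f t).
Proof.
move=> [c1 c2]; have mf := ccont_lmeas (conj c1 c2).
pose g t := normc (f t).
have cg : continuous g.
  have -> : g = (fun t => Num.sqrt (Re (f t) ^+ 2 + Im (f t) ^+ 2)).
    by apply/funext => t; rewrite -normc_sqr sqrtr_sqr ger0_norm // normc_ge0.
  move=> x; apply: (@continuous_comp _ _ _ (fun t => Re (f t) ^+ 2 + Im (f t) ^+ 2) (@Num.sqrt R)).
    by apply: cvgD; apply: cvgM; [exact: c1|exact: c1|exact: c2|exact: c2].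
  exact: sqrt_continuous.
have [ab|ba] := leP a b; last first.
  apply: (cin_ext (f := fun=> 0)); last exact: cin0.
  move=> t; rewrite cindE; case: ifP => [/andP[h1 h2]|]; last by rewrite mul0r.
  by have := lt_le_trans h1 h2; rewrite ltNge (ltW ba).
have [M hM] : exists M, forall t, a < t <= b -> g t <= M.
  have [M _ hM] := @EVT_max R g a b ab (continuous_subspaceT cg).
  by exists (g M) => t /andP[h1 h2]; apply: hM; rewrite in_itv /= (ltW h1).
apply: (@cin_le _ _ _ mu (fun t => `|M| * normc (cind a b t))).
- by apply: cmeasM; [exact: lmeas_cind|].
- by apply: rinZ; exact: (cin_norm (cin_cind a b)).
- move=> t; rewrite normcM normc_cind; case: ifP => h; last by rewrite mul0r mulr0.
  by rewrite mul1r mulr1; apply: le_trans (hM t h) (ler_norm M).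
Qed.
Lemma cI_ReE (f : R -> C) : Re (cI mu f) = rI mu (fun t => Re (f t)). Proof. by []. Qed.
Lemma cI_ImE (f : R -> C) : Im (cI mu f) = rI mu (fun t => Im (f t)). Proof. by []. Qed.
Lemma cI_ftc F f a b : a < b -> crd F f -> ccont f ->
  cI mu (fun t => cind a b t * f t) = F b - F a.
Proof.
move=> ab dF [c1 c2]; apply: complexP.
  rewrite cI_ReE ReB -(rI_ftc ab (fun x => proj1 (dF x)) c1); congr rI.
  by apply/funext => t; rewrite /cind ReMr.
rewrite cI_ImE ImB -(rI_ftc ab (fun x => proj2 (dF x)) c2); congr rI.
by apply/funext => t; rewrite /cind ImMr.
Qed.
Lemma ccont_cexp s : ccont (fun t => cexp (s * t%:C)).
Proof. exact: crd_cont (crd_cexp s). Qed.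
Lemma ccontM f g : ccont f -> ccont g -> ccont (fun t => f t * g t).
Proof.
move=> [f1 f2] [g1 g2]; split; [under eq_fun do rewrite ReM|under eq_fun do rewrite ImM] => x.
  by apply: cvgB; apply: cvgM; [exact: f1|exact: g1|exact: f2|exact: g2].
by apply: cvgD; apply: cvgM; [exact: f1|exact: g2|exact: f2|exact: g1].
Qed.
Lemma ccont_cst c : ccont (fun=> c).
Proof. by split => x; exact: cvg_cst. Qed.
Lemma ccontZ c f : ccont f -> ccont (fun t => c * f t).
Proof. by move=> h; apply: ccontM => //; exact: ccont_cst. Qed.

Lemma lt_natr_bound (t : R) : exists N, forall n, (N <= n)%N -> - n.+1%:R < t <= n.+1%:R.
Proof.
exists (Num.bound `|t|) => n Nn.
have : `|t| < n.+1%:R by apply: lt_le_trans (archi_boundP (normr_ge0 t)) _; rewrite ler_nat (leq_trans Nn).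
by rewrite ltr_norml => /andP[-> /ltW ->].
Qed.
(** Dominated convergence over the windows []-(n+1), n+1]]; the shift by one keeps every window
    nondegenerate, as the fundamental theorem of calculus requires. *)
Lemma cI_trunc f : cin mu f ->
  ccvg (fun n => cI mu (fun t => cind (- n.+1%:R) n.+1%:R t * f t)) (cI mu f).
Proof.
move=> [mf hf].
have mF n : lmeas (fun t => cind (- n.+1%:R) n.+1%:R t * f t).
  by apply: cmeasM => //; exact: lmeas_cind.
have cF : \forall t \ae mu, ccvg (fun n => cind (- n.+1%:R) n.+1%:R t * f t) (f t).
  apply: aeW => t; have [N hN] := lt_natr_bound t.
  by apply: (ccvg_eventually (N := N)) => n /hN h; rewrite cindE h mul1r.
have bF n t : normc (cind (- n.+1%:R) n.+1%:R t * f t) <= normc (f t).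
  by rewrite normcM ler_piMl ?normc_ge0 ?normc_cind_le1.
exact: (proj2 (cI_dct mF mf cF hf bF)).
Qed.

Definition step (t : R) : R := \1_(`]0, +oo[%classic) t.
Lemma stepE t : step t = if 0 < t then 1 else 0.
Proof.
rewrite /step indicE; case: ifP => h; first by rewrite mem_set //= in_itv /= h.
by rewrite memNset //= in_itv /= h.
Qed.
Lemma rmeas_step : rmeas step.
Proof. by apply: measurable_indic; exact: measurable_itv. Qed.
Lemma expR_cvg0 (a : R) : 0 < a -> (fun n : nat => expR (- (a * n%:R))) @ \oo --> (0 : R).
Proof.
move=> a0; rewrite (_ : (fun n => _) = (fun n => (expR (- a)) ^+ n)); last first.
  by apply/funext => n; rewrite -expRM_natr mulNr.
by apply: cvg_expr; rewrite ger0_norm ?expR_ge0 // expR_lt1 oppr_lt0.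
Qed.
Lemma rin_step_exp a : 0 < a -> rin mu (fun t => step t * expR (- (a * t))) /\
  rI mu (fun t => step t * expR (- (a * t))) = a^-1.
Proof.
move=> a0.
have cexpa : continuous (fun t => expR (- (a * t))).
  move=> x; apply: (@continuous_comp _ _ _ (fun t => - (a * t)) (@expR R)); last exact: continuous_expR.
  by apply: cvgN; apply: cvgMl_tmp; exact: cvg_id.
have h : (\int[mu]_(x in `[0%R, +oo[%classic) (expR (- (a * x)))%:E = (a^-1)%:E)%E.
  have dE x : is_derive x (1 : R) (fun t => - a^-1 * expR (- (a * t))) (expR (- (a * x))).
    have d1 : is_derive x (1 : R) (fun t : R => - (a * t)) (- a).
      by apply: is_derive_eq; rewrite /GRing.scale /= mulr1.
    by apply: is_derive_eq; rewrite /GRing.scale /=; field; exact: lt0r_neq0.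
  rewrite (@ge0_continuous_FTC2y R _ (fun t => - a^-1 * expR (- (a * t))) 0 0) //.
  - by rewrite mulr0 oppr0 expR0 mulr1 sub0e -EFinN opprK.
  - by apply: continuous_subspaceT.
  - rewrite -[X in _ --> X](mulr0 (- a^-1)); apply: cvgMl_tmp.
    apply: (@cvg_comp _ _ _ (fun t => a * t) (fun t => expR (- t)) _ +oo%R); last exact: cvgr_expR.
    by apply: gt0_cvgMry => //; exact: cvg_id.
  - apply: cvg_at_right_filter; apply: cvgMl_tmp; exact: cexpa.
  - by move=> x _; rewrite derive1E; have [_ ->] := dE x.
have mf : rmeas (fun t => step t * expR (- (a * t))).
  by apply: measurable_funM; [exact: rmeas_step|exact: rmeas_cont].
have e : (\int[mu]_x (step x * expR (- (a * x)))%:E = (a^-1)%:E)%E.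
  rewrite -h -integral_itv_obnd_cbnd; last first.
    by apply/measurable_EFinP; apply: measurable_funTS; exact: rmeas_cont.
  rewrite [RHS]integral_mkcond; apply: eq_integral => x _; rewrite patchE /step indicE.
  by case: ifP => _; rewrite ?mul1r ?mul0r.
have i : rin mu (fun t => step t * expR (- (a * t))).
  apply: rinP => //; last by rewrite e ltry.
  by move=> x; rewrite mulr_ge0 ?expR_ge0 // stepE; case: ifP.
by split => //; have := rIE i; rewrite e => -[].
Qed.

(** The antiderivative $-e^{-st}/s$ on []0, n+1]] leaves $1/s$ and a boundary term that decays with
    [n]. *)
Lemma cexp_step s : 0 < Re s ->
  cin mu (fun t => (step t)%:C * cexp (- s * t%:C)) /\
  cI mu (fun t => (step t)%:C * cexp (- s * t%:C)) = s^-1.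
Proof.
move=> s0; have [i1 _] := rin_step_exp s0.
have s0' : s != 0 by apply: contraTneq s0 => ->; rewrite ltxx.
have me : lmeas (fun t => (step t)%:C * cexp (- s * t%:C)).
  by apply: cmeasM; [apply: cmeas_real; exact: rmeas_step|exact: lmeas_cexp].
have ne t : normc ((step t)%:C * cexp (- s * t%:C)) = step t * expR (- (Re s * t)).
  rewrite normcM normc_cexp_st ReN mulNr normc_pos // stepE; by case: ifP.
have ci : cin mu (fun t => (step t)%:C * cexp (- s * t%:C)).
  by split => //; under eq_fun do rewrite ne.
split => //.
have [k1 k2] : ccvg (fun n => cI mu (fun t => cind (- n.+1%:R) n.+1%:R t * ((step t)%:C * cexp (- s * t%:C)))) s^-1 /\ True.
  split => //; have s1 : - s != 0 by rewrite oppr_eq0.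
  have dF := crdZ (- s)^-1 (crd_cexp (- s)).
  have e n : cI mu (fun t => cind (- n.+1%:R) n.+1%:R t * ((step t)%:C * cexp (- s * t%:C))) =
     (- s)^-1 * cexp (- s * n.+1%:R%:C) - (- s)^-1.
    have n0 : 0 < n.+1%:R :> R by rewrite ltr0n.
    transitivity (cI mu (fun t => cind 0 n.+1%:R t * ((- s)^-1 * (- s * cexp (- s * t%:C))))).
      apply: cI_ext => t; rewrite (mulKf s1) stepE !cindE.
      have [t0|t0] := boolP (0 < t); last first.
        by rewrite [X in _ * (X * _) = _](_ : _ = 0) //= !mul0r mulr0.
      by rewrite (lt_trans _ t0) ?oppr_lt0 //= mul1r.
    rewrite (cI_ftc n0 dF); last by apply: ccontZ; apply: ccontZ; exact: ccont_cexp.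
    by rewrite mulr0 cexp0 mulr1.
  apply: (ccvg_ext (fun n => esym (e n))).
  have -> : s^-1 = (- s)^-1 * 0 - (- s)^-1 by rewrite mulr0 sub0r invrN opprK.
  apply: ccvgB; last exact: ccvg_cst.
  apply: ccvgZ; rewrite /ccvg; under eq_fun do rewrite subr0 normc_cexp_st ReN mulNr.
  by have := expR_cvg0 s0; rewrite -(@cvg_shiftS _ (fun n => expR (- (Re s * n%:R)))).
exact: ccvg_uniq (cI_trunc ci) k1.
Qed.

End FundamentalTheorem.

(** * Plancherel's theorem *)

Section PoissonKernel.
Variable R : realType.
Local Notation C := R[i].
Local Notation mu := (@lebesgue_measure R).
Local Notation T := (measurableTypeR R).
Implicit Types (f g p : R -> C) (e : R).

Definition eabs e (u : R) : R := expR (- (e * `|u|)).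
(** This is $2\pi$ times the Poisson kernel of the half plane. Its total mass $2\pi$ is the source
    of the factors $2\pi$ in Plancherel's identity and in the inversion formula. *)
Definition PK e (t : R) : R := 2 * e / (e ^+ 2 + t ^+ 2).

Lemma eabs_ge0 e u : 0 <= eabs e u. Proof. exact: expR_ge0. Qed.
Lemma eabs_le1 e u : 0 <= e -> eabs e u <= 1.
Proof. by move=> e0; rewrite expR_le1 oppr_le0 mulr_ge0. Qed.
Lemma rmeas_eabs e : rmeas (eabs e).
Proof.
apply: rmeas_cont => x; apply: (@continuous_comp _ _ _ (fun u => - (e * `|u|)) (@expR R)); last exact: continuous_expR.
by apply: cvgN; apply: cvgMl_tmp; exact: norm_continuous.
Qed.
Lemma eabs_step e u : u != 0 -> eabs e u = step u * expR (- (e * u)) + step (- u) * expR (- (e * - u)).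
Proof.
move=> u0; rewrite !stepE oppr_gt0 /eabs; have [up|un] := ltP 0 u.
  by rewrite ltNge (ltW up) /= mul1r mul0r addr0 ger0_norm // ltW.
have -> : u < 0 by rewrite lt_neqAle u0.
by rewrite mul0r add0r mul1r ler0_norm.
Qed.
Lemma neq_ae (a : R) : \forall x \ae mu, x != a.
Proof.
exists [set a]; split; first exact: measurable_set1.
  exact: lebesgue_measure_set1.
by move=> x /= h; apply/eqP; apply: contra_notT h.
Qed.
Lemma rin_eabs e : 0 < e -> rin mu (eabs e).
Proof.
move=> e0; have [i1 _] := rin_step_exp e0.
apply: (rin_ae (rmeas_eabs e) _ (rinD i1 (rin_opp i1))).
by apply: ae_mono (neq_ae 0) => u /(eabs_step e) ->.
Qed.
(** The half lines contribute $1/(e-it)$ and $1/(e+it)$, whose sum is $2e/(e^2+t^2)$; the origin,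
    left out by both, is null. *)
Lemma FT_eabs e t : 0 < e -> FT (fun u => (eabs e u)%:C) t = (PK e t)%:C.
Proof.
move=> e0; rewrite /FT /MT.
pose s1 : C := e%:C - ii * t%:C; pose s2 : C := e%:C + ii * t%:C.
have r1 : Re s1 = e by rewrite /s1 ReB Re_mulr_rc /= mul0r subr0.
have r2 : Re s2 = e by rewrite /s2 ReD Re_mulr_rc /= mul0r addr0.
have [|c1 v1] := @cexp_step R s1; first by rewrite r1.
have [|c2 v2] := @cexp_step R s2; first by rewrite r2.
have c2' := cin_opp c2.
have -> : cI mu (fun u => (eabs e u)%:C * cexp (ii * t%:C * u%:C)) =
   cI mu (fun u => (step u)%:C * cexp (- s1 * u%:C) + (step (- u))%:C * cexp (- s2 * (- u)%:C)).
  apply: cI_ae.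
  - by apply: cmeasM; [apply: cmeas_real; exact: rmeas_eabs|exact: lmeas_cexp].
  - exact: cin_meas (cinD c1 c2').
  - apply: ae_mono (neq_ae 0) => u u0; rewrite (eabs_step _ u0) rcD mulrDl; congr (_ + _).
      by rewrite rcM -mulrA -cexp_real -cexpD; congr (_ * cexp _); rewrite /s1 rcN rcM; ring.
    by rewrite rcM -mulrA -cexp_real -cexpD; congr (_ * cexp _); rewrite /s2 !rcN rcM rcN; ring.
rewrite (cID c1 c2') v1 (cI_opp (cin_meas c2)) v2.
have n1 : s1 != 0 by apply/eqP => h; move: r1; rewrite h /= => e00; rewrite -e00 ltxx in e0.
have n2 : s2 != 0 by apply/eqP => h; move: r2; rewrite h /= => e00; rewrite -e00 ltxx in e0.
have es : s1 * s2 = (e ^+ 2 + t ^+ 2)%:C.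
  by rewrite /s1 /s2; apply: complexP; rewrite ?ReE ?ImE /=; ring.
have n3 : e ^+ 2 + t ^+ 2 != 0 by rewrite gt_eqF // ltr_wpDr ?sqr_ge0 // exprn_gt0.
rewrite /PK rcM rcV -es rcM rcnat.
have -> : s1^-1 + s2^-1 = (s1 + s2) / (s1 * s2) by field; rewrite n1 n2.
by congr (_ / _); rewrite /s1 /s2; ring.
Qed.
Lemma PK_ge0 e t : 0 < e -> 0 <= PK e t.
Proof. by move=> e0; rewrite divr_ge0 ?mulr_ge0 ?addr_ge0 ?sqr_ge0 // ltW. Qed.
Lemma rmeas_PK e : 0 < e -> rmeas (PK e).
Proof.
move=> e0; apply: rmeas_cont => x; apply: cvgMl_tmp; apply: cvgV.
  by rewrite gt_eqF // ltr_wpDr ?sqr_ge0 // exprn_gt0.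
by apply: cvgD; [exact: cvg_cst|apply: cvgM; exact: cvg_id].
Qed.
Lemma rin_step_PK1 : rin mu (fun t => step t * PK 1 t) /\ rI mu (fun t => step t * PK 1 t) = pi.
Proof.
have cK : continuous (PK 1).
  move=> x; apply: cvgMl_tmp; apply: cvgV; first by rewrite gt_eqF // ltr_wpDr ?sqr_ge0 // exprn_gt0.
  by apply: cvgD; [exact: cvg_cst|apply: cvgM; exact: cvg_id].
have h : (\int[mu]_(x in `[0%R, +oo[%classic) (PK 1 x)%:E = pi%:E)%E.
  have dE (x : R) : is_derive x (1 : R) (fun t => 2 * atan t) (PK 1 x).
    have d1 : is_derive x (1 : R) (@atan R) (1 + x ^+ 2)^-1.
      by split; [exact: derivable_atan|rewrite -derive1E derive1_atan].
    by apply: is_derive_eq; rewrite /PK /GRing.scale /= mulr1 expr1n.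
  rewrite (@ge0_continuous_FTC2y R _ (fun t => 2 * atan t) 0 pi) //.
  - by rewrite atan0 mulr0 sube0.
  - by move=> x _; exact: PK_ge0.
  - by apply: continuous_subspaceT.
  - rewrite -[X in _ --> X](_ : 2 * (pi / 2) = pi); last by field.
    by apply: cvgMl_tmp; exact: cvgy_atan.
  - by apply: cvg_at_right_filter; apply: cvgMl_tmp; exact: continuous_atan.
  - by move=> x _; rewrite derive1E; have [_ ->] := dE x.
have mf : rmeas (fun t => step t * PK 1 t).
  by apply: measurable_funM; [exact: rmeas_step|exact: rmeas_cont].
have e : (\int[mu]_x (step x * PK 1 x)%:E = pi%:E)%E.
  rewrite -h -integral_itv_obnd_cbnd; last first.
    by apply/measurable_EFinP; apply: measurable_funTS; exact: rmeas_cont.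
  rewrite [RHS]integral_mkcond; apply: eq_integral => x _; rewrite patchE /step indicE.
  by case: ifP => _; rewrite ?mul1r ?mul0r.
have i : rin mu (fun t => step t * PK 1 t).
  apply: rinP => //; last by rewrite e ltry.
  by move=> x; rewrite mulr_ge0 ?PK_ge0 // stepE; case: ifP.
by split => //; have := rIE i; rewrite e => -[].
Qed.
Lemma PK1 : rin mu (PK 1) /\ rI mu (PK 1) = 2 * pi.
Proof.
have [i v] := rin_step_PK1; have i2 := rinD i (rin_opp i).
have e : \forall x \ae mu, step x * PK 1 x + step (- x) * PK 1 (- x) = PK 1 x.
  apply: ae_mono (neq_ae 0) => x x0; rewrite !stepE oppr_gt0 /PK sqrrN.
  have [xp|xn] := ltP 0 x; first by rewrite ltNge (ltW xp) /= mul1r mul0r addr0.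
  have -> : x < 0 by rewrite lt_neqAle x0.
  by rewrite mul0r add0r mul1r.
have m := rmeas_PK (ltr01 : 0 < 1 :> R).
split; first exact: (rin_ae m e i2).
rewrite -(rI_ae (rin_meas i2) m e) (rID i (rin_opp i)) (rI_opp (rin_meas i)) v; ring.
Qed.
Lemma PK_scale e t : 0 < e -> e * PK e (e * t) = PK 1 t.
Proof.
move=> e0; rewrite /PK; field.
have h1 : 0 < 1 + t ^+ 2 by rewrite ltr_wpDr ?sqr_ge0.
have h2 : 0 < e ^+ 2 + (e * t) ^+ 2 by rewrite ltr_wpDr ?sqr_ge0 // exprn_gt0.
by rewrite !gt_eqF.
Qed.
Lemma rin_PK e : 0 < e -> rin mu (PK e) /\ rI mu (PK e) = 2 * pi.
Proof.
move=> e0; have S := scale_substitutes e0; have m := rmeas_PK e0; have [i v] := PK1.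
have h : (fun t => e * PK e (e * t)) = PK 1 by apply/funext => t; exact: PK_scale.
split; first by apply: (proj2 (subst_rin S m)); rewrite h.
by rewrite (subst_rI S m) h.
Qed.

(* Smoothing an indicator function of an interval by the Poisson kernel. *)
Definition sm a b e (s : R) : C := cI mu (fun t => cind a b t * (PK e (s + t))%:C).

Lemma cin_PK e : 0 < e -> cin mu (fun t => (PK e t)%:C).
Proof. by move=> e0; apply: cin_real; have [] := rin_PK e0. Qed.
Lemma cin_PK_shift e s : 0 < e -> cin mu (fun t => (PK e (s + t))%:C).
Proof.
by move=> e0; apply: cin_ext (cin_shift s (cin_PK e0)) => t; rewrite addrC.
Qed.
Lemma sm_bound a b e s : 0 < e -> normc (sm a b e s) <= 2 * pi.
Proof.
move=> e0; have [i v] := rin_PK e0; have m := rmeas_PK e0.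
have i2 : rin mu (fun t => PK e (s + t)).
  by have := rin_shift s i; under eq_fun do rewrite addrC.
have ci := cin_bM (lmeas_cind a b) (normc_cind_le1 a b) (cin_PK_shift s e0).
apply: le_trans (normc_cI_le ci i2 _) _.
  by move=> t; rewrite normcM normc_pos ?PK_ge0 // ler_piMl ?PK_ge0 // normc_cind_le1.
rewrite -v -(rI_shift s m); under [X in _ <= rI _ X]eq_fun do rewrite addrC.
by [].
Qed.
Lemma sm_scale a b e s : 0 < e -> sm a b e s = cI mu (fun t => cind a b (e * t - s) * (PK 1 t)%:C).
Proof.
move=> e0; have mP := cmeas_real (rmeas_PK e0).
have m1 : lmeas (fun t => cind a b (t - s) * (PK e t)%:C).
  by apply: cmeasM => //; apply: (lmeas_comp (lmeas_cind a b)); exact: rmeas_shift.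
have -> : sm a b e s = cI mu (fun t => cind a b (t - s) * (PK e t)%:C).
  rewrite -(cI_shift s m1); apply: cI_ext => t.
  by rewrite addrK (addrC t).
rewrite (subst_cI (scale_substitutes e0) m1); apply: cI_ext => t.
by rewrite mulrCA -rcM PK_scale.
Qed.
(** After scaling, the kernel is fixed and only the indicator moves: its argument tends to [- s],
    and away from the endpoints the indicator is locally constant. [PK 1] dominates. *)
Lemma sm_cvg a b s : - s != a -> - s != b ->
  ccvg (fun n => sm a b n.+1%:R^-1 s) ((2 * pi)%:C * cind a b (- s)).
Proof.
move=> sa sb; have [i v] := PK1.
pose F n t := cind a b (n.+1%:R^-1 * t - s) * (PK 1 t)%:C.
have n0 n : 0 < n.+1%:R^-1 :> R by rewrite invr_gt0 ltr0n.
apply: (ccvg_ext (u := fun n => cI mu (F n))) => [n|]; first by rewrite sm_scale.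
have mP := cmeas_real (rmeas_PK (ltr01 : 0 < 1 :> R)).
have mF n : lmeas (F n).
  apply: cmeasM => //; apply: (lmeas_comp (lmeas_cind a b)).
  by apply: rmeas_cont => x; apply: cvgB; [apply: cvgMl_tmp; exact: cvg_id|exact: cvg_cst].
have mG : lmeas (fun t => cind a b (- s) * (PK 1 t)%:C) by apply: cmeasM => //; exact: cmeas_cst.
have cF : \forall t \ae mu, ccvg (fun n => F n t) (cind a b (- s) * (PK 1 t)%:C).
  apply: aeW => t.
  have tn : (fun n => n.+1%:R^-1 * t - s) @ \oo --> - s.
    rewrite -[X in _ --> X]add0r; apply: cvgB; last exact: cvg_cst.
    by rewrite -[X in _ --> X](mul0r t); apply: cvgMr_tmp; exact: cvg_harmonic.
  have [N hN] : exists N, forall n, (N <= n)%N -> cind a b (n.+1%:R^-1 * t - s) = cind a b (- s).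
    (* An argument closer than [d] to [- s] lies on the same side of both endpoints as [- s]. *)
    pose d := Num.min `|- s - a| `|- s - b|.
    have d0 : 0 < d by rewrite lt_min !normr_gt0 !subr_eq0 sa sb.
    have /cvgrPdist_lt/(_ _ d0)[N _ hN] := tn.
    exists N => n /hN; rewrite lt_min => /andP[].
    set y := _ * t - s; rewrite !cindE => h1 h2.
    have e1 : (a < y) = (a < - s).
      move: h1; rewrite lter_norml => /andP[].
      have [h|h] := ltP a (- s).
        by rewrite ger0_norm ?subr_ge0 ?(ltW h) // => k1 k2; apply/idP; lra.
      by rewrite ler0_norm ?subr_le0 // => k1 k2; apply/negbTE; rewrite -leNgt; lra.
    have e2 : (y <= b) = (- s <= b).
      move: h2; rewrite lter_norml => /andP[].
      have [h|h] := leP (- s) b.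
        have hb : - s < b by rewrite lt_neqAle sb.
        by rewrite ltr0_norm ?subr_lt0 // => k1 k2; apply/idP; lra.
      by rewrite gtr0_norm ?subr_gt0 // => k1 k2; apply/negbTE; rewrite -ltNge; lra.
    by rewrite e1 e2.
  by apply: (ccvg_eventually (N := N)) => n /hN h; rewrite /F h.
have bF n t : normc (F n t) <= PK 1 t.
  by rewrite normcM normc_pos ?PK_ge0 // ler_piMl ?PK_ge0 ?normc_cind_le1.
have [_ h] := cI_dct mF mG cF i bF.
move: h; rewrite (cIZ _ (cin_PK ltr01)) cI_real v mulrC => h; exact: h.
Qed.
End PoissonKernel.

(** * The Fourier transform on L^2 *)

Section Plancherel.
Variable R : realType.
Local Notation C := R[i].
Local Notation mu := (@lebesgue_measure R).
Local Notation T := (measurableTypeR R).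
Implicit Types (f g p G phi : R -> C).

Definition l12 f := cin mu f /\ l2 mu f.

Lemma l12_cind a b : l12 (cind a b). Proof. by split; [exact: cin_cind|exact: l2_cind]. Qed.
Lemma l12B f g : l12 f -> l12 g -> l12 (fun x => f x - g x).
Proof. by move=> [h1 h2] [h3 h4]; split; [exact: cinB|exact: l2B]. Qed.
Lemma FTB f g u : cin mu f -> cin mu g -> FT (fun x => f x - g x) u = FT f u - FT g u.
Proof.
move=> hf hg; rewrite /FT /MT -(cIB (cin_FT u hf) (cin_FT u hg)); apply: cI_ext => t.
by rewrite mulrBl.
Qed.
Lemma cexp_i_conj (u t : R) : (conjc (cexp (ii * u%:C * t%:C))) = cexp (ii * (- u)%:C * t%:C).
Proof.
rewrite cexp_conj; congr cexp; apply: complexP.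
  by rewrite Re_conj !Re_mulr_rc /=; ring.
by rewrite Im_conj !Im_mulr_rc /=; ring.
Qed.
Lemma FT_conj f u : cin mu f -> FT (fun t => (conjc (f t))) u = (conjc (FT f (- u))).
Proof.
move=> hf; rewrite /FT /MT -(cI_conj (cin_FT (- u) hf)); apply: cI_ext => t.
by rewrite conjcM cexp_i_conj opprK.
Qed.
Lemma cexp_iD (u v t : R) : cexp (ii * u%:C * t%:C) * cexp (ii * v%:C * t%:C) = cexp (ii * (u + v)%:C * t%:C).
Proof. by rewrite -cexpD; congr cexp; rewrite rcD; ring. Qed.
Lemma FT_mod f (v u : R) : FT (fun t => f t * cexp (ii * v%:C * t%:C)) u = FT f (v + u).
Proof. by apply: cI_ext => t; rewrite -mulrA cexp_iD. Qed.

Lemma lmeas_eabs e : lmeas (fun u : R => (eabs e u)%:C).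
Proof. by apply: cmeas_real; exact: rmeas_eabs. Qed.
Lemma cin_eabs e : 0 < e -> cin mu (fun u => (eabs e u)%:C).
Proof. by move=> e0; apply: cin_real; exact: rin_eabs. Qed.
Lemma cin_FT_eabs e f : 0 < e -> cin mu f -> cin mu (fun u => FT f u * (eabs e u)%:C).
Proof.
move=> e0 hf; apply: (cin_bM _ _ (cin_eabs e0)); first exact: lmeas_FT (cin_meas hf).
by move=> u; exact: FT_bound.
Qed.
(* The damping factor turns into convolution with the Poisson kernel. *)
Lemma FT_FT_eabs e f s : 0 < e -> cin mu f ->
  FT (fun u => FT f u * (eabs e u)%:C) s = cI mu (fun t => f t * (PK e (s + t))%:C).
Proof.
move=> e0 hf; rewrite /FT {1}/MT.
transitivity (cI mu (fun u => FT f u * ((eabs e u)%:C * cexp (ii * s%:C * u%:C)))).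
  by apply: cI_ext => u; rewrite mulrA.
rewrite (FT_mult hf (cin_FT s (cin_eabs e0))); apply: cI_ext => t.
by rewrite FT_mod FT_eabs.
Qed.

(** Pairing [FT f] with its damped conjugate gives the left side. By the multiplication formula this
    is also the pairing of [f] with the convolution of its conjugate with [PK e], which Young's
    inequality with mass $2\pi$ and Cauchy-Schwarz bound uniformly in [e]. *)
Lemma bessel_eabs e f : 0 < e -> l12 f ->
  rin mu (fun u => normc (FT f u) ^+ 2 * eabs e u) /\
  rI mu (fun u => normc (FT f u) ^+ 2 * eabs e u) <= 2 * pi * N2 mu f.
Proof.
move=> e0 [hf lf]; have hc := cin_conj hf.
have mFT := lmeas_FT (cin_meas hf).
pose psi u := (conjc (FT f u)) * (eabs e u)%:C.
have cpsi : cin mu psi.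
  apply: (cin_bM (cmeas_conj mFT) _ (cin_eabs e0)) => u.
  by rewrite normc_conj; exact: FT_bound.
have key : cI mu (fun u => FT f u * psi u) = (rI mu (fun u => normc (FT f u) ^+ 2 * eabs e u))%:C.
  by rewrite -cI_real; apply: cI_ext => u; rewrite /psi mulrA mul_conjc -rcM.
have i1 : rin mu (fun u => normc (FT f u) ^+ 2 * eabs e u).
  have := cin_Re (cin_bM mFT (fun u => FT_bound u hf) cpsi).
  by under eq_fun do rewrite /psi mulrA mul_conjc ReMr /=.
split => //.
have [iP vP] := rin_PK e0.
pose fc t := conjc (f t).
have lfc : l2 mu fc by exact: l2_conj.
have [lK nK] := cv_L2 (cin_PK e0) lfc.
(* Conjugation reverses the frequency; since [PK e] is even, [- s + t] may be replaced by [s - t],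
   and the integral becomes a convolution. *)
have hpsi s : FT psi s = cv (fun t => (PK e t)%:C) fc s.
  have c1 : cin mu (fun t => f t * (PK e (- s + t))%:C).
    apply: (cin_Mb (M := 2 * e / e ^+ 2) hf).
      apply: cmeas_real; apply: (@measurableT_comp _ _ _ T T T (PK e)); [exact: rmeas_PK|].
      by apply: measurable_funD => //; exact: measurable_cst.
    move=> t; rewrite normc_pos ?PK_ge0 // /PK ler_pM2l ?mulr_gt0 // lef_pV2 ?posrE ?exprn_gt0 //.
      by rewrite lerDl sqr_ge0.
    by rewrite ltr_wpDr ?sqr_ge0 // exprn_gt0.
  have -> : FT psi s = conjc (FT (fun u => FT f u * (eabs e u)%:C) (- s)).
    rewrite -(FT_conj s (cin_FT_eabs e0 hf)); apply: cI_ext => u; congr (_ * _).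
    by rewrite /psi conjcM conjc_real.
  rewrite (FT_FT_eabs (- s) e0 hf) -(cI_conj c1) (cvC s (cin_meas (cin_PK e0)) (l2_meas lfc)).
  apply: cI_ext => t; rewrite conjcM conjc_real; congr (_ * _%:C).
  by have -> : - s + t = - (s - t) by [rewrite opprB addrC]; rewrite /PK sqrrN.
have hc2 : cI mu (fun u => FT f u * psi u) = cI mu (fun t => f t * cv (fun t => (PK e t)%:C) fc t).
  by rewrite (FT_mult hf cpsi); apply: cI_ext => t; rewrite hpsi.
have := cauchy_schwarz lf lK; rewrite -hc2 key normc_pos; last first.
  by apply: rI_ge0 => u; rewrite mulr_ge0 ?sqr_ge0 ?eabs_ge0.
have vP' : rI mu (fun t => normc (PK e t)%:C) = 2 * pi.
  by rewrite -vP; congr rI; apply/funext => t; rewrite normc_pos // PK_ge0.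
have p0 : 0 <= 2 * pi :> R by rewrite mulr_ge0 ?pi_ge0.
move=> h; rewrite -(@ler_pXn2r _ 2) ?nnegrE //; last 2 first.
- by apply: rI_ge0 => u; rewrite mulr_ge0 ?sqr_ge0 ?eabs_ge0.
- by rewrite mulr_ge0 ?N2_ge0.
apply: le_trans h _; apply: (@le_trans _ _ (N2 mu f * ((2 * pi) ^+ 2 * N2 mu f))).
  rewrite ler_wpM2l ?N2_ge0 //; apply: le_trans nK _.
  by rewrite vP' /fc N2_conj.
by rewrite le_eqVlt; apply/orP; left; apply/eqP; ring.
Qed.

Lemma eabs_cvg1 (u : R) : (fun n => eabs n.+1%:R^-1 u) @ \oo --> (1 : R).
Proof.
have h : (fun n => expR (- (n.+1%:R^-1 * `|u|))) @ \oo --> expR (0 : R).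
  apply: (@continuous_cvg _ _ _ \oo _ (fun n => - (n.+1%:R^-1 * `|u|)) (@expR R)) => //; first exact: continuous_expR.
  rewrite -oppr0; apply: cvgN; rewrite -(mul0r `|u|); apply: cvgMr_tmp; exact: cvg_harmonic.
by rewrite expR0 in h.
Qed.
(** The damping factors increase to 1, so monotone convergence removes them from the uniform bound
    and gives square-integrability at the same time. *)
Lemma bessel f : l12 f -> l2 mu (FT f) /\ N2 mu (FT f) <= 2 * pi * N2 mu f.
Proof.
move=> hf; have mFT := lmeas_FT (cin_meas (proj1 hf)).
have n0 n : 0 < n.+1%:R^-1 :> R by rewrite invr_gt0 ltr0n.
pose g n u := (normc (FT f u) ^+ 2 * eabs n.+1%:R^-1 u)%:E.
have mn : rmeas (fun u => normc (FT f u) ^+ 2) by exact/measurable_funX/cmeas_normc.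
have lim : (\int[mu]_u (normc (FT f u) ^+ 2)%:E <= (2 * pi * N2 mu f)%:E)%E.
  have -> : (\int[mu]_u (normc (FT f u) ^+ 2)%:E = limn (fun n => \int[mu]_u g n u))%E.
    rewrite -monotone_convergence //.
    - apply: eq_integral => u _; apply/esym/cvg_lim => //; apply: cvg_EFin; first exact: nearW.
      by rewrite -[X in _ --> X]mulr1; apply: cvgMl_tmp; exact: eabs_cvg1.
    - by move=> n; apply/measurable_EFinP; apply: measurable_funM => //; exact: rmeas_eabs.
    - by move=> n u _; rewrite lee_fin mulr_ge0 ?sqr_ge0 ?eabs_ge0.
    - move=> u _ m n mn'; rewrite lee_fin ler_wpM2l ?sqr_ge0 // ler_expR lerN2 ler_wpM2r //.
      by rewrite lef_pV2 ?posrE ?ltr0n // ler_nat.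
  apply: lime_le.
    apply: ereal_nondecreasing_is_cvgn => m n mn'; apply: ge0_le_integral => //.
    - by move=> u _; rewrite lee_fin mulr_ge0 ?sqr_ge0 ?eabs_ge0.
    - by apply/measurable_EFinP; apply: measurable_funM => //; exact: rmeas_eabs.
    - by apply/measurable_EFinP; apply: measurable_funM => //; exact: rmeas_eabs.
    - move=> u _; rewrite lee_fin ler_wpM2l ?sqr_ge0 // ler_expR lerN2 ler_wpM2r //.
      by rewrite lef_pV2 ?posrE ?ltr0n // ler_nat.
  apply: nearW => n; have [i h] := bessel_eabs (n0 n) hf.
  by rewrite /g rIE // lee_fin.
have i : rin mu (fun u => normc (FT f u) ^+ 2).
  by apply: rinP => //; [move=> u; exact: sqr_ge0|exact: le_lt_trans lim (ltry _)].
by split; [split|move: lim; rewrite rIE // lee_fin].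
Qed.

(** A transform on L^2 described by duality against integrable and square-integrable test functions,
    for which [FT] is an honest integral. No representative is singled out: [G] is determined up to
    a null set. *)
Definition isFT f G := [/\ l2 mu f, l2 mu G &
  forall phi, l12 phi -> cI mu (fun u => G u * phi u) = cI mu (fun t => f t * FT phi t)].

Lemma isFT_FT f : l12 f -> isFT f (FT f).
Proof.
move=> hf; split; [by case: hf|by case: (bessel hf)|move=> phi hp].
by apply: FT_mult; [case: hf|case: hp].
Qed.
Lemma isFT_lim (F G : nat -> R -> C) f g : (forall n, isFT (F n) (G n)) -> l2 mu f -> l2 mu g ->
  l2cvg mu F f -> l2cvg mu G g -> isFT f g.
Proof.
move=> h lf lg cF cG; split => // phi hp; have [lp _] := bessel hp.
have h1 := l2cvg_cI (fun n => let: And3 _ b _ := h n in b) lg (proj2 hp) cG.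
have h2 := l2cvg_cI (fun n => let: And3 a _ _ := h n in a) lf lp cF.
apply: ccvg_uniq h1 _; apply: ccvg_ext h2 => n.
by have [_ _ ->] := h n.
Qed.
Lemma isFTB f G g H : isFT f G -> isFT g H -> isFT (fun x => f x - g x) (fun x => G x - H x).
Proof.
move=> [a1 a2 a3] [b1 b2 b3]; split; [exact: l2B|exact: l2B|move=> phi hp].
have [lp _] := bessel hp; have := a3 _ hp; have := b3 _ hp => e1 e2.
rewrite (cI_ext mu (fun x => mulrBl (phi x) (G x) (H x))).
rewrite (cI_ext mu (fun x => mulrBl (FT phi x) (f x) (g x))).
rewrite (cIB (cin_l2 a2 (proj2 hp)) (cin_l2 b2 (proj2 hp))).
by rewrite (cIB (cin_l2 a1 lp) (cin_l2 b1 lp)) e1 e2.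
Qed.
Lemma isFTZ c f G : isFT f G -> isFT (fun x => c * f x) (fun x => c * G x).
Proof.
move=> [a1 a2 a3]; split; [exact: l2Z|exact: l2Z|move=> phi hp].
have [lp _] := bessel hp.
rewrite (cI_ext mu (fun x => esym (mulrA c (G x) (phi x)))).
rewrite (cI_ext mu (fun x => esym (mulrA c (f x) (FT phi x)))).
by rewrite (cIZ c (cin_l2 a2 (proj2 hp))) (cIZ c (cin_l2 a1 lp)) a3.
Qed.
Lemma isFT_ae f G f' G' : lmeas f' -> lmeas G' -> (\forall x \ae mu, f x = f' x) ->
  (\forall x \ae mu, G x = G' x) -> isFT f G -> isFT f' G'.
Proof.
move=> mf mG ef eG [a1 a2 a3]; split; [exact: (l2_ae mf ef a1)|exact: (l2_ae mG eG a2)|move=> phi hp].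
have [mp _] := proj1 hp; have mFp := lmeas_FT mp.
have -> : cI mu (fun u => G' u * phi u) = cI mu (fun u => G u * phi u).
  apply: cI_ae; [exact: cmeasM|apply: cmeasM => //; exact: l2_meas a2|].
  by apply: ae_mono eG => x ->.
have -> : cI mu (fun u => f' u * FT phi u) = cI mu (fun u => f u * FT phi u).
  apply: cI_ae; [exact: cmeasM|apply: cmeasM => //; exact: l2_meas a1|].
  by apply: ae_mono ef => x ->.
exact: a3.
Qed.

Definition trunc n f (t : R) : C := cind (- n.+1%:R) n.+1%:R t * f t.
Lemma l12_trunc n f : l2 mu f -> l12 (trunc n f).
Proof.
move=> hf; split; first by apply: cin_l2 => //; exact: l2_cind.
by apply: (l2_bM (lmeas_cind _ _) (normc_cind_le1 _ _)).
Qed.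
Lemma l2cvg_trunc f : l2 mu f -> l2cvg mu (fun n => trunc n f) f.
Proof.
move=> hf; apply: l2cvg_dom => //.
- by move=> n; apply: cmeasM; [exact: lmeas_cind|exact: l2_meas hf].
- by move=> n t; rewrite normcM ler_piMl ?normc_ge0 ?normc_cind_le1.
- move=> t; have [N hN] := lt_natr_bound t.
  by apply: (ccvg_eventually (N := N)) => n /hN h; rewrite /trunc cindE h mul1r.
Qed.

Lemma isFT_ex_cvg f : l2 mu f -> exists G, isFT f G /\ l2cvg mu (fun n => FT (trunc n f)) G.
Proof.
move=> lf; have lt n := l12_trunc n lf; have ct := l2cvg_trunc lf.
have lF n : l2 mu (FT (trunc n f)) by case: (bessel (lt n)).
have p0 : 0 < pi :> R by exact: pi_gt0.
have [|G [lG cG]] := @l2_complete R _ T mu (fun n => FT (trunc n f)) lF.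
(* The denominator pays for a factor 4, from comparing two truncations with [f], and for the factor
   $2\pi$ of the transform bound. *)
- move=> e e0; have e8 : 0 < e / (8 * pi) by rewrite divr_gt0 // mulr_gt0.
  have /cvgrPdist_le/(_ _ e8)[N _ hN] := ct.
  exists N => m n mN nN.
  have hb := bessel (l12B (lt m) (lt n)).
  have -> : N2 mu (fun x => FT (trunc m f) x - FT (trunc n f) x) =
            N2 mu (FT (fun x => trunc m f x - trunc n f x)).
    by apply: N2_ext => x; rewrite (FTB x (proj1 (lt m)) (proj1 (lt n))).
  apply: le_trans (proj2 hb) _.
  have hm := hN m mN; have hn := hN n nN.
  rewrite /= sub0r normrN ger0_norm ?N2_ge0 // in hm; rewrite /= sub0r normrN ger0_norm ?N2_ge0 // in hn.
  have k : N2 mu (fun x => trunc m f x - trunc n f x) <= 4 * (e / (8 * pi)).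
    have -> : N2 mu (fun x => trunc m f x - trunc n f x) =
      N2 mu (fun x => (trunc m f x - f x) - (trunc n f x - f x)) by apply: N2_ext => x; ring.
    apply: le_trans (N2B (l2B (proj2 (lt m)) lf) (l2B (proj2 (lt n)) lf)) _; lra.
  apply: le_trans (_ : 2 * pi * (4 * (e / (8 * pi))) <= _).
    by rewrite ler_pM2l // mulr_gt0.
  rewrite le_eqVlt; apply/orP; left; apply/eqP.
  have pn : pi != 0 :> R by exact: lt0r_neq0.
  by move: (pi : R) pn => q pn; field.
exists G; split => //; apply: isFT_lim ct cG => // n; exact: isFT_FT.
Qed.
Lemma isFT_ex f : l2 mu f -> exists G, isFT f G.
Proof. by move=> /isFT_ex_cvg[G [h _]]; exists G. Qed.
End Plancherel.

(** * Fourier inversion and Plancherel's identity *)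

Section FourierInversion.
Variable R : realType.
Local Notation C := R[i].
Local Notation mu := (@lebesgue_measure R).
Local Notation T := (measurableTypeR R).
Implicit Types (f g p G phi : R -> C).

Lemma ae_all (P : nat -> R -> Prop) : (forall n, \forall x \ae mu, P n x) ->
  \forall x \ae mu, forall n, P n x.
Proof.
move=> h; have := @ae_foralln _ _ _ mu P h.
by [].
Qed.

(** Lebesgue's differentiation theorem: the primitive based at [- n] is identically 0, hence so is
    its derivative, which is [h] almost everywhere to the right of [- n]. Countably many base points
    cover the line. *)
Lemma rI_itv_eq0 (h : R -> R) : rmeas h -> (forall a b, rin mu (fun t => \1_(`]a, b]%classic) t * h t)) ->
  (forall a b, a < b -> rI mu (fun t => \1_(`]a, b]%classic) t * h t) = 0) ->
  \forall x \ae mu, h x = 0.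
Proof.
move=> mh ih zh.
have e a b : (\int[mu]_(x in `]a, b]) (h x)%:E = \int[mu]_x (\1_(`]a, b]%classic) x * h x)%:E)%E.
  rewrite [LHS]integral_mkcond; apply: eq_integral => x _; rewrite patchE indicE.
  by case: ifP => _; rewrite ?mul1r ?mul0r.
have ii' a b : mu.-integrable `]a, b] (EFin \o h).
  apply: (proj2 (@integrable_mkcond _ _ _ mu _ (EFin \o h) (measurable_itv _))).
  apply: eq_integrable (ih a b) => // x _; rewrite patchE indicE.
  by case: ifP => _; rewrite ?mul1r ?mul0r.
have loc : locally_integrable [set: R] h.
  split => //; first exact: openT.
  move=> K _ cK; have [M [_ hM]] := compact_bounded cK.
  have KM : K `<=` `](- (`|M| + 2)), (`|M| + 2)].
    move=> x /(hM (`|M| + 1)); rewrite ltr_pwDr ?ler_norm // => /(_ isT).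
    rewrite /= ler_norml in_itv /= => /andP[h1 h2]; apply/andP; split; lra.
  have mK : measurable K by exact: compact_measurable.
  have mI := @measurable_itv R (Interval (BRight (- (`|M| + 2))) (BRight (`|M| + 2))).
  by have /integrableP[_] := @integrableS _ T R mu _ K (EFin \o h) mI mK KM (ii' _ _).
have := @ae_all (fun n x => - n%:R < x -> h x = 0).
move=> H; apply: ae_mono (H _) => [x hx|n].
  apply: (hx (Num.bound x^-1 + Num.bound `|x|)%N).
  have := archi_boundP (normr_ge0 x); have : (0 : R) <= (Num.bound x^-1)%:R by [].
  by have := ler_norm (- x); rewrite normrN natrD; lra.
have := @FTC1 R h (BRight (- n%:R)) (fun y => ii' _ y) loc.
apply: ae_mono => x hx xn; have [_ <-] := hx xn.
rewrite derive1E /derive.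
apply/cvg_lim; first exact: Rhausdorff.
apply: cvg_near_cst; have d0 : 0 < x + n%:R by lra.
near=> k.
have kx : - n%:R < k *: 1 + x.
  have : `|k| < x + n%:R by near: k; apply: dnbhs0_lt.
  by rewrite /GRing.scale /= mulr1 ltr_norml => /andP[h1 h2]; lra.
have z y : - n%:R < y -> (\int[mu]_(t in [set` `](- n%:R), y]]) h t)%R = 0.
  by move=> hy; rewrite /Rintegral e -rI_def zh.
by rewrite /= !z // subrr scaler0.
Unshelve. all: by end_near. Qed.

Lemma l2_itv_eq f g : l2 mu f -> l2 mu g ->
  (forall a b, a < b -> cI mu (fun t => cind a b t * f t) = cI mu (fun t => cind a b t * g t)) ->
  \forall x \ae mu, f x = g x.
Proof.
move=> lf lg h; have lfg := l2B lf lg.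
have cfg a b : cin mu (fun t => cind a b t * (f t - g t)) by apply: cin_l2 => //; exact: l2_cind.
have z a b : a < b -> cI mu (fun t => cind a b t * (f t - g t)) = 0.
  move=> ab; rewrite (cI_ext mu (fun t => mulrBr (cind a b t) (f t) (g t))).
  by rewrite cIB ?h ?subrr //; apply: cin_l2 => //; exact: l2_cind.
have [m1 m2] := l2_meas lfg.
have z1 : \forall x \ae mu, Re (f x - g x) = 0.
  apply: rI_itv_eq0 => // a b.
    by have := cin_Re (cfg a b); under eq_fun do rewrite ReMr.
  move=> ab; have := congr1 (@complex.Re R) (z a b ab); rewrite cI_ReE /=.
  by under eq_fun do rewrite ReMr.
have z2 : \forall x \ae mu, Im (f x - g x) = 0.
  apply: rI_itv_eq0 => // a b.
    by have := cin_Im (cfg a b); under eq_fun do rewrite ImMr.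
  move=> ab; have := congr1 (@complex.Im R) (z a b ab); rewrite cI_ImE /=.
  by under eq_fun do rewrite ImMr.
apply: ae_mono2 z1 z2 => x h1 h2; apply/eqP; rewrite -subr_eq0; apply/eqP.
exact: complexP.
Qed.

Lemma isFT_uniq f G H : isFT f G -> isFT f H -> \forall x \ae mu, G x = H x.
Proof.
move=> [_ b1 c1] [_ b2 c2]; apply: l2_itv_eq => // a b ab.
rewrite (cI_ext mu (fun t => mulrC (cind a b t) (G t))) c1; last exact: l12_cind.
by rewrite (cI_ext mu (fun t => mulrC (cind a b t) (H t))) c2; last exact: l12_cind.
Qed.

Lemma isFT_bound f G : isFT f G -> N2 mu G <= 2 * pi * N2 mu f.
Proof.
move=> hG; have [lf lG _] := hG; have lt n := l12_trunc n lf; have ct := l2cvg_trunc lf.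
have bt n : N2 mu (FT (trunc n f)) <= 2 * pi * N2 mu f.
  apply: le_trans (proj2 (bessel (lt n))) _; rewrite ler_pM2l ?mulr_gt0 ?pi_gt0 //.
  apply: N2_le => //; first by case: (lt n).
  by move=> x; rewrite normcM ler_piMl ?normc_ge0 ?normc_cind_le1.
have [H [hH cH]] := isFT_ex_cvg lf; have [_ lH _] := hH.
have eHG := isFT_uniq hH hG.
rewrite -(N2_ae (l2_meas lH) (l2_meas lG) eHG).
apply: (N2_limit_le (b := fun=> 2 * pi * N2 mu f) _ lH cH bt); last exact: cvg_cst.
by move=> n; have [] := bessel (lt n).
Qed.

Lemma isFT_trunc_cvg f G : isFT f G -> l2cvg mu (fun n => FT (trunc n f)) G.
Proof.
move=> hG; have [lf lG _] := hG; have lt n := l12_trunc n lf; have ct := l2cvg_trunc lf.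
apply: (cvg0_squeeze _ (cvg0_const_mul (2 * pi) ct)) => n; rewrite N2_ge0 /=.
exact: isFT_bound (isFTB (isFT_FT (lt n)) hG).
Qed.

Lemma isFT_pair f G g H : isFT f G -> isFT g H ->
  cI mu (fun u => G u * g u) = cI mu (fun t => f t * H t).
Proof.
move=> hG hH; have [lf lG pG] := hG; have [lg lH _] := hH.
have ltg n := l12_trunc n lg.
have swp (a b : R -> C) : cI mu (fun u => a u * b u) = cI mu (fun u => b u * a u).
  by apply: cI_ext => u; rewrite mulrC.
have h1 := l2cvg_cI (fun n => proj2 (ltg n)) lg lG (l2cvg_trunc lg).
have h2 := l2cvg_cI (fun n => proj1 (bessel (ltg n))) lH lf (isFT_trunc_cvg hH).
rewrite swp [RHS]swp; apply: ccvg_uniq h1 _; apply: ccvg_ext h2 => n.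
by rewrite swp -(pG _ (ltg n)) swp.
Qed.

(** Inversion tested on an interval. The damping factor makes the second transform absolutely
    convergent. As it tends to 1, one side is dominated by the integrable product of two L^2
    transforms; on the other the smoothed indicator tends to $2\pi$ times the indicator and stays
    below $2\pi$. *)
Lemma FT_FT_cind f a b : l12 f -> a < b ->
  cI mu (fun u => FT f u * FT (cind a b) u) = (2 * pi)%:C * cI mu (fun t => cind a b t * f (- t)).
Proof.
move=> [cf lf] ab; have cc := cin_cind a b.
have n0 n : 0 < n.+1%:R^-1 :> R by rewrite invr_gt0 ltr0n.
have cFF : cin mu (fun u => FT f u * FT (cind a b) u).
  by apply: cin_l2; apply: (proj1 (bessel _)); [split|exact: l12_cind].
have mf := cin_meas cf; have mFT := lmeas_FT mf; have mFc := lmeas_FT (lmeas_cind a b).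
(* damped version, computed in two ways *)
have e n : cI mu (fun u => FT f u * (FT (cind a b) u * (eabs n.+1%:R^-1 u)%:C)) =
           cI mu (fun t => f t * sm a b n.+1%:R^-1 t).
  rewrite (FT_mult cf (cin_FT_eabs (n0 n) cc)); apply: cI_ext => t.
  by rewrite FT_FT_eabs.
have L : ccvg (fun n => cI mu (fun u => FT f u * (FT (cind a b) u * (eabs n.+1%:R^-1 u)%:C)))
              (cI mu (fun u => FT f u * FT (cind a b) u)).
  have mF n : lmeas (fun u => FT f u * (FT (cind a b) u * (eabs n.+1%:R^-1 u)%:C)).
    by apply: cmeasM => //; apply: cmeasM => //; exact: lmeas_eabs.
  apply: (proj2 (cI_dct mF (cin_meas cFF) _ (cin_norm cFF) _)).
    apply: aeW => u; apply: (ccvg_ext (u := fun n => FT f u * FT (cind a b) u * (eabs n.+1%:R^-1 u)%:C)).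
      by move=> n; rewrite mulrA.
    rewrite -[X in ccvg _ X]mulr1; apply: ccvgZ; apply/ccvgP; split; last exact: cvg_cst.
    exact: eabs_cvg1.
  move=> n u; rewrite mulrA normcM ler_piMr ?normc_ge0 // normc_pos ?eabs_ge0 // eabs_le1 //.
have msm n : lmeas (sm a b n.+1%:R^-1).
  apply: (cmeas_cI mu (f := fun z : T * T => cind a b z.2 * (PK n.+1%:R^-1 (z.1 + z.2))%:C)).
  apply: cmeasM; first exact: (cmeas_comp (lmeas_cind a b) (@measurable_snd2 R)).
  apply: cmeas_real; apply: (@measurableT_comp _ _ _ _ T T (PK n.+1%:R^-1)); first exact: rmeas_PK.
  by apply: measurable_funD; [exact: measurable_fst|exact: measurable_snd].
have mR : lmeas (fun t => f t * ((2 * pi)%:C * cind a b (- t))).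
  apply: cmeasM => //; apply: cmeasM; first exact: cmeas_cst.
  by apply: (lmeas_comp (lmeas_cind a b)); exact: rmeas_opp.
have L2 : ccvg (fun n => cI mu (fun t => f t * sm a b n.+1%:R^-1 t))
               (cI mu (fun t => f t * ((2 * pi)%:C * cind a b (- t)))).
  have mF n : lmeas (fun t => f t * sm a b n.+1%:R^-1 t) by apply: cmeasM.
  have cF : \forall t \ae mu, ccvg (fun n => f t * sm a b n.+1%:R^-1 t) (f t * ((2 * pi)%:C * cind a b (- t))).
    apply: ae_mono2 (neq_ae (- a)) (neq_ae (- b)) => t ta tb; apply: ccvgZ; apply: sm_cvg.
      by rewrite eqr_oppLR.
    by rewrite eqr_oppLR.
  have iG : rin mu (fun t => 2 * pi * normc (f t)) by apply: rinZ; case: cf.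
  have bF n t : normc (f t * sm a b n.+1%:R^-1 t) <= 2 * pi * normc (f t).
    by rewrite normcM mulrC ler_wpM2r ?normc_ge0 // sm_bound.
  exact: (proj2 (cI_dct mF mR cF iG bF)).
rewrite (ccvg_uniq L (ccvg_ext (fun n => esym (e n)) L2)).
have c1 : cin mu (fun t => cind a b t * f (- t)).
  apply: (cin_bM (lmeas_cind a b) (normc_cind_le1 a b)); exact: cin_opp.
rewrite -(cIZ _ c1) -[RHS]cI_opp; last by apply: cmeasM; [exact: cmeas_cst|case: c1].
by apply: cI_ext => t; rewrite opprK; ring.
Qed.

(** For [g] integrable and square-integrable, some transform of [FT g] exists by completeness, and
    its integrals over intervals identify it; truncation then extends the formula to L^2. *)
Lemma isFT_inv f G : isFT f G -> isFT G (fun t => (2 * pi)%:C * f (- t)).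
Proof.
move=> hG; have [lf lG _] := hG; have lt n := l12_trunc n lf.
have lo g : l2 mu g -> l2 mu (fun t => (2 * pi)%:C * g (- t)).
  by move=> lg; apply: l2Z; exact: l2_opp.
have step1 g : l12 g -> isFT (FT g) (fun t => (2 * pi)%:C * g (- t)).
  move=> hg; have lFg := proj1 (bessel hg); have [K hK] := isFT_ex lFg.
  have [_ lK pK] := hK; have l2o := lo g (proj2 hg).
  apply: isFT_ae hK; [exact: l2_meas lFg|exact: l2_meas l2o|exact: aeW|].
  apply: l2_itv_eq => // a b ab.
  rewrite (cI_ext mu (fun t => mulrC (cind a b t) (K t))) pK; last exact: l12_cind.
  rewrite (FT_FT_cind hg ab) -cIZ; last first.
    by apply: cin_l2; [exact: l2_cind|apply: l2_opp; case: hg].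
  by apply: cI_ext => t; rewrite mulrCA.
apply: (isFT_lim (fun n => step1 _ (lt n))) => //; [exact: lo|exact: isFT_trunc_cvg|].
apply: (l2cvgM (M := 2 * pi)).
- exact: cmeas_cst.
- by move=> x; rewrite normc_pos // mulr_ge0 ?pi_ge0.
- by move=> n; apply: l2_opp; case: (lt n).
- exact: l2_opp.
- have := l2cvg_trunc lf; rewrite /l2cvg.
  have h n : N2 mu (fun x => trunc n f (- x) - f (- x)) = N2 mu (fun x => trunc n f x - f x).
    apply: (@N2_opp _ (fun x => trunc n f x - f x)).
    by apply: cmeasB; [exact: l2_meas (proj2 (lt n))|exact: l2_meas lf].
  by have -> : (fun n => N2 mu (fun x => trunc n f (- x) - f (- x))) = (fun n => N2 mu (fun x => trunc n f x - f x)) by apply/funext.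
Qed.

(** The one-sided bound applied to the inverse transform reads $(2\pi)^2\|f\|^2\le2\pi\|G\|^2$,
    which is the reverse inequality. *)
Lemma isFT_N2 f G : isFT f G -> N2 mu G = 2 * pi * N2 mu f.
Proof.
move=> hG; apply/eqP; rewrite eq_le isFT_bound //=.
have [lf lG _] := hG; have p0 : 0 < 2 * pi :> R by rewrite mulr_gt0 // pi_gt0.
have := isFT_bound (isFT_inv hG); rewrite N2Z; last exact: l2_opp.
rewrite normc_pos; last exact: ltW.
rewrite (N2_opp (l2_meas lf)).
by rewrite expr2 -mulrA ler_pM2l.
Qed.

Lemma isFT_cv p f G : cin mu p -> isFT f G -> isFT (cv p f) (fun u => FT p u * G u).
Proof.
move=> hp hG; have [lf lG _] := hG; have lt n := l12_trunc n lf; have mp := cin_meas hp.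
have bp u := FT_bound u hp; have mFp := lmeas_FT mp.
have h n : isFT (cv p (trunc n f)) (fun u => FT p u * FT (trunc n f) u).
  have c1 := cv_L1 hp (proj1 (lt n)); have c2 := cv_L2 hp (proj2 (lt n)).
  have := isFT_FT (conj (proj1 c1) (proj1 c2)).
  have -> : FT (cv p (trunc n f)) = (fun u => FT p u * FT (trunc n f) u); last by [].
  apply/funext => u; apply: (proj2 (MT_cv _ _ _ _)) => //.
  - exact: cin_meas (proj1 (lt n)).
  - exact: cin_FT.
  - exact: cin_FT (proj1 (lt n)).
apply: (isFT_lim h).
- exact: (proj1 (cv_L2 hp lf)).
- exact: (l2_bM mFp bp lG).
- apply: (cvg0_squeeze _ (cvg0_const_mul _ (l2cvg_trunc lf))) => n; rewrite N2_ge0 /=.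
  have ld := l2B (proj2 (lt n)) lf.
  apply: le_trans (proj2 (cv_L2 hp ld)).
  rewrite le_eqVlt; apply/orP; left; apply/eqP; apply: N2_ae.
  + by apply: cmeasB; apply: lmeas_cv => //; [exact: cin_meas (proj1 (lt n))|exact: l2_meas lf].
  + by apply: lmeas_cv => //; exact: l2_meas ld.
  + apply: ae_mono2 (cv_L2_ae hp (proj2 (lt n))) (cv_L2_ae hp lf) => x h1 h2.
    by rewrite /cv -(cIB h1 h2); apply: cI_ext => t; rewrite mulrBr.
- apply: (l2cvgM mFp bp) => //; last exact: isFT_trunc_cvg.
  by move=> n; apply: (proj1 (bessel (lt n))).
Qed.

Lemma l12_FT_inj f g : l12 f -> l12 g -> (\forall u \ae mu, FT f u = FT g u) ->
  \forall x \ae mu, f x = g x.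
Proof.
move=> hf hg e; have h := isFTB (isFT_FT hf) (isFT_FT hg).
have [lfg lG _] := h.
have z : N2 mu (fun x => FT f x - FT g x) = 0.
  rewrite (@N2_ae _ _ _ mu _ (fun=> 0) (l2_meas lG)); first by rewrite /N2 rI_def integral0_eq // => x _; rewrite normc0 expr0n.
    exact: cmeas_cst.
  by apply: ae_mono e => x ->; rewrite subrr.
have := isFT_N2 h; rewrite z => /esym/eqP; rewrite mulf_eq0 gt_eqF ?mulr_gt0 ?pi_gt0 //= => /eqP.
by move=> /(N2_eq0 lfg); apply: ae_mono => x /eqP; rewrite subr_eq0 => /eqP.
Qed.
End FourierInversion.

(** * Cauchy's theorem on rectangles *)

Section ComplexDifferentiability.
Variable R : realType.
Local Notation C := R[i].
Local Notation mu := (@lebesgue_measure R).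
Implicit Types (f g : C -> C) (z h l : C).

(** Differentiability with real radii and a first-order remainder instead of a quotient, so that
    products and compositions are plain estimates; [holo_cdiff] and [cdiff_holo] relate it to
    [holo_at]. *)
Definition cderiv f z l := forall e : R, 0 < e -> exists2 d : R, 0 < d &
  forall h, normc h < d -> normc (f (z + h) - f z - l * h) <= e * normc h.
Definition cdiff f z := exists l, cderiv f z l.
Definition ccontat f z := forall e : R, 0 < e -> exists2 d : R, 0 < d &
  forall h, normc h < d -> normc (f (z + h) - f z) <= e.

Lemma normE z : `|z| = (normc z)%:C. Proof. by case: z. Qed.
Lemma holo_cdiff f z : holo_at f z -> cdiff f z.
Proof.
move=> /cvg_ex[/= l hl]; exists l => e e0.
have eC : (0 : C) < e%:C by rewrite ltcR.
have /cvgrPdist_le/(_ _ eC) := hl.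
rewrite near_withinE => /nbhs_ballP[d /= d0 hd].
move: d0; rewrite ltcE => /andP[/eqP imd red].
exists (Re d) => // h hd'; have [->|h0] := eqVneq h 0.
  by rewrite addr0 subrr mulr0 subrr normc0 mulr0.
have := hd h _ h0; rewrite /ball /= sub0r normrN.
have -> : `|h| < d by rewrite normE ltcE /= imd eqxx.
move=> /(_ isT); rewrite normE lecR => k.
have -> : f (z + h) - f z - l * h = - (h * (l - h^-1 * (f (h * 1 + z) - f z))).
  by rewrite mulr1 (addrC h); field.
by rewrite normcN normcM mulrC ler_wpM2r ?normc_ge0.
Qed.
Lemma cdiff_holo f z : cdiff f z -> holo_at f z.
Proof.
move=> [l hl]; apply/cvg_ex; exists l; apply/cvgrPdist_le => e.
rewrite ltcE => /andP[/eqP ime ree].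
have [d d0 hd] := hl _ ree.
rewrite near_withinE; apply/nbhs_ballP.
exists d%:C => [|h]; first by rewrite /= ltcR.
move=> bh h0.
have k : normc (f (z + h) - f z - l * h) <= Re e * normc h.
  by apply: hd; move: bh; rewrite /ball /= sub0r normrN normE ltcR.
rewrite normE lecE /= ime eqxx /=.
have -> : l - h^-1 *: (f (h *: 1 + z) - f z) = - (h^-1 * (f (z + h) - f z - l * h)).
  by rewrite /GRing.scale /= mulr1 (addrC z); field.
by rewrite (normcN (h^-1 * _)) (normcM h^-1) (normcV h) ler_pdivrMl ?(mulrC (normc h)) // (normc_gt0 h).
Qed.

Lemma cderiv_cont f z l : cderiv f z l -> ccontat f z.
Proof.
move=> hl e e0; have [d d0 hd] := hl 1 ltr01.
have k0 : 0 < 1 + normc l by rewrite ltr_pwDl ?normc_ge0.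
exists (Num.min d (e / (1 + normc l))); first by rewrite lt_min d0 divr_gt0.
move=> h; rewrite lt_min => /andP[/hd h1 h2].
have -> : f (z + h) - f z = (f (z + h) - f z - l * h) + l * h by rewrite subrK.
apply: le_trans (normcD _ _) _; rewrite normcM.
apply: le_trans (_ : (1 + normc l) * normc h <= _); first by rewrite mulrDl lerD2r.
by rewrite mulrC -ler_pdivlMr // ltW.
Qed.
Lemma cdiff_cont f z : cdiff f z -> ccontat f z.
Proof. by move=> [l /cderiv_cont]. Qed.
Lemma cderiv_cst c z : cderiv (fun=> c) z 0.
Proof. by move=> e e0; exists 1 => // h _; rewrite mul0r subrr subr0 normc0 mulr_ge0 ?normc_ge0 ?ltW. Qed.
Lemma cderiv_id z : cderiv id z 1.
Proof. by move=> e e0; exists 1 => // h _; rewrite mul1r (addrC z) addrK subrr normc0 mulr_ge0 ?normc_ge0 ?ltW. Qed.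
Lemma cderivD f g z l1 l2 : cderiv f z l1 -> cderiv g z l2 -> cderiv (fun x => f x + g x) z (l1 + l2).
Proof.
move=> h1 h2 e e0; have e2 : 0 < e / 2 by rewrite divr_gt0.
have [d1 d10 k1] := h1 _ e2; have [d2 d20 k2] := h2 _ e2.
exists (Num.min d1 d2); first by rewrite lt_min d10.
move=> h; rewrite lt_min => /andP[/k1 q1 /k2 q2].
have -> : f (z + h) + g (z + h) - (f z + g z) - (l1 + l2) * h =
  (f (z + h) - f z - l1 * h) + (g (z + h) - g z - l2 * h) by ring.
by apply: le_trans (normcD _ _) _; lra.
Qed.
Lemma cderivM f g z l1 l2 : cderiv f z l1 -> cderiv g z l2 ->
  cderiv (fun x => f x * g x) z (l1 * g z + f z * l2).
Proof.
move=> h1 h2 e e0.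
pose K := 1 + normc (g z) + normc l1 + normc (f z).
have K0 : 0 < K by rewrite /K; have := normc_ge0 (g z); have := normc_ge0 l1; have := normc_ge0 (f z); lra.
have eK : 0 < Num.min (e / (4 * K)) 1 by rewrite lt_min ltr01 andbT divr_gt0 // mulr_gt0.
have [d1 d10 k1] := h1 _ eK; have [d2 d20 k2] := h2 _ eK.
have [d3 d30 k3] := cderiv_cont h2 eK.
exists (Num.min d1 (Num.min d2 d3)); first by rewrite !lt_min d10 d20.
move=> h; rewrite !lt_min => /and3P[/k1 q1 /k2 q2 /k3 q3].
set m := Num.min _ _ in q1 q2 q3 eK.
have m1 : m <= 1 by rewrite ge_min lexx orbT.
have mK : m * (4 * K) <= e by rewrite -ler_pdivlMr ?mulr_gt0 // ge_min lexx.
have -> : f (z + h) * g (z + h) - f z * g z - (l1 * g z + f z * l2) * h =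
  (f (z + h) - f z - l1 * h) * g z + (f (z + h) - f z - l1 * h) * (g (z + h) - g z)
  + l1 * h * (g (z + h) - g z) + f z * (g (z + h) - g z - l2 * h) by ring.
have gz := normc_ge0 (g z); have fz := normc_ge0 (f z); have nl := normc_ge0 l1; have nh := normc_ge0 h.
apply: le_trans (normcD _ _) _; rewrite normcM.
apply: le_trans (lerD (normcD _ _) (lexx _)) _.
apply: le_trans (lerD (lerD (normcD _ _) (lexx _)) (lexx _)) _; rewrite !normcM.
have b1 : normc (f (z + h) - f z - l1 * h) * normc (g z) <= m * normc h * normc (g z) by rewrite ler_wpM2r.
have b2 : normc (f (z + h) - f z - l1 * h) * normc (g (z + h) - g z) <= m * normc h * 1.
  by apply: ler_pM; rewrite ?normc_ge0 // (le_trans q3).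
have b3 : normc l1 * normc h * normc (g (z + h) - g z) <= normc l1 * normc h * m.
  by rewrite ler_wpM2l // mulr_ge0.
have b4 : normc (f z) * normc (g (z + h) - g z - l2 * h) <= normc (f z) * (m * normc h).
  by rewrite ler_wpM2l.
apply: le_trans (lerD (lerD (lerD b1 b2) b3) b4) _.
have -> : m * normc h * normc (g z) + m * normc h * 1 + normc l1 * normc h * m + normc (f z) * (m * normc h) =
  (m * K) * normc h by rewrite /K; ring.
rewrite ler_wpM2r //; have : 0 <= m * K by rewrite mulr_ge0 // ltW.
lra.
Qed.
Lemma cderiv_comp f g z l1 l2 : cderiv g z l1 -> cderiv f (g z) l2 -> cderiv (fun x => f (g x)) z (l2 * l1).
Proof.
move=> h1 h2 e e0.
pose K := 1 + normc l1 + normc l2.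
have K0 : 0 < K by rewrite /K; have := normc_ge0 l1; have := normc_ge0 l2; lra.
have eK : 0 < Num.min (e / (2 * K)) 1 by rewrite lt_min ltr01 andbT divr_gt0 // mulr_gt0.
have [d1 d10 k1] := h1 _ eK; have [d2 d20 k2] := h2 _ eK.
have [d3 d30 k3] : exists2 d : R, 0 < d & forall h, normc h < d -> normc (g (z + h) - g z) < d2.
  have dd : 0 < d2 / 2 by rewrite divr_gt0.
  have [d d0 k] := cderiv_cont h1 dd; exists d => // h /k q; apply: le_lt_trans q _; lra.
exists (Num.min d1 d3); first by rewrite !lt_min d10.
move=> h; rewrite !lt_min => /andP[/k1 q1 /k3 /k2]; set m := Num.min _ _ in q1 eK *.
rewrite (addrC (g z)) subrK => q2.
have m1 : m <= 1 by rewrite ge_min lexx orbT.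
have mK : m * (2 * K) <= e by rewrite -ler_pdivlMr ?mulr_gt0 // ge_min lexx.
have nl := normc_ge0 l1; have nl2 := normc_ge0 l2; have nh := normc_ge0 h.
have gb : normc (g (z + h) - g z) <= K * normc h.
  have -> : g (z + h) - g z = (g (z + h) - g z - l1 * h) + l1 * h by rewrite subrK.
  apply: le_trans (normcD _ _) _; rewrite normcM /K.
  have : m * normc h <= normc h by rewrite ler_piMl.
  have : 0 <= normc l2 * normc h by rewrite mulr_ge0.
  lra.
have -> : f (g (z + h)) - f (g z) - l2 * l1 * h =
  (f (g (z + h)) - f (g z) - l2 * (g (z + h) - g z)) + l2 * (g (z + h) - g z - l1 * h) by ring.
apply: le_trans (normcD _ _) _; rewrite normcM.
apply: le_trans (lerD q2 (ler_wpM2l nl2 q1)) _.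
have b : m * normc (g (z + h) - g z) <= m * (K * normc h) by rewrite ler_wpM2l // ltW.
apply: le_trans (lerD b (lexx _)) _.
have : normc l2 * (m * normc h) <= K * (m * normc h).
  by apply: ler_wpM2r; [rewrite mulr_ge0 // ltW|rewrite /K; lra].
have : m * (2 * K) * normc h <= e * normc h by rewrite ler_wpM2r.
lra.
Qed.
Lemma cderiv_inv z : z != 0 -> cderiv (fun x => x^-1) z (- (z ^- 2)).
Proof.
move=> z0 e e0; have n0 : 0 < normc z by rewrite normc_gt0.
(* The first radius gives $|z+h|\ge|z|/2$; the second then makes the remainder $h^2/(z^2(z+h))$ at
   most $e|h|$. *)
exists (Num.min (normc z / 2) (e * normc z ^+ 3 / 2)).
  by rewrite lt_min !divr_gt0 // mulr_gt0 // exprn_gt0.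
move=> h; rewrite lt_min => /andP[h1 h2].
have zh : normc z / 2 <= normc (z + h).
  have := normcB (z + h) h; rewrite addrK; lra.
have zh0 : z + h != 0 by rewrite -normc_gt0; apply: lt_le_trans zh; rewrite divr_gt0.
have -> : (z + h)^-1 - z^-1 - - z ^- 2 * h = h * h * (z ^- 2 * (z + h)^-1).
  by field; rewrite zh0 z0.
rewrite normcM normcM mulrC normcM !normcV normcX -mulrA.
have nh := normc_ge0 h.
rewrite !mulrA -!mulrA mulrA mulrA ler_wpM2r // -mulrA.
rewrite ler_pdivrMl ?exprn_gt0 // ler_pdivrMl; last by rewrite normc_gt0.
apply: le_trans (ltW h2) _.
have : normc z / 2 * (normc z ^+ 2 * e) <= normc (z + h) * (normc z ^+ 2 * e).
  by rewrite ler_wpM2r // mulr_ge0 ?exprn_ge0 // ltW.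
by apply: le_trans; rewrite le_eqVlt; apply/orP; left; apply/eqP; ring.
Qed.
Lemma cdiffM f g z : cdiff f z -> cdiff g z -> cdiff (fun x => f x * g x) z.
Proof. by move=> [l1 h1] [l2 h2]; exists (l1 * g z + f z * l2); exact: cderivM. Qed.
Lemma cdiffD f g z : cdiff f z -> cdiff g z -> cdiff (fun x => f x + g x) z.
Proof. by move=> [l1 h1] [l2 h2]; exists (l1 + l2); exact: cderivD. Qed.
Lemma cdiff_cst c z : cdiff (fun=> c) z. Proof. by exists 0; exact: cderiv_cst. Qed.
Lemma cdiff_id z : cdiff id z. Proof. by exists 1; exact: cderiv_id. Qed.
Lemma cdiffZ c f z : cdiff f z -> cdiff (fun x => c * f x) z.
Proof. by move=> h; apply: cdiffM => //; exact: cdiff_cst. Qed.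
Lemma cdiffB f g z : cdiff f z -> cdiff g z -> cdiff (fun x => f x - g x) z.
Proof.
move=> h1 h2; have := cdiffD h1 (cdiffZ (-1) h2).
by have -> : (fun x => f x + -1 * g x) = (fun x => f x - g x) by apply/funext => x; rewrite mulN1r.
Qed.
Lemma cdiff_comp f g z : cdiff g z -> cdiff f (g z) -> cdiff (fun x => f (g x)) z.
Proof. by move=> [l1 h1] [l2 h2]; exists (l2 * l1); exact: cderiv_comp. Qed.
Lemma cdiffV f z : cdiff f z -> f z != 0 -> cdiff (fun x => (f x)^-1) z.
Proof. by move=> h n; apply: (cdiff_comp h); exists (- (f z ^- 2)); exact: cderiv_inv. Qed.
Lemma cdiffX f z n : cdiff f z -> cdiff (fun x => f x ^+ n) z.
Proof.
move=> h; elim: n => [|n ih]; first exact: cdiff_cst.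
by under eq_fun do rewrite exprS; exact: cdiffM.
Qed.
Lemma cdiff_ext f g z : (forall x, f x = g x) -> cdiff f z -> cdiff g z.
Proof. by move=> h; have -> : f = g by apply/funext. Qed.

End ComplexDifferentiability.

(** * Integrals along segments and around rectangles *)

Section Goursat.
Variable R : realType.
Local Notation C := R[i].
Local Notation mu := (@lebesgue_measure R).
Implicit Types (f g : C -> C) (a b c d x y : R).

Lemma continuous_eps (g : R -> R) : (forall t e, 0 < e -> exists2 d : R, 0 < d &
  forall s, `|s - t| < d -> `|g s - g t| <= e) -> continuous g.
Proof.
move=> h t; apply/cvgrPdist_le => e e0; have [d d0 hd] := h t e e0.
near=> s; rewrite distrC; apply: hd; rewrite distrC; near: s; exact: cvgr_dist_lt.
Unshelve. all: by end_near. Qed.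

Definition cont_on (g : R -> C) a b := forall t, a <= t <= b -> forall e : R, 0 < e ->
  exists2 d : R, 0 < d & forall s, `|s - t| < d -> normc (g s - g t) <= e.
(** A retraction of the line onto a segment that does not increase distances: it extends functions
    continuous on the segment to the whole line, where global continuity results apply. *)
Definition clamp a b (t : R) := Num.max a (Num.min b t).

Lemma clamp_in a b t : a <= b -> a <= clamp a b t <= b.
Proof. by move=> ab; rewrite /clamp le_max lexx ge_max ab ge_min lexx. Qed.
Lemma clampE a b t : a <= t <= b -> clamp a b t = t.
Proof. by move=> /andP[h1 h2]; rewrite /clamp (min_idPr h2) (max_idPr h1). Qed.
Lemma clamp_dist a b s t : `|clamp a b s - clamp a b t| <= `|s - t|.
Proof.
rewrite /clamp ler_norml.
have := ler_norm (s - t); have := ler_norm (- (s - t)); rewrite normrN => h1 h2.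
by case: (leP b s) => q1; case: (leP b t) => q2; (case: (leP a b) => q3 || idtac);
  (case: (leP a s) => q4 || idtac); (case: (leP a t) => q5 || idtac); apply/andP; split; lra.
Qed.

Lemma cin_cont_on (g : R -> C) a b : cont_on g a b -> cin mu (fun t => cind a b t * g t).
Proof.
move=> hg; have [ab|ba] := leP a b; last first.
  apply: (cin_ext (f := fun=> 0)); last exact: cin0.
  move=> t; rewrite cindE; case: ifP => [/andP[h1 h2]|]; last by rewrite mul0r.
  by have := lt_le_trans h1 h2; rewrite ltNge (ltW ba).
have cg : ccont (fun t => g (clamp a b t)).
  have h t (e : R) : 0 < e -> exists2 d : R, 0 < d & forall s, `|s - t| < d -> normc (g (clamp a b s) - g (clamp a b t)) <= e.
    move=> e0; have [d d0 hd] := hg _ (clamp_in t ab) e e0; exists d => // s hs.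
    by apply: hd; apply: le_lt_trans hs; exact: clamp_dist.
  split; apply: continuous_eps => t e e0; have [d d0 hd] := h t e e0; exists d => // s /hd k.
    by rewrite -ReB; apply: le_trans k; exact: Re_le_normc.
  by rewrite -ImB; apply: le_trans k; exact: Im_le_normc.
apply: cin_ext (cin_cont_itv a b cg) => t; rewrite cindE; case: ifP => [/andP[h1 h2]|_]; last by rewrite !mul0r.
by rewrite clampE // (ltW h1).
Qed.
Lemma cind_split a b c t : a <= b -> b <= c -> cind a c t = cind a b t + cind b c t.
Proof.
move=> ab bc; rewrite !cindE; have [h1|h1] := leP t b.
  by rewrite (le_trans h1 bc) !andbT /= addr0.
by rewrite !andbF add0r (le_lt_trans ab h1).
Qed.
Lemma cI_seg_split (g : R -> C) a b c : cont_on g a c -> a <= b -> b <= c ->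
  cI mu (fun t => cind a c t * g t) = cI mu (fun t => cind a b t * g t) + cI mu (fun t => cind b c t * g t).
Proof.
move=> hg ab bc; rewrite -cID.
- by apply: cI_ext => t; rewrite (cind_split t ab bc) mulrDl.
- by apply: cin_cont_on => t /andP[h1 h2]; apply: hg; rewrite h1 (le_trans h2).
- by apply: cin_cont_on => t /andP[h1 h2]; apply: hg; rewrite h2 (le_trans ab).
Qed.
Lemma cI_seg_bound (g : R -> C) a b (M : R) : cont_on g a b -> a <= b -> 0 <= M ->
  (forall t, a <= t <= b -> normc (g t) <= M) -> normc (cI mu (fun t => cind a b t * g t)) <= (b - a) * M.
Proof.
move=> hg ab M0 hM; have [e|nab] := eqVneq a b.
  have -> : cI mu (fun t => cind a b t * g t) = cI mu (fun=> 0); last by rewrite cI0 normc0 mulr_ge0 ?subr_ge0.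
  apply: cI_ext => t; rewrite cindE e; case: ifP => [/andP[h1 h2]|]; last by rewrite mul0r.
  by have := lt_le_trans h1 h2; rewrite ltxx.
have ltab : a < b by rewrite lt_neqAle nab.
have i : rin mu (fun t => M * (\1_(`]a, b]%classic) t : R)) by apply: rinZ; exact: rin_itv.
apply: le_trans (normc_cI_le (cin_cont_on hg) i _) _.
  move=> t; rewrite normcM normc_cind indicE; case: ifP => h.
    by rewrite mem_set //= ?in_itv //= mul1r mulr1; apply: hM; case/andP: h => /ltW -> ->.
  by rewrite mul0r memNset ?mulr0 //= in_itv /= h.
rewrite rIZ; last exact: rin_itv.
have := rI_ftc ltab (fun x : R => is_derive_id x (1 : R)) (fun x => cvg_cst (1 : R)).
rewrite (_ : (fun t => \1_(`]a, b]%classic) t * 1) = \1_(`]a, b]%classic)); last by apply/funext => t; rewrite mulr1.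
by move=> ->; rewrite mulrC.
Qed.

Definition hseg f y a b := cI mu (fun x => cind a b x * f (x +i* y)).
Definition vseg f x c d := cI mu (fun y => cind c d y * f (x +i* y)).
(** The boundary is run counterclockwise, and [ii] is the velocity along a vertical side. *)
Definition RI f a b c d := hseg f c a b + ii * vseg f b c d - hseg f d a b - ii * vseg f a c d.
Definition on_rect (P : C -> Prop) a b c d := forall z, a <= Re z <= b -> c <= Im z <= d -> P z.

Definition on_bdry (P : C -> Prop) a b c d :=
  (forall x, a <= x <= b -> P (x +i* c) /\ P (x +i* d)) /\ (forall y, c <= y <= d -> P (a +i* y) /\ P (b +i* y)).
Lemma on_rect_bdry (P : C -> Prop) a b c d : a <= b -> c <= d -> on_rect P a b c d -> on_bdry P a b c d.
Proof. by move=> ab cd h; split => t ht; split; apply: h; rewrite //= ?lexx ?ab ?cd. Qed.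

Lemma ccontat_h f x y (e : R) : ccontat f (x +i* y) -> 0 < e ->
  exists2 d : R, 0 < d & forall s, `|s - x| < d -> normc (f (s +i* y) - f (x +i* y)) <= e.
Proof.
move=> h e0; have [d d0 hd] := h e e0; exists d => // s hs.
have -> : s +i* y = x +i* y + (s - x)%:C by apply: complexP; rewrite ?ReD ?ImD /=; ring.
by apply: hd; rewrite normc_real.
Qed.
Lemma ccontat_v f x y (e : R) : ccontat f (x +i* y) -> 0 < e ->
  exists2 d : R, 0 < d & forall s, `|s - y| < d -> normc (f (x +i* s) - f (x +i* y)) <= e.
Proof.
move=> h e0; have [d d0 hd] := h e e0; exists d => // s hs.
have -> : x +i* s = x +i* y + ii * (s - y)%:C by apply: complexP; rewrite ?ReD ?ImD ?Re_mulr_rc ?Im_mulr_rc /=; ring.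
by apply: hd; rewrite normcM normc_i mul1r normc_real.
Qed.
Lemma cont_on_h f y a b : (forall x, a <= x <= b -> ccontat f (x +i* y)) -> cont_on (fun x => f (x +i* y)) a b.
Proof. by move=> h t tab e e0; exact: ccontat_h (h t tab) e0. Qed.
Lemma cont_on_v f x c d : (forall y, c <= y <= d -> ccontat f (x +i* y)) -> cont_on (fun y => f (x +i* y)) c d.
Proof. by move=> h t tab e e0; exact: ccontat_v (h t tab) e0. Qed.

Lemma RI_split_x f a b c d e : (forall x, a <= x <= e -> ccontat f (x +i* c) /\ ccontat f (x +i* d)) -> a <= b -> b <= e ->
  RI f a e c d = RI f a b c d + RI f b e c d.
Proof.
move=> h ab be; rewrite /RI /hseg (cI_seg_split (b := b)) // ?(cI_seg_split (a := a) (b := b) (c := e)) //.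
- by ring.
- by apply: cont_on_h => x /h[].
- by apply: cont_on_h => x /h[].
Qed.
Lemma RI_split_y f a b c d e : (forall y, c <= y <= e -> ccontat f (a +i* y) /\ ccontat f (b +i* y)) -> c <= d -> d <= e ->
  RI f a b c e = RI f a b c d + RI f a b d e.
Proof.
move=> h cd de; rewrite /RI /vseg (cI_seg_split (b := d)) // ?(cI_seg_split (a := c) (b := d) (c := e)) //.
- by ring.
- by apply: cont_on_v => x /h[].
- by apply: cont_on_v => x /h[].
Qed.
Lemma RI_bound f a b c d (M : R) : on_bdry (ccontat f) a b c d -> a <= b -> c <= d -> 0 <= M ->
  on_bdry (fun z => normc (f z) <= M) a b c d -> normc (RI f a b c d) <= 2 * (b - a + (d - c)) * M.
Proof.
move=> [ch cv] ab cd M0 [bh bv].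
have k1 : normc (hseg f c a b) <= (b - a) * M.
  by apply: cI_seg_bound => //; [apply: cont_on_h => x /ch[]|move=> x /bh[]].
have k2 : normc (hseg f d a b) <= (b - a) * M.
  by apply: cI_seg_bound => //; [apply: cont_on_h => x /ch[]|move=> x /bh[]].
have k3 : normc (vseg f a c d) <= (d - c) * M.
  by apply: cI_seg_bound => //; [apply: cont_on_v => x /cv[]|move=> x /bv[]].
have k4 : normc (vseg f b c d) <= (d - c) * M.
  by apply: cI_seg_bound => //; [apply: cont_on_v => x /cv[]|move=> x /bv[]].
rewrite /RI; apply: le_trans (normcB _ _) _; apply: le_trans (lerD (normcB _ _) (lexx _)) _.
apply: le_trans (lerD (lerD (normcD _ _) (lexx _)) (lexx _)) _.
rewrite !normcM !normc_i !mul1r.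
have -> : 2 * (b - a + (d - c)) * M = (b - a) * M + (d - c) * M + (b - a) * M + (d - c) * M by ring.
by rewrite !lerD.
Qed.
Lemma RI_ext f g a b c d : on_bdry (fun z => f z = g z) a b c d -> RI f a b c d = RI g a b c d.
Proof.
move=> [eh ev]; rewrite /RI /hseg /vseg; congr (_ + ii * _ - _ - ii * _); apply: cI_ext => t;
rewrite cindE; case: ifP => [/andP[/ltW h1 h2]|_]; rewrite ?mul0r // !mul1r.
- by have [|->] := eh t; rewrite ?h1.
- by have [|_ ->] := ev t; rewrite ?h1.
- by have [|_ ->] := eh t; rewrite ?h1.
- by have [|->] := ev t; rewrite ?h1.
Qed.
Lemma RI_D f g a b c d : on_bdry (ccontat f) a b c d -> on_bdry (ccontat g) a b c d ->
  RI (fun z => f z + g z) a b c d = RI f a b c d + RI g a b c d.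
Proof.
move=> [fh fv] [gh gv].
have e (F G : R -> C) u v : cont_on F u v -> cont_on G u v ->
    cI mu (fun t => cind u v t * (F t + G t)) = cI mu (fun t => cind u v t * F t) + cI mu (fun t => cind u v t * G t).
  move=> hF hG; rewrite -cID; [|exact: cin_cont_on|exact: cin_cont_on].
  by apply: cI_ext => x; rewrite mulrDr.
rewrite /RI /hseg /vseg !e.
- by ring.
- by apply: cont_on_v => x /fv[].
- by apply: cont_on_v => x /gv[].
- by apply: cont_on_h => x /fh[].
- by apply: cont_on_h => x /gh[].
- by apply: cont_on_v => x /fv[].
- by apply: cont_on_v => x /gv[].
- by apply: cont_on_h => x /fh[].
- by apply: cont_on_h => x /gh[].
Qed.
(** Explicit antiderivatives along the four sides cancel at the corners. In Goursat's argument this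
    removes the first-order approximation. *)
Lemma RI_affine (u v : C) a b c d : a < b -> c < d -> RI (fun z => u + v * z) a b c d = 0.
Proof.
move=> ab cd; case: u v => [u1 u2] [v1 v2].
pose H y (x : R) : C := (u1 +i* u2) * x%:C + (v1 +i* v2) * ((x * x / 2)%:C + ii * (y * x)%:C).
pose V x (y : R) : C := (u1 +i* u2) * y%:C + (v1 +i* v2) * ((x * y)%:C + ii * (y * y / 2)%:C).
have dH y : crd (H y) (fun x => (u1 +i* u2) + (v1 +i* v2) * (x +i* y)).
  move=> x; have e1 (t : R) : Re (H y t) = u1 * t + v1 * (t * t / 2) - v2 * (y * t).
    by rewrite /H /=; ring.
  have e2 (t : R) : Im (H y t) = u2 * t + v2 * (t * t / 2) + v1 * (y * t).
    by rewrite /H /=; ring.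
  split; [under eq_fun do rewrite e1|under eq_fun do rewrite e2]; apply: is_derive_eq;
  by rewrite ?ReD ?ImD ?ReM ?ImM /GRing.scale /=; field.
have dV x : crd (V x) (fun y => (u1 +i* u2) + (v1 +i* v2) * (x +i* y)).
  move=> y; have e1 (t : R) : Re (V x t) = u1 * t + v1 * (x * t) - v2 * (t * t / 2).
    by rewrite /V /=; ring.
  have e2 (t : R) : Im (V x t) = u2 * t + v2 * (x * t) + v1 * (t * t / 2).
    by rewrite /V /=; ring.
  split; [under eq_fun do rewrite e1|under eq_fun do rewrite e2]; apply: is_derive_eq;
  by rewrite ?ReD ?ImD ?ReM ?ImM /GRing.scale /=; field.
have cH y : ccont (fun x => (u1 +i* u2) + (v1 +i* v2) * (x +i* y)).
  split => x; [under eq_fun do rewrite ReD ReM /=|under eq_fun do rewrite ImD ImM /=];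
  apply: cvgD; try exact: cvg_cst; [apply: cvgB|apply: cvgD]; try exact: cvg_cst; apply: cvgMl_tmp; exact: cvg_id.
have cV x : ccont (fun y => (u1 +i* u2) + (v1 +i* v2) * (x +i* y)).
  split => y; [under eq_fun do rewrite ReD ReM /=|under eq_fun do rewrite ImD ImM /=];
  apply: cvgD; try exact: cvg_cst; [apply: cvgB|apply: cvgD]; try exact: cvg_cst; apply: cvgMl_tmp; exact: cvg_id.
rewrite /RI /hseg /vseg !(cI_ftc ab (dH _) (cH _)) !(cI_ftc cd (dV _) (cV _)).
by rewrite /H /V; apply: complexP => /=; field.
Qed.
End Goursat.

(** * Goursat's theorem, a lower Cauchy bound and the identity theorem *)

Section GoursatTheorem.
Variable R : realType.
Local Notation C := R[i].
Local Notation mu := (@lebesgue_measure R).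
Implicit Types (f g : C -> C) (a b c d x y : R).

(** Inner sides cancel, and each quarter has a quarter of the squared semiperimeter: if all four
    quarters satisfied the upper bound, the whole rectangle would. *)
Lemma bisect_step f a b c d (e : R) : a < b -> c < d -> on_rect (ccontat f) a b c d ->
  e * (b - a + (d - c)) ^+ 2 < normc (RI f a b c d) ->
  exists u v : bool, let p := if u then (a + b) / 2 else a in let q := if v then (c + d) / 2 else c in
  e * ((b - a) / 2 + (d - c) / 2) ^+ 2 < normc (RI f p (p + (b - a) / 2) q (q + (d - c) / 2)).
Proof.
move=> ab cd hf.
pose m := (a + b) / 2; pose n := (c + d) / 2.
have am : a <= m by rewrite /m; lra.
have mb : m <= b by rewrite /m; lra.
have cn : c <= n by rewrite /n; lra.
have nd : n <= d by rewrite /n; lra.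
have e1 : a + (b - a) / 2 = m by rewrite /m; field.
have e2 : m + (b - a) / 2 = b by rewrite /m; field.
have e3 : c + (d - c) / 2 = n by rewrite /n; field.
have e4 : n + (d - c) / 2 = d by rewrite /n; field.
rewrite (RI_split_x (b := m)) //; last by move=> x xab; split; apply: hf; rewrite //= ?lexx (ltW cd).
rewrite (RI_split_y (d := n) (a := a)) //; last first.
  by move=> y ycd; split; apply: hf; rewrite //= ?am ?lexx ?(ltW ab).
rewrite (RI_split_y (d := n) (a := m)) //; last first.
  by move=> y ycd; split; apply: hf; rewrite //= ?am ?lexx ?(ltW ab).
move=> H; apply: contrapT => N.
have k u v : normc (RI f (if u then m else a) ((if u then m else a) + (b - a) / 2)
    (if v then n else c) ((if v then n else c) + (d - c) / 2)) <= e * ((b - a) / 2 + (d - c) / 2) ^+ 2.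
  by rewrite leNgt; apply/negP => k; apply: N; exists u, v.
move: H; apply/negP; rewrite -leNgt.
have := k false false; have := k false true; have := k true false; have := k true true.
rewrite /= e1 e2 e3 e4 => k1 k2 k3 k4.
apply: le_trans (normcD _ _) _; apply: le_trans (lerD (normcD _ _) (normcD _ _)) _.
apply: le_trans (lerD (lerD k4 k3) (lerD k2 k1)) _.
by rewrite le_eqVlt; apply/orP; left; apply/eqP; field.
Qed.

Lemma bisect_bounds (a b p w : R) (u : bool) : 0 < w -> a <= p -> p + w <= b ->
  let q := if u then (p + (p + w)) / 2 else p in (a <= q /\ q + w / 2 <= b) /\ p <= q <= p + w / 2.
Proof. by move=> w0 h1 h2; case: u => /=; split; try split; try (apply/andP; split); lra. Qed.

Lemma geometric_mono (x : nat -> R) (W : R) : 0 <= W -> (forall n, x n <= x n.+1 <= x n + W / 2 ^+ n.+1) ->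
  exists l, forall n, x n <= l <= x n + W / 2 ^+ n.
Proof.
move=> W0 hx.
have p2 n : 0 < 2 ^+ n :> R by rewrite exprn_gt0.
have e2 n : W / 2 ^+ n = W / 2 ^+ n.+1 + W / 2 ^+ n.+1.
  by rewrite exprS; field; rewrite gt_eqF.
have [|l [_ hl]] := @geometric_limit R x (W / 2).
  move=> k; have /andP[h1 h2] := hx k; rewrite ger0_norm ?subr_ge0 //.
  have : W / 2 / 2 ^+ k = W / 2 ^+ k.+1 by rewrite exprS; field; rewrite gt_eqF.
  lra.
have mono n k : x n <= x (n + k)%N /\ x (n + k)%N <= x n + W / 2 ^+ n - W / 2 ^+ (n + k).
  elim: k => [|k [i1 i2]]; first by rewrite addn0; split; [|rewrite addrK].
  have /andP[h1 h2] := hx (n + k)%N; rewrite addnS; have := e2 (n + k)%N; split; lra.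
have small (e : R) : 0 < e -> exists N, forall n, (N <= n)%N -> W / 2 ^+ n <= e.
  move=> e0; exists (Num.bound (W / e)) => n hn.
  rewrite ler_pdivrMr // mulrC -ler_pdivrMr //; apply: ltW.
  apply: lt_le_trans (archi_boundP _) _; first by rewrite divr_ge0 // ltW.
  rewrite -natrX ler_nat (leq_trans hn) // ltnW //; exact: ltn_expl.
exists l => n; apply/andP; split; apply/ler_addgt0Pr => e e0; have [N hN] := small e e0;
  have := hN (n + N)%N (leq_addl _ _); have := hl (n + N)%N; have [h1 h2] := mono n N; rewrite ler_norml;
  have : 2 * (W / 2) / 2 ^+ (n + N) = W / 2 ^+ (n + N) by field; rewrite gt_eqF.
all: have : 0 <= W / 2 ^+ (n + N) by rewrite divr_ge0 // ltW.
all: lra.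
Qed.

Lemma goursat f a b c d : a < b -> c < d -> on_rect (cdiff f) a b c d -> RI f a b c d = 0.
Proof.
move=> ab cd hf; apply/eqP; rewrite -[_ == _]negbK -normc_gt0; apply/negP => I0.
pose W := b - a; pose H := d - c.
have W0 : 0 < W by rewrite subr_gt0.
have H0 : 0 < H by rewrite subr_gt0.
have WH : 0 < W + H by rewrite addr_gt0.
have p2 n : 0 < 2 ^+ n :> R by rewrite exprn_gt0.
(* The integral equals $2e(W+H)^2$, so the starting rectangle satisfies the strict inequality of
   [bad] with room to spare. *)
pose e := normc (RI f a b c d) / (2 * (W + H) ^+ 2).
have e0 : 0 < e by rewrite divr_gt0 // mulr_gt0 // exprn_gt0.
pose bad n (p : R * R) := [/\ a <= p.1 /\ p.1 + W / 2 ^+ n <= b, c <= p.2 /\ p.2 + H / 2 ^+ n <= d &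
  e * (W / 2 ^+ n + H / 2 ^+ n) ^+ 2 < normc (RI f p.1 (p.1 + W / 2 ^+ n) p.2 (p.2 + H / 2 ^+ n))].
have half V n : V / 2 ^+ n.+1 = V / 2 ^+ n / 2 :> R by rewrite exprS; field; rewrite gt_eqF.
(* Badness is a premise inside the existential, so that the choice of a quarter is a total function
   of the corner. *)
have stp n p : exists q, bad n p -> bad n.+1 q /\
    (p.1 <= q.1 <= p.1 + W / 2 ^+ n.+1 /\ p.2 <= q.2 <= p.2 + H / 2 ^+ n.+1).
  have [|nb] := pselect (bad n p); last by exists p.
  case: p => p1 p2' [[h1 h2] [h3 h4] h5]; rewrite /= in h1 h2 h3 h4 h5 *.
  have w0 : 0 < W / 2 ^+ n by rewrite divr_gt0.
  have v0 : 0 < H / 2 ^+ n by rewrite divr_gt0.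
  have [||| |u [v /= huv]] := @bisect_step f p1 (p1 + W / 2 ^+ n) p2' (p2' + H / 2 ^+ n) e.
  - by rewrite ltrDl.
  - by rewrite ltrDl.
  - move=> z /andP[z1 z2] /andP[z3 z4]; apply: cdiff_cont; apply: hf; apply/andP; split.
    + exact: le_trans z1.
    + exact: le_trans h2.
    + exact: le_trans z3.
    + exact: le_trans h4.
  - by move: h5; rewrite /= !(addrAC _ _ (- _)) !subrr !add0r.
  move: huv; rewrite !(addrAC _ _ (- _)) !subrr !add0r -!half => huv.
  exists (if u then (p1 + (p1 + W / 2 ^+ n)) / 2 else p1, if v then (p2' + (p2' + H / 2 ^+ n)) / 2 else p2') => _.
  have [b1 b2] := bisect_bounds u w0 h1 h2; have [b3 b4] := bisect_bounds v v0 h3 h4.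
  by split; [split => //=; rewrite !half|rewrite /= !half].
have [F hF] : exists F : nat -> R * R -> R * R, forall n p, bad n p -> bad n.+1 (F n p) /\
    (p.1 <= (F n p).1 <= p.1 + W / 2 ^+ n.+1 /\ p.2 <= (F n p).2 <= p.2 + H / 2 ^+ n.+1).
  by exists (fun n => projT1 (choice (stp n))) => n; exact: projT2 (choice (stp n)).
pose fix u n := if n is m.+1 then F m (u m) else (a, c).
have bu n : bad n (u n).
  elim: n => [|n ih]; last by have [] := hF n _ ih.
  split; rewrite /= ?expr0 ?divr1; [split => //; rewrite /W /H; lra..|].
  have -> : a + W = b by rewrite /W; ring.
  have -> : c + H = d by rewrite /H; ring.
  have -> : e * (W + H) ^+ 2 = normc (RI f a b c d) / 2 by rewrite /e; field; rewrite gt_eqF.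
  lra.
have [l1 hl1] : exists l, forall n, (u n).1 <= l <= (u n).1 + W / 2 ^+ n.
  by apply: geometric_mono => [|n]; [exact: ltW|have [_ []] := hF n _ (bu n)].
have [l2 hl2] : exists l, forall n, (u n).2 <= l <= (u n).2 + H / 2 ^+ n.
  by apply: geometric_mono => [|n]; [exact: ltW|have [_ []] := hF n _ (bu n)].
pose Z := l1 +i* l2.
have [l hl] : cdiff f Z.
  apply: hf; [move: (hl1 0%N)|move: (hl2 0%N)]; rewrite /= expr0 divr1 => /andP[-> h];
  apply: (le_trans h); rewrite /W /H; lra.
have e4 : 0 < e / 4 by rewrite divr_gt0.
have [dl dl0 hdl] := hl _ e4.
have [n hn] : exists n, (W + H) / 2 ^+ n < dl.
  exists (Num.bound ((W + H) / dl)).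
  rewrite ltr_pdivrMr // mulrC -ltr_pdivrMr //.
  apply: lt_trans (archi_boundP _) _; first by rewrite divr_ge0 // ltW.
  by rewrite -natrX ltr_nat; exact: ltn_expl.
have [[q1 q2] [q3 q4]] := bu n; apply/negP; rewrite -leNgt.
set w := W / 2 ^+ n in q2 *; set v := H / 2 ^+ n in q4 *.
set X := (u n).1 in q1 q2 *; set Y := (u n).2 in q3 q4 *.
have w0 : 0 < w by rewrite divr_gt0.
have v0 : 0 < v by rewrite divr_gt0.
(* [A] is the first-order approximation at the point [Z] common to all rectangles; its integral is
   0, and the remainder [r] is at most [e / 4] times the distance to [Z]. *)
pose A z := (f Z - l * Z) + l * z.
pose r z := f z - A z.
have cA z : cdiff A z by apply: cdiffD; [exact: cdiff_cst|apply: cdiffZ; exact: cdiff_id].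
have cf : on_rect (cdiff f) X (X + w) Y (Y + v).
  by move=> z /andP[z1 z2] /andP[z3 z4]; apply: hf; apply/andP; split; lra.
have -> : RI f X (X + w) Y (Y + v) = RI r X (X + w) Y (Y + v).
  have eA t : f t = A t + r t by rewrite /r; ring.
  have := @RI_D R A r X (X + w) Y (Y + v).
  rewrite RI_affine ?ltrDl // add0r => <-.
  - by apply: RI_ext; split => t _; split; exact: eA.
  - by split => t _; split; exact: cdiff_cont.
  - apply: on_rect_bdry; rewrite ?lerDl ?ltW // => z z1 z2.
    by apply: cdiff_cont; apply: cdiffB => //; exact: cf.
have zb z : X <= Re z <= X + w -> Y <= Im z <= Y + v -> normc (z - Z) <= w + v.
  move=> /andP[z1 z2] /andP[z3 z4]; apply: le_trans (normc_le_ReIm _) _.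
  have := hl1 n; have := hl2 n; rewrite -/X -/Y -/w -/v => /andP[? ?] /andP[? ?].
  by rewrite ReB ImB /=; apply: lerD; rewrite ler_norml; apply/andP; split; lra.
have wv : w + v < dl by rewrite /w /v -mulrDl.
apply: le_trans (@RI_bound R r X (X + w) Y (Y + v) (e / 4 * (w + v)) _ _ _ _ _) _.
- apply: on_rect_bdry; rewrite ?lerDl ?ltW // => z z1 z2.
  by apply: cdiff_cont; apply: cdiffB => //; exact: cf.
- by rewrite lerDl ltW.
- by rewrite lerDl ltW.
- by rewrite mulr_ge0 // ?addr_ge0 // ltW.
- apply: on_rect_bdry; rewrite ?lerDl ?ltW // => z z1 z2; have zz := zb z z1 z2.
  have := hdl (z - Z) (le_lt_trans zz wv); rewrite (addrC Z) subrK.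
  have -> : f z - f Z - l * (z - Z) = r z by rewrite /r /A; ring.
  by move=> k; apply: le_trans k _; rewrite ler_wpM2l // ltW.
have -> : X + w - X = w by ring.
have -> : Y + v - Y = v by ring.
have : 0 <= e * (w + v) ^+ 2 by rewrite mulr_ge0 ?exprn_ge0 // ?addr_ge0 // ltW.
(* Perimeter times maximum is half of what badness requires, a contradiction. *)
have -> : 2 * (w + v) * (e / 4 * (w + v)) = e * (w + v) ^+ 2 / 2 by field.
lra.
Qed.

Lemma cI_seg_Im_ge (g : R -> C) a b (m : R) : cont_on g a b -> a < b ->
  (forall t, a <= t <= b -> m <= Im (g t)) -> (b - a) * m <= Im (cI mu (fun t => cind a b t * g t)).
Proof.
move=> hg ab hm; rewrite cI_ImE.
have i : rin mu (fun t => m * (\1_(`]a, b]%classic) t : R)) by apply: rinZ; exact: rin_itv.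
apply: le_trans (rI_le i _ _).
- rewrite rIZ; last exact: rin_itv.
  have := rI_ftc ab (fun x : R => is_derive_id x (1 : R)) (fun x => cvg_cst (1 : R)).
  rewrite (_ : (fun t => \1_(`]a, b]%classic) t * 1) = \1_(`]a, b]%classic)); last by apply/funext => t; rewrite mulr1.
  by move=> ->; rewrite mulrC.
- exact: cin_Im (cin_cont_on hg).
- move=> t; rewrite cindE indicE; case: ifP => h.
    by rewrite mem_set //= ?in_itv //= mul1r mulr1; apply: hm; case/andP: h => /ltW -> ->.
  by rewrite mul0r memNset ?mulr0 //= in_itv /= h.
Qed.
Lemma cI_segZ (g : R -> C) a b (k : C) : cont_on g a b ->
  k * cI mu (fun t => cind a b t * g t) = cI mu (fun t => cind a b t * (k * g t)).
Proof.
move=> hg; rewrite -(cIZ k (cin_cont_on hg)); apply: cI_ext => t; ring.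
Qed.
Lemma cont_onZ (g : R -> C) a b (k : C) : cont_on g a b -> cont_on (fun t => k * g t) a b.
Proof.
move=> hg t tab e e0; have k0 : 0 < 1 + normc k by rewrite ltr_pwDl ?normc_ge0.
have [|d d0 hd] := hg t tab (e / (1 + normc k)); first by rewrite divr_gt0.
exists d => // s /hd h; rewrite -mulrBr normcM.
apply: le_trans (_ : (1 + normc k) * normc (g s - g t) <= _).
  by rewrite ler_wpM2r ?normc_ge0 // lerDr.
by rewrite mulrC -ler_pdivlMr.
Qed.

(** On each side, with its orientation, the imaginary part of the integrand is
    $r/(t^2+r^2)\ge1/(2r)$ over a length $2r$, so the four sides contribute at least 1 each. *)
Lemma RI_inv_ge (z : C) (r : R) : 0 < r ->
  4 <= normc (RI (fun t => (t - z)^-1) (Re z - r) (Re z + r) (Im z - r) (Im z + r)).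
Proof.
move=> r0; have rn : r != 0 by rewrite gt_eqF.
apply: le_trans (le_trans (ler_norm _) (Im_le_normc _)).
pose g (t : C) := (t - z)^-1.
have Vim (x y : R) : Im ((x +i* y)^-1) = - y / (x ^+ 2 + y ^+ 2) by rewrite mulNr.
have Vre (x y : R) : Re ((x +i* y)^-1) = x / (x ^+ 2 + y ^+ 2) by [].
have zE x y : (x +i* y) - z = (x - Re z) +i* (y - Im z) by case: z {g}.
have cg (t : C) : t != z -> ccontat g t.
  move=> tz; apply: cdiff_cont; apply: cdiffV; last by rewrite subr_eq0.
  by apply: cdiffB; [exact: cdiff_id|exact: cdiff_cst].
have nz x y : (x != Re z) || (y != Im z) -> (x +i* y) != z by case: z {g zE cg} => a b /=; rewrite eq_complex /= -negb_and.
have p1 : (r + r) * (2 * r)^-1 = 1 by field.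
have ineq (t s : R) : - r <= t <= r -> (2 * r)^-1 <= r / (t ^+ 2 + r ^+ 2).
  move=> /andP[t1 t2]; have q : t ^+ 2 <= r ^+ 2 by rewrite -subr_ge0 subr_sqr mulr_ge0 //; lra.
  have q0 : 0 < t ^+ 2 + r ^+ 2 by rewrite ltr_wpDl ?sqr_ge0 ?exprn_gt0.
  rewrite ler_pdivlMr // mulrC ler_pdivrMr ?mulr_gt0 //.
  have : 0 <= r ^+ 2 - t ^+ 2 by rewrite subr_ge0.
  by move: q; rewrite !expr2; lra.
have ab : Re z - r < Re z + r by lra.
have cd : Im z - r < Im z + r by lra.
have L : forall V : R, V + r - (V - r) = r + r by move=> V; ring.
have H1 : 1 <= Im (hseg g (Im z - r) (Re z - r) (Re z + r)).
  have co : cont_on (fun x => g (x +i* (Im z - r))) (Re z - r) (Re z + r).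
    apply: cont_on_h => x _; apply: cg; apply: nz; apply/orP; right; apply/eqP; lra.
  have := @cI_seg_Im_ge (fun x => g (x +i* (Im z - r))) _ _ (2 * r)^-1 co ab; rewrite L p1; apply => t /andP[t1 t2].
  rewrite /g zE Vim; have := @ineq (t - Re z) 0.
  have -> : - (Im z - r - Im z) = r by ring.
  have -> : (Im z - r - Im z) ^+ 2 = r ^+ 2 by ring.
  by apply; apply/andP; split; lra.
have H2 : 1 <= Im (- hseg g (Im z + r) (Re z - r) (Re z + r)).
  have co : cont_on (fun x => g (x +i* (Im z + r))) (Re z - r) (Re z + r).
    apply: cont_on_h => x _; apply: cg; apply: nz; apply/orP; right; apply/eqP; lra.
  rewrite /hseg -mulN1r (cI_segZ _ co).
  have := @cI_seg_Im_ge _ _ _ (2 * r)^-1 (cont_onZ (-1) co) ab; rewrite L p1; apply => t /andP[t1 t2].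
  rewrite mulN1r ImN /g zE Vim -mulNr opprK; have := @ineq (t - Re z) 0.
  have -> : Im z + r - Im z = r by ring.
  by apply; apply/andP; split; lra.
have H3 : 1 <= Im (ii * vseg g (Re z + r) (Im z - r) (Im z + r)).
  have co : cont_on (fun y => g ((Re z + r) +i* y)) (Im z - r) (Im z + r).
    apply: cont_on_v => x _; apply: cg; apply: nz; apply/orP; left; apply/eqP; lra.
  rewrite /vseg (cI_segZ _ co).
  have := @cI_seg_Im_ge _ _ _ (2 * r)^-1 (cont_onZ ii co) cd; rewrite L p1; apply => t /andP[t1 t2].
  rewrite ImM /= mul0r add0r mul1r /g zE Vre; have := @ineq (t - Im z) 0.
  have -> : Re z + r - Re z = r by ring.
  by rewrite (addrC (r ^+ 2)); apply; apply/andP; split; lra.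
have H4 : 1 <= Im (- (ii * vseg g (Re z - r) (Im z - r) (Im z + r))).
  have co : cont_on (fun y => g ((Re z - r) +i* y)) (Im z - r) (Im z + r).
    apply: cont_on_v => x _; apply: cg; apply: nz; apply/orP; left; apply/eqP; lra.
  rewrite /vseg -mulNr (cI_segZ _ co).
  have := @cI_seg_Im_ge _ _ _ (2 * r)^-1 (cont_onZ (- ii) co) cd; rewrite L p1; apply => t /andP[t1 t2].
  rewrite ImM /= oppr0 mul0r add0r mulN1r /g zE Vre -mulNr; have := @ineq (t - Im z) 0.
  have -> : - (Re z - r - Re z) = r by ring.
  have -> : (Re z - r - Re z) ^+ 2 = r ^+ 2 by ring.
  by rewrite (addrC (r ^+ 2)); apply; apply/andP; split; lra.
rewrite /RI ImD (ImD _ (- hseg _ _ _ _)) (ImD (hseg _ _ _ _)); move: H1 H2 H3 H4; rewrite /g; lra.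
Qed.

(** The frame between the two rectangles is cut into four rectangles that avoid [z], and each
    contributes 0 by Goursat's theorem. *)
Lemma RI_shrink g (z : C) a b c d A B D E : a < A -> A < Re z -> Re z < B -> B < b ->
  c < D -> D < Im z -> Im z < E -> E < d ->
  (forall t : C, a <= Re t <= b -> c <= Im t <= d -> t != z -> cdiff g t) ->
  RI g a b c d = RI g A B D E.
Proof.
move=> aA Az zB Bb cD Dz zE Ed dg.
have nz (t : C) : (Re t != Re z) || (Im t != Im z) -> t != z by apply: contraTneq => ->; rewrite !eqxx.
have GR a' b' c' d' : a <= a' -> b' <= b -> c <= c' -> d' <= d -> a' < b' -> c' < d' ->
    (b' < Re z) || (Re z < a') || (d' < Im z) || (Im z < c') -> RI g a' b' c' d' = 0.
  move=> k1 k2 k3 k4 k5 k6 k7; apply: goursat => // t /andP[t1 t2] /andP[t3 t4].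
  apply: dg; first by rewrite (le_trans k1 t1) (le_trans t2 k2).
    by rewrite (le_trans k3 t3) (le_trans t4 k4).
  apply: nz; case/orP: k7 => [/orP[/orP[k|k]|k]|k]; apply/orP.
  - by left; rewrite lt_eqF // (le_lt_trans t2 k).
  - by left; rewrite gt_eqF // (lt_le_trans k t1).
  - by right; rewrite lt_eqF // (le_lt_trans t4 k).
  - by right; rewrite gt_eqF // (lt_le_trans k t3).
have cn x y : a <= x <= b -> c <= y <= d -> (x != Re z) || (y != Im z) -> ccontat g (x +i* y).
  by move=> k1 k2 k3; apply: cdiff_cont; apply: dg => //; exact: nz.
have [AB DE] := (lt_trans Az zB, lt_trans Dz zE).
have [[Ab aB] [Dd cE]] := ((lt_trans AB Bb, lt_trans aA AB), (lt_trans DE Ed, lt_trans cD DE)).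
have [[cz zd] [az zb]] := ((lt_trans cD Dz, lt_trans zE Ed), (lt_trans aA Az, lt_trans zB Bb)).
have [ab cd] := (lt_trans aA Ab, lt_trans cD Dd).
rewrite (RI_split_x (b := A)) ?ltW //; last first.
  move=> x hx; split; apply: cn => //=; rewrite ?lexx ?(ltW cd) //; apply/orP; right.
    by rewrite lt_eqF.
  by rewrite gt_eqF.
rewrite (GR a A c d) ?lexx ?(ltW Ab) ?Az // add0r (RI_split_x (b := B)) ?ltW //; last first.
  move=> x /andP[hx1 hx2]; split; apply: cn => //=; rewrite ?lexx ?(ltW cd) ?(le_trans (ltW aA) hx1) //; apply/orP; right.
    by rewrite lt_eqF.
  by rewrite gt_eqF.
rewrite (GR B b c d) ?lexx ?(ltW aB) ?zB ?orbT // addr0 (RI_split_y (d := D)) ?ltW //; last first.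
  move=> y hy; split; apply: cn => //; rewrite ?(ltW aA) ?(ltW Ab) ?(ltW aB) ?(ltW Bb) //; apply/orP; left.
    by rewrite lt_eqF.
  by rewrite gt_eqF.
rewrite (GR A B c D) ?lexx ?(ltW aA) ?(ltW Bb) ?(ltW Dd) ?Dz ?orbT // add0r (RI_split_y (d := E)) ?ltW //; last first.
  move=> y /andP[hy1 hy2]; split; apply: cn => //; rewrite ?(ltW aA) ?(ltW Ab) ?(ltW aB) ?(ltW Bb) ?(le_trans (ltW cD) hy1) //; apply/orP; left.
    by rewrite lt_eqF.
  by rewrite gt_eqF.
by rewrite (GR A B E d) ?lexx ?(ltW aA) ?(ltW Bb) ?(ltW cE) ?zE ?orbT // addr0.
Qed.

Lemma square_bdry (P : C -> Prop) z (r : R) : 0 < r ->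
  (forall t, `|Re t - Re z| <= r -> `|Im t - Im z| <= r -> r <= normc (t - z) -> P t) ->
  on_bdry P (Re z - r) (Re z + r) (Im z - r) (Im z + r).
Proof.
move=> r0 hP; have [r1 r2] : `|r| = r /\ `|- r| = r by rewrite normrN gtr0_norm.
have s (x : R) : x - r - x = - r /\ x + r - x = r by split; ring.
have d (x t : R) : x - r <= t <= x + r -> `|t - x| <= r by rewrite ler_distl.
split=> t /d ht; split; apply: hP; rewrite /= ?(s _).1 ?(s _).2 ?r1 ?r2 //.
- by apply: le_trans (Im_le_normc _); rewrite ImB /= (s _).1 r2.
- by apply: le_trans (Im_le_normc _); rewrite ImB /= (s _).2 r1.
- by apply: le_trans (Re_le_normc _); rewrite ReB /= (s _).1 r2.
- by apply: le_trans (Re_le_normc _); rewrite ReB /= (s _).2 r1.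
Qed.

(** A one-sided form of Cauchy's formula, enough to prove that a value is 0: shrink to a small
    square, replace the numerator by [f z], and bound the kernel from below. *)
Lemma cauchy_lower f (z : C) a b c d : a < Re z < b -> c < Im z < d ->
  on_rect (cdiff f) a b c d -> 4 * normc (f z) <= normc (RI (fun t => f t / (t - z)) a b c d).
Proof.
move=> /andP[az zb] /andP[cz zd] hf.
apply/ler_addgt0Pr => e e0.
have e8 : 0 < e / 8 by rewrite divr_gt0.
have fz : cdiff f z by apply: hf; rewrite ?ltW //= ltW.
have [dl dl0 hdl] := cdiff_cont fz e8.
(* The bound [r + r < dl] puts the square inside the disc where [f] is within [e / 8] of [f z]; the
   perimeter $8r$ then cancels the kernel bound $1/r$. *)
have [r [r0 rd]] : exists r : R, 0 < r /\ [/\ r + r < dl, a < Re z - r, Re z + r < b, c < Im z - r & Im z + r < d].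
  pose m := Num.min (dl / 2) (Num.min (Num.min (Re z - a) (b - Re z)) (Num.min (Im z - c) (d - Im z))).
  have m0 : 0 < m by rewrite !lt_min !subr_gt0 az zb cz zd divr_gt0.
  have : m / 2 < m by lra.
  rewrite {2}/m !lt_min => /and3P[h1 /andP[h2 h3] /andP[h4 h5]]; exists (m / 2); split; [lra|split; lra].
case: rd => rd h1 h2 h3 h4.
have dm (t : C) : t != z -> cdiff (fun x : C => (x - z)^-1) t.
  by move=> tz; apply: cdiffV; rewrite ?subr_eq0 //; apply: cdiffB; [exact: cdiff_id|exact: cdiff_cst].
rewrite (@RI_shrink _ z a b c d (Re z - r) (Re z + r) (Im z - r) (Im z + r)) //; rewrite ?ltrBlDr ?ltrDl //; last first.
  by move=> t t1 t2 tz; apply: cdiffM; [exact: hf|exact: dm].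
have sub (t : C) : `|Re t - Re z| <= r -> `|Im t - Im z| <= r -> cdiff f t.
  rewrite !ler_distl => /andP[t1 t2] /andP[t3 t4]; apply: hf; apply/andP; split.
  - exact: le_trans (ltW h1) t1. - exact: le_trans t2 (ltW h2).
  - exact: le_trans (ltW h3) t3. - exact: le_trans t4 (ltW h4).
have nz (t : C) : r <= normc (t - z) -> t != z.
  by apply: contraTneq => ->; rewrite subrr normc0 -ltNge.
(* The numerator is frozen at [z]; the error is at most [e / 8] over a distance at least [r]. *)
pose q t := (f t - f z) / (t - z).
have ci : on_bdry (ccontat (fun t => (t - z)^-1)) (Re z - r) (Re z + r) (Im z - r) (Im z + r).
  by apply: square_bdry => // t _ _ h; apply: cdiff_cont; apply: dm; exact: nz.
have cp : on_bdry (ccontat (fun t => f z * (t - z)^-1)) (Re z - r) (Re z + r) (Im z - r) (Im z + r).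
  by apply: square_bdry => // t _ _ h; apply: cdiff_cont; apply: cdiffZ; apply: dm; exact: nz.
have cq : on_bdry (ccontat q) (Re z - r) (Re z + r) (Im z - r) (Im z + r).
  apply: square_bdry => // t t1 t2 h; apply: cdiff_cont.
  by apply: cdiffM; [apply: cdiffB; [exact: sub|exact: cdiff_cst]|apply: dm; exact: nz].
have -> : RI (fun t => f t / (t - z)) (Re z - r) (Re z + r) (Im z - r) (Im z + r) =
    f z * RI (fun t => (t - z)^-1) (Re z - r) (Re z + r) (Im z - r) (Im z + r) + RI q (Re z - r) (Re z + r) (Im z - r) (Im z + r).
  have <- : RI (fun t => f z * (t - z)^-1) (Re z - r) (Re z + r) (Im z - r) (Im z + r) =
      f z * RI (fun t => (t - z)^-1) (Re z - r) (Re z + r) (Im z - r) (Im z + r).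
    case: ci => c1 c2; rewrite /RI /hseg /vseg !mulrBr !mulrDr !(mulrCA (f z) ii) -!cI_segZ //.
    - by apply: (@cont_on_v R (fun t => (t - z)^-1)) => x /c2[].
    - by apply: (@cont_on_h R (fun t => (t - z)^-1)) => x /c1[].
    - by apply: (@cont_on_v R (fun t => (t - z)^-1)) => x /c2[].
    - by apply: (@cont_on_h R (fun t => (t - z)^-1)) => x /c1[].
  rewrite -RI_D //; apply: RI_ext; apply: square_bdry => // t _ _ _; rewrite /q; ring.
have k1 := RI_inv_ge z r0.
have k2 : normc (RI q (Re z - r) (Re z + r) (Im z - r) (Im z + r)) <= e.
  have lr (x : R) : x - r <= x + r by rewrite lerD2l ge0_cp // ltW.
  have er : 0 <= e / 8 / r by rewrite divr_ge0 // ltW.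
  apply: le_trans (@RI_bound R q _ _ _ _ (e / 8 / r) cq (lr _) (lr _) er _) _.
    apply: square_bdry => // t t1 t2 tz; rewrite /q normcM normcV.
    apply: ler_pM; [exact: normc_ge0|by rewrite invr_ge0 normc_ge0| |by rewrite lef_pV2 // posrE ?(lt_le_trans r0)].
    have := hdl (t - z); rewrite (addrC z) subrK; apply.
    apply: le_lt_trans (normc_le_ReIm _) _; apply: le_lt_trans rd; rewrite ReB ImB; exact: lerD.
  have L (x : R) : x + r - (x - r) = r + r by ring.
  rewrite !L le_eqVlt; apply/orP; left; apply/eqP; field; exact: lt0r_neq0.
set V := RI (fun t => (t - z)^-1) _ _ _ _ in k1 *; set U := RI q _ _ _ _ in k2 *.
have k3 : 4 * normc (f z) <= normc (f z * V) by rewrite normcM mulrC ler_wpM2l ?normc_ge0.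
apply: le_trans k3 _; have := normcB (f z * V + U) U; rewrite addrK => h.
by apply: le_trans h _; rewrite lerD2l.
Qed.

Lemma ccvg_eps (u : nat -> C) l : (forall e : R, 0 < e -> exists N, forall n, (N <= n)%N -> normc (u n - l) <= e) ->
  ccvg u l.
Proof.
move=> h; apply/cvgrPdist_le => e /h[N hN]; exists N => // n /= /hN.
by rewrite sub0r normrN ger0_norm ?normc_ge0.
Qed.

(* Vertical sides are negligible when [f] decays along the strip. *)
Lemma contour_shift f c d : c < d -> (forall z, c <= Im z <= d -> cdiff f z) ->
  (forall e : R, 0 < e -> exists N : R, forall x y, N <= `|x| -> c <= y <= d -> normc (f (x +i* y)) <= e) ->
  cin mu (fun x => f (x +i* c)) -> cin mu (fun x => f (x +i* d)) ->
  cI mu (fun x => f (x +i* c)) = cI mu (fun x => f (x +i* d)).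
Proof.
move=> cd hf dec ic id.
apply/eqP; rewrite -subr_eq0; apply/eqP.
have A := ccvgB (cI_trunc ic) (cI_trunc id).
apply: (ccvg_uniq A); apply: ccvg_eps => e e0.
have e2 : 0 < e / (2 * (1 + (d - c))) by rewrite divr_gt0 // mulr_gt0 //; lra.
have [N hN] := dec _ e2; exists (Num.bound `|N|) => n hn.
have nN : N <= n.+1%:R.
  apply: le_trans (ler_norm _) _; apply: ltW; apply: lt_le_trans (archi_boundP (normr_ge0 N)) _.
  by rewrite ler_nat (leq_trans hn).
have n0 : - n.+1%:R < n.+1%:R :> R by have := ltr0Sn R n; lra.
have cf z : c <= Im z <= d -> ccontat f z by move=> h; apply: cdiff_cont; exact: hf.
have G : RI f (- n.+1%:R) n.+1%:R c d = 0 by apply: goursat => // z _; exact: hf.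
have v1 : normc (vseg f n.+1%:R c d) <= (d - c) * (e / (2 * (1 + (d - c)))).
  apply: cI_seg_bound; rewrite ?ltW //; first by apply: cont_on_v => y yc; exact: cf.
  by move=> y yc; apply: hN => //; rewrite ger0_norm.
have v2 : normc (vseg f (- n.+1%:R) c d) <= (d - c) * (e / (2 * (1 + (d - c)))).
  apply: cI_seg_bound; rewrite ?ltW //; first by apply: cont_on_v => y yc; exact: cf.
  by move=> y yc; apply: hN => //; rewrite normrN ger0_norm.
rewrite subr0 -/(hseg f c _ _) -/(hseg f d _ _).
have -> : hseg f c (- n.+1%:R) n.+1%:R - hseg f d (- n.+1%:R) n.+1%:R =
    ii * vseg f (- n.+1%:R) c d - ii * vseg f n.+1%:R c d + RI f (- n.+1%:R) n.+1%:R c d by rewrite /RI; ring.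
rewrite G addr0; apply: le_trans (normcB _ _) _; rewrite !normcM normc_i !mul1r.
apply: le_trans (lerD v2 v1) _.
have -> : (d - c) * (e / (2 * (1 + (d - c)))) + (d - c) * (e / (2 * (1 + (d - c)))) = e * ((d - c) / (1 + (d - c))) by field; lra.
by rewrite ger_pMr // ler_pdivrMr; lra.
Qed.

Lemma ccont_cont_on (g : R -> C) a b : ccont g -> cont_on g a b.
Proof.
move=> [c1 c2] t _ e e0; have e2 : 0 < e / 2 by rewrite divr_gt0.
have /cvgrPdist_le/(_ _ e2)/nbhs_ballP[d1 d10 h1] := c1 t.
have /cvgrPdist_le/(_ _ e2)/nbhs_ballP[d2 d20 h2] := c2 t.
exists (Num.min d1 d2); first by rewrite lt_min d10.
move=> s; rewrite lt_min distrC => /andP[/h1 k1 /h2 k2].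
apply: le_trans (normc_le_ReIm _) _; rewrite ReB ImB distrC (distrC (Im _)).
by rewrite [leRHS](splitr e); apply: lerD.
Qed.
(** The derivative $se^{st}$ is integrated over $0\le t\le1$; [cexp_sub1_id] repeats this with
    $s(e^{st}-1)$ to gain a second factor of [s]. *)
Lemma cexp_sub1 (s : C) : normc (cexp s - 1) <= normc s * expR (normc s).
Proof.
have := cI_ftc ltr01 (crd_cexp s) (ccontZ s (ccont_cexp s)).
rewrite mulr1 mulr0 cexp0 => <-.
have := @cI_seg_bound R (fun t => s * cexp (s * t%:C)) 0 1 (normc s * expR (normc s)).
rewrite subr0 mul1r; apply.
- exact: ccont_cont_on (ccontZ s (ccont_cexp s)).
- exact: ler01.
- by rewrite mulr_ge0 ?normc_ge0 ?expR_ge0.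
- move=> t /andP[t0 t1]; rewrite normcM normc_cexp ler_wpM2l ?normc_ge0 // ler_expR.
  apply: le_trans (ler_norm _) (le_trans (Re_le_normc _) _).
  by rewrite normcM normc_real (ger0_norm t0) ler_piMr ?normc_ge0.
Qed.
Lemma cexp_sub1_id (s : C) : normc (cexp s - 1 - s) <= normc s ^+ 2 * expR (normc s).
Proof.
have co : ccont (fun t : R => s * (cexp (s * t%:C) - 1)).
  by apply: ccontZ; case: (ccont_cexp s) => c1 c2; split => t;
   [under eq_fun do rewrite ReB|under eq_fun do rewrite ImB]; apply: cvgB; rewrite ?ReB ?ImB; try exact: cvg_cst; [exact: c1|exact: c2].
have dF : crd (fun t : R => cexp (s * t%:C) - s * t%:C) (fun t => s * (cexp (s * t%:C) - 1)).
  move=> t; have [h1 h2] := crd_cexp s t; split.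
    under eq_fun do rewrite ReB Re_mulr_rc; apply: is_derive_eq.
    by rewrite mulrBr mulr1 ReB /GRing.scale /= mulr1.
  under eq_fun do rewrite ImB Im_mulr_rc; apply: is_derive_eq.
  by rewrite mulrBr mulr1 ImB /GRing.scale /= mulr1.
have := cI_ftc ltr01 dF co.
rewrite mulr1 mulr0 cexp0 subr0 => e.
have -> : cexp s - 1 - s = cexp s - s - 1 by ring.
rewrite -e; have := @cI_seg_bound R (fun t => s * (cexp (s * t%:C) - 1)) 0 1 (normc s ^+ 2 * expR (normc s)).
rewrite subr0 mul1r; apply.
- exact: ccont_cont_on.
- exact: ler01.
- by rewrite mulr_ge0 ?exprn_ge0 ?normc_ge0 ?expR_ge0.
- move=> t /andP[t0 t1]; rewrite normcM expr2 -mulrA ler_wpM2l ?normc_ge0 //.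
  apply: le_trans (cexp_sub1 _) _; have k : normc (s * t%:C) <= normc s.
    by rewrite normcM normc_real (ger0_norm t0) ler_piMr ?normc_ge0.
  by apply: ler_pM; rewrite ?normc_ge0 ?expR_ge0 ?ler_expR.
Qed.
Lemma cdiff_cexp z : cdiff (@cexp R) z.
Proof.
exists (cexp z) => e e0.
have n0 : 0 < normc (cexp z) by rewrite normc_cexp expR_gt0.
exists (Num.min 1 (e / (normc (cexp z) * expR 1))).
  by rewrite lt_min ltr01 divr_gt0 // mulr_gt0 // expR_gt0.
move=> h; rewrite lt_min => /andP[h1 h2].
have -> : cexp (z + h) - cexp z - cexp z * h = cexp z * (cexp h - 1 - h) by rewrite cexpD; ring.
rewrite normcM; apply: le_trans (ler_wpM2l (ltW n0) (cexp_sub1_id h)) _.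
rewrite expr2 -mulrA mulrCA [leRHS]mulrC ler_wpM2l ?normc_ge0 // mulrCA.
apply: le_trans (_ : normc h * (normc (cexp z) * expR 1) <= _).
  by rewrite ler_wpM2l ?normc_ge0 // ler_wpM2l ?(ltW n0) // ler_expR ltW.
by rewrite -ler_pdivlMr ?ltW // mulr_gt0 // expR_gt0.
Qed.

Lemma cont_on_bounded (g : R -> C) a b : cont_on g a b -> a <= b ->
  exists M : R, 0 < M /\ forall t, a <= t <= b -> normc (g t) <= M.
Proof.
move=> hg ab; have cg : continuous (fun t => normc (g (clamp a b t))).
  apply: continuous_eps => t e e0; have [d d0 hd] := hg _ (clamp_in t ab) e e0; exists d => // s hs.
  apply: le_trans (normc_dist_le _ _) _.
  by apply: hd; apply: le_lt_trans hs; exact: clamp_dist.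
have [|x _ hx] := @EVT_max R (fun t => normc (g (clamp a b t))) a b ab.
  exact: continuous_subspaceT.
exists (1 + normc (g (clamp a b x))); split; first by rewrite ltr_pwDl ?normc_ge0.
move=> t tab; have := hx t; rewrite in_itv /= tab clampE // => /(_ isT) h; apply: le_trans h _; lra.
Qed.
Lemma on_bdry_bounded f a b c d : on_bdry (ccontat f) a b c d -> a <= b -> c <= d ->
  exists M : R, 0 < M /\ on_bdry (fun u => normc (f u) <= M) a b c d.
Proof.
move=> [h v] ab cd.
have [M1 [m1 k1]] := cont_on_bounded (cont_on_h (fun x hx => (h x hx).1)) ab.
have [M2 [m2 k2]] := cont_on_bounded (cont_on_h (fun x hx => (h x hx).2)) ab.
have [M3 [m3 k3]] := cont_on_bounded (cont_on_v (fun x hx => (v x hx).1)) cd.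
have [M4 [m4 k4]] := cont_on_bounded (cont_on_v (fun x hx => (v x hx).2)) cd.
exists (M1 + M2 + M3 + M4); split; first lra.
split => t ht; split.
- by have := k1 t ht; lra.
- by have := k2 t ht; lra.
- by have := k3 t ht; lra.
- by have := k4 t ht; lra.
Qed.

(* The weight [exp (l (u + u^2 / 2))] is small on the part of the boundary of
   the square [-1 <= Re u <= 1], [-1 <= Im u <= 1] with [Re u <= 0], compared
   with its size at points [-1/2 < u <= 0]. *)
Lemma identity_step f (c : R) : (forall z, cdiff f z) -> (forall z, c < Re z -> f z = 0) ->
  forall z, c - 1/2 < Re z -> f z = 0.
Proof.
move=> hf f0 z zc; have [|zc'] := ltP c (Re z); first exact: f0.
apply/eqP; rewrite -[_ == _]negbK -normc_gt0; apply/negP => fz0.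
pose o := c +i* Im z.
pose q (u : C) := u + u ^+ 2 / 2%:R.
pose E (l : R) u := f u * cexp (l%:C * (q (u - o) - q (z - o))).
have dq u : cdiff (fun u => q (u - o)) u.
  have d0 : cdiff (fun u => u - o) u by apply: cdiffB; [exact: cdiff_id|exact: cdiff_cst].
  apply: cdiffD => //; apply: cdiffM; last exact: cdiff_cst.
  exact: cdiffX.
have dE l u : cdiff (E l) u.
  apply: cdiffM => //; apply: (cdiff_comp (g := fun u => l%:C * (q (u - o) - q (z - o)))); last exact: cdiff_cexp.
  by apply: cdiffZ; apply: cdiffB => //; exact: cdiff_cst.
have Rq (u : C) : Re (q u) = Re u + (Re u ^+ 2 - Im u ^+ 2) / 2.
  by rewrite /q -rcnat -rcV ReD Re_mulr_rc; case: u => x y; rewrite !expr2 /=.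
have E1 l : E l z = f z by rewrite /E subrr mulr0 cexp0 mulr1.
pose Q l u := E l u / (u - z).
have cP : on_bdry (ccontat (fun u => f u / (u - z))) (c - 1) (c + 1) (Im z - 1) (Im z + 1).
  have cn (u : C) : u != z -> ccontat (fun u => f u / (u - z)) u.
    move=> uz; apply: cdiff_cont; apply: cdiffM; first exact: hf.
    by apply: cdiffV; rewrite ?subr_eq0 //; apply: cdiffB; [exact: cdiff_id|exact: cdiff_cst].
  split => t ht; split; apply: cn; apply/eqP => h; move: zc zc' (congr1 Re h) (congr1 Im h) => /=; lra.
have [|| M [M0 [hMh hMv]]] := on_bdry_bounded cP; [lra|lra|].
have H l : 0 <= l -> 4 * normc (f z) <= 8 * (expR (- (l / 8)) * M).
  move=> l0; rewrite -{1}(E1 l).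
  have zin : c - 1 < Re z < c + 1 by apply/andP; split; lra.
  have zin2 : Im z - 1 < Im z < Im z + 1 by apply/andP; split; lra.
  apply: le_trans (cauchy_lower zin zin2 _) _; first by move=> u _ _; exact: dE.
  have Ew u : normc (f u / (u - z)) <= M -> (c < Re u) || (Re (q (u - o)) <= - (1/2)) ->
      normc (E l u / (u - z)) <= expR (- (l / 8)) * M.
    move=> uM /orP[cu|qu].
      by rewrite /E f0 // !mul0r normc0 mulr_ge0 ?expR_ge0 // ltW.
    rewrite /E mulrAC normcM normc_cexp mulrC; apply: ler_pM; rewrite ?expR_ge0 ?normc_ge0 // ler_expR.
    rewrite mulrC Re_mulr_rc ReB (Rq (z - o)) !ReB !ImB /= subrr expr0n subr0.
    (* Less than 1/2 to the left of [c] the exponent is at least $-3/8$, while on the relevant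
       boundary it is at most $-1/2$; the gap $1/8$ is the decay rate in [l]. *)
    have qz : - (3/8) <= Re z - c + (Re z - c) ^+ 2 / 2.
      have : 0 <= (Re z - c + 1/2) * (Re z - c + 3/2) by rewrite mulr_ge0; lra.
      rewrite expr2; lra.
    have : 0 <= l * (- (1/8) - (Re (q (u - o)) - (Re z - c + (Re z - c) ^+ 2 / 2))) by rewrite mulr_ge0 //; lra.
    lra.
  have qE x y : Re (q (x +i* y - o)) = x - c + ((x - c) ^+ 2 - (y - Im z) ^+ 2) / 2 by rewrite Rq ReB ImB.
  have hor x y : c - 1 <= x <= c + 1 -> (y - Im z) ^+ 2 = 1 -> (c < x) || (Re (q (x +i* y - o)) <= - (1/2)).
    move=> /andP[x1 x2] y2; have [//|xc] := ltP c x; rewrite qE y2 /=.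
    have : 0 <= (c - x) * (1 + (x - c)) by rewrite mulr_ge0; lra.
    by rewrite expr2; lra.
  have EB : on_bdry (fun u => normc (E l u / (u - z)) <= expR (- (l / 8)) * M) (c - 1) (c + 1) (Im z - 1) (Im z + 1).
    split => t ht; split; apply: Ew.
    - exact: (hMh t ht).1.
    - by apply: hor => //; rewrite (_ : Im z - 1 - Im z = -1) ?sqrrN ?expr1n //; ring.
    - exact: (hMh t ht).2.
    - by apply: hor => //; rewrite (_ : Im z + 1 - Im z = 1) ?expr1n //; ring.
    - exact: (hMv t ht).1.
    - apply/orP; right; rewrite qE.
      have := sqr_ge0 (t - Im z); have -> : c - 1 - c = -1 by ring.
      by rewrite sqrrN expr1n; lra.
    - exact: (hMv t ht).2.
    - by apply/orP; left; rewrite /=; lra.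
  have EP : on_bdry (ccontat (fun u => E l u / (u - z))) (c - 1) (c + 1) (Im z - 1) (Im z + 1).
    have cn (u : C) : u != z -> ccontat (fun u => E l u / (u - z)) u.
      move=> uz; apply: cdiff_cont; apply: cdiffM; first exact: dE.
      by apply: cdiffV; rewrite ?subr_eq0 //; apply: cdiffB; [exact: cdiff_id|exact: cdiff_cst].
    split => t ht; split; apply: cn; apply/eqP => h; move: zc zc' (congr1 Re h) (congr1 Im h) => /=; lra.
  have := RI_bound EP _ _ _ EB.
  have -> : 2 * (c + 1 - (c - 1) + (Im z + 1 - (Im z - 1))) = 8 by ring.
  apply; [lra|lra|]; by rewrite mulr_ge0 ?expR_ge0 // ltW.
(* With [l = 8 * K] the bound becomes $4|f(z)|e^K\le8M=4K|f(z)|$, which contradicts $e^K\ge1+K$. *)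
pose K := 2 * M / normc (f z).
have K0 : 0 <= K by rewrite divr_ge0 ?mulr_ge0 // ltW.
have := H (8 * K) (mulr_ge0 (ler0n _ 8) K0).
have -> : 8 * K / 8 = K by field.
rewrite expRN mulrCA ler_pdivlMl ?expR_gt0 // leNgt => /negP; apply.
apply: lt_le_trans (_ : (1 + K) * (4 * normc (f z)) <= _); last first.
  by rewrite ler_wpM2r ?mulr_ge0 ?normc_ge0 // expR_ge1Dx.
have -> : (1 + K) * (4 * normc (f z)) = 4 * normc (f z) + 8 * M by rewrite /K; field; rewrite gt_eqF.
lra.
Qed.
Lemma identity_half_plane f (c : R) : (forall z, cdiff f z) -> (forall z, c < Re z -> f z = 0) ->
  forall z, f z = 0.
Proof.
move=> hf f0; have step n z : c - n%:R / 2 < Re z -> f z = 0.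
  elim: n z => [|n ih]; first by move=> z; rewrite mul0r subr0; exact: f0.
  move=> z hz; apply: (identity_step hf ih); apply: le_lt_trans hz; rewrite -addn1 natrD; lra.
move=> z; apply: (step (Num.bound (2 * `|c - Re z|))).
have := archi_boundP (mulr_ge0 (ler0n _ 2) (normr_ge0 (c - Re z))); have := ler_norm (c - Re z); lra.
Qed.
End GoursatTheorem.

(* The library makes [counting] a measure and a sigma-finite content, but not a sigma-finite measure. *)
Definition cntm (R : realType) : set nat -> \bar R := @counting nat R.
HB.instance Definition _ (R : realType) := Measure.on (@cntm R).
HB.instance Definition _ (R : realType) := @Measure_isSigmaFinite.Build _ _ _ (@cntm R) (sigma_finite_counting R).

(** * Series as integrals against the counting measure *)

Section Series.
Variable R : realType.
Local Notation C := R[i].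
Local Notation cnt := (@cntm R).

Lemma cmeas_nat (a : nat -> C) : cmeas a.
Proof. by split. Qed.

Lemma rin_cnt (a : nat -> R) (M : R) : (forall n, \sum_(k < n) `|a k| <= M) -> rin cnt a.
Proof.
move=> h; apply/integrableP; split; first exact/measurable_EFinP.
rewrite ge0_integral_count; last by move=> k; rewrite lee_fin.
apply: le_lt_trans (ltry M).
apply: lime_le; first by apply: is_cvg_nneseries => k _ _; rewrite lee_fin.
by apply: nearW => n; rewrite big_mkord sumEFin lee_fin.
Qed.
Lemma cin_cnt (a : nat -> C) (M : R) : (forall n, \sum_(k < n) normc (a k) <= M) -> cin cnt a.
Proof.
move=> h; split; first exact: cmeas_nat.
apply: (@rin_cnt _ M) => n; apply: le_trans (h n).
by apply: ler_sum => k _; rewrite ger0_norm ?normc_ge0.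
Qed.
Lemma rin_cnt_sum_le (a : nat -> R) n : rin cnt a -> (forall k, 0 <= a k) -> \sum_(k < n) a k <= rI cnt a.
Proof.
move=> ia a0; rewrite -lee_fin -rIE // ge0_integral_count; last by move=> k; rewrite lee_fin.
rewrite -sumEFin -(big_mkord xpredT (fun k => (a k)%:E)).
by apply: nneseries_lim_ge => k _; rewrite lee_fin.
Qed.
Lemma cI_cnt1 (c : C) m : cI cnt (fun k => if k == m then c else 0) = c.
Proof.
have i1 : rin cnt (fun k => \1_[set m] k : R).
  apply: (@rin_cnt _ 1) => n; have [mn|nm] := ltnP m n.
    rewrite (bigD1 (Ordinal mn)) //= big1 ?addr0 => [|i].
      by rewrite indicE mem_set // normr1.
    move=> im; rewrite indicE memNset ?normr0 // => /= e; case/negP: im; exact/eqP/val_inj.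
  rewrite big1 // => i _; rewrite indicE memNset ?normr0 // => e; by have := ltn_ord i; rewrite e ltnNge nm.
have e : rI cnt (fun k => \1_[set m] k : R) = 1.
  rewrite rI_def integral_indic // setIT.
  suff: counting [set m] = 1%:E :> \bar R by move=> e; exact: (congr1 fine e).
  by rewrite /counting (asboolT (finite_set1 m)) fset_set1 finmap.cardfs1.
transitivity (cI cnt (fun k => c * ((\1_[set m] k : R)%:C))).
  apply: cI_ext => k; rewrite indicE; case: eqP => [->|n]; first by rewrite mem_set // mulr1.
  by rewrite memNset ?mulr0.
by rewrite cIZ ?cI_real ?e ?mulr1 //; exact: cin_real.
Qed.
Lemma cin_cnt1 (c : C) m : cin cnt (fun k => if k == m then c else 0).
Proof.
apply: (@cin_cnt _ (normc c)) => n; have [mn|nm] := ltnP m n.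
  rewrite (bigD1 (Ordinal mn)) //= eqxx big1 ?addr0 // => i.
  by rewrite -val_eqE /= => /negbTE ->; rewrite normc0.
rewrite big1 ?normc_ge0 // => i _; case: eqP => [e|]; rewrite ?normc0 //.
by have := ltn_ord i; rewrite e ltnNge nm.
Qed.
Lemma cI_cnt_fin (a : nat -> C) n : cin cnt (fun k => if (k < n)%N then a k else 0) /\
  cI cnt (fun k => if (k < n)%N then a k else 0) = \sum_(k < n) a k.
Proof.
elim: n => [|n [i e]]; first by rewrite big_ord0; split; [exact: cin0|exact: cI0].
have E k : (if (k < n.+1)%N then a k else 0) = (if (k < n)%N then a k else 0) + (if k == n then a n else 0).
  by rewrite ltnS leq_eqVlt; case: eqP => [->|_] /=; rewrite ?ltnn ?add0r ?addr0.
split; first by apply: cin_ext (cinD i (cin_cnt1 (a n) n)) => k; rewrite E.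
rewrite big_ord_recr /= -e -[X in _ + X](cI_cnt1 (a n) n) -(cID i (cin_cnt1 (a n) n)).
by apply: cI_ext => k; rewrite E.
Qed.
Lemma csum_cvg (a : nat -> C) : cin cnt a -> ccvg (fun n => \sum_(k < n) a k) (cI cnt a).
Proof.
move=> ia.
have h1 : \forall k \ae cnt, ccvg (fun n => if (k < n)%N then a k else 0) (a k).
  by apply: aeW => k; apply: (@ccvg_eventually _ _ _ k.+1) => n kn; rewrite kn.
have h2 n k : normc (if (k < n)%N then a k else 0) <= normc (a k).
  by case: ifP => _; rewrite ?normc0 ?normc_ge0.
have [_] := @cI_dct R _ _ cnt (fun n k => if (k < n)%N then a k else 0) a (fun k => normc (a k))
  (fun=> cmeas_nat _) (cmeas_nat _) h1 (cin_norm ia) h2.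
by apply: ccvg_ext => n; have [_ ->] := cI_cnt_fin a n.
Qed.

Context d (T : measurableType d) (mu : {sigma_finite_measure set T -> \bar R}).

Lemma measurable_nat_prod (g : nat -> T -> R) : (forall n, measurable_fun setT (g n)) ->
  measurable_fun setT (fun z : nat * T => g z.1 z.2).
Proof.
move=> mg _ B mB; rewrite setTI.
have -> : (fun z : nat * T => g z.1 z.2) @^-1` B = \bigcup_n ([set n] `*` (g n @^-1` B)).
  apply/seteqP; split => [[n x] h|[n x] [m _ [/= -> h]]] //.
  by exists n.
apply: bigcupT_measurable => n; apply: measurableX => //.
by rewrite -[X in measurable X]setTI; exact: mg.
Qed.
Lemma cmeas_nat_prod (F : nat -> T -> C) : (forall n, cmeas (F n)) -> cmeas (fun z : nat * T => F z.1 z.2).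
Proof.
move=> h; split.
  by apply: (@measurable_nat_prod (fun n x => Re (F n x))) => n; case: (h n).
by apply: (@measurable_nat_prod (fun n x => Im (F n x))) => n; case: (h n).
Qed.
(** Exchange of sum and integral as Fubini's theorem on the product with the counting measure; the
    bound [M] on partial sums is absolute convergence there. *)
Lemma series_cin (F : nat -> T -> C) (M : R) : (forall n, cin mu (F n)) ->
  (forall n, \sum_(k < n) rI mu (fun x => normc (F k x)) <= M) ->
  [/\ (\forall x \ae mu, cin cnt (fun n => F n x)), cin mu (fun x => cI cnt (fun n => F n x)),
     cin cnt (fun n => cI mu (F n)) &
     cI mu (fun x => cI cnt (fun n => F n x)) = cI cnt (fun n => cI mu (F n))].
Proof.
move=> iF hM.
have h : cin (cnt \x mu)%E (fun z => F z.1 z.2).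
  have mF : cmeas (fun z : nat * T => F z.1 z.2) by apply: cmeas_nat_prod => n; exact: cin_meas (iF n).
  have h1 : \forall n \ae cnt, rin mu (fun y => normc (F n y)) by apply: aeW => n; exact: cin_norm (iF n).
  have h2 : rin cnt (fun n => rI mu (fun y => normc (F n y))).
    apply: (@rin_cnt _ M) => n; apply: le_trans (hM n).
    by apply: ler_sum => k _; rewrite ger0_norm ?rI_ge0 // => x; exact: normc_ge0.
  exact: (@cin_prod R _ _ nat T cnt mu _ mF h1 h2).
have [h1 h2 _] := cin_fubini h; have [h3 h4 _] := cin_fubini (cin_swap h).
by split => //; rewrite -(cI_swap h).
Qed.
End Series.

Section MeasurableInverse.
Variable R : realType.
Context d (T : measurableType d).

(** The inverse is $\bar f\,e^{-\ln|f|^2}$; at a zero of [f] the conjugate factor gives 0, in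
    agreement with the convention for [0^-1]. *)
Lemma cmeasV (f : T -> R[i]) : cmeas f -> cmeas (fun x => (f x)^-1).
Proof.
move=> mf; have mn : measurable_fun setT (fun x => expR (- ln (normc (f x) ^+ 2))).
  apply: (measurableT_comp (@measurable_expR R)); apply: measurableT_comp => //.
  apply: (measurableT_comp (@measurable_ln R)); apply: measurable_funX; exact: cmeas_normc.
apply: cmeas_ext (cmeasM (cmeas_conj mf) (cmeas_real mn)) => x /=.
case: (eqVneq (f x) 0) => [->|fx].
  by rewrite invr0 (_ : conjc 0 = 0) ?mul0r //; apply: complexP => //=; rewrite oppr0.
have n0 : 0 < normc (f x) ^+ 2 by rewrite exprn_gt0 // normc_gt0.
rewrite expRN lnK // rcV -mul_conjc invfM mulrCA divff ?mulr1 //.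
by rewrite -normc_eq0 normc_conj normc_eq0.
Qed.
End MeasurableInverse.

Section LebesgueVariants.
Variable R : realType.
Local Notation mu := (@lebesgue_measure R).
Implicit Types f g : R -> R[i].

Lemma cI_extR f g : (forall x, f x = g x) -> cI mu f = cI mu g.
Proof. by move=> e; rewrite (cI_ext mu e). Qed.
Lemma cin_extR f g : (forall x, f x = g x) -> cin mu f -> cin mu g.
Proof. by move=> e; rewrite (_ : f = g) //; apply/funext. Qed.
Lemma l2_extR f g : (forall x, f x = g x) -> l2 mu f -> l2 mu g.
Proof. by move=> e; rewrite (_ : f = g) //; apply/funext. Qed.
Lemma lmeas_ext f g : (forall x, f x = g x) -> lmeas f -> lmeas g.
Proof. exact: cmeas_ext. Qed.
Lemma cin_dom f (g : R -> R) : lmeas f -> rin mu g -> (forall x, normc (f x) <= g x) -> cin mu f.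
Proof. exact: cin_le. Qed.
Lemma l2_dom f g : lmeas f -> l2 mu g -> (forall x, normc (f x) <= normc (g x)) -> l2 mu f.
Proof.
move=> mf [_ ig] h; apply: l2_le mf ig _ => x.
by rewrite ler_pXn2r ?nnegrE ?normc_ge0.
Qed.
End LebesgueVariants.

(** * Poisson summation *)

Section PoissonSummation.
Variable R : realType.
Local Notation C := R[i].
Local Notation mu := (@lebesgue_measure R).
Implicit Types (f g q : R -> C).

Definition ech (k t : R) : C := cexp (ii * (2 * pi * k)%:C * t%:C).

Lemma cexp_iE (x : R) : cexp (ii * x%:C) = cos x +i* sin x.
Proof.
have [e1 e2] : Re (ii * x%:C) = 0 /\ Im (ii * x%:C) = x by rewrite /=; split; ring.
by rewrite cexpE e1 e2 expR0 mul1r.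
Qed.
Lemma cexp_2pi (k : R) : k \is a Num.int -> cexp (ii * (2 * pi * k)%:C) = 1.
Proof.
have h (n : nat) : cexp (ii * (2 * pi * n%:R : R)%:C) = 1.
  have -> : ii * (2 * pi * n%:R : R)%:C = n%:R * (ii * (2 * pi : R)%:C).
    by rewrite [in LHS]rcM rcnat; ring.
  by rewrite cexpMn cexp_iE mulr_natl cos2pi sin2pi expr1n.
case/intrP => -[n|n] ->; first exact: h.
rewrite NegzE mulrNz -pmulrn mulrN rcN mulrN cexpN h invr1 //.
Qed.

Lemma echD k l t : ech (k + l) t = ech k t * ech l t.
Proof. by rewrite /ech mulrDr rcD mulrDr mulrDl cexpD. Qed.
Lemma ech0 t : ech 0 t = 1.
Proof. by rewrite /ech mulr0 mulr0 mul0r cexp0. Qed.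
Lemma echN k t : ech (- k) t = (ech k t)^-1.
Proof. by rewrite /ech mulrN rcN mulrN mulNr cexpN. Qed.
Lemma ech_conj k t : conjc (ech k t) = ech (- k) t.
Proof. by rewrite /ech cexp_i_conj -mulrN. Qed.
Lemma normc_ech k t : normc (ech k t) = 1.
Proof. exact: normc_cexp_i. Qed.
Lemma ech_shift k n t : k \is a Num.int -> n \is a Num.int -> ech k (t + n) = ech k t.
Proof.
move=> hk hn; rewrite /ech rcD mulrDr cexpD.
have -> : ii * (2 * pi * k)%:C * n%:C = ii * (2 * pi * (k * n))%:C :> C by rewrite !rcM; ring.
by rewrite cexp_2pi ?mulr1 // rpredM.
Qed.
Lemma lmeas_ech k : lmeas (ech k).
Proof. exact: lmeas_cexp. Qed.

Lemma cin_cindM a b f : cin mu f -> cin mu (fun t => cind a b t * f t).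
Proof. by move=> hf; apply: (cin_bM (M := 1)) hf; [exact: lmeas_cind|move=> t; exact: normc_cind_le1]. Qed.
Lemma cin_echM k f : cin mu f -> cin mu (fun t => f t * ech k t).
Proof. by move=> hf; apply: (cin_Mb (M := 1)) hf _ _; [exact: lmeas_ech|move=> t; rewrite normc_ech]. Qed.

Local Notation I := (cind (- 2^-1) (2^-1 : R)).

Lemma cI_ech k : k \is a Num.int -> cI mu (fun t => I t * ech k t) = if k == 0 then 1 else 0.
Proof.
move=> hk; case: eqP => [->|/eqP k0].
  have e t : I t * ech 0 t = I t * 1 by rewrite ech0.
  rewrite (cI_ext mu e) (@cI_ftc _ (fun t => t%:C)); last first.
  - exact: ccont_cst.
  - move=> x; split => /=; first exact: is_derive_id. exact: is_derive_cst.
  - by lra.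
  by rewrite -rcB; congr (_%:C); lra.
pose s : C := ii * (2 * pi * k)%:C.
have s0 : s != 0.
  by rewrite -normc_gt0 /s normcM normc_i mul1r normc_gt0 rc_neq0 // !mulf_neq0 ?pnatr_eq0 // gt_eqF ?pi_gt0.
rewrite (@cI_ftc _ (fun t => s^-1 * ech k t)); last first.
- exact: ccont_cexp.
- have h := crdZ s^-1 (crd_cexp s); move=> x; have [h1 h2] := h x.
  have e : ech k x = s^-1 * (s * cexp (s * x%:C)) by rewrite mulrA mulVf // mul1r.
  by rewrite e.
- by lra.
have -> : ech k (2^-1) = ech k (- 2^-1).
  by rewrite -[in RHS](@ech_shift k 1) ?rpred1 //; congr ech; lra.
by rewrite subrr.
Qed.

(** [g] is the projection of the conjugate of [q] onto the span. Its integral against [q] and its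
    squared norm both equal [S], so Cauchy-Schwarz reads $S^2\le\|q\|^2S$. *)
Lemma bessel_orthonormal (n : nat) (phi : nat -> R -> C) q : l2 mu q -> (forall j, l2 mu (phi j)) ->
  (forall i j : nat, cI mu (fun t => phi i t * conjc (phi j t)) = if i == j then 1 else 0) ->
  \sum_(j < n) normc (cI mu (fun t => q t * phi j t)) ^+ 2 <= N2 mu q.
Proof.
move=> lq lp ho; set a := fun j => cI mu (fun t => q t * phi j t); set S := \sum_(j < n) _.
pose g t := \sum_(j < n) conjc (a j) * phi j t.
have lg : l2 mu g.
  rewrite /g; elim: (n) => [|m IH]; first by apply: (l2_ext (f := fun=> 0)) (l20 _) => x; rewrite big_ord0.
  apply: (l2_ext (f := fun t : measurableTypeR R => \sum_(j < m) conjc (a j) * phi j t + conjc (a m) * phi m t)).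
    by move=> x; rewrite big_ord_recr.
  by apply: l2D => //; exact: l2Z.
have h1 : cI mu (fun t => q t * g t) = S%:C.
  have e t : q t * g t = \sum_(j < n) conjc (a j) * (q t * phi j t).
    by rewrite mulr_sumr; apply: eq_bigr => j _; rewrite mulrCA.
  rewrite (cI_ext mu e) cI_sum; last by move=> j; apply: cinZ; exact: cin_l2.
  rewrite /S rmorph_sum; apply: eq_bigr => j _.
  by rewrite cIZ ?[conjc _ * _]mulrC ?mul_conjc //; exact: cin_l2.
have h2 : N2 mu g = S.
  suff : (N2 mu g)%:C = S%:C :> C by case.
  rewrite -cI_conj_N2.
  have e t : g t * conjc (g t) = \sum_(i < n) conjc (a i) * (\sum_(j < n) a j * (phi i t * conjc (phi j t))).
    rewrite [in LHS]/g mulr_suml; apply: eq_bigr => i _; rewrite -mulrA; congr (_ * _).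
    rewrite (_ : conjc (g t) = \sum_(j < n) a j * conjc (phi j t)).
      by rewrite mulr_sumr; apply: eq_bigr => j _; rewrite mulrCA.
    rewrite /g; apply: (big_ind2 (fun x y : C => conjc x = y)) => [|x x' y y' <- <-|j _].
    - by apply: complexP => //=; rewrite oppr0.
    - by rewrite conjcD.
    - by rewrite conjcM conjcK.
  have ip i j : cin mu (fun t => phi i t * conjc (phi j t)) by apply: cin_l2 => //; exact: l2_conj.
  rewrite (cI_ext mu e) cI_sum; last by move=> i; apply: cinZ; apply: cin_sum => j; apply: cinZ.
  rewrite /S rmorph_sum; apply: eq_bigr => i _.
  rewrite cIZ; last by apply: cin_sum => j; apply: cinZ.
  rewrite cI_sum; last by move=> j; apply: cinZ.
  rewrite (bigD1 i) //= big1 ?addr0; last first.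
    by move=> j ji; rewrite cIZ // ho [X in if X then _ else _](_ : _ = false) ?mulr0 //; apply/negbTE; rewrite eq_sym.
  by rewrite cIZ // ho eqxx mulr1 mulrC mul_conjc.
have := cauchy_schwarz lq lg; rewrite h1 h2.
have S0 : 0 <= S by apply: sumr_ge0 => j _; exact: sqr_ge0.
rewrite normc_pos //; case: (eqVneq S 0) => [-> _|Sn]; first by rewrite N2_ge0.
by rewrite expr2 ler_pM2r // lt_def Sn.
Unshelve. all: try done.
Qed.

(** Symmetric partial sums over the integers, used for both sides of Poisson's formula. *)
Definition per g N : C := g 0 + \sum_(i < N) (g i.+1%:R + g (- i.+1%:R)).

(** The Dirichlet kernel is a geometric sum, so only its two end terms survive. *)
Lemma per_ech_telescope M t : (ech 1 t - 1) * per (fun k => ech k t) M = ech M.+1%:R t - ech (- M%:R) t.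
Proof.
rewrite /per; elim: M => [|M IH]; first by rewrite big_ord0 addr0 ech0 mulr1 oppr0 ech0.
rewrite big_ord_recr /= addrA mulrDr IH mulrDr !mulrBl !mul1r -!echD.
rewrite -[in X in _ + X = _](natrD _ 1 M.+1) add1n.
have -> : 1 - M.+1%:R = - M%:R :> R by rewrite -[in LHS]natr1; lra.
ring.
Qed.

Lemma cin_per (F : R -> R -> C) N : (forall r, cin mu (F r)) -> cin mu (fun t => per (F^~ t) N).
Proof.
move=> h; apply: cinD => //; apply: cin_sum => i; exact: cinD.
Qed.
Lemma cI_per (F : R -> R -> C) N : (forall r, cin mu (F r)) ->
  cI mu (fun t => per (F^~ t) N) = per (fun r => cI mu (F r)) N.
Proof.
move=> h; rewrite cID //; last by apply: cin_sum => i; exact: cinD.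
by rewrite cI_sum => [|i]; [congr (_ + _); apply: eq_bigr => i _; rewrite cID|exact: cinD].
Qed.
Lemma perZ c g N : per (fun r => c * g r) N = c * per g N.
Proof. by rewrite /per mulrDr mulr_sumr; congr (_ + _); apply: eq_bigr => i _; rewrite mulrDr. Qed.
Lemma per_ext g h N : (forall r, r \is a Num.int -> g r = h r) -> per g N = per h N.
Proof.
move=> e; rewrite /per e ?rpred0 //; congr (_ + _); apply: eq_bigr => i _.
by rewrite !e // ?rpredN rpred_nat.
Qed.

(* On the fundamental interval, [2 |sin (pi t)| >= pi |t|]. *)
Lemma ech1_lower (t : R) : `|t| <= 2^-1 -> pi * `|t| <= normc (ech 1 t - 1).
Proof.
wlog t0 : t / 0 <= t.
  move=> H; case: (leP 0 t) => [/H//|tn]; rewrite -[in X in X -> _]normrN => h.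
  have e : normc (ech 1 t - 1) = normc (ech 1 (- t) - 1).
    rewrite -[LHS]normc_conj; congr normc.
    have -> : ech 1 (- t) = conjc (ech 1 t) by rewrite ech_conj echN /ech rcN mulrN cexpN.
    by case: (ech 1 t) => u v; apply: complexP => /=; rewrite ?subr0 ?oppr0 ?addr0.
  by rewrite -normrN e; apply: H => //; rewrite oppr_ge0 ltW.
rewrite ger0_norm // => th.
(* The modulus is $2\sin(2y)=4\sin y\cos y$ with $2y\le\pi/2$. Then $\cos^2y\ge1/2$, and $\sin y\ge
   y\cos y$ by the mean value theorem. *)
set y := pi * t / 2.
have pp := pi_gt0 R.
have y0 : 0 <= y by rewrite /y; apply: mulr_ge0 => //; rewrite mulr_ge0 // ltW.
have y1 : 2 * y <= pi / 2 by rewrite /y; nra.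
have cy : 2^-1 <= cos y ^+ 2.
  have := cosD y y; rewrite -mulr2n -mulr_natl => h.
  have : 0 <= cos (2 * y) by apply: cos_ge0_pihalf; apply/andP; split => //; nra.
  rewrite mulr_natl h; have := cos2Dsin2 y; rewrite !expr2; lra.
have cy0 : 0 <= cos y by apply: cos_ge0_pihalf; apply/andP; split; nra.
have sy : y * cos y <= sin y.
  case: (eqVneq y 0) => [->|yn]; first by rewrite mul0r sin0.
  have yp : 0 < y by rewrite lt_def yn.
  have [c] := @MVT _ (@sin R) (@cos R) 0 y yp (fun x _ => is_derive_sin x) (continuous_subspaceT (@continuous_sin R)).
  rewrite in_itv /= => /andP[c0 c1]; rewrite sin0 !subr0 => ->.
  rewrite mulrC ler_pM2r //.
  by apply: ltW; rewrite ltr_cos // ?in_itv /=; (apply/andP; split => //; nra).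
have e : normc (ech 1 t - 1) ^+ 2 = (4 * (sin y * cos y)) ^+ 2.
  rewrite /ech (_ : ii * (2 * pi * 1)%:C * t%:C = ii * ((y + y) + (y + y))%:C); last first.
    by rewrite -mulrA -rcM; congr (_ * _%:C); rewrite /y; field.
  rewrite cexp_iE normc_sqr /= subr0.
  have h : (1 : R) = (cos y ^+ 2 + sin y ^+ 2) ^+ 2 by rewrite cos2Dsin2 expr1n.
  rewrite [X in (_ - X) ^+ 2]h (cosD (y + y)) (sinD (y + y)) !cosD !sinD.
  rewrite -[RHS]mulr1 [X in _ = _ * X]h; ring.
rewrite -(@ler_pXn2r _ 2) ?nnegrE ?normc_ge0 ?mulr_ge0 ?(ltW pp) // e.
rewrite ler_pXn2r ?nnegrE ?mulr_ge0 ?(ltW pp) //; last by apply: le_trans sy; exact: mulr_ge0.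
have : y * cos y * cos y <= sin y * cos y by apply: ler_wpM2r.
have -> : pi * t = 2 * y by rewrite /y; field.
move: cy; rewrite expr2; nra.
Qed.

Section Summation.
Variables (f : R -> C) (B : R) (a b : C).
Hypotheses (hf : cin mu f) (B0 : 0 <= B).
Hypothesis hB : forall N t, `|t| <= 2^-1 -> normc (per (fun r => f (r + t)) N - per f N) <= B * `|t|.
Hypothesis ha : ccvg (per f) a.
Hypothesis hb : ccvg (per (fun k => FT f (2 * pi * k))) b.

Let A N t := per (fun r => f (r + t)) N.

Let cin_win k r : cin mu (fun t => I t * (f (r + t) * ech k t)).
Proof.
apply: cin_cindM; apply: cin_echM.
by apply: cin_ext (cin_shift r hf) => t; rewrite addrC.
Qed.

(** Translates of the unit interval by the integers of modulus at most [N] tile []-(N+1/2), N+1/2]],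
    and characters of integral frequency are invariant under them. *)
Let period k N : k \is a Num.int ->
  cI mu (fun t => I t * (A N t * ech k t)) =
  cI mu (fun t => cind (- (N%:R + 2^-1)) (N%:R + 2^-1) t * (f t * ech k t)).
Proof.
move=> hk.
have e t : I t * (A N t * ech k t) = per (fun r => I t * (f (r + t) * ech k t)) N.
  by rewrite [A N t * _]mulrC mulrA -perZ; apply: per_ext => r _; rewrite -mulrA [ech _ _ * _]mulrC.
rewrite (cI_ext mu e) (@cI_per (fun r t => I t * (f (r + t) * ech k t))); last by move=> r; exact: cin_win.
have cw x y : cin mu (fun t => cind x y t * (f t * ech k t)).
  by apply: cin_cindM; exact: cin_echM.
have e2 r : r \is a Num.int -> cI mu (fun t => I t * (f (r + t) * ech k t)) =
    cI mu (fun t => cind (r - 2^-1) (r + 2^-1) t * (f t * ech k t)).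
  move=> hr; rewrite -(cI_shift r (cin_meas (cw _ _))); apply: cI_ext => t.
  rewrite ech_shift // [r + t]addrC; congr (_ * _); rewrite !cindE.
  by congr (if _ then _ else _); apply/andP/andP => -[h1 h2]; split; lra.
rewrite (per_ext _ e2) /per; elim: N {e} => [|N IH].
  by rewrite big_ord0 addr0 !add0r.
rewrite big_ord_recr /= addrA IH addrA addrAC.
have l1 : - N.+1%:R - 2^-1 <= - N.+1%:R + 2^-1 :> R by lra.
have l2 : - N.+1%:R + 2^-1 <= N%:R + 2^-1 :> R.
  have : (0 : R) <= N%:R by []. by rewrite -natr1; lra.
have l3 : N%:R + 2^-1 <= N.+1%:R + 2^-1 :> R by rewrite -natr1; lra.
rewrite -!cID //; last by apply: cinD.
apply: cI_ext => t; rewrite -!mulrDl; congr (_ * _).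
have -> : - (N.+1%:R + 2^-1) = - N.+1%:R - 2^-1 :> R by rewrite opprD.
rewrite (cind_split t l1 (le_trans l2 l3)) (cind_split t l2 l3) addrA [_ + cind _ (N%:R + _) _]addrC.
have -> : N.+1%:R - 2^-1 = N%:R + 2^-1 :> R by rewrite -natr1; lra.
by have -> : - N.+1%:R + 2^-1 = - (N%:R + 2^-1) :> R by rewrite -natr1; lra.
Qed.

Let lim_coef k : k \is a Num.int -> ccvg (fun N => cI mu (fun t => I t * (A N t * ech k t))) (FT f (2 * pi * k)).
Proof.
move=> hk; apply: (ccvg_ext (u := fun N : nat => cI mu (fun t => cind (- (N%:R + 2^-1)) (N%:R + 2^-1) t * (f t * ech k t)))).
  by move=> N; rewrite period.
have ce : cin mu (fun t => f t * ech k t).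
  exact: cin_echM.
apply: (cI_dct _ _ _ (cin_norm ce) _).2.
- by move=> N; apply: cmeasM (lmeas_cind _ _) (cin_meas ce).
- exact: cin_meas ce.
- apply: aeW => t; have [N0 hN] := lt_natr_bound t.
  apply: (ccvg_eventually (N := N0.+1)) => -[//|n] hn.
  rewrite cindE ifT ?mul1r //; have := hN n hn; lra.
- move=> N t; rewrite normcM normc_cind; case: ifP => _; rewrite ?mul1r ?mul0r ?normc_ge0 //.
Qed.

(** The difference quotient at 0 of the truncated periodization; [hB] and [ech1_lower] bound it
    uniformly in [N]. *)
Let q N t := I t * ((A N t - per f N) / (ech 1 t - 1)).

Let q_bound N t : normc (q N t) <= B / pi * normc (I t).
Proof.
rewrite /q normcM mulrC normc_cind; case: ifP => ht; last by rewrite !mulr0.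
rewrite !mulr1 normcM normcV.
have h : `|t| <= 2^-1 by rewrite ler_norml; case/andP: ht => h1 h2; lra.
have pp := pi_gt0 R.
case: (eqVneq t 0) => [->|t0].
  have -> : A N 0 = per f N by apply: per_ext => r _; rewrite addr0.
  by rewrite subrr normc0 mul0r divr_ge0 // ltW.
have tp : 0 < `|t| by rewrite normr_gt0.
have h1 := ech1_lower h; have h2 : 0 < pi * `|t| by exact: mulr_gt0.
rewrite ler_pdivrMr; last exact: lt_le_trans h1.
apply: le_trans (hB N h) _.
by rewrite -mulrA; apply: ler_wpM2l => //; rewrite mulrC ler_pdivlMr // mulrC.
Qed.

Let lmeas_A N : lmeas (A N).
Proof.
have ms r : lmeas (fun t => f (r + t)).
  by apply: cin_meas; apply: cin_ext (cin_shift r hf) => t; rewrite addrC.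
apply: cmeasD; first exact: ms.
by apply: cmeas_sum => i; apply: cmeasD; exact: ms.
Qed.

Let lmeas_q N : lmeas (q N).
Proof.
apply: cmeasM (lmeas_cind _ _) _; apply: cmeasM; first by apply: cmeasB => //; exact: cmeas_cst.
by apply: cmeasV; apply: cmeasB (lmeas_ech 1) _; exact: cmeas_cst.
Qed.

Let N2_q N : l2 mu (q N) /\ N2 mu (q N) <= (B / pi) ^+ 2.
Proof.
have l2b : l2 mu (fun t => (B / pi)%:C * I t) by apply: l2Z; exact: l2_cind.
have le t : normc (q N t) <= normc ((B / pi)%:C * I t).
  by rewrite normcM normc_pos ?divr_ge0 ?(ltW (pi_gt0 R)).
have lq : l2 mu (q N).
  exact: l2_dom l2b _.
split=> //; apply: le_trans (N2_le lq l2b le) _.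
rewrite (N2Z _ (l2_cind _ _)) normc_pos ?divr_ge0 ?(ltW (pi_gt0 R)) //.
have -> : N2 mu I = 1.
  suff : (N2 mu I)%:C = 1 :> C by case.
  have z0 : (0 : R) \is a Num.int by exact: rpred0.
  have := cI_ech z0; rewrite eqxx => <-.
  rewrite -cI_conj_N2; apply: cI_ext => t; rewrite mul_conjc normc_cind ech0 mulr1 cindE.
  by case: ifP => _; rewrite ?expr1n ?expr0n.
by rewrite mulr1.
Qed.

Let d N k := cI mu (fun t => q N t * (I t * ech k t)).

Let bessel_q N K (k : nat -> R) : (forall j, k j \is a Num.int) -> injective k ->
  \sum_(j < K) normc (d N (k j)) ^+ 2 <= (B / pi) ^+ 2.
Proof.
move=> hk ik; apply: le_trans (N2_q N).2.
apply: (@bessel_orthonormal K (fun j t => I t * ech (k j) t)) => [|j|i j]; first exact: (N2_q N).1.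
  apply: l2_dom (l2_cind (- 2^-1) (2^-1)) _; first exact: cmeasM (lmeas_cind _ _) (lmeas_ech _).
  by move=> t; rewrite normcM normc_ech mulr1.
have e t : I t * ech (k i) t * conjc (I t * ech (k j) t) = I t * ech (k i - k j) t.
  rewrite conjcM ech_conj echD mulrACA; congr (_ * _).
  by rewrite mul_conjc normc_cind cindE; case: ifP => _; rewrite ?expr1n ?expr0n.
rewrite (cI_ext mu e) cI_ech ?rpredB // subr_eq0; congr (if _ then _ else _).
by apply/eqP/eqP => [/ik|->].
Qed.

(** Telescoping the Dirichlet kernel turns the error of a Fourier partial sum at 0 into a difference
    of two Fourier coefficients of [q N]. *)
Let diff N M : per (fun k => cI mu (fun t => I t * (A N t * ech k t))) M - per f N = d N M.+1%:R - d N (- M%:R).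
Proof.
have cA k : cin mu (fun t => I t * (A N t * ech k t)).
  have e t : per (fun r => I t * (f (r + t) * ech k t)) N = I t * (A N t * ech k t).
    by rewrite [A N t * _]mulrC mulrA -perZ; apply: per_ext => r _; rewrite -mulrA [ech _ _ * _]mulrC.
  by apply: cin_extR e _; apply: (@cin_per (fun r t => I t * (f (r + t) * ech k t))).
have cE k : cin mu (fun t => I t * ech k t).
  by apply: cin_echM; exact: cin_cind.
have e1 : per f N = per (fun k => cI mu (fun t => per f N * (I t * ech k t))) M.
  rewrite (@per_ext (fun k => cI mu (fun t => per f N * (I t * ech k t))) (fun k => per f N * (if k == 0 then 1 else 0))); last first.
    by move=> k hk; rewrite cIZ // cI_ech.
  rewrite perZ [X in _ * X](_ : _ = 1) ?mulr1 // /per eqxx big1 ?addr0 // => i _.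
  by rewrite oppr_eq0 pnatr_eq0 addr0.
rewrite [X in _ - X]e1 -!cI_per //; last by move=> k; exact: cinZ.
rewrite -cIB; [|exact: (@cin_per (fun k t => I t * (A N t * ech k t)))|]; last first.
  by apply: (@cin_per (fun k t => per f N * (I t * ech k t))) => k; exact: cinZ.
have cq k : cin mu (fun t => q N t * (I t * ech k t)).
  apply: cin_l2; first exact: (N2_q N).1.
  apply: l2_dom (l2_cind (- 2^-1) (2^-1)) _; first exact: cmeasM (lmeas_cind _ _) (lmeas_ech _).
  by move=> t; rewrite normcM normc_ech mulr1.
rewrite /d -cIB //; apply: cI_ext => t.
have -> : per (fun k => I t * (A N t * ech k t)) M = I t * A N t * per (fun k => ech k t) M.
  by rewrite -perZ; apply: per_ext => k _; rewrite mulrA.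
have -> : per (fun k => per f N * (I t * ech k t)) M = per f N * I t * per (fun k => ech k t) M.
  by rewrite -perZ; apply: per_ext => k _; rewrite mulrA.
rewrite -mulrBr -mulrBr -per_ech_telescope /q cindE; case: ifP => ht; last by rewrite !(mul0r, mulr0) subrr.
rewrite !mul1r !mulr1 -mulrBl mulrA; congr (_ * _).
case: (eqVneq (ech 1 t - 1) 0) => [e0|n0]; last by rewrite divfK.
have h : `|t| <= 2^-1 by rewrite ler_norml; case/andP: ht => h1 h2; lra.
have := ech1_lower h; rewrite e0 normc0 pmulr_rle0 ?pi_gt0 // normr_le0 => /eqP ->.
by rewrite mulr0 /A (@per_ext _ f) ?subrr // => r _; rewrite addr0.
Qed.

(** By Bessel's inequality the errors are square-summable in [M], uniformly in [N]. For finitely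
    many [M] the bound survives the limit in [N], so the limiting errors [F M] are square-summable
    and tend to 0. *)
Lemma poisson_summation : a = b.
Proof.
pose E N M := per (fun k => cI mu (fun t => I t * (A N t * ech k t))) M - per f N.
pose F M := per (fun k => FT f (2 * pi * k)) M - a.
have EF M : ccvg (E^~ M) (F M).
  apply: ccvgB => //.
  rewrite /per; apply: ccvgD; first by apply: lim_coef; rewrite rpred0.
  elim: M => [|M IH]; first by apply: ccvg_ext (ccvg_cst _) => n; rewrite !big_ord0.
  rewrite big_ord_recr /=.
  apply: ccvg_ext (ccvgD IH (ccvgD (lim_coef (k := M.+1%:R) _) (lim_coef (k := - M.+1%:R) _))) => [n||].
  - by rewrite big_ord_recr.
  - exact: rpred_nat.
  - by rewrite rpredN rpred_nat.
have bE N K : \sum_(M < K) normc (E N M) ^+ 2 <= 4 * (B / pi) ^+ 2.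
  have h1 := @bessel_q N K (fun j => j.+1%:R) (fun j => rpred_nat _ _) _.
  have h2 := @bessel_q N K (fun j => - j%:R) (fun j => _) _.
  apply: (@le_trans _ _ (2 * (\sum_(M < K) normc (d N M.+1%:R) ^+ 2) + 2 * (\sum_(M < K) normc (d N (- M%:R)) ^+ 2))).
    rewrite !mulr_sumr -big_split; apply: ler_sum => M _ /=.
    have h3 : E N M = d N M.+1%:R + - d N (- M%:R) by rewrite /E diff.
    by rewrite h3 -[normc (d N (- M%:R))]normcN normcD_sqr.
  have {}h1 := h1 _; have {}h2 := h2 _ _.
  suff : \sum_(M < K) normc (d N M.+1%:R) ^+ 2 <= (B / pi) ^+ 2 /\ \sum_(M < K) normc (d N (- M%:R)) ^+ 2 <= (B / pi) ^+ 2.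
    case=> {}h1 {}h2; have -> : 4 * (B / pi) ^+ 2 = 2 * (B / pi) ^+ 2 + 2 * (B / pi) ^+ 2 by ring.
    by apply: lerD; rewrite ler_pM2l.
  split; [apply: h1|apply: h2].
  - by move=> i j /eqP; rewrite eqr_nat eqSS => /eqP.
  - by move=> j; rewrite rpredN rpred_nat.
  - by move=> i j /oppr_inj/eqP; rewrite eqr_nat => /eqP.
have bF K : \sum_(M < K) normc (F M) ^+ 2 <= 4 * (B / pi) ^+ 2.
  have h : (fun N => \sum_(M < K) normc (E N M) ^+ 2) @ \oo --> \sum_(M < K) normc (F M) ^+ 2.
    apply: cvg_big => [|M _]; first exact: add_continuous.
    have hc := ccvg_norm (EF M).
    rewrite (_ : (fun N => normc (E N M) ^+ 2) = (fun N => normc (E N M) * normc (E N M))); first exact: cvgM.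
    by apply/funext => N; rewrite expr2.
  by apply: (cvgr_to_le h); near=> N; exact: bE.
have F0 : ccvg F 0.
  apply: (ccvg_le (e := fun M => normc (F M))) => [n|]; first by rewrite subr0.
  apply: sqr_cvg0 => [n|]; first exact: normc_ge0.
  apply: cvg_series_cvg_0; apply: nondecreasing_is_cvgn.
    apply: nondecreasing_series => n _ _; exact: sqr_ge0.
  exists (4 * (B / pi) ^+ 2) => _ [K _ <-]; rewrite /series /= big_mkord; exact: bF.
have := ccvg_uniq F0 (ccvgB hb (ccvg_cst a)).
by move/esym/eqP; rewrite subr_eq0 => /eqP.
Unshelve. all: by end_near.
Qed.
End Summation.
End PoissonSummation.

(** * Xi as a Laplace transform *)

Section SelfDualFunction.
Variable R : realType.
Local Notation C := R[i].
Local Notation mu := (@lebesgue_measure R).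

Definition gs (x : R) : R := expR (- (pi * x ^+ 2)).
(** This is $(x^2g')'$ for the Gaussian $g$ above. It vanishes at 0 and is its own Fourier
    transform, and its Mellin transform carries the factor $s(s-1)$ of xi. *)
Definition Hf (x : R) : R := (4 * pi ^+ 2 * x ^+ 4 - 6 * pi * x ^+ 2) * gs x.

Lemma pi_lt4 : pi < 4 :> R.
Proof. by have h := @pihalf_lt2 R; lra. Qed.
Lemma pi_gt1 : 1 < pi :> R.
Proof. by have h := @pi_ge2 R; lra. Qed.
Lemma gs_gt0 x : 0 < gs x. Proof. exact: expR_gt0. Qed.
Lemma HfN x : Hf (- x) = Hf x. Proof. by rewrite /Hf /gs sqrrN (_ : (- x) ^+ 4 = x ^+ 4) //; ring. Qed.
Lemma Hf0 : Hf 0 = 0. Proof. by rewrite /Hf !expr0n /= !mulr0 subrr mul0r. Qed.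

Lemma gs_bound k x : (1 + x ^+ 2) ^+ k * gs x <= k`!%:R * expR 1.
Proof.
have y0 : 0 <= 1 + x ^+ 2 by rewrite addr_ge0 // sqr_ge0.
have h1 : gs x <= expR 1 * expR (- (1 + x ^+ 2)).
  by rewrite -expRD ler_expR; have := pi_gt1; have := sqr_ge0 x; nra.
have h2 : (1 + x ^+ 2) ^+ k <= k`!%:R * expR (1 + x ^+ 2).
  rewrite mulrC -ler_pdivrMr; last by rewrite ltr0n fact_gt0.
  case: k => [|k]; first by rewrite expr0 fact0 divr1 -[leLHS]expR0 ler_expR.
  by apply: le_trans (expR_ge1Dxn k y0); rewrite lerDr.
apply: le_trans (ler_wpM2l (exprn_ge0 _ y0) h1) _.
apply: le_trans (ler_wpM2r _ h2) _; first by rewrite mulr_ge0 // expR_ge0.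
rewrite mulrACA [X in _ * X]mulrC -mulrA [X in _ * (_ * X)]mulrC -expRD.
by rewrite (_ : 1 + x ^+ 2 - (1 + x ^+ 2) = 0) ?expR0 ?mulr1 ?mulrA //; ring.
Qed.

(** The common majorant: integrable on the line, summable over the integers, and stable under
    dilation up to a constant. *)
Definition dc (x : R) : R := (1 + x ^+ 2)^-1.
Lemma dc_gt0 x : 0 < dc x. Proof. by rewrite invr_gt0 ltr_pwDl // sqr_ge0. Qed.
Lemma dcK x : (1 + x ^+ 2) * dc x = 1.
Proof. by rewrite /dc divff // gt_eqF // ltr_pwDl // sqr_ge0. Qed.
Lemma rin_dc : rin mu dc.
Proof.
have h := rinZ (2^-1) (rin_PK (ltr01 : 0 < 1 :> R)).1.
rewrite (_ : dc = fun x => 2^-1 * PK 1 x) //; apply/funext => x.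
by rewrite /dc /PK expr1n mulr1 mulrA mulVf ?mul1r // pnatr_eq0.
Qed.
Lemma gs_dc k x : (1 + x ^+ 2) ^+ k * gs x <= k.+1`!%:R * expR 1 * dc x.
Proof.
have h := ler_wpM2r (ltW (dc_gt0 x)) (gs_bound k.+1 x); apply: le_trans h.
by rewrite [_ ^+ k.+1]exprSr [_ * _ * gs x]mulrAC -[leRHS]mulrA dcK mulr1.
Qed.
Lemma dc_small (K e : R) : 0 <= K -> 0 < e -> exists N : R, forall x, N <= `|x| -> K * dc x <= e.
Proof.
move=> K0 e0; exists (K / e) => x h.
have h1 : K <= e * (1 + x ^+ 2).
  rewrite mulrC -ler_pdivrMr //; apply: le_trans h _; rewrite -[x ^+ 2]real_normK ?num_real //.
  by have := sqr_ge0 (`|x| - 1); rewrite !expr2; have := normr_ge0 x; nra.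
by apply: le_trans (ler_wpM2r (ltW (dc_gt0 x)) h1) _; rewrite -mulrA dcK mulr1.
Qed.

Lemma cI_exact (F f : R -> C) (K : R) : crd F f -> ccont f -> cin mu f -> (forall x, normc (F x) <= K * dc x) ->
  cI mu f = 0.
Proof.
move=> hF cf hf hK; have h := cI_trunc hf.
apply: ccvg_uniq h _; apply: ccvg_eps => e e0.
have K0 : 0 <= K by have := le_trans (normc_ge0 _) (hK 0); rewrite pmulr_lge0 // dc_gt0.
have e2 : 0 < e / 2 by rewrite divr_gt0.
have [N hN] := dc_small K0 e2.
have [n0 hn0] := lt_natr_bound N; exists n0 => n /hn0/andP[_ h1].
rewrite subr0 (cI_ftc _ hF cf); last by rewrite -subr_gt0 opprK addr_gt0.
apply: le_trans (normcB _ _) _; rewrite [e]splitr; apply: lerD; apply: le_trans (hK _) _; apply: hN;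
  by rewrite ?normrN ger0_norm // ltW.
Qed.

Lemma gs_total : rin mu gs /\ rI mu gs = 1.
Proof.
have sp : 0 < Num.sqrt pi :> R by rewrite sqrtr_gt0 pi_gt0.
have S := scale_substitutes sp.
have mg : rmeas (@gauss_fun R) by exact: measurable_gauss_fun.
have ig : rin mu (@gauss_fun R) by exact: integrableT_gauss.
have eg : rI mu (@gauss_fun R) = Num.sqrt pi by rewrite rI_def integralT_gauss.
have e x : Num.sqrt pi * gauss_fun (Num.sqrt pi * x) = Num.sqrt pi * gs x.
  by rewrite /gauss_fun /gs exprMn sqr_sqrtr // pi_ge0.
have h1 := (subst_rin S mg).1 ig.
have h2 := subst_rI S mg.
have ef : gs = fun x => (Num.sqrt pi)^-1 * (Num.sqrt pi * gauss_fun (Num.sqrt pi * x)).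
  by apply/funext => x; rewrite e mulrA mulVf ?mul1r // gt_eqF.
rewrite ef; split; first exact: rinZ.
by rewrite rIZ // -h2 eg mulVf // gt_eqF.
Qed.

Lemma is_derive_gs (x : R) : is_derive x (1 : R) gs (- (2 * pi * x) * gs x).
Proof.
have h : is_derive x (1 : R) (fun t : R => - (pi * t ^+ 2)) (- (2 * pi * x)).
  by apply: is_derive_eq; rewrite /GRing.scale /=; ring.
have := @is_derive1_comp R expR (fun t : R => - (pi * t ^+ 2)) x _ _ (is_derive_expR _) h.
by rewrite mulrC.
Qed.

Definition q4 (a b c d e x : R) : R := a * x ^+ 4 + b * x ^+ 3 + c * x ^+ 2 + d * x + e.

Lemma is_derive_q4_gs (a b c d x : R) : is_derive x (1 : R) (fun t : R => q4 0 a b c d t * gs t)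
   (q4 (- (2 * pi * a)) (- (2 * pi * b)) (3 * a - 2 * pi * c) (2 * b - 2 * pi * d) c x * gs x).
Proof.
have h : is_derive x (1 : R) (q4 0 a b c d) (3 * a * x ^+ 2 + 2 * b * x + c).
  by rewrite /q4; apply: is_derive_eq; rewrite /GRing.scale /=; ring.
have H := @is_deriveM _ _ _ _ _ _ _ _ h (is_derive_gs x).
by apply: is_derive_eq; rewrite /GRing.scale /= /q4; ring.
Qed.

Lemma continuous_gs : continuous gs.
Proof. by move=> x; apply: differentiable_continuous; apply/derivable1_diffP; case: (is_derive_gs x). Qed.

Lemma continuous_q4_gs a b c d e : continuous (fun x => q4 a b c d e x * gs x).
Proof.
move=> x; apply: cvgM; last exact: continuous_gs.
have [h _] : is_derive x (1 : R) (q4 a b c d e) (4 * a * x ^+ 3 + 3 * b * x ^+ 2 + 2 * c * x + d).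
  by rewrite /q4; apply: is_derive_eq; rewrite /GRing.scale /=; ring.
by apply: differentiable_continuous; apply/derivable1_diffP.
Qed.

Lemma q4_bound a b c d e x : `|q4 a b c d e x| <= (`|a| + `|b| + `|c| + `|d| + `|e|) * (1 + x ^+ 2) ^+ 2.
Proof.
have y : forall k : nat, (k <= 4)%N -> `|x| ^+ k <= (1 + x ^+ 2) ^+ 2.
  have n0 := normr_ge0 x; rewrite -[x ^+ 2]real_normK ?num_real //; move: (`|x|) n0 => z z0.
  have h1 : z <= 1 + z ^+ 2 by have := sqr_ge0 (z - 1); rewrite !expr2; nra.
  have h2 : 1 <= 1 + z ^+ 2 by rewrite lerDl sqr_ge0.
  have h3 : z ^+ 2 <= 1 + z ^+ 2 by rewrite lerDr.
  have y0 : 0 <= 1 + z ^+ 2 by exact: le_trans h2.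
  have h4 : 1 + z ^+ 2 <= (1 + z ^+ 2) ^+ 2 by rewrite expr2 ler_peMr.
  case=> [|[|[|[|[|//]]]]] _.
  - by rewrite expr0; exact: le_trans h4.
  - by rewrite expr1; exact: le_trans h4.
  - exact: le_trans h4.
  - by rewrite exprS [leRHS]expr2; apply: ler_pM => //; exact: sqr_ge0.
  - by rewrite (_ : 4%N = (2 + 2)%N) // exprD [leRHS]expr2; apply: ler_pM => //; exact: sqr_ge0.
have z u k : (k <= 4)%N -> `|u * x ^+ k| <= `|u| * (1 + x ^+ 2) ^+ 2.
  by move=> hk; rewrite normrM normrX; apply: ler_wpM2l => //; exact: y.
rewrite !mulrDl; do !(apply: le_trans (ler_normD _ _) _; apply: lerD); try exact: z.
- by have := z d 1%N isT; rewrite expr1.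
- by have := z e 0%N isT; rewrite expr0 mulr1.
Qed.

Lemma q4_gs_dc a b c d e x : `|q4 a b c d e x * gs x| <= (`|a| + `|b| + `|c| + `|d| + `|e|) * (6 * expR 1) * dc x.
Proof.
rewrite normrM (ger0_norm (ltW (gs_gt0 x))) -!mulrA.
apply: le_trans (ler_wpM2r (ltW (gs_gt0 x)) (q4_bound _ _ _ _ _ x)) _.
rewrite -mulrA; apply: ler_wpM2l; first by rewrite !addr_ge0.
by have := gs_dc 2 x; rewrite -!mulrA.
Qed.

Lemma HfE x : Hf x = q4 (4 * pi ^+ 2) 0 (- (6 * pi)) 0 0 x * gs x.
Proof. by rewrite /Hf /q4; congr (_ * _); ring. Qed.
Lemma rmeas_Hf : rmeas Hf.
Proof.
rewrite (_ : Hf = fun x => q4 (4 * pi ^+ 2) 0 (- (6 * pi)) 0 0 x * gs x); last by apply/funext => x; exact: HfE.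
exact: rmeas_cont (@continuous_q4_gs _ _ _ _ _).
Qed.

(** What is left of [Hc k] on the line $\Im z=k$ once the multiple of the Gaussian giving [Hf k] is
    removed. [F], polynomials of degree at most 3 times the Gaussian, is an explicit primitive
    vanishing at infinity. *)
Lemma FT_Hf_core (k : R) :
  let f x := ((q4 (4 * pi ^+ 2) 0 (- (24 * pi ^+ 2 * k ^+ 2 + 6 * pi)) 0 (12 * pi * k ^+ 2) x * gs x) +i*
     (q4 0 (16 * pi ^+ 2 * k) 0 (- (16 * pi ^+ 2 * k ^+ 3 + 12 * pi * k)) 0 x * gs x)) in
  cin mu f /\ cI mu f = 0.
Proof.
pose F (x : R) : C := (q4 0 (-2 * pi) 0 (12 * pi * k ^+ 2) 0 x * gs x) +i*
  (q4 0 0 (- (8 * pi * k)) 0 (8 * pi * k ^+ 3 - 2 * k) x * gs x).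
have hn a b c d e a' b' c' d' e' : exists K, forall x, normc ((q4 a b c d e x * gs x) +i* (q4 a' b' c' d' e' x * gs x)) <= K * dc x.
  eexists => x; apply: le_trans (normc_le_ReIm _) _; apply: le_trans (lerD (q4_gs_dc _ _ _ _ _ _) (q4_gs_dc _ _ _ _ _ _)) _.
  by rewrite -mulrDl; exact: lexx.
have [K hK] := hn 0 (-2 * pi) 0 (12 * pi * k ^+ 2) 0 0 0 (- (8 * pi * k)) 0 (8 * pi * k ^+ 3 - 2 * k).
move=> f.
have cf : ccont f by split; exact: continuous_q4_gs.
have [L hL] := hn (4 * pi ^+ 2) 0 (- (24 * pi ^+ 2 * k ^+ 2 + 6 * pi)) 0 (12 * pi * k ^+ 2)
  0 (16 * pi ^+ 2 * k) 0 (- (16 * pi ^+ 2 * k ^+ 3 + 12 * pi * k)) 0.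
have fi : cin mu f := cin_dom (ccont_lmeas cf) (rinZ L rin_dc) hL.
split => //; apply: (@cI_exact F f K) => // x; split; apply: is_derive_eq (is_derive_q4_gs _ _ _ _ _) _ => /=; congr (_ * _); rewrite /q4; ring.
Qed.

Definition Hc (k : R) (z : C) : C :=
  (4 * (pi ^+ 2)%:C * z ^+ 4 - 6 * (pi : R)%:C * z ^+ 2) * cexp (- ((pi : R)%:C * z ^+ 2) + ii * (2 * pi * k)%:C * z).

Lemma Hc_real k x : Hc k (x +i* 0) = (Hf x)%:C * cexp (ii * (2 * pi * k)%:C * x%:C).
Proof.
rewrite /Hc cexpD mulrA -[x +i* 0]/(x%:C) -!rcX -!rcM -rcN cexp_real; congr (_ * _).
by rewrite /Hf rcM rcB !rcM !rcnat.
Qed.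

(** Completing the square makes the exponent $-\pi x^2-\pi k^2$. The polynomial factor is split into
    the constant $4\pi^2k^4-6\pi k^2$, which yields [Hf k], and a part whose integral is 0. *)
Lemma Hc_shift k x : Hc k (x +i* k) = (gs k)%:C *
  ((q4 (4 * pi ^+ 2) 0 (- (24 * pi ^+ 2 * k ^+ 2 + 6 * pi)) 0 (12 * pi * k ^+ 2) x * gs x +i*
     (q4 0 (16 * pi ^+ 2 * k) 0 (- (16 * pi ^+ 2 * k ^+ 3 + 12 * pi * k)) 0 x * gs x)) + (4 * pi ^+ 2 * k ^+ 4 - 6 * pi * k ^+ 2)%:C * (gs x)%:C).
Proof.
rewrite /Hc (_ : - _ + _ = (- (pi * x ^+ 2) + - (pi * k ^+ 2))%:C); last first.
  by apply: complexP => /=; ring.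
rewrite cexp_real expRD -/(gs x) -/(gs k).
by apply: complexP; rewrite /q4 /=; ring.
Qed.

Lemma Hc_bound k x y : 0 <= y <= k ->
  normc (Hc k (x +i* y)) <= 128 * (1 + k ^+ 2) ^+ 2 * (6 * expR 1) * dc x.
Proof.
case/andP => y0 yk; rewrite /Hc normcM normc_cexp.
have p1 := pi_gt1; have p4 := pi_lt4.
(* The real part of the exponent is $-\pi x^2-\pi y(2k-y)$, and the second term is nonpositive
   between the two lines. *)
have e1 : expR (Re (- ((pi : R)%:C * (x +i* y) ^+ 2) + ii * (2 * pi * k)%:C * (x +i* y))) <= gs x.
  rewrite ler_expR ReD ReN expr2 /=.
  have : 0 <= pi * y * (2 * k - y) by apply: mulr_ge0; [apply: mulr_ge0 => //; lra|lra].
  nra.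
set A := 1 + k ^+ 2; set X := 1 + x ^+ 2.
have A1 : 1 <= A by rewrite lerDl sqr_ge0.
have X1 : 1 <= X by rewrite lerDl sqr_ge0.
have n2 : normc (x +i* y) ^+ 2 <= A * X.
  rewrite sqr_normc_i; have : y ^+ 2 <= k ^+ 2 by rewrite ler_pXn2r ?nnegrE //; exact: le_trans yk.
  rewrite /A /X; have := sqr_ge0 x; have := sqr_ge0 k; nra.
have n20 := sqr_ge0 (normc (x +i* y)).
have e2 : normc (4 * (pi ^+ 2)%:C * (x +i* y) ^+ 4 - 6 * (pi : R)%:C * (x +i* y) ^+ 2) <= 128 * A ^+ 2 * X ^+ 2.
  have n4 (n : nat) (c : R) (u : C) j : 0 <= c -> normc (n%:R * c%:C * u ^+ j) = n%:R * c * normc u ^+ j.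
    by move=> c0; rewrite normcM normcX -rcnat -rcM normc_pos // mulr_ge0.
  apply: le_trans (normcB _ _) _; rewrite !n4 ?sqr_ge0 ?(ltW (pi_gt0 R)) // (_ : 4%N = (2 * 2)%N) // exprM.
  move: (normc (x +i* y) ^+ 2) n2 n20 => u hu u0.
  have h2 : u ^+ 2 <= (A * X) ^+ 2 by rewrite ler_pXn2r ?nnegrE //; nra.
  have h3 : pi ^+ 2 <= 16 :> R by rewrite expr2; nra.
  have h4 : A * X <= (A * X) ^+ 2 by rewrite expr2 ler_peMr; nra.
  have h5 : 4 * pi ^+ 2 * u ^+ 2 <= 64 * (A * X) ^+ 2.
    by apply: ler_pM => //; [rewrite mulr_ge0 // sqr_ge0|exact: sqr_ge0|lra].
  have h6 : 6 * pi * u <= 24 * (A * X) ^+ 2.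
    apply: ler_pM => //; [lra|lra|exact: le_trans h4].
  rewrite -mulrA -exprMn; have := sqr_ge0 (A * X); lra.
apply: le_trans (ler_pM (normc_ge0 _) (expR_ge0 _) e2 e1) _.
have A0 : 0 <= 128 * A ^+ 2 by rewrite mulr_ge0 // sqr_ge0.
by rewrite -[leLHS]mulrA -[leRHS]mulrA; apply: ler_wpM2l => //; exact: (gs_dc 2).
Qed.

Lemma cdiff_Hc k z : cdiff (Hc k) z.
Proof.
apply: cdiffM.
  by apply: cdiffB; apply: cdiffZ; apply: cdiffX; exact: cdiff_id.
apply: cdiff_comp; last exact: cdiff_cexp.
apply: cdiffD; last by apply: cdiffZ; exact: cdiff_id.
apply: (cdiff_ext (f := fun z => (- (pi : R)%:C) * z ^+ 2)); first by move=> x; rewrite mulNr.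
by apply: cdiffZ; apply: cdiffX; exact: cdiff_id.
Qed.

(** The contour moves from the real axis to the line through $ik$, where the integral is elementary;
    evenness handles negative frequencies. *)
Lemma FT_Hf (k : R) : FT (fun x => (Hf x)%:C) (2 * pi * k) = (Hf k)%:C.
Proof.
have pos (r : R) : 0 <= r -> FT (fun x => (Hf x)%:C) (2 * pi * r) = (Hf r)%:C.
  move=> r0; rewrite /FT /MT (cI_extR (fun x => esym (Hc_real r x))).
  have ci y : 0 <= y <= r -> cin mu (fun x => Hc r (x +i* y)).
    move=> hy; apply: cin_dom (rinZ (128 * (1 + r ^+ 2) ^+ 2 * (6 * expR 1)) rin_dc) _; last by move=> x; exact: Hc_bound.
    have m1 : lmeas (fun x : R => x +i* y).
      have h := cmeasD (lmeas_id R) (@cmeas_cst R _ (measurableTypeR R) (Complex 0 y)).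
      apply: (@lmeas_ext _ (fun x : R => x%:C + Complex 0 y)) h => x.
      by apply: complexP => /=; ring.
    have mX n : lmeas (fun x : R => (x +i* y) ^+ n).
      elim: n => [|n IH]; first exact: cmeas_cst.
      by apply: lmeas_ext (cmeasM m1 IH) => x; rewrite exprS.
    have mc (c : C) n : lmeas (fun x : R => c * (x +i* y) ^+ n) by apply: cmeasM; [exact: cmeas_cst|exact: mX].
    apply: cmeasM; first by apply: cmeasB; exact: mc.
    by apply: cmeas_cexp; apply: cmeasD; [apply: cmeasN; exact: mc|exact: (mc _ 1%N)].
  have -> : cI mu (fun x => Hc r (x +i* 0)) = cI mu (fun x => Hc r (x +i* r)).
    case: (eqVneq r 0) => [->//|rn].
    apply: contour_shift; [by rewrite lt_def rn|by move=> z _; exact: cdiff_Hc| | |].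
    - move=> e e0; have K0 : 0 <= 128 * (1 + r ^+ 2) ^+ 2 * (6 * expR 1).
        apply: mulr_ge0; last by apply: mulr_ge0 => //; exact: expR_ge0.
        by apply: mulr_ge0 => //; exact: sqr_ge0.
      have [N hN] := dc_small K0 e0; exists N => x y hx hy.
      exact: le_trans (Hc_bound x hy) (hN x hx).
    - by apply: ci; rewrite lexx.
    - by apply: ci; rewrite lexx r0.
  rewrite (cI_extR (Hc_shift r)).
  have cg : cin mu (fun x => (gs x)%:C) by apply: cin_real; exact: gs_total.1.
  have [c1 c2] := FT_Hf_core r.
  rewrite cIZ; last by apply: cinD => //; exact: cinZ.
  rewrite cID //; last exact: cinZ.
  rewrite c2 add0r cIZ // cI_real gs_total.2 mulr1 -rcM mulrC; congr (_%:C).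
case: (leP 0 k) => [/pos//|kn].
have {pos} := pos (- k); rewrite HfN => <-; last by rewrite oppr_ge0 ltW.
rewrite /FT /MT -(cI_opp (f := fun t => (Hf t)%:C * cexp (ii * (2 * pi * - k)%:C * t%:C))); last first.
  apply: cmeasM; [exact: cmeas_real rmeas_Hf|exact: lmeas_cexp].
by apply: cI_extR => t; rewrite HfN; congr (_ * cexp _); rewrite mulrN !rcN; ring.
Qed.
End SelfDualFunction.

(** * The theta series of the self-dual function *)

Section ThetaFunction.
Variable R : realType.
Local Notation C := R[i].
Local Notation mu := (@lebesgue_measure R).
Local Notation cnt := (@cntm R).

Definition CH k : R := (`|4 * pi ^+ 2 : R| + `|0 : R| + `|- (6 * pi) : R| + `|0 : R| + `|0 : R|) * ((k + 2)`!%:R * expR 1).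
Lemma CH_ge0 k : 0 <= CH k.
Proof. by rewrite mulr_ge0 ?addr_ge0 // mulr_ge0 // expR_ge0. Qed.
Lemma Hf_decay k x : `|Hf x| * (1 + x ^+ 2) ^+ k <= CH k.
Proof.
have y0 : 0 <= 1 + x ^+ 2 by rewrite addr_ge0 // sqr_ge0.
rewrite HfE normrM (ger0_norm (ltW (gs_gt0 x))).
apply: le_trans (ler_wpM2r (exprn_ge0 _ y0) (ler_wpM2r (ltW (gs_gt0 x)) (q4_bound _ _ _ _ _ x))) _.
rewrite /CH; set S := _ + _; have S0 : 0 <= S by rewrite !addr_ge0.
have -> : S * (1 + x ^+ 2) ^+ 2 * gs x * (1 + x ^+ 2) ^+ k = S * ((1 + x ^+ 2) ^+ (k + 2) * gs x).
  by rewrite exprD; move: ((1 + x ^+ 2) ^+ k) ((1 + x ^+ 2) ^+ 2) => u v; ring.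
by apply: ler_wpM2l => //; exact: gs_bound.
Qed.
Lemma Hf_dc x : `|Hf x| <= CH 1 * dc x.
Proof.
have := ler_wpM2r (ltW (dc_gt0 x)) (Hf_decay 1 x); rewrite expr1 -mulrA dcK mulr1; exact.
Qed.
Lemma rin_Hf : rin mu (@Hf R).
Proof.
by apply: rin_le (rinZ (CH 1) (rin_dc R)) _ => [|x]; [exact: rmeas_Hf|exact: Hf_dc].
Qed.

Lemma is_derive_Hf (x : R) :
  is_derive x (1 : R) (@Hf R) (x * q4 (- (8 * pi ^+ 3)) 0 (28 * pi ^+ 2) 0 (- (12 * pi)) x * gs x).
Proof.
have h : is_derive x (1 : R) (fun x : R => 4 * pi ^+ 2 * x ^+ 4 - 6 * pi * x ^+ 2) (16 * pi ^+ 2 * x ^+ 3 - 12 * pi * x).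
  by apply: is_derive_eq; rewrite /GRing.scale /=; ring.
have H := @is_deriveM _ _ _ _ _ _ _ _ h (is_derive_gs x).
by apply: is_derive_eq; rewrite /GRing.scale /= /q4; ring.
Qed.

(** The derivative is a quintic times a Gaussian, hence dominated by [dc]: the local Lipschitz
    constants can be summed over integer translates, as hypothesis [hB] of the summation formula
    demands. *)
Lemma Hf_lipschitz : exists2 K : R, 0 <= K & forall u v : R, u < v -> exists2 c : R, u <= c <= v &
  `|Hf v - Hf u| <= K * dc c * (v - u).
Proof.
pose S : R := `|- (8 * pi ^+ 3) : R| + `|0 : R| + `|28 * pi ^+ 2 : R| + `|0 : R| + `|- (12 * pi) : R|.
have S0 : 0 <= S by rewrite !addr_ge0.
exists (S * (4`!%:R * expR 1)) => [|u v uv]; first by rewrite mulr_ge0 // mulr_ge0 // expR_ge0.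
have cHf : {within `[u, v], continuous (@Hf R)}.
  apply: continuous_subspaceT => x; apply: differentiable_continuous; apply/derivable1_diffP.
  by case: (is_derive_Hf x).
have [c cuv ->] := @MVT _ (@Hf R) _ u v uv (fun x _ => is_derive_Hf x) cHf.
exists c; first by move: cuv; rewrite in_itv /= => /andP[/ltW -> /ltW ->].
rewrite normrM (ger0_norm (ltW (_ : 0 < v - u))) ?subr_gt0 //.
apply: ler_wpM2r; first by rewrite subr_ge0 ltW.
rewrite !normrM (ger0_norm (ltW (gs_gt0 c))).
have y0 : 0 <= 1 + c ^+ 2 by rewrite addr_ge0 // sqr_ge0.
have h1 : `|c| <= 1 + c ^+ 2.
  by rewrite -[c ^+ 2]real_normK ?num_real //; have := sqr_ge0 (`|c| - 1); rewrite !expr2; have := normr_ge0 c; nra.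
have h2 := ler_pM (normr_ge0 _) (normr_ge0 _) h1 (q4_bound (- (8 * pi ^+ 3)) 0 (28 * pi ^+ 2) 0 (- (12 * pi)) c).
apply: le_trans (ler_wpM2r (ltW (gs_gt0 c)) h2) _.
rewrite -/S [leLHS](_ : _ = S * ((1 + c ^+ 2) ^+ 3 * gs c)); last by ring.
by rewrite -[leRHS]mulrA; apply: ler_wpM2l => //; exact: (gs_dc 3).
Qed.

(** Comparison with the telescoping terms $2/n-2/(n+1)$. *)
Lemma sum_dc N : \sum_(i < N) dc i.+1%:R <= 2 :> R.
Proof.
suff h : \sum_(i < N) dc i.+1%:R <= 2 - 2 / N.+1%:R :> R.
  by apply: le_trans h _; rewrite gerBl divr_ge0.
elim: N => [|N IH]; first by rewrite big_ord0 divr1 subrr.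
rewrite big_ord_recr /=; apply: le_trans (lerD IH (lexx _)) _.
have n0 : (0 : R) <= N%:R by [].
rewrite /dc -[N.+2%:R]natr1 -[N.+1%:R]natr1; move: (N%:R : R) n0 => n n0.
have p1 : 0 < n + 1 by lra.
have p2 : 0 < n + 1 + 1 by lra.
have p3 : 0 < 1 + (n + 1) ^+ 2 by rewrite ltr_pwDl // sqr_ge0.
have h : (1 + (n + 1) ^+ 2)^-1 <= 2 / ((n + 1) * (n + 1 + 1)).
  rewrite ler_pdivlMr ?mulr_gt0 // mulrC ler_pdivrMr // expr2; nra.
have e : 2 / (n + 1) - 2 / (n + 1 + 1) = 2 / ((n + 1) * (n + 1 + 1)) by field; apply/andP; split; rewrite gt_eqF.
by lra.
Qed.

Lemma dc_scale (x : R) (n : R) : 0 < x -> dc (x * n) <= (Num.min 1 (x ^+ 2))^-1 * dc n.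
Proof.
move=> x0; have c0 : 0 < Num.min 1 (x ^+ 2) by rewrite lt_min ltr01 exprn_gt0.
have h : Num.min 1 (x ^+ 2) * (1 + n ^+ 2) <= 1 + (x * n) ^+ 2.
  rewrite mulrDr mulr1 exprMn; apply: lerD; first by rewrite ge_min lexx.
  by apply: ler_wpM2r; rewrite ?sqr_ge0 // ge_min lexx orbT.
have p (z : R) : 0 < 1 + z ^+ 2 by rewrite ltr_pwDl // sqr_ge0.
by rewrite /dc -invfM lef_pV2 // posrE // mulr_gt0.
Qed.

(** Half of the sum over all integers: [Hf] is even, and the index 0 contributes nothing. *)
Definition Phi (x : R) : R := rI cnt (fun n => Hf (n.+1%:R * x)).

Lemma rin_Phi x : 0 < x -> rin cnt (fun n => Hf (n.+1%:R * x)).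
Proof.
move=> x0; apply: (@rin_cnt _ _ (CH 1 * (Num.min 1 (x ^+ 2))^-1 * 2)) => N.
have c0 : 0 < Num.min 1 (x ^+ 2) by rewrite lt_min ltr01 exprn_gt0.
have h : \sum_(k < N) `|Hf (k.+1%:R * x)| <= CH 1 * (Num.min 1 (x ^+ 2))^-1 * \sum_(k < N) dc k.+1%:R.
  rewrite mulr_sumr; apply: ler_sum => k _; apply: le_trans (Hf_dc _) _.
  by rewrite -mulrA; apply: ler_wpM2l; [exact: CH_ge0|rewrite mulrC; exact: dc_scale].
apply: le_trans h _; apply: ler_wpM2l; last exact: sum_dc.
by rewrite mulr_ge0 ?CH_ge0 // invr_ge0 ltW.
Qed.

Lemma Phi_cvg x : 0 < x -> ccvg (fun N => \sum_(k < N) (Hf (k.+1%:R * x))%:C) (Phi x)%:C.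
Proof.
by move=> x0; rewrite /Phi -cI_real; apply: csum_cvg; apply: cin_real; exact: rin_Phi.
Qed.

Lemma FT_Hf_scale (x k : R) : 0 < x -> FT (fun t => (Hf (x * t))%:C) (2 * pi * k) = (x^-1 * Hf (k * x^-1))%:C.
Proof.
move=> x0; pose g (t : R) : C := (Hf t)%:C * cexp (ii * (2 * pi * (k * x^-1))%:C * t%:C).
have mg : lmeas g by apply: cmeasM; [exact: cmeas_real (@rmeas_Hf R)|exact: lmeas_cexp].
have ig : cin mu g by apply: (@cin_FT _ (fun t => (Hf t)%:C)); apply: cin_real; exact: rin_Hf.
rewrite rcM -(FT_Hf (k * x^-1)) [in RHS]/FT [in RHS]/MT -/g (subst_cI (scale_substitutes x0) mg).
have e t : (Hf (x * t))%:C * cexp (ii * (2 * pi * k)%:C * t%:C) =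
  (x^-1)%:C * (x%:C * g (x * t)).
  rewrite /g.
  rewrite mulrA -rcM mulVf ?gt_eqF // mul1r; congr (_ * cexp _).
  rewrite -!mulrA -!rcM; congr (_ * _%:C); field; by rewrite gt_eqF.
rewrite /FT /MT (cI_extR e); apply: cIZ.
exact: ((subst_cin (scale_substitutes x0) mg).1 ig).
Qed.

Lemma per_even (g : R -> C) N : (forall r, g (- r) = g r) -> g 0 = 0 -> per g N = 2 * \sum_(i < N) g i.+1%:R.
Proof.
move=> ge g0; rewrite /per g0 add0r mulr_sumr; apply: eq_bigr => i _.
by rewrite ge mulr_natl mulr2n.
Qed.

(** Poisson summation for $t\mapsto H(xt)$. As $H$ is even, self-dual and zero at 0, both sides are
    twice a series over positive integers. *)
Lemma Phi_inv (x : R) : 0 < x -> Phi x = x^-1 * Phi x^-1.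
Proof.
move=> x0; pose f (t : R) : C := (Hf (x * t))%:C.
have fe r : f (- r) = f r by rewrite /f mulrN HfN.
have f0 : f 0 = 0 by rewrite /f mulr0 Hf0.
have hf : cin mu f.
  apply: cin_real; have h := (subst_rin (scale_substitutes x0) (@rmeas_Hf R)).1 rin_Hf.
  have e : (fun t => Hf (x * t)) = (fun t => x^-1 * (x * Hf (x * t))).
    by apply/funext => t; rewrite mulrA mulVf ?mul1r // gt_eqF.
  by rewrite e; exact: rinZ.
have [K K0 hK] := Hf_lipschitz.
pose cx := Num.min 1 ((x / 2) ^+ 2).
have cx0 : 0 < cx by rewrite lt_min ltr01 exprn_gt0 // divr_gt0.
pose L := K * x * cx^-1.
have L0 : 0 <= L by rewrite !mulr_ge0 ?invr_ge0 // ltW.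
(* For a nonzero integer [r], a point within [x / 2] of [x * r] has modulus at least $x|r|/2$;
   [dc_scale] then compares it with [r]. *)
have dcb (r c : R) : r \is a Num.int -> x * (r - 2^-1) <= c -> c <= x * (r + 2^-1) -> dc c <= cx^-1 * dc r.
  move=> hr h1 h2; apply: le_trans (dc_scale r (divr_gt0 x0 (ltr0n _ 2))).
  rewrite /dc lef_pV2 ?posrE ?ltr_pwDl ?sqr_ge0 // lerD2l.
  rewrite -[c ^+ 2]real_normK ?num_real // -[leLHS]real_normK ?num_real //.
  rewrite ler_pXn2r ?nnegrE // normrM ger0_norm ?divr_ge0 ?(ltW x0) //.
  case: (eqVneq r 0) => [->|rn]; first by rewrite normr0 mulr0.
  have r1 : 1 <= `|r| by move: hr rn => /intrP[m ->]; rewrite intr_eq0 -intr_norm -[1]/(1%:~R) ler_int -gtz0_ge1 normr_gt0.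
  have : `|c - x * r| <= x / 2 by rewrite ler_norml; apply/andP; split; lra.
  have := ler_normB (c - (c - x * r)) 0; have := ler_normB c (c - x * r).
  have -> : c - (c - x * r) = x * r by ring.
  rewrite normrM (gtr0_norm x0); move: r1; set z := `|r|; set y := `|c|; nra.
have hL r t : r \is a Num.int -> `|t| <= 2^-1 -> normc (f (r + t) - f r) <= L * dc r * `|t|.
  move=> hr ht; rewrite /f -rcB normc_real.
  have [t1 t2] : - 2^-1 <= t /\ t <= 2^-1 by move: ht; rewrite ler_norml => /andP[].
  case: (ltgtP t 0) => [tn|tp|->]; last by rewrite addr0 subrr !normr0 mulr0.
  - have uv : x * (r + t) < x * r by rewrite ltr_pM2l // gtrDl.
    have [c /andP[c1 c2] h] := hK _ _ uv; rewrite distrC; apply: le_trans h _.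
    have := dcb r c hr _ _; rewrite (_ : x * r - x * (r + t) = x * `|t|); last by rewrite ltr0_norm //; ring.
    move=> h; rewrite mulrA; apply: ler_wpM2r => //.
    rewrite mulrAC /L -!mulrA; apply: ler_wpM2l => //; apply: ler_wpM2l; first exact: ltW.
    by apply: h; nra.
  - have uv : x * r < x * (r + t) by rewrite ltr_pM2l // ltrDl.
    have [c /andP[c1 c2] h] := hK _ _ uv; apply: le_trans h _.
    have := dcb r c hr _ _; rewrite (_ : x * (r + t) - x * r = x * `|t|); last by rewrite gtr0_norm //; ring.
    move=> h; rewrite mulrA; apply: ler_wpM2r => //.
    rewrite mulrAC /L -!mulrA; apply: ler_wpM2l => //; apply: ler_wpM2l; first exact: ltW.
    by apply: h; nra.
(* The 5 is [dc 0 = 1] plus twice the bound 2 of [sum_dc]. *)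
have hB N t : `|t| <= 2^-1 -> normc (per (fun r => f (r + t)) N - per f N) <= L * 5 * `|t|.
  move=> ht.
  have -> : per (fun r => f (r + t)) N - per f N = per (fun r => f (r + t) - f r) N.
    by rewrite /per opprD addrACA -sumrB; congr (_ + _); apply: eq_bigr => i _; rewrite opprD addrACA.
  have h1 : normc (per (fun r => f (r + t) - f r) N) <= L * `|t| * (dc 0 + \sum_(i < N) (dc i.+1%:R + dc i.+1%:R)).
    rewrite mulrDr mulr_sumr; apply: le_trans (normcD _ _) _; apply: lerD.
      by have := hL 0 t (rpred0 _) ht; rewrite mulrAC.
    apply: le_trans (normc_sum _ _ _) _; apply: ler_sum => i _.
    apply: le_trans (normcD _ _) _; rewrite mulrDr; apply: lerD.
      by have := hL i.+1%:R t (rpred_nat _ _) ht; rewrite mulrAC.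
    have := hL (- i.+1%:R) t _ ht; rewrite mulrAC /dc sqrrN; apply.
    by rewrite rpredN rpred_nat.
  apply: le_trans h1 _; rewrite mulrAC; apply: ler_wpM2r => //; apply: ler_wpM2l => //.
  rewrite big_split /= /dc expr0n /= addr0 invr1; have := sum_dc N; rewrite /dc; lra.
have ha : ccvg (per f) (2 * (Phi x)%:C).
  apply: ccvg_ext (ccvgZ 2 (Phi_cvg x0)) => N; rewrite per_even //; congr (_ * _).
  by apply: eq_bigr => i _; rewrite /f mulrC.
have hb : ccvg (per (fun k => FT f (2 * pi * k))) (2 * (x^-1 * Phi x^-1)%:C).
  have h : ccvg (fun N => 2 * ((x^-1)%:C * \sum_(k < N) (Hf (k.+1%:R * x^-1))%:C)) (2 * (x^-1 * Phi x^-1)%:C).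
    by rewrite rcM; apply: ccvgZ; apply: ccvgZ; apply: Phi_cvg; rewrite invr_gt0.
  apply: ccvg_ext h => N; rewrite (@per_even (fun k => FT f (2 * pi * k))) => [|r|].
  - by rewrite mulr_sumr; congr (_ * _); apply: eq_bigr => i _; rewrite FT_Hf_scale //; exact: esym (rcM _ _).
  - by rewrite !FT_Hf_scale // mulNr HfN.
  - by rewrite FT_Hf_scale // mul0r Hf0 mulr0.
have L50 : 0 <= L * 5 by rewrite mulr_ge0.
have := poisson_summation hf L50 hB ha hb.
by move/(mulfI (_ : (2 : C) != 0)) => h; have := h (negbT (pnatr_eq0 _ 2)); case.
Qed.
End ThetaFunction.

(** * Differentiability of Laplace transforms *)

Section LaplaceTransform.
Variable R : realType.
Local Notation C := R[i].
Local Notation mu := (@lebesgue_measure R).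
Implicit Types (f : R -> C) (s : C).

Definition mtin f s := cin mu (fun t => f t * cexp (s * t%:C)).

Lemma normcM_cexp (x s : C) (t : R) : normc (x * cexp (s * t%:C)) = normc x * expR (Re s * t).
Proof. by rewrite normcM normc_cexp_st. Qed.

Lemma mtin_lmeas f s : mtin f s -> lmeas f.
Proof.
move=> /cin_meas h; apply: (@lmeas_ext _ (fun t => f t * cexp (s * t%:C) * cexp (- s * t%:C))) => [t|].
  by rewrite -mulrA -cexpD mulNr subrr cexp0 mulr1.
exact: cmeasM h (lmeas_cexp _).
Qed.

Lemma mtin_Re f s s' : Re s = Re s' -> mtin f s -> mtin f s'.
Proof.
move=> e h; apply: cin_dom (cin_norm h) _ => [|t].
  by apply: cmeasM (lmeas_cexp _); exact: mtin_lmeas h.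
by rewrite !normcM_cexp e.
Qed.

Definition tmul f (t : R) : C := t%:C * f t.

Lemma sqr_le_expR (d x : R) : 0 < d -> 0 <= x -> x ^+ 2 <= 2 / d ^+ 2 * expR (d * x).
Proof.
move=> d0 x0; have y0 : 0 <= d * x by rewrite mulr_ge0 // ltW.
have h : (d * x) ^+ 2 <= 2 * expR (d * x).
  have := expR_ge1Dxn 1 y0; rewrite (_ : (2`!)%:R = 2 :> R) // => h.
  have : (d * x) ^+ 2 / 2 <= expR (d * x) by apply: le_trans h; rewrite lerDr.
  by rewrite ler_pdivrMr // [_ * 2]mulrC.
have d2 : 0 < d ^+ 2 by rewrite exprn_gt0.
rewrite mulrAC ler_pdivlMr // mulrC -exprMn //.
Qed.

Lemma expR_abs_le (a b : R) : expR (a * `|b|) <= expR (a * b) + expR (- a * b).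
Proof.
case: (leP 0 b) => h; first by rewrite ger0_norm // lerDl expR_ge0.
by rewrite ltr0_norm // mulrN mulNr lerDr expR_ge0.
Qed.

(** Convergence on both sides of a line leaves room for a factor $e^{d|t|}$, which pays for powers
    of [t] and for small changes of [s]. *)
Lemma rin_mt_abs f s (d : R) : mtin f (s + d%:C) -> mtin f (s - d%:C) ->
  rin mu (fun t => normc (f t) * expR (Re s * t) * expR (d * `|t|)).
Proof.
move=> h1 h2; have mf := mtin_lmeas h1.
apply: rin_le (rinD (cin_norm h1) (cin_norm h2)) _.
  apply: measurable_funM; first by apply: measurable_funM; [exact: cmeas_normc|
    apply: rmeas_cont => x; apply: continuous_comp; [exact: mulrl_continuous|exact: continuous_expR]].
  apply: rmeas_cont => x; apply: continuous_comp; last exact: continuous_expR.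
  apply: continuous_comp; [exact: norm_continuous|exact: mulrl_continuous].
move=> t; rewrite !normcM_cexp ReB ReD /= !mulrDl !expRD.
rewrite ger0_norm ?mulr_ge0 ?normc_ge0 ?expR_ge0 // !mulrA.
by rewrite -mulrDr; apply: ler_wpM2l; [rewrite mulr_ge0 ?normc_ge0 ?expR_ge0|rewrite expR_abs_le].
Qed.

Lemma lmeas_tmul f : lmeas f -> lmeas (tmul f).
Proof. by move=> h; apply: cmeasM (lmeas_id R) h. Qed.

Lemma mtin_tmul f s (d : R) : 0 < d -> mtin f (s + d%:C) -> mtin f (s - d%:C) -> mtin (tmul f) s.
Proof.
move=> d0 h1 h2; have h := rin_mt_abs h1 h2; have mf := mtin_lmeas h1.
apply: cin_dom (rinZ d^-1 h) _ => [|t]; first by apply: cmeasM (lmeas_cexp _); exact: lmeas_tmul.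
rewrite normcM_cexp /tmul normcM normc_real -[leLHS]mulrA mulrCA.
rewrite -[leRHS]mulrC -!mulrA; apply: ler_wpM2l; first exact: normc_ge0.
rewrite [leLHS]mulrC; apply: ler_wpM2l; first exact: expR_ge0.
rewrite ler_pdivlMr // mulrC; apply: le_trans (expR_ge1Dx _); by rewrite lerDr.
Qed.

Lemma mtin_mid f s (d : R) : mtin f (s + d%:C) -> mtin f (s - d%:C) -> 0 <= d -> mtin f s.
Proof.
move=> h1 h2 d0; have h := rin_mt_abs h1 h2; have mf := mtin_lmeas h1.
apply: cin_dom h _ => [|t]; first exact: cmeasM mf (lmeas_cexp _).
rewrite normcM normc_cexp_st -[leLHS]mulr1; apply: ler_wpM2l; first by rewrite mulr_ge0 ?normc_ge0 ?expR_ge0.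
by rewrite -expR0 ler_expR mulr_ge0.
Qed.

Lemma MT_cderiv f s (d : R) : 0 < d -> mtin f (s + d%:C) -> mtin f (s - d%:C) ->
  cderiv (MT f) s (MT (tmul f) s).
Proof.
move=> d0 h1 h2; have h := rin_mt_abs h1 h2; have mf := mtin_lmeas h1.
(* Half of the room [d] absorbs $t^2$ at the cost of [K]; the other half absorbs the factor
   $e^{|k||t|}$ of the exponential remainder. *)
pose K := 2 / (d / 2) ^+ 2.
have d20 : 0 < d / 2 by rewrite divr_gt0.
have K0 : 0 < K by rewrite divr_gt0 // exprn_gt0.
pose M := rI mu (fun t => normc (f t) * expR (Re s * t) * expR (d * `|t|)).
have M0 : 0 <= M by apply: rI_ge0 => t; rewrite !mulr_ge0 ?normc_ge0 ?expR_ge0.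
move=> e e0; exists (Num.min (d / 2) (e / (K * M + 1))).
  by rewrite lt_min d20 divr_gt0 // ltr_wpDl // mulr_ge0 // ltW.
move=> k; rewrite lt_min => /andP[hk1 hk2].
have hs : mtin f s := mtin_mid h1 h2 (ltW d0).
have ht : mtin (tmul f) s := mtin_tmul d0 h1 h2.
have hb t : normc (f t * cexp ((s + k) * t%:C) - f t * cexp (s * t%:C) - k * (tmul f t * cexp (s * t%:C))) <=
   K * normc k ^+ 2 * (normc (f t) * expR (Re s * t) * expR (d * `|t|)).
  have -> : f t * cexp ((s + k) * t%:C) - f t * cexp (s * t%:C) - k * (tmul f t * cexp (s * t%:C)) =
     f t * cexp (s * t%:C) * (cexp (k * t%:C) - 1 - k * t%:C) by rewrite mulrDl cexpD /tmul; ring.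
  rewrite normcM normcM_cexp.
  apply: le_trans (ler_wpM2l _ (cexp_sub1_id _)) _; first by rewrite mulr_ge0 ?normc_ge0 ?expR_ge0.
  rewrite [leRHS]mulrC -[leRHS]mulrA; apply: ler_wpM2l; first by rewrite mulr_ge0 ?normc_ge0 ?expR_ge0.
  rewrite normcM normc_real exprMn.
  have h3 : expR (normc k * `|t|) <= expR (d / 2 * `|t|) by rewrite ler_expR ler_wpM2r // ltW.
  have h4 := sqr_le_expR d20 (normr_ge0 t).
  have -> : expR (d * `|t|) = expR (d / 2 * `|t|) * expR (d / 2 * `|t|) by rewrite -expRD -mulrDl -splitr.
  have k0 := sqr_ge0 (normc k).
  have h5 := ler_pM (sqr_ge0 _) (expR_ge0 _) h4 h3.
  have rearr (a b c : R) : b * b * (a * c) = c * (a * b * b) by ring.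
  rewrite (rearr K (expR (d / 2 * `|t|)) (normc k ^+ 2)); rewrite -/K in h5; have h6 := ler_wpM2l k0 h5.
  by rewrite (mulrA (normc k ^+ 2) (`|t| ^+ 2)) in h6.
have ck : cin mu (fun t => f t * cexp ((s + k) * t%:C)).
  apply: cin_dom h _ => [|t]; first exact: cmeasM mf (lmeas_cexp _).
  rewrite normcM_cexp -mulrA; apply: ler_wpM2l; first exact: normc_ge0.
  rewrite ReD mulrDl expRD; apply: ler_wpM2l; first exact: expR_ge0.
  rewrite ler_expR; apply: le_trans (ler_norm _) _; rewrite normrM; apply: ler_wpM2r => //.
  apply: le_trans (Re_le_normc _) _; apply: ltW; apply: lt_trans hk1 _.
  by rewrite ltr_pdivrMr // ltr_pMr // ltr1n.
have e1 : MT f (s + k) - MT f s - k * MT (tmul f) s =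
   cI mu (fun t => f t * cexp ((s + k) * t%:C) - f t * cexp (s * t%:C) - k * (tmul f t * cexp (s * t%:C))).
  by rewrite cIB ?cIB ?cIZ //; [exact: cinB|exact: cinZ].
rewrite [MT (tmul f) s * k]mulrC e1; apply: le_trans (normc_cI_le _ (rinZ (K * normc k ^+ 2) h) hb) _.
  by apply: cinB; [exact: cinB|exact: cinZ].
rewrite rIZ // -/M expr2 mulrA [K * _ * _ * M](_ : _ = (K * M) * normc k * normc k); last by ring.
apply: ler_wpM2r; first exact: normc_ge0.
have KM : 0 <= K * M by rewrite mulr_ge0 // ltW.
apply: (@le_trans _ _ ((K * M + 1) * normc k)); first by apply: ler_wpM2r; [exact: normc_ge0|rewrite lerDl].
rewrite mulrC -ler_pdivlMr; [exact: ltW|by rewrite ltr_wpDl].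
Qed.

(** Decay faster than every exponential makes the Laplace transform entire, and it survives
    multiplication by [t] and by real exponentials. *)
Definition sexp f := lmeas f /\ forall a : R, 0 <= a -> exists K : R, forall t, normc (f t) <= K * expR (- (a * `|t|)).

Lemma sexp_mtin f s : sexp f -> mtin f s.
Proof.
case=> mf hf; have [K hK] := hf (`|Re s| + 1) (addr_ge0 (normr_ge0 _) ler01).
have K0 : 0 <= K by have := le_trans (normc_ge0 _) (hK 0); rewrite normr0 mulr0 oppr0 expR0 mulr1.
apply: cin_dom (rinZ K (rin_eabs (ltr01 : 0 < 1 :> R))) _ => [|t]; first exact: cmeasM mf (lmeas_cexp _).
rewrite normcM_cexp; apply: le_trans (ler_wpM2r (expR_ge0 _) (hK t)) _.
rewrite -mulrA; apply: ler_wpM2l => //; rewrite -expRD ler_expR mul1r mulrDl mul1r opprD -addrA addrCA gerDl.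
by rewrite addrC subr_le0; apply: le_trans (ler_norm _) _; rewrite normrM.
Qed.
Lemma sexp_l12 f : sexp f -> l12 f.
Proof.
move=> hf; have h := sexp_mtin 0 hf.
have h0 : cin mu f by apply: cin_extR h => t; rewrite mul0r cexp0 mulr1.
split=> //; have [K hK] := hf.2 0 (lexx _).
have K0 : 0 <= K by have := le_trans (normc_ge0 _) (hK 0); rewrite mul0r oppr0 expR0 mulr1.
split; first exact: hf.1.
apply: rin_le (rinZ K (cin_norm h0)) _ => [|t].
  by apply: measurable_funX; apply: cmeas_normc; exact: hf.1.
rewrite ger0_norm ?sqr_ge0 // expr2; apply: ler_wpM2r; first exact: normc_ge0.
by have := hK t; rewrite mul0r oppr0 expR0 mulr1.
Qed.
Lemma sexp_cdiff f s : sexp f -> cderiv (MT f) s (MT (tmul f) s).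
Proof. by move=> hf; apply: (MT_cderiv ltr01); exact: sexp_mtin. Qed.
Lemma sexp_tmul f : sexp f -> sexp (tmul f).
Proof.
case=> mf hf; split; first exact: lmeas_tmul.
move=> a a0; have [K hK] := hf (a + 1) (addr_ge0 a0 ler01); exists K => t.
have K0 : 0 <= K by have := le_trans (normc_ge0 _) (hK 0); rewrite normr0 mulr0 oppr0 expR0 mulr1.
rewrite normcM normc_real; apply: le_trans (ler_wpM2l (normr_ge0 _) (hK t)) _.
rewrite mulrCA; apply: ler_wpM2l => //; rewrite mulrDl mul1r opprD expRD mulrCA -[leRHS]mulr1.
apply: ler_wpM2l; first exact: expR_ge0.
rewrite expRN ler_pdivrMr ?expR_gt0 // mul1r; apply: le_trans (expR_ge1Dx _); by rewrite lerDr.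
Qed.
Lemma sexp_expM f (c : R) : sexp f -> sexp (fun t => f t * cexp (c%:C * t%:C)).
Proof.
case=> mf hf; split; first exact: cmeasM mf (lmeas_cexp _).
move=> a a0; have [K hK] := hf (a + `|c|) (addr_ge0 a0 (normr_ge0 _)); exists K => t.
have K0 : 0 <= K by have := le_trans (normc_ge0 _) (hK 0); rewrite normr0 mulr0 oppr0 expR0 mulr1.
rewrite normcM_cexp; apply: le_trans (ler_wpM2r (expR_ge0 _) (hK t)) _.
rewrite -mulrA; apply: ler_wpM2l => //; rewrite -expRD ler_expR /= mulrDl opprD -addrA gerDl.
by rewrite addrC subr_le0; apply: le_trans (ler_norm _) _; rewrite normrM.
Qed.
Lemma MT_expM f (c s : C) : MT (fun t => f t * cexp (c * t%:C)) s = MT f (c + s).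
Proof. by rewrite /MT; apply: cI_extR => t; rewrite -mulrA -cexpD -mulrDl. Qed.
Lemma mtin_expM f (c s : C) : mtin f (c + s) <-> mtin (fun t => f t * cexp (c * t%:C)) s.
Proof. by split; apply: cin_extR => t; rewrite -mulrA -cexpD -mulrDl. Qed.
Lemma MT_shift f s (a : R) : mtin f s ->
  mtin (fun t => f (t + a)) s /\ MT (fun t => f (t + a)) s = cexp (- s * a%:C) * MT f s.
Proof.
move=> hf; pose g t := f t * cexp (s * t%:C).
have ig : cin mu g by [].
have e t : cexp (- s * a%:C) * g (t + a) = f (t + a) * cexp (s * t%:C).
  by rewrite /g mulrCA -cexpD; congr (_ * cexp _); rewrite rcD; ring.
split; first by apply: cin_extR e _; apply: cinZ; exact: cin_shift.
by rewrite [LHS]/MT -(cI_extR e) cIZ ?(cI_shift a (cin_meas ig)) //; exact: cin_shift.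
Qed.
End LaplaceTransform.

Section IntegralTransfer.
Variable R : realType.
Local Notation C := R[i].
Local Notation mu := (@lebesgue_measure R).

Lemma Rintegral_rI (D : set R) (f : R -> R) : measurable D ->
  Rintegral mu D f = rI mu (fun x => \1_D x * f x).
Proof.
move=> mD; rewrite rI_def /Rintegral; congr fine; rewrite integral_mkcond.
apply: eq_integral => x _; rewrite patchE indicE; case: ifP => _; by rewrite ?mul1r ?mul0r.
Qed.
Lemma CInt_cI (D : set R) (f : R -> C) : measurable D ->
  CInt D f = cI mu (fun x => (\1_D x : R)%:C * f x).
Proof.
move=> mD; rewrite /CInt !Rintegral_rI //; apply: complexP; rewrite ?cI_ReE ?cI_ImE /=.
  by congr rI; apply/funext => x; rewrite ReMr.
by congr rI; apply/funext => x; rewrite ImMr.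
Qed.

Lemma CInt_exp (f : R -> C) : lmeas (fun t => (expR t)%:C * f (expR t)) ->
  CInt `]0, +oo[ f = cI mu (fun t => (expR t)%:C * f (expR t)).
Proof.
move=> mf; rewrite (subst_cI (ln_substitutes R) mf) CInt_cI; last exact: measurable_itv.
apply: cI_extR => x; rewrite indicE; case: ifPn => h.
  rewrite mem_set /=; last by rewrite in_itv /= h.
  by rewrite mulrA -rcM -expRD addNr expR0 lnK.
rewrite memNset /= ?mul0r //; rewrite in_itv /= andbT; exact/negP.
Qed.
End IntegralTransfer.

(** * The Gamma function as a Laplace transform *)

Section GammaFunction.
Variable R : realType.
Local Notation C := R[i].
Local Notation mu := (@lebesgue_measure R).

(** The substitution $x=e^v$ turns Euler's integral for $\Gamma(s)$ into the two-sided Laplace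
    transform of this function. *)
Definition Eg (v : R) : C := (expR (- expR v))%:C.

Lemma lmeas_Eg : lmeas Eg.
Proof.
apply: cmeas_real; apply: rmeas_cont => x; apply: continuous_comp; last exact: continuous_expR.
by apply: continuousN; exact: continuous_expR.
Qed.
Lemma Eg_bound s : 0 < Re s -> exists K : R, forall v, normc (Eg v * cexp (s * v%:C)) <= K * expR (- (Num.min 1 (Re s) * `|v|)).
Proof.
move=> s0; set d := Num.min 1 (Re s).
have d0 : 0 < d by rewrite lt_min ltr01.
(* One term of the exponential series gives $e^{-y}\le k!\,y^{-k}$ for $y=e^v$; taking [k] above
   $\Re s+1$ leaves decay $e^{-v}$ for positive [v]. *)
pose k := (Num.truncn (Re s + 1)).+1.
have hk : Re s + 1 < k%:R by exact: truncnS_gt.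
exists (k`!%:R) => v; rewrite normcM_cexp normc_pos ?expR_ge0 // -expRD.
have f1 : 1 <= k`!%:R :> R by rewrite ler1n fact_gt0.
case: (leP 0 v) => hv; last first.
  apply: le_trans (ler_peMl (expR_ge0 _) f1); rewrite ler_expR ltr0_norm // mulrN opprK.
  apply: (@le_trans _ _ (Re s * v)); first by rewrite gerDr oppr_le0 expR_ge0.
  by apply: ler_wnM2r; [exact: ltW|rewrite ge_min lexx orbT].
rewrite ger0_norm //.
have h : expR (- expR v) <= k`!%:R * expR (- (k%:R * v)).
  have := expR_ge1Dxn (Num.truncn (Re s + 1)) (expR_ge0 v); rewrite -/k -expRM_natl => h.
  have h2 : expR (k%:R * v) / k`!%:R <= expR (expR v) by apply: le_trans h; rewrite lerDr.
  rewrite !expRN -ler_pdivrMl ?ltr0n ?fact_gt0 // -invfM lef_pV2 ?posrE ?mulr_gt0 ?expR_gt0 ?ltr0n ?fact_gt0 //.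
  by move: h2; rewrite ler_pdivrMr ?ltr0n ?fact_gt0 // [_ * (k`!)%:R]mulrC.
rewrite expRD; apply: le_trans (ler_wpM2r (expR_ge0 _) h) _; rewrite -mulrA; apply: ler_wpM2l => //.
rewrite -expRD ler_expR -mulNr -mulrDl -mulNr; apply: ler_wpM2r => //.
have : d <= 1 by rewrite ge_min lexx.
lra.
Qed.

Lemma mtin_Eg s : 0 < Re s -> mtin Eg s.
Proof.
move=> s0; have [K hK] := Eg_bound s0.
have d0 : 0 < Num.min 1 (Re s) by rewrite lt_min ltr01.
by apply: cin_dom (rinZ K (rin_eabs d0)) hK; exact: cmeasM lmeas_Eg (lmeas_cexp _).
Qed.

Lemma Gamma_MT s : 0 < Re s -> Gamma_c s = MT Eg s.
Proof.
move=> s0; have e t : (expR t)%:C * (cpow (expR t) (s - 1) * (expR (- expR t))%:C) = Eg t * cexp (s * t%:C).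
  rewrite cpowE ?expR_gt0 // expRK mulrA -cexp_real -cexpD mulrC; congr (_ * cexp _); ring.
rewrite /Gamma_c CInt_exp; first exact: (cI_extR e).
by apply: lmeas_ext (cmeasM lmeas_Eg (lmeas_cexp s)) => t; rewrite e.
Qed.

Lemma exp_abs_dc (d x : R) : 0 < d -> expR (- (d * `|x|)) <= (1 + 2 / d ^+ 2) * dc x.
Proof.
move=> d0; have h := sqr_le_expR d0 (normr_ge0 x); rewrite real_normK ?num_real // in h.
have h1 : 1 <= expR (d * `|x|) by rewrite -expR0 ler_expR mulr_ge0 // ltW.
have h2 : 1 + x ^+ 2 <= (1 + 2 / d ^+ 2) * expR (d * `|x|) by rewrite mulrDl mul1r lerD.
have := ler_wpM2r (mulr_ge0 (ltW (dc_gt0 x)) (expR_ge0 (- (d * `|x|)))) h2.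
rewrite mulrA dcK mul1r [X in _ <= X -> _](_ : _ = (1 + 2 / d ^+ 2) * dc x * (expR (d * `|x|) * expR (- (d * `|x|)))); last by ring.
by rewrite -expRD subrr expR0 mulr1.
Qed.

Lemma crd_Eg_cexp s : crd (fun v => Eg v * cexp (s * v%:C)) (fun v => s * (Eg v * cexp (s * v%:C)) - Eg v * cexp ((s + 1) * v%:C)).
Proof.
move=> x; have [h1 h2] := crd_cexp s x.
have hE : is_derive x (1 : R) (fun t : R => expR (- expR t)) (- (expR x * expR (- expR x))).
  have hn : is_derive x (1 : R) (fun t : R => - expR t) (- expR x) by apply: is_derive_eq.
  have := @is_derive1_comp R expR (fun t : R => - expR t) x _ _ (is_derive_expR _) hn.
  by rewrite mulrN mulrC.
have e1 : cexp ((s + 1) * x%:C) = (expR x)%:C * cexp (s * x%:C) by rewrite mulrDl mul1r addrC cexpD cexp_real.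
split.
- rewrite (_ : (fun t => Re (Eg t * cexp (s * t%:C))) = (fun t => expR (- expR t) * Re (cexp (s * t%:C)))); last first.
    by apply/funext => t; rewrite ReMr.
  have H := @is_deriveM _ _ _ _ _ _ _ _ hE h1; apply: is_derive_eq.
  by rewrite /GRing.scale /= e1 /Eg !ReE !ImE; ring.
- rewrite (_ : (fun t => Im (Eg t * cexp (s * t%:C))) = (fun t => expR (- expR t) * Im (cexp (s * t%:C)))); last first.
    by apply/funext => t; rewrite ImMr.
  have H := @is_deriveM _ _ _ _ _ _ _ _ hE h2; apply: is_derive_eq.
  by rewrite /GRing.scale /= e1 /Eg !ImE !ReE; ring.
Qed.

Lemma ccont_Eg : ccont Eg.
Proof.
split => x /=; last exact: cst_continuous.
apply: continuous_comp; last exact: continuous_expR.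
by apply: continuousN; exact: continuous_expR.
Qed.

(** Integration by parts, in the form that the derivative of $e^{-e^v}e^{sv}$ has integral 0. *)
Lemma MT_Eg_rec s : 0 < Re s -> MT Eg (s + 1) = s * MT Eg s.
Proof.
move=> s0; have [K hK] := Eg_bound s0.
have d0 : 0 < Num.min 1 (Re s) by rewrite lt_min ltr01.
have K0 : 0 <= K by have := le_trans (normc_ge0 _) (hK 0); rewrite normr0 mulr0 oppr0 expR0 mulr1.
have i1 := mtin_Eg s0.
have i2 : mtin Eg (s + 1) by apply: mtin_Eg; rewrite ReD addr_gt0.
have c1 z : ccont (fun v => Eg v * cexp (z * v%:C)) by apply: ccontM ccont_Eg (ccont_cexp z).
have := cI_exact (crd_Eg_cexp s) _ _ (K := K * (1 + 2 / Num.min 1 (Re s) ^+ 2)).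
rewrite cIB; [|exact: cinZ|exact: i2]; rewrite cIZ // => h.
apply/eqP; rewrite eq_sym -subr_eq0; apply/eqP; apply: h.
- have [a1 a2] := ccontZ s (c1 s); have [b1 b2] := c1 (s + 1).
  split => x.
    by under eq_fun do rewrite ReB; apply: cvgB; [exact: a1|exact: b1].
  by under eq_fun do rewrite ImB; apply: cvgB; [exact: a2|exact: b2].
- by apply: cinB; [exact: cinZ|exact: i2].
- move=> x; apply: le_trans (hK x) _; rewrite -mulrA; apply: ler_wpM2l => //; exact: exp_abs_dc.
Qed.
End GammaFunction.

(** * The archimedean factor of xi *)

Section XiKernel.
Variable R : realType.
Local Notation C := R[i].
Local Notation mu := (@lebesgue_measure R).
Local Notation cnt := (@cntm R).

Definition gam (s : C) : C := 2^-1 * s * (s - 1) * cpow pi (- (s / 2%:R)) * Gamma_c (s / 2%:R).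
Definition Hexp (t : R) : C := (Hf (expR t))%:C.

Lemma Re_half (s : C) : Re (s / 2) = Re s / 2.
Proof. by rewrite -(rcnat R 2) -rcV mulrC ReMr mulrC. Qed.

(** Under $v=2t+\ln\pi$ the two monomials become Gamma integrals at $z+2$ and $z+1$ with $z=s/2$,
    and $4(z+1)z-6z=s(s-1)$; the Jacobian is the factor $1/2$ of xi. *)
Lemma Hexp_MT s : 0 < Re s -> mtin Hexp s /\ MT Hexp s = gam s.
Proof.
move=> s0; set z : C := s / 2; have z0 : 0 < Re z by rewrite Re_half divr_gt0.
pose E k (v : R) : C := Eg v * cexp ((z + k%:R) * v%:C).
have Rk (k : nat) : 0 < Re (z + k%:R) by rewrite ReD -rcnat /= ltr_wpDr.
have iE k : cin mu (E k) := mtin_Eg (Rk k).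
pose G v := 4 * E 2%N v - 6 * E 1%N v.
have iG : cin mu G by apply: cinB; exact: cinZ.
have cG : cI mu G = (4 * (z + 1) * z - 6 * z) * MT (@Eg R) z.
  have r1 : MT (@Eg R) (z + 1) = z * MT (@Eg R) z := MT_Eg_rec z0.
  have r2 : MT (@Eg R) (z + 2) = (z + 1) * MT (@Eg R) (z + 1).
    have -> : z + 2 = z + 1 + 1 by ring.
    exact: (MT_Eg_rec (Rk 1%N)).
  rewrite cIB ?cIZ //; [|exact: cinZ|exact: cinZ]; rewrite -/(MT (@Eg R) (z + 2)) -/(MT (@Eg R) (z + 1)) r2 r1; ring.
pose a : R := ln pi.
have sc := scale_substitutes (ltr0n R 2 : 0 < 2).
have iG' := cin_shift a iG.
have h1 := subst_cI sc (cin_meas iG').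
have h2 := (subst_cin sc (cin_meas iG')).1 iG'.
rewrite (cI_shift a (cin_meas iG)) cG in h1.
have e t : cexp (- z * a%:C) * 2^-1 * (2%:C * G (2 * t + a)) = Hexp t * cexp (s * t%:C).
  set v := 2 * t + a; have ev : expR v = pi * expR t ^+ 2.
    by rewrite /v expRD expRM_natl lnK ?posrE ?pi_gt0 // mulrC.
  have -> : G v = ((4 * expR v ^+ 2 - 6 * expR v) * expR (- expR v))%:C * cexp (z * v%:C).
    have Ek k : E k v = (expR (- expR v))%:C * (cexp (z * v%:C) * (expR v)%:C ^+ k).
      by rewrite /E mulrDl cexpD cexpMn cexp_real.
    have pe (y : R) : (4 * y ^+ 2 - 6 * y)%:C = 4 * y%:C ^+ 2 - 6 * y%:C.
      by rewrite rcB [in LHS](rcM 4) [in LHS](rcM 6) (rcX y 2) -!rcnat.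
    by rewrite /G !Ek (rcM (_ - _)) pe; ring.
  have -> : cexp (s * t%:C) = cexp (- z * a%:C) * cexp (z * v%:C).
    by rewrite -cexpD; congr cexp; rewrite /v /z rcD rcM rcnat; field.
  rewrite /Hexp (_ : Hf (expR t) = (4 * expR v ^+ 2 - 6 * expR v) * expR (- expR v)); last first.
    by rewrite /Hf /gs ev; ring.
  by rewrite rcnat; field.
split.
  by apply: cin_extR e _; exact: cinZ.
rewrite /MT -(cI_extR e) cIZ // -h1 /gam (Gamma_MT z0) cpowE ?pi_gt0 // -/z.
have -> : s = 2 * z by rewrite /z mulrC divfK // pnatr_eq0.
rewrite mulNr mulrN [_%:C * z]mulrC.
by field.
Qed.
End XiKernel.

(** * The kernel [PX] and its properties *)

Section XiRepresentation.
Variable R : realType.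
Local Notation C := R[i].
Local Notation mu := (@lebesgue_measure R).
Local Notation cnt := (@cntm R).

(** The factor $e^{t/2}$ recentres at the critical line, so that $\xi(s)$ is the transform at
    $s-1/2$. *)
Definition PX (t : R) : C := (Phi (expR t) * expR (t / 2))%:C.
Definition phiE (t : R) : C := (Phi (expR t))%:C.

(** The functional equation $\xi(s)=\xi(1-s)$ at the level of kernels; it is [Phi_inv] in
    logarithmic coordinates. *)
Lemma PX_even t : PX (- t) = PX t.
Proof.
rewrite /PX (Phi_inv (expR_gt0 (- t))) -expRN opprK; congr (_%:C).
rewrite [_ * Phi _]mulrC -mulrA -expRD; congr (_ * expR _); lra.
Qed.

Lemma cpow_nat n (s : C) : cpow n.+1%:R (- s) = cexp (- s * (ln n.+1%:R)%:C).
Proof. by rewrite cpowE ?ltr0n // mulrC. Qed.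

Lemma zeta_partialE (s : C) N : zeta_partial s N = \sum_(k < N) cpow k.+1%:R (- s).
Proof. by rewrite /zeta_partial big_add1 big_mkord. Qed.

Lemma normc_cpow_nat n (s : C) : 2 <= Re s -> normc (cpow n.+1%:R (- s)) <= 2 * dc n.+1%:R.
Proof.
move=> s2; rewrite cpow_nat normc_cexp_st ReN.
have n0 : (0 : R) < n.+1%:R by rewrite ltr0n.
have n1 : (1 : R) <= n.+1%:R by rewrite ler1n.
have l0 : 0 <= ln n.+1%:R :> R by rewrite ln_ge0.
apply: (@le_trans _ _ (n.+1%:R ^- 2)).
  apply: (@le_trans _ _ (expR (- (2 * ln n.+1%:R)))).
    by rewrite ler_expR mulNr lerN2 ler_wpM2r.
  by rewrite expRN expRM_natl lnK.
have n2 : (1 : R) <= n.+1%:R ^+ 2 by rewrite expr_ge1.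
rewrite /dc ler_pdivlMr ?ltr_pwDl ?sqr_ge0 // mulrC ler_pdivrMr; last by apply: lt_le_trans n2.
lra.
Qed.

(** Each term of the theta series is [Hexp] translated by $\ln n$, which multiplies its transform by
    $n^{-s}$. For $\Re s\ge2$ the explicit bound $n^{-2}$ justifies termwise integration. *)
Lemma phiE_MT s : 2 <= Re s -> mtin phiE s /\ ccvg (fun N => gam s * zeta_partial s N) (MT phiE s).
Proof.
move=> s2; have s0 : 0 < Re s by apply: lt_le_trans s2.
have [iH mH] := Hexp_MT s0.
pose F n t : C := Hexp (t + ln n.+1%:R) * cexp (s * t%:C).
have hF n := MT_shift (ln n.+1%:R) iH.
have iF n : cin mu (F n) := (hF n).1.
have cF n : cI mu (F n) = cpow n.+1%:R (- s) * gam s by rewrite cpow_nat -mH; exact: (hF n).2.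
pose I0 := rI mu (fun t => normc (Hexp t * cexp (s * t%:C))).
have I00 : 0 <= I0 by apply: rI_ge0 => t; exact: normc_ge0.
have nF n : rI mu (fun t => normc (F n t)) = normc (cpow n.+1%:R (- s)) * I0.
  have mI : rmeas (fun t => normc (Hexp t * cexp (s * t%:C))) := cmeas_normc (cin_meas iH).
  have rI1 := rin_shift (ln n.+1%:R) (cin_norm iH).
  have e1 := rI_shift (ln n.+1%:R) mI; rewrite -/I0 in e1.
  rewrite cpow_nat normc_cexp_st -e1 -(rIZ _ rI1).
  congr rI; apply/funext => t; rewrite /F !normcM_cexp mulrCA -expRD; congr (_ * expR _).
  by rewrite ReN; ring.
have bF N : \sum_(k < N) rI mu (fun x => normc (F k x)) <= 4 * I0.
  apply: (@le_trans _ _ (\sum_(k < N) 2 * dc k.+1%:R * I0)).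
    by apply: ler_sum => k _; rewrite nF; apply: ler_wpM2r => //; exact: normc_cpow_nat.
  by rewrite -mulr_suml -mulr_sumr; apply: ler_wpM2r => //; have := sum_dc R N; lra.
have [_ h2 h3 h4] := series_cin iF bF.
have e t : cI cnt (fun n => F n t) = phiE t * cexp (s * t%:C).
  have e1 n : F n t = (Hf (n.+1%:R * expR t))%:C * cexp (s * t%:C).
    by rewrite /F /Hexp expRD lnK ?posrE ?ltr0n // mulrC [expR t * _]mulrC mulrC.
  rewrite (cI_ext cnt e1) cIZr ?cI_real //; apply: cin_real; exact: rin_Phi (expR_gt0 t).
split; first exact: cin_extR e h2.
have -> : MT phiE s = cI cnt (fun n => cI mu (F n)) by rewrite -h4; apply: cI_extR => t; rewrite e.
apply: ccvg_ext (csum_cvg h3) => N; rewrite zeta_partialE mulr_sumr; apply: eq_bigr => k _.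
by rewrite cF mulrC.
Qed.

(** Of the [k + 1] available factors of decay of [Hf], one sums the series over [n] and the others
    give decay in [x]. *)
Lemma Phi_bound k x : 1 <= x -> `|Phi x| <= CH R k.+1 * 2 * x ^- (2 * k).
Proof.
move=> x1; have x0 : 0 < x by apply: lt_le_trans x1.
rewrite -normc_real; apply: ccvg_bound (Phi_cvg x0) _ => N.
apply: le_trans (normc_sum _ _ _) _.
apply: (@le_trans _ _ (\sum_(i < N) CH R k.+1 * x ^- (2 * k) * dc i.+1%:R)); last first.
  rewrite -mulr_sumr [leRHS]mulrAC; apply: ler_wpM2l; last exact: sum_dc.
  by rewrite mulr_ge0 ?CH_ge0 // invr_ge0 exprn_ge0 // ltW.
apply: ler_sum => i _; rewrite normc_real; have h := Hf_decay k.+1 (i.+1%:R * x).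
set y := i.+1%:R * x in h *.
have i1 : (1 : R) <= i.+1%:R by rewrite ler1n.
have h1 : 1 + i.+1%:R ^+ 2 <= 1 + y ^+ 2.
  by rewrite lerD2l ler_pXn2r ?nnegrE ?ler0n // ?mulr_ge0 ?(ltW x0) // ler_peMr.
have h2 : x ^+ (2 * k) <= (1 + y ^+ 2) ^+ k.
  rewrite exprM; apply: lerXn2r; rewrite ?nnegrE ?addr_ge0 ?sqr_ge0 //.
  apply: (@le_trans _ _ (y ^+ 2)); last by rewrite lerDr.
  by rewrite ler_pXn2r ?nnegrE ?mulr_ge0 ?(ltW x0) // ler_peMl // ltW.
have h3 : `|Hf y| * ((1 + i.+1%:R ^+ 2) * x ^+ (2 * k)) <= CH R k.+1.
  apply: le_trans h; apply: ler_wpM2l => //; rewrite (exprS (1 + y ^+ 2)).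
  exact: ler_pM (addr_ge0 ler01 (sqr_ge0 _)) (exprn_ge0 _ (ltW x0)) h1 h2.
have p1 : 0 < x ^+ (2 * k) by rewrite exprn_gt0.
have := ler_wpM2r (mulr_ge0 (ltW (dc_gt0 i.+1%:R)) (ltW (_ : 0 < x ^- (2 * k)))) h3.
rewrite invr_gt0 => /(_ p1).
rewrite [X in X <= _ -> _](_ : _ = `|Hf y| * ((1 + i.+1%:R ^+ 2) * dc i.+1%:R) * (x ^+ (2 * k) * x ^- (2 * k))); last first.
  by move: (x ^+ (2 * k)) (x ^- (2 * k)) (1 + _) (dc _) => u v a b; ring.
by rewrite dcK divff ?gt_eqF // !mulr1 mulrA mulrAC.
Qed.

Lemma lmeas_phiE : lmeas phiE.
Proof. by have [h _] := phiE_MT (lexx (Re (2%:C : C)) : 2 <= Re (2%:C : C)); exact: mtin_lmeas h. Qed.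

Lemma PXE t : PX t = phiE t * cexp ((2^-1 : C) * t%:C).
Proof.
by rewrite /PX rcM -[(expR _)%:C]cexp_real; congr (_ * cexp _); rewrite rcM rcV rcnat mulrC.
Qed.

(** [Phi_bound] with arbitrary [k] gives the decay at $+\infty$, and evenness transfers it to
    $-\infty$. *)
Lemma sexp_PX : sexp PX.
Proof.
split; first by apply: lmeas_ext (cmeasM lmeas_phiE (lmeas_cexp (2^-1 : C))) => t; rewrite PXE.
move=> a a0; pose k := (Num.truncn a).+1.
have hk : a < k%:R by exact: truncnS_gt.
have k1 : (1 : R) <= k%:R by rewrite ler1n.
exists (CH R k.+1 * 2).
have pos t : 0 <= t -> normc (PX t) <= CH R k.+1 * 2 * expR (- (a * t)).
  move=> t0; rewrite /PX normc_real normrM (ger0_norm (expR_ge0 _)).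
  have x1 : 1 <= expR t by rewrite -expR0 ler_expR.
  apply: le_trans (ler_wpM2r (expR_ge0 _) (Phi_bound k x1)) _.
  rewrite -[leLHS]mulrA; apply: ler_wpM2l; first by rewrite mulr_ge0 // CH_ge0.
  rewrite -expRM_natl -expRN -expRD ler_expR natrM; nra.
move=> t; case: (leP 0 t) => h; first by rewrite ger0_norm //; exact: pos.
by rewrite ltr0_norm // -PX_even; apply: pos; rewrite oppr_ge0 ltW.
Qed.

Lemma Hf_gt0 (x : R) : 1 <= x -> 0 < Hf x.
Proof.
move=> x1; rewrite mulr_gt0 ?gs_gt0 // (_ : _ - _ = 2 * pi * x ^+ 2 * (2 * pi * x ^+ 2 - 3)); last by ring.
have p1 := @pi_ge2 R; have x2 : 1 <= x ^+ 2 by rewrite expr_ge1 // (le_trans _ x1).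
by rewrite !mulr_gt0 ?pi_gt0 // ?(lt_le_trans _ x2) //; nra.
Qed.

(** For $x\ge1$ one has $2\pi x^2>3$, so all terms of the theta series are positive. This is how the
    kernel is seen not to be null. *)
Lemma PX_neq0 t : 0 <= t -> PX t != 0.
Proof.
move=> t0; have x1 : 1 <= expR t by rewrite -expR0 ler_expR.
rewrite /PX rc_eq0 mulf_neq0 ?gt_eqF ?expR_gt0 //.
have nn k : 0 <= Hf (k.+1%:R * expR t).
  by apply: ltW; apply: Hf_gt0; apply: le_trans x1 _; rewrite ler_peMl ?expR_ge0 // ler1n.
have := rin_cnt_sum_le 1 (rin_Phi (expR_gt0 t)) nn.
by rewrite big_ord1 mul1r; apply: lt_le_trans; exact: Hf_gt0.
Qed.

Lemma PX_not_ae0 : ~ (\forall t \ae mu, PX t = 0).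
Proof.
move=> h; have e : cI mu (fun t => cind 0 1 t * 1) = 0.
  rewrite -(cI0 mu); apply: cI_ae; [by apply: cmeasM; [exact: lmeas_cind|exact: cmeas_cst]|exact: cmeas_cst|].
  apply: ae_mono h => t h; rewrite cindE; case: ifP => [/andP[t0 _]|]; last by rewrite mul0r.
  by move: (PX_neq0 (ltW t0)); rewrite h eqxx.
move: e; rewrite (@cI_ftc _ (fun t => t%:C)) //; last exact: ccont_cst.
  by rewrite subr0 => /eqP; rewrite rc_eq0 oner_eq0.
by move=> x; split => /=; [exact: is_derive_id|exact: is_derive_cst].
Qed.

(** Both sides are entire, and for $\Re s>2$ both are limits of the same partial sums; the identity
    theorem on a half plane concludes. *)
Lemma xi_kernel (X : C -> C) : is_riemann_xi X -> forall s, X s = MT PX (s - 2^-1).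
Proof.
case=> hX lX s; apply/eqP; rewrite -subr_eq0; apply/eqP; move: s.
apply: (@identity_half_plane _ _ 2) => [z|z hz].
  apply: cdiffB; first exact: holo_cdiff.
  apply: (cdiff_comp (f := MT PX) (g := fun z => z - 2^-1)); first by apply: cdiffB; [exact: cdiff_id|exact: cdiff_cst].
  by eexists; exact: sexp_cdiff sexp_PX.
have z1 : 1 < Re z by apply: lt_trans hz; rewrite ltr1n.
have [_ h2] := phiE_MT (ltW hz).
have h1 : ccvg (fun N => gam z * zeta_partial z N) (X z).
  apply: ccvg_eps => e e0; have eC : (0 : C) < e%:C by rewrite ltcR.
  have /cvgrPdist_le/(_ _ eC)[N _ hN] := lX z z1; exists N => n hn.
  by have := hN n hn; rewrite normE lecR normc_distC.
rewrite (ccvg_uniq h1 h2) (_ : MT PX _ = MT phiE z) ?subrr //.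
rewrite (_ : PX = fun t => phiE t * cexp ((2^-1 : C) * t%:C)); last by apply/funext => t; rewrite PXE.
by rewrite MT_expM addrCA subrr addr0.
Qed.
End XiRepresentation.

(** * Zeros of a Fourier transform of super-exponential decay form a null set *)

Section NullZeros.
Variable R : realType.
Local Notation C := R[i].
Local Notation mu := (@lebesgue_measure R).

(* A zero of [f] at which the derivative [g] does not vanish is isolated, and isolated zeros are countable. *)
Lemma ae_deriv_zero (f g : R -> C) : (forall u e, 0 < e -> exists2 d : R, 0 < d &
    forall h : R, `|h| < d -> normc (f (u + h) - f u - g u * h%:C) <= e * `|h|) ->
  \forall u \ae mu, f u = 0 -> g u = 0.
Proof.
(* Each [S n] holds for at most one [u], the only zero in the [n]-th rational interval; hence almost
   every [u] avoids all of them. *)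
move=> hfg; pose S (n : nat) (u : R) := exists p q : rat, unpickle n = Some (p, q) /\
  (ratr p < u < ratr q /\ f u = 0 /\ forall v, ratr p < v < ratr q -> f v = 0 -> v = u).
have hS n : \forall u \ae mu, ~ S n u.
  case: (pselect (exists a, S n a)) => [[a Sa]|ha]; last by apply: aeW => u hu; apply: ha; exists u.
  apply: ae_mono (neq_ae a) => u /eqP ua [p [q [e1 [hu [fu _]]]]]; apply: ua.
  case: Sa => p' [q' [e2 [_ [_ h]]]]; move: e1; rewrite e2 => -[e3 e4]; subst.
  exact: h.
apply: ae_mono (ae_all hS) => u hu fu; apply: contrapT => gu.
have g0 : 0 < normc (g u) by rewrite normc_gt0; apply/eqP.
have [d d0 hd] := hfg u (normc (g u) / 2) (divr_gt0 g0 (ltr0n _ 2)).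
have iso v : `|v - u| < d -> f v = 0 -> v = u.
  move=> hv fv; have := hd _ hv; rewrite [u + _]addrC subrK fv fu subr0 sub0r normcN normcM normc_real.
  case: (eqVneq v u) => // vu; have v0 : 0 < `|v - u| by rewrite normr_gt0 subr_eq0.
  by rewrite ler_pM2r // leNgt ltr_pdivrMr // ltr_pMr // ltr1n.
have [p /[!in_itv]/= /andP[p1 p2]] : exists p : rat, ratr p \in `](u - d), u[%R by apply: rat_in_itvoo; lra.
have [q /[!in_itv]/= /andP[q1 q2]] : exists q : rat, ratr q \in `]u, (u + d)[%R by apply: rat_in_itvoo; lra.
apply: (hu (pickle (p, q))); exists p, q; split; first exact: pickleK.
split; first by rewrite p2 q1.
split=> // v /andP[v1 v2]; apply: iso; rewrite ltr_norml; apply/andP; split; lra.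
Qed.

Definition itaylor (x : R) n : C := \sum_(k < n) (ii * x%:C) ^+ k * (k`!%:R^-1)%:C.

Lemma itaylor_term (x : R) k : (ii * x%:C) ^+ k * (k`!%:R^-1)%:C = cos_coeff x k +i* sin_coeff x k :> C.
Proof.
have i2 m : (ii : C) ^+ m.*2 = ((-1) ^+ m)%:C.
  by rewrite -mul2n exprM (_ : (ii : C) ^+ 2 = (-1)%:C) -?rcX //; apply: complexP => /=; ring.
rewrite exprMn -rcX -mulrA -rcM /cos_coeff /sin_coeff /= -exprnP -[in (ii) ^+ k](odd_double_half k).
case: (boolP (odd k)) => hk /=.
  rewrite add1n exprS i2 [in k.-1./2](_ : k.-1./2 = k./2); last first.
    by rewrite -[k in LHS]odd_double_half hk add1n /= doubleK.
  by apply: complexP => /=; ring.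
by rewrite add0n i2; apply: complexP => /=; ring.
Qed.

Lemma itaylor_cvg x : ccvg (itaylor x) (cexp (ii * x%:C)).
Proof.
have e n : itaylor x n = series (cos_coeff x) n +i* series (sin_coeff x) n.
  rewrite /itaylor /series /= !big_mkord; elim: n => [|n IH]; first by rewrite !big_ord0.
  by rewrite !big_ord_recr /= IH itaylor_term.
rewrite cexp_iE; apply/ccvgP; split.
  rewrite (_ : (fun n => _) = series (cos_coeff x)); last by apply/funext => n; rewrite e.
  by rewrite /= unlock; exact: is_cvg_series_cos_coeff.
rewrite (_ : (fun n => _) = series (sin_coeff x)); last by apply/funext => n; rewrite e.
by rewrite /= unlock; exact: is_cvg_series_sin_coeff.
Qed.

Lemma itaylor_bound x n : normc (itaylor x n) <= expR `|x|.
Proof.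
have h : series (exp_coeff `|x|) n <= expR `|x|.
  rewrite /expR; apply: nondecreasing_cvgn_le; last exact: is_cvg_series_exp_coeff.
  by apply: nondecreasing_series => k _ _; rewrite /exp_coeff /= divr_ge0 ?exprn_ge0.
apply: le_trans h; rewrite /series /= big_mkord; apply: le_trans (normc_sum _ _ _) _.
apply: ler_sum => k _; rewrite normcM normcX normcM normc_i mul1r normc_real normc_pos ?invr_ge0 //.
Qed.

Lemma Re_i0 (u : R) : Re (ii * u%:C) = Re (0 : C).
Proof. by rewrite /= !mul0r mulr0 subr0. Qed.
Lemma sexp_iter p k : sexp p -> sexp (iter k (@tmul R) p).
Proof. by move=> hp; elim: k => //= k IH; exact: sexp_tmul. Qed.
Lemma iter_tmulE p k t : iter k (@tmul R) p t = t%:C ^+ k * p t.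
Proof. by elim: k => [|k IH] /=; rewrite ?mul1r // /tmul IH mulrA exprS. Qed.

(** The Taylor series of $e^{ivt}$ is integrated term by term, and every term is a multiple of a
    vanishing moment. The majorant $|p(t)|e^{|v||t|}$ is integrable by super-exponential decay. *)
Lemma FT_moments_eq0 p u : sexp p -> (forall k, FT (iter k (@tmul R) p) u = 0) -> forall v, FT p (u + v) = 0.
Proof.
move=> hp hk v; pose F n t := p t * cexp (ii * u%:C * t%:C) * itaylor (v * t) n.
have iF n : cin mu (F n) /\ cI mu (F n) = 0.
  have e t : \sum_(k < n) ((ii * v%:C) ^+ k * (k`!%:R^-1)%:C) * (iter k (@tmul R) p t * cexp (ii * u%:C * t%:C)) = F n t.
    rewrite /F /itaylor mulr_sumr; apply: eq_bigr => k _; rewrite iter_tmulE rcM (mulrA ii) [in RHS]exprMn.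
    by set a := (ii * v%:C) ^+ k; set b := t%:C ^+ k; ring.
  have ik k : cin mu (fun t => iter k (@tmul R) p t * cexp (ii * u%:C * t%:C)) := sexp_mtin _ (sexp_iter k hp).
  have ic (k : 'I_n) : cin mu (fun t => ((ii * v%:C) ^+ k * (k`!%:R^-1)%:C) * (iter k (@tmul R) p t * cexp (ii * u%:C * t%:C))).
    by apply: cinZ; exact: ik.
  split; first by apply: cin_extR e _; exact: cin_sum.
  rewrite -(cI_extR e) cI_sum // big1 // => k _; rewrite cIZ; last exact: ik.
  by have := hk k; rewrite /FT /MT => ->; rewrite mulr0.
have id := rin_mt_abs (sexp_mtin (0 + `|v|%:C) hp) (sexp_mtin (0 - `|v|%:C) hp).
have mp := hp.1.
have mG : lmeas (fun t => p t * cexp (ii * (u + v)%:C * t%:C)) := cmeasM mp (lmeas_cexp _).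
have hpt t : ccvg (fun n => F n t) (p t * cexp (ii * (u + v)%:C * t%:C)).
  rewrite /F rcD mulrDr mulrDl cexpD mulrA; apply: ccvgZ.
  by rewrite -mulrA -rcM; exact: itaylor_cvg.
have hbd n t : normc (F n t) <= normc (p t) * expR (Re (0 : C) * t) * expR (`|v| * `|t|).
  rewrite /F normcM normcM_cexp Re_i0; apply: ler_pM; last by rewrite -normrM; exact: itaylor_bound.
  - by rewrite mulr_ge0 ?normc_ge0 // expR_ge0.
  - exact: normc_ge0.
  - exact: lexx.
have hae : \forall t \ae mu, ccvg (fun n => F n t) (p t * cexp (ii * (u + v)%:C * t%:C)) by apply: aeW => t; exact: hpt.
have [_ h] := cI_dct (fun n => cin_meas (iF n).1) mG hae id hbd.
by apply: ccvg_uniq h _; apply: ccvg_ext (ccvg_cst 0) => n; rewrite (iF n).2.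
Qed.

(** For almost every point, a zero of any derivative is a zero of the next one; such a zero has
    infinite order and forces the transform, hence [p], to vanish. *)
Lemma FT_zeros_null p : sexp p -> ~ (\forall t \ae mu, p t = 0) -> \forall u \ae mu, FT p u != 0.
Proof.
move=> hp hn.
have hd k : \forall u \ae mu, FT (iter k (@tmul R) p) u = 0 -> ii * FT (iter k.+1 (@tmul R) p) u = 0.
  apply: (ae_deriv_zero (f := FT (iter k (@tmul R) p)) (g := fun u => ii * FT (iter k.+1 (@tmul R) p) u)) => u e e0.
  have [d d0 H] := sexp_cdiff (ii * u%:C) (sexp_iter k hp) e0; exists d => // h hh.
  have := H (ii * h%:C); rewrite normcM normc_i mul1r normc_real => /(_ hh).
  by rewrite /FT rcD mulrDr; congr (normc _ <= _); rewrite mulrCA mulrA.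
apply: ae_mono (ae_all hd) => u hu; apply/eqP => h0.
have hk k : FT (iter k (@tmul R) p) u = 0.
  elim: k => [//|k /hu/eqP]; rewrite mulf_eq0 => /orP[/eqP/(congr1 (@normc R))|/eqP//].
  by rewrite normc_i normc0 => /eqP; rewrite oner_eq0.
apply: hn; have z12 : l12 (fun=> 0 : C) by split; [exact: cin0|exact: l20].
apply: (l12_FT_inj (sexp_l12 hp) z12); apply: aeW => v.
have := FT_moments_eq0 hp hk (v - u); rewrite addrC subrK => ->.
by rewrite /FT /MT; apply/esym; rewrite -[RHS](cI0 mu); apply: cI_extR => t; rewrite mul0r.
Qed.
End NullZeros.

(** * Causality and inner functions *)

Section FourierSupplement.
Variable R : realType.
Local Notation C := R[i].
Local Notation mu := (@lebesgue_measure R).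
Implicit Types f g k G : R -> C.

Lemma isFT_opp f G : isFT f G -> isFT (fun t => f (- t)) (fun u => G (- u)).
Proof.
case=> lf lG h; split; [exact: l2_opp|exact: l2_opp|] => phi [c1 c2].
have h2 := h (fun t => phi (- t)) (conj (cin_opp c1) (l2_opp c2)).
have mG : lmeas (fun u => G (- u) * phi u) by apply: cmeasM; [exact: l2_meas (l2_opp lG)|exact: cin_meas c1].
rewrite -(cI_opp mG).
have e1 u : G (- - u) * phi (- u) = G u * phi (- u) by rewrite opprK.
rewrite (cI_extR e1) h2.
have mf : lmeas (fun t => f t * FT (fun t => phi (- t)) t).
  by apply: cmeasM; [exact: l2_meas lf|apply: lmeas_FT; exact: cin_meas (cin_opp c1)].
rewrite -(cI_opp mf); apply: cI_extR => t; congr (_ * _).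
rewrite /FT /MT -[RHS](cI_opp (cin_meas (cin_FT t c1))); apply: cI_extR => x; congr (_ * cexp _).
by rewrite !rcN; ring.
Qed.

Lemma isFT_from_FT G : l2 mu G -> exists k, isFT k G.
Proof.
move=> lG; have [K hK] := isFT_ex lG.
have h := isFTZ ((2 * pi)^-1)%:C (isFT_opp (isFT_inv hK)).
have p2 : (2 * pi : R) != 0 by rewrite mulf_neq0 ?gt_eqF ?pi_gt0.
exists (fun t => ((2 * pi)^-1)%:C * K (- t)); have [lk _ _] := h.
apply: isFT_ae h; [exact: l2_meas lk|exact: l2_meas lG|exact: aeW|].
by apply: aeW => x; rewrite opprK mulrA -rcM mulVf // mul1r.
Qed.

Lemma isFT_inj f g F G : isFT f F -> isFT g G -> (\forall u \ae mu, F u = G u) -> \forall t \ae mu, f t = g t.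
Proof.
move=> hf hg h; have hB := isFTB hf hg.
have [lB lB' _] := hB.
have e : N2 mu (fun u => F u - G u) = 0.
  have ae0 : \forall u \ae mu, F u - G u = 0 by apply: ae_mono h => u ->; rewrite subrr.
  rewrite (N2_ae (l2_meas lB') (@cmeas_cst R _ (measurableTypeR R) 0) ae0) /N2 (_ : (fun _ => _) = fun _ : R => (0 : R)).
    have := rIZ 0 (rin0 mu); rewrite mul0r => e0.
    by rewrite e0 mul0r.
  by apply/funext => x; rewrite normc0 expr0n.
have := isFT_N2 hB; rewrite e => /esym/eqP; rewrite mulf_eq0 => /orP[|/eqP/(N2_eq0 lB)].
  by rewrite gt_eqF // mulr_gt0 // pi_gt0.
by apply: ae_mono => t /eqP; rewrite subr_eq0 => /eqP.
Qed.

Lemma ae_ex (P : R -> Prop) a b : a < b -> (\forall u \ae mu, P u) -> exists2 u, a < u <= b & P u.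
Proof.
move=> ab h; apply: contrapT => hn.
have e : cI mu (fun t => cind a b t * 1) = 0.
  rewrite -(cI0 mu); apply: cI_ae; [by apply: cmeasM; [exact: lmeas_cind|exact: cmeas_cst]|exact: cmeas_cst|].
  apply: ae_mono h => t Pt; rewrite cindE; case: ifP => [ht|]; last by rewrite mul0r.
  by exfalso; apply: hn; exists t.
move: e; rewrite (@cI_ftc _ (fun t => t%:C)) //; last exact: ccont_cst.
  by rewrite -rcB => /eqP; rewrite rc_eq0 subr_eq0 gt_eqF.
by move=> x; split => /=; [exact: is_derive_id|exact: is_derive_cst].
Qed.

Definition causal f := forall t, t <= 0 -> f t = 0.
(** Damping moves the Fourier transform to the line $\Re s=-c$; for positive [c] it makes causal
    functions of L^2 integrable. *)
Definition wt (c : R) f (t : R) : C := f t * cexp (- c%:C * t%:C).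

Lemma lmeas_step : lmeas (fun t : R => (step t)%:C).
Proof. exact: cmeas_real (@rmeas_step R). Qed.

Lemma l2_step_exp s : Re s < 0 -> l2 mu (fun t => (step t)%:C * cexp (s * t%:C)) /\
  N2 mu (fun t => (step t)%:C * cexp (s * t%:C)) = (- 2 * Re s)^-1.
Proof.
move=> s0; have s2 : 0 < - 2 * Re s by lra.
have [h1 h2] := rin_step_exp s2.
have e t : normc ((step t)%:C * cexp (s * t%:C)) ^+ 2 = step t * expR (- (- 2 * Re s * t)).
  rewrite normcM_cexp exprMn normc_real real_normK ?num_real // stepE -expRM_natl.
  by case: ifP => _; rewrite ?expr1n ?expr0n /= ?mul0r // !mul1r; congr expR; ring.
have ef : (fun t => normc ((step t)%:C * cexp (s * t%:C)) ^+ 2) = (fun t => step t * expR (- (- 2 * Re s * t))).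
  by apply/funext => t; exact: e.
split; last by rewrite /N2 ef.
by split; [apply: cmeasM lmeas_step (lmeas_cexp _)|rewrite ef].
Qed.

Lemma causal_step f t : causal f -> f t = f t * (step t)%:C.
Proof. by move=> h; rewrite stepE; case: ltP => ht; rewrite ?mulr1 // h // mul0r. Qed.

Lemma causal_mtin f s : l2 mu f -> causal f -> Re s < 0 -> mtin f s.
Proof.
move=> lf cf s0; have [h _] := l2_step_exp s0.
by apply: cin_extR (cin_l2 lf h) => t; rewrite mulrA -causal_step.
Qed.

Lemma causal_wt f c : l2 mu f -> causal f -> 0 <= c -> l2 mu (wt c f) /\ N2 mu (wt c f) <= N2 mu f.
Proof.
move=> lf cf c0; have mw : lmeas (wt c f) := cmeasM (l2_meas lf) (lmeas_cexp _).
have le t : normc (wt c f t) <= normc (f t).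
  rewrite /wt normcM_cexp; case: (leP t 0) => ht; first by rewrite cf // normc0 mul0r.
  by rewrite ler_piMr ?normc_ge0 // -[leRHS]expR0 ler_expR ReN /= mulNr oppr_le0 mulr_ge0 // ltW.
have lw := l2_dom mw lf le; split=> //; exact: N2_le.
Qed.
Lemma causal_wt_l12 f c : l2 mu f -> causal f -> 0 < c -> l12 (wt c f).
Proof.
move=> lf cf c0; split; last exact: (causal_wt lf cf (ltW c0)).1.
by apply: causal_mtin => //; rewrite ReN /= oppr_lt0.
Qed.
Lemma FT_wt f c u : FT (wt c f) u = MT f (- c%:C + ii * u%:C).
Proof. exact: MT_expM. Qed.
Lemma wt_cv p f c : cin mu (wt c p) -> cin mu (wt c f) ->
  \forall t \ae mu, wt c (cv p f) t = cv (wt c p) (wt c f) t.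
Proof.
move=> ip jf; apply: ae_mono (cv_ae ip jf) => t it.
have e x : wt c p x * wt c f (t - x) * cexp (c%:C * t%:C) = p x * f (t - x).
  rewrite /wt; transitivity (p x * f (t - x) * (cexp (- c%:C * x%:C) * cexp (- c%:C * (t - x)%:C) * cexp (c%:C * t%:C))).
    ring.
  by rewrite -!cexpD (_ : _ + _ + _ = 0) ?cexp0 ?mulr1 // rcB; ring.
rewrite [LHS]/wt /cv -(cI_extR e) cIZr // -mulrA -cexpD mulNr subrr cexp0 mulr1 //.
Qed.
Lemma cv_causal p f : causal p -> causal f -> causal (cv p f).
Proof.
move=> hp hf t t0; rewrite /cv -(cI0 mu); apply: cI_extR => x.
case: (leP x 0) => hx; first by rewrite hp // mul0r.
by rewrite hf ?mulr0 //; lra.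
Qed.
End FourierSupplement.

(** * The operator defined by a quotient of Fourier transforms *)

Section TransferOperator.
Variable R : realType.
Local Notation C := R[i].
Local Notation mu := (@lebesgue_measure R).
Implicit Types f g k G : R -> C.
Variables pN pD : R -> C.
Hypotheses (sN : sexp pN) (sD : sexp pD) (nD : ~ (\forall t \ae mu, pD t = 0)).
Hypothesis habs : forall u, normc (FT pN u) = normc (FT pD u).

(** At a zero of the denominator the quotient is 0 by convention, so the modulus is at most 1
    everywhere and equal to 1 off a null set. *)
Definition Th (u : R) : C := FT pN u / FT pD u.
(** A relation rather than a map, since transforms and images are determined only up to null
    sets. *)
Definition TT f k := exists G, isFT f G /\ isFT k (fun u => Th u * G u).

Lemma line_neq0 (a : R) : \forall u \ae mu, MT pD (a%:C + ii * u%:C) != 0.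
Proof.
have h : ~ (\forall t \ae mu, pD t * cexp (a%:C * t%:C) = 0).
  move=> h; apply: nD; apply: ae_mono h => t /eqP.
  by rewrite mulf_eq0 (negbTE (cexp_neq0 _)) orbF => /eqP.
by apply: ae_mono (FT_zeros_null (sexp_expM a sD) h) => u; rewrite /FT MT_expM.
Qed.
Lemma D_neq0 : \forall u \ae mu, FT pD u != 0.
Proof. by apply: ae_mono (line_neq0 0) => u; rewrite add0r. Qed.
Lemma lmeas_Th : lmeas Th.
Proof. by apply: cmeasM; [|apply: cmeasV]; apply: lmeas_FT; [exact: sN.1|exact: sD.1]. Qed.
Lemma Th_le1 u : normc (Th u) <= 1.
Proof.
rewrite /Th normcM normcV habs; case: (eqVneq (normc (FT pD u)) 0) => [->|h]; last by rewrite divff.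
by rewrite mul0r.
Qed.
Lemma Th_abs1 u : FT pD u != 0 -> normc (Th u) = 1.
Proof. by move=> h; rewrite /Th normcM normcV habs divff // normc_eq0. Qed.

Lemma l2_Th G : l2 mu G -> l2 mu (fun u => Th u * G u) /\ N2 mu (fun u => Th u * G u) <= N2 mu G.
Proof.
move=> lG; split; first exact: l2_bM lmeas_Th Th_le1 lG.
by have := N2_bM lmeas_Th Th_le1 lG; rewrite expr1n mul1r.
Qed.

Lemma TT_ex f : l2 mu f -> exists k, TT f k.
Proof.
move=> lf; have [G hG] := isFT_ex lf; have [_ lG _] := hG.
by have [k hk] := isFT_from_FT (l2_Th lG).1; exists k, G.
Qed.
Lemma TT_l2 f k : TT f k -> l2 mu f /\ l2 mu k.
Proof. by case=> G [[h1 _ _] [h2 _ _]]. Qed.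
Lemma TT_uniq f k k' : TT f k -> TT f k' -> \forall t \ae mu, k t = k' t.
Proof.
case=> G [h1 h2] [G' [h1' h2']]; apply: isFT_inj h2 h2' _.
by apply: ae_mono (isFT_uniq h1 h1') => u ->.
Qed.
Lemma TT_N2 f k : TT f k -> N2 mu k <= N2 mu f.
Proof.
case=> G [h1 h2]; have [_ lG _] := h1; have := (l2_Th lG).2.
by rewrite (isFT_N2 h1) (isFT_N2 h2) ler_pM2l // mulr_gt0 ?pi_gt0.
Qed.
Lemma TT_ae f k k' : lmeas k' -> (\forall t \ae mu, k t = k' t) -> TT f k -> TT f k'.
Proof.
move=> mk e [G [h1 h2]]; exists G; split=> //; have [_ l2' _] := h2.
by apply: isFT_ae h2 => //; [exact: l2_meas l2'|exact: aeW].
Qed.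

Lemma wt_inj (c : R) (f g : R -> C) : (\forall t \ae mu, wt c f t = wt c g t) -> \forall t \ae mu, f t = g t.
Proof. by apply: ae_mono => t /(mulIf (cexp_neq0 _)). Qed.

Lemma cv_sexp_MT p f s : sexp p -> l2 mu f -> causal f -> Re s < 0 ->
  mtin (cv p f) s /\ MT (cv p f) s = MT p s * MT f s.
Proof.
by move=> sp lf cf s0; apply: MT_cv (sexp_mtin s sp) (causal_mtin lf cf s0); [exact: sp.1|exact: l2_meas lf].
Qed.

Lemma cv_sexp_wt p f c : sexp p -> l2 mu f -> causal f -> 0 < c -> l12 (wt c (cv p f)).
Proof.
move=> sp lf cf c0; have ip : cin mu (wt c p) := sexp_mtin _ sp.
have [i1 l1] := causal_wt_l12 lf cf c0.
have mc : lmeas (wt c (cv p f)) by apply: cmeasM (lmeas_cexp _); apply: lmeas_cv; [exact: sp.1|exact: l2_meas lf].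
have e := wt_cv ip i1.
have e' : \forall t \ae mu, cv (wt c p) (wt c f) t = wt c (cv p f) t by apply: ae_mono e.
split; [exact: cin_ae mc e' (cv_L1 ip i1).1|exact: l2_ae mc e' (cv_L2 ip l1).1].
Qed.

(** Clearing the denominator on the imaginary axis gives [cv pD k = cv pN f] almost everywhere, an
    identity between functions; its Laplace transform can then be taken on a line further left. *)
Lemma TT_line c f k s : TT f k -> causal f -> causal k -> 0 < c -> Re s = - c ->
  MT pD s * MT k s = MT pN s * MT f s.
Proof.
move=> hT cf ck c0 hs; have [lf lk] := TT_l2 hT; have s0 : Re s < 0 by rewrite hs oppr_lt0.
rewrite -(cv_sexp_MT sD lk ck s0).2 -(cv_sexp_MT sN lf cf s0).2.
have e : \forall t \ae mu, cv pD k t = cv pN f t.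
  have [G [h1 h2]] := hT.
  apply: isFT_inj (isFT_cv (sexp_l12 sD).1 h2) (isFT_cv (sexp_l12 sN).1 h1) _.
  by apply: ae_mono D_neq0 => u hu; rewrite /Th; field.
apply: cI_ae; [apply: cmeasM (lmeas_cexp _)|apply: cmeasM (lmeas_cexp _)|].
- by apply: lmeas_cv; [exact: sD.1|exact: l2_meas lk].
- by apply: lmeas_cv; [exact: sN.1|exact: l2_meas lf].
- by apply: ae_mono e => t ->.
Qed.

(** The reverse passage: transforms on one line determine the damped convolutions, hence
    [cv pD k = cv pN f], and on the imaginary axis [FT pD] is cancelled off its null set of
    zeros. *)
Lemma line_TT c f k : l2 mu f -> l2 mu k -> causal f -> causal k -> 0 < c ->
  (forall s, Re s = - c -> MT pD s * MT k s = MT pN s * MT f s) -> TT f k.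
Proof.
move=> lf lk cf ck c0 h; have [G hG] := isFT_ex lf; exists G; split=> //.
have [K hK] := isFT_ex lk; apply: isFT_ae (hK); [exact: l2_meas lk| |exact: aeW|].
  by have [_ lG _] := hG; exact: l2_meas (l2_Th lG).1.
have e : \forall t \ae mu, cv pD k t = cv pN f t.
  apply: (@wt_inj c); apply: l12_FT_inj (cv_sexp_wt sD lk ck c0) (cv_sexp_wt sN lf cf c0) _.
  apply: aeW => u; rewrite !FT_wt.
  have hs : Re (- c%:C + ii * u%:C) = - c by rewrite /= !mul0r mulr0 !subr0 addr0.
  have s0 : Re (- c%:C + ii * u%:C) < 0 by rewrite hs oppr_lt0.
  by rewrite (cv_sexp_MT sD lk ck s0).2 (cv_sexp_MT sN lf cf s0).2 h.
have h1 := isFT_cv (sexp_l12 sD).1 hK.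
have h2 := isFT_cv (sexp_l12 sN).1 hG.
have [l1 l1' _] := h1; have [l2' l2'' _] := h2.
have h3 := isFT_ae (l2_meas l2') (l2_meas l1') e (aeW _ (fun u => erefl)) h1.
apply: ae_mono2 D_neq0 (isFT_uniq h3 h2) => u hu e1.
by rewrite /Th mulrAC -e1 mulrC mulKf.
Qed.
End TransferOperator.

(** * Causality, convolution and square-integrability *)

Section Causality.
Variable R : realType.
Local Notation C := R[i].
Local Notation mu := (@lebesgue_measure R).
Implicit Types f g k G : R -> C.
Variables pN pD : R -> C.
Hypotheses (sN : sexp pN) (sD : sexp pD) (nD : ~ (\forall t \ae mu, pD t = 0)).
Hypothesis habs : forall u, normc (FT pN u) = normc (FT pD u).
Local Notation TT := (TT pN pD).

Definition causal_op := forall f, l2 mu f -> causal f -> forall k, TT f k -> \forall t \ae mu, t < 0 -> k t = 0.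

(** [causal] speaks of every point [t <= 0], while images are known only almost everywhere; for a
    causal operator this cut changes them on a null set. *)
Definition cpart k (t : R) : C := k t * (step t)%:C.
Lemma causal_cpart k : causal (cpart k).
Proof. by move=> t t0; rewrite /cpart stepE ltNge t0 mulr0. Qed.
Lemma normc_step t : normc ((step t)%:C : C) <= 1.
Proof. by rewrite stepE normc_real; case: ifP => _; rewrite ?normr1 ?normr0. Qed.
Lemma l2_cpart k : l2 mu k -> l2 mu (cpart k).
Proof.
move=> lk; apply: (l2_dom _ lk); first exact: cmeasM (l2_meas lk) (lmeas_step R).
by move=> t; rewrite normcM ler_piMr ?normc_ge0 // normc_step.
Qed.
Lemma ae_cpart k : (\forall t \ae mu, t < 0 -> k t = 0) -> \forall t \ae mu, k t = cpart k t.
Proof.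
move=> h; apply: ae_mono2 h (neq_ae 0) => t h t0; rewrite /cpart stepE.
by case: (ltgtP t 0) t0 => // ht _; [rewrite h // mul0r|rewrite mulr1].
Qed.
Lemma TT_cpart f k : causal_op -> l2 mu f -> causal f -> TT f k -> TT f (cpart k).
Proof.
move=> hc lf cf hT; have [_ lk] := TT_l2 hT.
exact: (TT_ae (l2_meas (l2_cpart lk)) (ae_cpart (hc _ lf cf _ hT)) hT).
Qed.

Section Convolution.
Variables (eta : R -> C) (c : R).
Hypotheses (ceta : causal eta) (c0 : 0 < c) (ieta : mtin eta (- c%:C)).
Hypothesis factor : forall s, Re s = - c -> MT pD s * MT eta s = MT pN s.

Let meta : lmeas eta := mtin_lmeas ieta.

Let eta_MT f s : l2 mu f -> causal f -> Re s = - c ->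
  mtin (cv eta f) s /\ MT (cv eta f) s = MT eta s * MT f s.
Proof.
move=> lf cf hs; apply: MT_cv meta (l2_meas lf) _ _.
  by apply: mtin_Re ieta; rewrite hs ReN.
by apply: causal_mtin => //; rewrite hs oppr_lt0.
Qed.
Let lmeas_eta f : l2 mu f -> lmeas (cv eta f).
Proof. by move=> lf; apply: lmeas_cv => //; exact: l2_meas lf. Qed.

Let eta_wt f : l2 mu f -> causal f -> l12 (wt c (cv eta f)).
Proof.
move=> lf cf; have ip : cin mu (wt c eta) := ieta.
have [i1 l1] := causal_wt_l12 lf cf c0.
have mc : lmeas (wt c (cv eta f)) by apply: cmeasM (lmeas_cexp _); exact: lmeas_eta.
have e' : \forall t \ae mu, cv (wt c eta) (wt c f) t = wt c (cv eta f) t by apply: ae_mono (wt_cv ip i1).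
split; [exact: cin_ae mc e' (cv_L1 ip i1).1|exact: l2_ae mc e' (cv_L2 ip l1).1].
Qed.

(** A convolution of causal functions is causal. Conversely, on $\Re s=-c$ the image and [cv eta f]
    have equal transforms once [MT pD] is cancelled, and the damped functions are determined by
    them. *)
Lemma causal_iff_conv : causal_op <->
  (forall f, l2 mu f -> causal f -> forall k, TT f k -> \forall t \ae mu, k t = cv eta f t).
Proof.
split=> h f lf cf k hT; last first.
  by apply: ae_mono (h f lf cf k hT) => t -> t0; apply: cv_causal => //; exact: ltW.
have [_ lk] := TT_l2 hT; have h1 := TT_cpart h lf cf hT.
suff e : \forall t \ae mu, cpart k t = cv eta f t.
  by apply: ae_mono2 (ae_cpart (h f lf cf k hT)) e => t -> ->.
apply: (@wt_inj R c); have ck := causal_cpart k.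
apply: l12_FT_inj (causal_wt_l12 (l2_cpart lk) ck c0) (eta_wt lf cf) _.
apply: ae_mono (line_neq0 sD nD (- c)) => u; rewrite rcN !FT_wt => hu.
have hs : Re (- c%:C + ii * u%:C) = - c by rewrite /= !mul0r mulr0 !subr0 addr0.
have := TT_line sN sD nD h1 cf ck c0 hs.
by rewrite (eta_MT lf cf hs).2 -(factor hs) -mulrA => /(mulfI hu).
Qed.

(** Square-integrability is what [line_TT] needs to recognise [cv eta f] as the image: the identity
    on the line always holds. *)
Lemma causal_iff_l2 : causal_op <-> (forall f, l2 mu f -> causal f -> l2 mu (cv eta f)).
Proof.
split=> [/causal_iff_conv h f lf cf|h].
  have [k hT] := TT_ex sN sD habs lf; have [_ lk] := TT_l2 hT.
  exact: l2_ae (lmeas_eta lf) (h f lf cf k hT) lk.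
apply/causal_iff_conv => f lf cf k hT.
apply: (TT_uniq hT); apply: (line_TT sN sD nD habs lf (h f lf cf) cf _ c0); first exact: cv_causal.
by move=> s hs; rewrite (eta_MT lf cf hs).2 -(factor hs) mulrA.
Qed.
End Convolution.
End Causality.

(** * From causality to an inner function *)

Section InnerFunction.
Variable R : realType.
Local Notation C := R[i].
Local Notation mu := (@lebesgue_measure R).
Implicit Types f g k G : R -> C.
Variables pN pD : R -> C.
Hypotheses (sN : sexp pN) (sD : sexp pD) (nD : ~ (\forall t \ae mu, pD t = 0)).
Hypothesis habs : forall u, normc (FT pN u) = normc (FT pD u).
Local Notation TT := (TT pN pD).
Local Notation Th := (Th pN pD).

(** Under $s=iz$ the upper half plane corresponds to $\Re s<0$, where transforms of causal functions
    converge. *)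
Definition Nm (z : C) := MT pN (ii * z).
Definition Dn (z : C) := MT pD (ii * z).

Lemma cdiff_MTi p (z : C) : sexp p -> cdiff (fun z => MT p (ii * z)) z.
Proof.
move=> sp; apply: (cdiff_comp (f := MT p) (g := fun z => ii * z)); first by apply: cdiffZ; exact: cdiff_id.
by eexists; exact: sexp_cdiff sp.
Qed.

Lemma Re_ii (z : C) : Re (ii * z) = - Im z.
Proof. by case: z => a b /=; ring. Qed.
Lemma quotient_boundary u : FT pD u != 0 -> forall e : R, 0 < e -> exists2 d : R, 0 < d &
  forall v, 0 < v < d -> Dn (u +i* v) != 0 /\ normc (Nm (u +i* v) / Dn (u +i* v) - Th u) <= e.
Proof.
move=> hu e e0; have D0 : 0 < normc (Dn u%:C) by rewrite normc_gt0.
have [d1 d10 h1] := cdiff_cont (cdiff_MTi u%:C sD) (divr_gt0 D0 (ltr0n R 2)).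
have [d2 d20 h2] := cdiff_cont (cdiffM (cdiff_MTi u%:C sN) (cdiffV (cdiff_MTi u%:C sD) hu)) e0.
exists (Num.min d1 d2); first by rewrite lt_min d10.
move=> v /andP[v0]; rewrite lt_min => /andP[v1 v2].
have ez : u +i* v = u%:C + ii * v%:C by apply: complexP => /=; ring.
have nv : normc (ii * v%:C) = v by rewrite normcM normc_i mul1r normc_real gtr0_norm.
rewrite ez; split; last by have := h2 (ii * v%:C); rewrite nv; apply.
apply/eqP => h0; have := h1 (ii * v%:C); rewrite nv => /(_ v1).
by rewrite -/(Dn _) h0 sub0r normcN leNgt ltr_pdivrMr // ltr_pMr // ltr1n.
Qed.

Definition inner_extension F := [/\ (forall z : C, 0 < Im z -> cdiff F z),
  (exists M : R, forall z : C, 0 < Im z -> normc (F z) <= M),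
  (forall z : C, 0 < Im z -> Dn z != 0 -> F z = Nm z / Dn z) &
  (\forall u \ae mu, (fun v : R => normc (F (u +i* v))) @ 0^'+ --> (1 : R))].

Lemma causal_cdiff k (z : C) : l2 mu k -> causal k -> 0 < Im z -> cdiff (fun z => MT k (ii * z)) z.
Proof.
move=> lk ck z0; apply: (cdiff_comp (f := MT k) (g := fun z => ii * z)); first by apply: cdiffZ; exact: cdiff_id.
have d0 : 0 < Im z / 2 by rewrite divr_gt0.
eexists; apply: (@MT_cderiv R k (ii * z) (Im z / 2) d0).
  by apply: causal_mtin => //; rewrite ReD Re_ii /=; lra.
by apply: causal_mtin => //; rewrite ReB Re_ii /=; lra.
Qed.

Lemma line_Dn_neq0 (c : R) : \forall u \ae mu, Dn (u +i* c) != 0.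
Proof.
apply: ae_mono (line_neq0 sD nD (- c)) => u; rewrite /Dn.
by rewrite (_ : ii * (u +i* c) = (- c)%:C + ii * u%:C) //; apply: complexP => /=; ring.
Qed.

(** The extension is read off from a single image: [f0] has transform $1/(1-iz)$, so the transform
    of its causal image times $1-iz$ is analytic and agrees with the quotient wherever the
    denominator is nonzero. *)
Lemma causal_inner : causal_op pN pD -> exists F, inner_extension F.
Proof.
move=> hc; pose f0 t : C := (step t)%:C * cexp (-1 * t%:C).
have m1 : Re (-1 : C) < 0 by rewrite ReN /= oppr_lt0.
have [lf0 _] := l2_step_exp m1.
have cf0 (s : C) : causal (fun t => (step t)%:C * cexp (s * t%:C)) by move=> t t0; rewrite stepE ltNge t0 mul0r.
have [k hT'] := TT_ex sN sD habs lf0.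
have hT := TT_cpart hc lf0 (cf0 _) hT'; set k0 := cpart k in hT.
have ck0 : causal k0 := causal_cpart k; have [_ lk0] := TT_l2 hT.
have line z : 0 < Im z -> forall f k, TT f k -> causal f -> causal k -> Dn z * MT k (ii * z) = Nm z * MT f (ii * z).
  by move=> z0 f k1 h cf ck; apply: (TT_line sN sD nD h cf ck z0); exact: Re_ii.
have Mf0 z : 0 < Im z -> 1 - ii * z != 0 /\ MT f0 (ii * z) = (1 - ii * z)^-1.
  move=> z0; have h : 0 < Re (1 - ii * z) by rewrite ReB Re_ii opprK /= addr_gt0.
  split; first by apply/eqP => e; move: h; rewrite e ltxx.
  rewrite -(cexp_step h).2; apply: cI_extR => t; rewrite /f0 -mulrA -cexpD; congr (_ * cexp _); ring.
pose F z := MT k0 (ii * z) * (1 - ii * z).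
have DF z : 0 < Im z -> Dn z * F z = Nm z.
  move=> z0; have [n0 e] := Mf0 z z0.
  by rewrite /F mulrA (line z z0 _ _ hT (cf0 _) ck0) e mulfVK.
have FE z : 0 < Im z -> Dn z != 0 -> F z = Nm z / Dn z by move=> z0 Dz; rewrite -(DF z z0) mulrC mulKf.
have dF z : 0 < Im z -> cdiff F z.
  move=> z0; apply: cdiffM; first exact: causal_cdiff.
  by apply: cdiffB; [exact: cdiff_cst|apply: cdiffZ; exact: cdiff_id].
(* The reproducing kernel at [z] bounds [F z] wherever the denominator does not vanish. *)
have b1 z : 0 < Im z -> Dn z != 0 -> normc (F z) <= 1.
  move=> z0 Dz; set s := ii * z; have s0 : Re s < 0 by rewrite Re_ii oppr_lt0.
  have s0' : Re (conjc s) < 0 by rewrite Re_conj.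
  have [lf Nf] := l2_step_exp s0'; have [lg Ng] := l2_step_exp s0.
  set f := (fun t => _) in lf Nf; set g := (fun t => _) in lg Ng.
  have [k' hk'] := TT_ex sN sD habs lf; have hk := TT_cpart hc lf (cf0 _) hk'.
  set kf := cpart k' in hk; have ckf : causal kf := causal_cpart k'; have [_ lkf] := TT_l2 hk.
  set Q := (- 2 * Re s)^-1 in Ng; rewrite Re_conj -/Q in Nf.
  have Q0 : 0 < Q by rewrite invr_gt0; lra.
  (* The transform of [f] at [s] integrates [f] against its own conjugate, whence the squared
     norm. *)
  have Mf : MT f s = Q%:C.
    rewrite -Nf -cI_conj_N2; apply: cI_extR => t.
    have -> : conjc (f t) = (step t)%:C * cexp (s * t%:C).
      rewrite /f (conjcM (step t)%:C) cexp_conj; congr (_ * cexp _); first by rewrite conjc_real.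
      by rewrite (conjcM (conjc s)) conjcK conjc_real.
    by rewrite /f stepE; case: ifP => _; rewrite ?mul0r ?mul1r.
  have e1 : MT kf s = F z * Q%:C.
    apply: (mulfI Dz); rewrite (line z z0 _ _ hk (cf0 _) ckf) Mf mulrA DF //.
  have e2 : MT kf s = cI mu (fun t => kf t * g t).
    by apply: cI_extR => t; rewrite /g mulrA -causal_step.
  have := cauchy_schwarz lkf lg; rewrite -e2 e1 normcM normc_pos ?(ltW Q0) // Ng exprMn.
  have h2 : N2 mu kf <= Q by rewrite -Nf; exact: TT_N2 hk.
  move=> h3; have := le_trans h3 (ler_wpM2r (ltW Q0) h2).
  rewrite -expr2 -ler_pdivlMr ?exprn_gt0 // divff ?gt_eqF ?exprn_gt0 //.
  by rewrite -[X in _ <= X](expr1n _ 2) ler_pXn2r ?nnegrE ?normc_ge0.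
exists F; split=> //.
(* At a zero of the denominator the bound follows by continuity from points of the same horizontal
   line, almost all of which are not zeros. *)
- exists 1 => z z0; rewrite leNgt; apply/negP => h.
  have e0 : 0 < (normc (F z) - 1) / 2 by rewrite divr_gt0 // subr_gt0.
  have [d d0 hd] := cdiff_cont (dF z z0) e0.
  have dd : Re z < Re z + d / 2 by rewrite ltrDl divr_gt0.
  have [u /andP[u1 u2] Du] := ae_ex dd (line_Dn_neq0 (Im z)).
  have := b1 (u +i* Im z) z0 Du; have := hd (u - Re z)%:C.
  have -> : z + (u - Re z)%:C = u +i* Im z by case: (z) => a b; apply: complexP => /=; ring.
  have uz : normc (u - Re z)%:C < d by rewrite normc_real gtr0_norm ?subr_gt0 //; lra.
  move=> /(_ uz) h1 h2; have := normc_dist_le (F (u +i* Im z)) (F z).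
  rewrite ler_norml => /andP[h3 _]; lra.
- apply: ae_mono (D_neq0 sD nD) => u hu; apply/cvgrPdist_le => e e0.
  have [d d0 hd] := quotient_boundary hu e0; near=> v.
  have hv : 0 < v < d.
    by apply/andP; split; near: v; [exact: nbhs_right_gt|exact: nbhs_right_lt].
  have [h1 h2] := hd v hv; have v0 : 0 < Im (u +i* v) by case/andP: hv.
  rewrite (FE _ v0 h1) -(Th_abs1 habs hu) distrC; apply: le_trans h2; exact: normc_dist_le.
Unshelve. all: by end_near.
Qed.
End InnerFunction.

(** * From an inner function to causality *)

Section InnerImpliesCausal.
Variable R : realType.
Local Notation C := R[i].
Local Notation mu := (@lebesgue_measure R).
Implicit Types f g k G : R -> C.

Lemma ccont_line (F : C -> C) (v : R) : (forall x, cdiff F (x +i* v)) -> ccont (fun x => F (x +i* v)).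
Proof.
move=> h; have hc t (e : R) : 0 < e -> exists2 d : R, 0 < d & forall s, `|s - t| < d -> normc (F (s +i* v) - F (t +i* v)) <= e.
  by move=> e0; apply: ccontat_h => //; exact: cdiff_cont.
split; apply: continuous_eps => t e e0; have [d d0 hd] := hc t e e0; exists d => // s hs.
  by rewrite -ReB; apply: le_trans (Re_le_normc _) (hd s hs).
by rewrite -ImB; apply: le_trans (Im_le_normc _) (hd s hs).
Qed.

Lemma MT_cind (a b : R) (s : C) : a < b -> s != 0 -> MT (cind a b) s = (cexp (s * b%:C) - cexp (s * a%:C)) / s.
Proof.
move=> ab s0; rewrite /MT (@cI_ftc _ (fun t => s^-1 * cexp (s * t%:C))) //; last exact: ccont_cexp.
  by rewrite -mulrBr mulrC.
move=> x; have [h1 h2] := crdZ s^-1 (crd_cexp s) x.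
by rewrite -(mulKf s0 (cexp (s * x%:C))).
Qed.

Variables pN pD : R -> C.
Hypotheses (sN : sexp pN) (sD : sexp pD) (nD : ~ (\forall t \ae mu, pD t = 0)).
Hypothesis habs : forall u, normc (FT pN u) = normc (FT pD u).
Local Notation TT := (TT pN pD).
Local Notation Th := (Th pN pD).
Local Notation Dn := (Dn pD).
Local Notation Nm := (Nm pN).

Section Shift.
Variables (F : C -> C) (M : R) (f G : R -> C) (a b : R).
Hypotheses (dF : forall z : C, 0 < Im z -> cdiff F z) (hM : forall z : C, 0 < Im z -> normc (F z) <= M).
Hypothesis FE : forall z : C, 0 < Im z -> Dn z != 0 -> F z = Nm z / Dn z.
Hypotheses (lf : l2 mu f) (cf : causal f) (hG : isFT f G) (a0 : 0 <= a) (ab : a < b).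
Let g := cind a b.
Let lg : l2 mu g := l2_cind a b.
Let cg : causal g.
Proof. by move=> t t0; rewrite /g cindE ifF //; apply/negbTE; rewrite negb_and -leNgt (le_trans t0 a0). Qed.

(** Analytic in the upper half plane; at height [c] it is [F] times the Fourier transforms of two
    damped functions, hence integrable along the line. *)
Let W z := F z * (MT f (ii * z) * MT g (ii * z)).
Let Wline (c u : R) : W (u +i* c) = F (u +i* c) * (FT (wt c f) u * FT (wt c g) u).
Proof.
by rewrite !FT_wt /W (_ : ii * (u +i* c) = - c%:C + ii * u%:C) //; apply: complexP => /=; ring.
Qed.

Let mF c : 0 < c -> lmeas (fun u => F (u +i* c)).
Proof. by move=> c0; apply: ccont_lmeas; apply: ccont_line => x; exact: dF. Qed.
Let FTw p c : l2 mu p -> causal p -> 0 < c -> [/\ l2 mu (FT (wt c p)), N2 mu (FT (wt c p)) <= 2 * pi * N2 mu p & isFT (wt c p) (FT (wt c p))].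
Proof.
move=> lp cp c0; have h := causal_wt_l12 lp cp c0; have [h1 h2] := bessel h; split=> //; last exact: isFT_FT.
by apply: le_trans h2 _; rewrite ler_pM2l ?mulr_gt0 ?pi_gt0 //; exact: (causal_wt lp cp (ltW c0)).2.
Qed.
Let M0 : 0 <= M.
Proof. by apply: le_trans (normc_ge0 (F 'i)) (hM _) => /=. Qed.
Let lFf c : 0 < c -> l2 mu (fun u => F (u +i* c) * FT (wt c f) u) /\
  N2 mu (fun u => F (u +i* c) * FT (wt c f) u) <= M ^+ 2 * (2 * pi * N2 mu f).
Proof.
move=> c0; have [h1 h2 _] := FTw lf cf c0; have hb u : normc (F (u +i* c)) <= M by exact: hM.
split; first exact: l2_bM (mF c0) hb h1.
by apply: le_trans (N2_bM (mF c0) hb h1) _; apply: ler_wpM2l; [exact: sqr_ge0|].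
Qed.

Let iW c : 0 < c -> cin mu (fun u => W (u +i* c)).
Proof.
move=> c0; have [h1 _ _] := FTw lg cg c0.
by apply: cin_extR (cin_l2 (lFf c0).1 h1) => u; rewrite Wline mulrA.
Qed.

(** Horizontal decay comes from the interval, whose transform is at most $2/|x|$; [F] and the
    transform of [f] are bounded above the lower line. *)
Let Wshift c d : 0 < c -> c < d -> cI mu (fun u => W (u +i* c)) = cI mu (fun u => W (u +i* d)).
Proof.
move=> c0 cd; apply: contour_shift => //; [|  |exact: iW|exact: iW (lt_trans c0 cd)].
  move=> z /andP[z1 _]; have z0 : 0 < Im z by exact: lt_le_trans z1.
  apply: cdiffM; first exact: dF.
  by apply: cdiffM; exact: causal_cdiff.
move=> e e0; have [iw _] := causal_wt_l12 lf cf c0.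
set A := rI mu (fun t => normc (wt c f t)).
have A0 : 0 <= A by apply: rI_ge0 => t; exact: normc_ge0.
exists (M * A * 2 / e + 1) => x y hx /andP[y1 y2]; have y0 : 0 < y by exact: lt_le_trans y1.
have x0 : 0 < `|x| by apply: lt_le_trans hx; rewrite ltr_wpDl // divr_ge0 ?(ltW e0) // !mulr_ge0.
have h1 : normc (MT f (ii * (x +i* y))) <= A.
  have hs : Re (ii * (x +i* y)) = - y by rewrite Re_ii.
  have im : mtin f (ii * (x +i* y)) by apply: causal_mtin => //; rewrite hs oppr_lt0.
  apply: normc_cI_le im (cin_norm iw) _ => t; rewrite /wt !normcM_cexp hs.
  case: (leP t 0) => ht; first by rewrite cf // normc0 !mul0r.
  apply: ler_wpM2l; first exact: normc_ge0.
  by rewrite ler_expR ReN /= !mulNr lerN2 ler_wpM2r // ltW.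
have s0 : ii * (x +i* y) != 0 :> C.
  rewrite -normc_gt0 normcM normc_i mul1r; apply: lt_le_trans (Re_le_normc _); exact: x0.
have h2 : normc (MT g (ii * (x +i* y))) <= 2 / `|x|.
  rewrite /g MT_cind // normcM normcV; apply: ler_pM; rewrite ?normc_ge0 ?invr_ge0 ?normc_ge0 //.
    apply: le_trans (normcB _ _) _; rewrite -[2]/(1 + 1); apply: lerD; rewrite normc_cexp_st Re_ii /= -[leRHS]expR0 ler_expR mulNr oppr_le0.
      by rewrite mulr_ge0 ?(ltW y0) // (le_trans a0) // ltW.
    by rewrite mulr_ge0 ?(ltW y0).
  rewrite lef_pV2 ?posrE ?normc_gt0 //.
  by rewrite normcM normc_i mul1r; exact: (Re_le_normc (x +i* y)).
have h3 : normc (F (x +i* y)) <= M by exact: hM.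
rewrite /W !normcM; apply: le_trans (ler_pM (normc_ge0 _) (mulr_ge0 (normc_ge0 _) (normc_ge0 _)) h3 (ler_pM (normc_ge0 _) (normc_ge0 _) h1 h2)) _.
have h4 : M * A * 2 / e <= `|x| by apply: le_trans hx; rewrite lerDl.
by rewrite ler_pdivrMr // in h4; rewrite !mulrA ler_pdivrMr // [e * _]mulrC.
Qed.

(** At height [d] the damped indicator has squared norm at most $\int_0^\infty e^{-2dt}dt=1/(2d)$,
    and the integral does not depend on the height. *)
Let W0 c : 0 < c -> cI mu (fun u => W (u +i* c)) = 0.
Proof.
move=> c0; set I := cI _ _; apply/eqP; rewrite -normc_eq0 -(sqrf_eq0 (normc I)) eq_le sqr_ge0 andbT.
pose K := M ^+ 2 * (2 * pi * N2 mu f) * (2 * pi).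
have K0 : 0 <= K by rewrite !mulr_ge0 ?sqr_ge0 ?N2_ge0 ?pi_ge0.
have bd d : c < d -> normc I ^+ 2 <= K * (2 * d)^-1.
  move=> cd; have d0 := lt_trans c0 cd; rewrite /I (Wshift c0 cd).
  have e u : W (u +i* d) = (F (u +i* d) * FT (wt d f) u) * FT (wt d g) u by rewrite Wline mulrA.
  rewrite (cI_extR e); have [l1 n1] := lFf d0; have [l2' _ isf] := FTw lg cg d0.
  apply: le_trans (cauchy_schwarz l1 l2') _; rewrite (isFT_N2 isf) /K -[leRHS]mulrA.
  apply: ler_pM => //; [exact: N2_ge0|by rewrite !mulr_ge0 ?N2_ge0 ?pi_ge0|].
  apply: ler_wpM2l; first by rewrite mulr_ge0 ?pi_ge0.
  have md : Re (- d%:C : C) < 0 by rewrite ReN /= oppr_lt0.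
  have [ls Ns] := l2_step_exp md.
  have [lw _ _] := isf; have := N2_le lw ls.
  rewrite Ns ReN /= mulrNN; apply=> t.
  rewrite /wt !normcM_cexp; apply: ler_wpM2r; first exact: expR_ge0.
  rewrite /g cindE stepE; case: ifP => [/andP[t1 _]|_]; last by rewrite normc0 normc_ge0.
  by rewrite ifT // (le_lt_trans a0).
rewrite leNgt; apply/negP => I0.
(* At this height $K/(2d)$ is already below $|I|^2$. *)
have := bd (c + K / normc I ^+ 2); rewrite ltrDl divr_gt0 //; last first.
  rewrite lt_def K0 andbT; apply/eqP => k0; have := bd (c + 1); rewrite k0 mul0r ltrDl ltr01 => /(_ isT).
  by rewrite leNgt I0.
move=> /(_ isT); set J := normc I ^+ 2 in I0 *; rewrite leNgt => /negP; apply.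
have p : 0 < 2 * (c + K / J) by rewrite mulr_gt0 // ltr_wpDr // divr_ge0 // ltW.
rewrite ltr_pdivrMr // mulrCA mulrDr mulrCA divff ?gt_eqF // mulr1.
have : 0 < J * c by exact: mulr_gt0. by lra.
Qed.

(** As the height tends to 0 the damped transforms converge in L^2 by Plancherel's identity, while
    [F] stays bounded and tends to [Th] off the zeros of the denominator. *)
Lemma boundary_pairing : cI mu (fun u => Th u * G u * FT g u) = 0.
Proof.
pose c n : R := n.+1%:R^-1; have c0 n : 0 < c n by rewrite invr_gt0 ltr0n.
have [_ lG _] := hG; have [lTG _] := l2_Th sN sD habs lG.
have l12g : l12 g := l12_cind a b; have [lFg _] := bessel l12g.
have wcvg p P : l2 mu p -> causal p -> isFT p P -> (fun n => N2 mu (fun u => FT (wt (c n) p) u - P u)) @ \oo --> (0 : R).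
  move=> lp cp hP; have h : l2cvg mu (fun n => wt (c n) p) p.
    apply: (l2cvg_dom _ lp) => [n|n t|t].
    - exact: l2_meas (causal_wt lp cp (ltW (c0 n))).1.
    - rewrite /wt normcM_cexp; case: (leP t 0) => ht; first by rewrite cp // normc0 mul0r.
      by rewrite ler_piMr ?normc_ge0 // -[leRHS]expR0 ler_expR ReN /= mulNr oppr_le0 mulr_ge0 // ltW.
    - apply: (ccvg_le (e := fun n => normc (p t) * (`|t| * expR `|t|) * c n)) => [n|]; last by apply: cvg0_const_mul; exact: cvg_harmonic.
      rewrite /wt -[X in _ - X]mulr1 -mulrBr normcM -mulrA; apply: ler_wpM2l; first exact: normc_ge0.
      apply: le_trans (cexp_sub1 _) _; rewrite mulNr normcN -rcM normc_real normrM (gtr0_norm (c0 n)).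
      rewrite [leRHS]mulrC mulrA; apply: ler_wpM2l; first by rewrite mulr_ge0 // ltW.
      by rewrite ler_expR ler_piMl // /c invf_le1 ?ltr0n // ler1n.
  have e n : N2 mu (fun u => FT (wt (c n) p) u - P u) = 2 * pi * N2 mu (fun t => wt (c n) p t - p t).
    by rewrite -(isFT_N2 (isFTB (let: And3 _ _ x := FTw lp cp (c0 n) in x) hP)).
  by rewrite (funext e); apply: cvg0_const_mul.
have cvf := wcvg f G lf cf hG; have cvg' := wcvg g (FT g) lg cg (isFT_FT l12g).
pose A n u := F (u +i* c n) * FT (wt (c n) f) u.
have hFM n u : normc (F (u +i* c n)) <= M by apply: hM; exact: c0.
have cvA : l2cvg mu A (fun u => Th u * G u).
  have lX n : l2 mu (fun u => F (u +i* c n) * (FT (wt (c n) f) u - G u)).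
    by apply: l2_bM (mF (c0 n)) (hFM n) _; apply: l2B => //; have [] := FTw lf cf (c0 n).
  have mY n : lmeas (fun u => F (u +i* c n) - Th u) by apply: cmeasB; [exact: mF|exact: lmeas_Th].
  have bY n u : normc (F (u +i* c n) - Th u) <= M + 1.
    by apply: le_trans (normcB _ _) _; apply: lerD; [exact: hFM|exact: Th_le1].
  have lY n : l2 mu (fun u => (F (u +i* c n) - Th u) * G u) by exact: l2_bM (mY n) (bY n) lG.
  apply: (@cvg0_squeeze _ _ (fun n => 2 * (M ^+ 2 * N2 mu (fun u => FT (wt (c n) f) u - G u)) + 2 * N2 mu (fun u => (F (u +i* c n) - Th u) * G u))).
    move=> n; rewrite N2_ge0 /=.
    have e u : A n u - Th u * G u = F (u +i* c n) * (FT (wt (c n) f) u - G u) + (F (u +i* c n) - Th u) * G u.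
      by rewrite /A; ring.
    rewrite (N2_ext mu e); apply: le_trans (N2D (lX n) (lY n)) _; apply: lerD => //.
    rewrite ler_pM2l //; apply: N2_bM (mF (c0 n)) (hFM n) _; apply: l2B => //; by have [] := FTw lf cf (c0 n).
  apply: cvg0_add; first by apply: cvg0_const_mul; exact: cvg0_const_mul.
  apply: cvg0_const_mul.
  have := @rI_dct _ _ _ mu (fun n u => normc ((F (u +i* c n) - Th u) * G u) ^+ 2) (fun=> 0) (fun u => (M + 1) ^+ 2 * normc (G u) ^+ 2).
  have z0 : rI mu (fun=> 0 : R) = 0 by have := rIZ 0 (rin0 mu); rewrite mul0r => ->; rewrite mul0r.
  rewrite z0 => h; apply: (h _ _ _ _ _).2.
  - by move=> n; apply: measurable_funX; apply: cmeas_normc; exact: l2_meas (lY n).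
  - exact: measurable_cst.
  - apply: ae_mono (D_neq0 sD nD) => u hu.
    apply: (@cvg0_squeeze _ _ (fun n => (M + 1) * normc (G u) ^+ 2 * normc (F (u +i* c n) - Th u))).
      move=> n; rewrite sqr_ge0 /= normcM exprMn expr2 [leRHS](_ : _ = (M + 1) * normc (F (u +i* c n) - Th u) * normc (G u) ^+ 2); last by ring.
      by apply: ler_wpM2r; [exact: sqr_ge0|apply: ler_wpM2r; [exact: normc_ge0|exact: bY]].
    apply: cvg0_const_mul; suff : ccvg (fun n => F (u +i* c n)) (Th u) by [].
    apply: ccvg_eps => e e0; have [d d0 hd] := quotient_boundary sN sD hu e0.
    have /cvgrPdist_lt/(_ _ d0)[N _ hN] := @cvg_harmonic R; exists N => n hn.
    have := hN n hn; rewrite sub0r normrN /harmonic /= (gtr0_norm (c0 n)) => cn.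
    have [|h1 h2] := hd (c n); first by rewrite c0 cn.
    by rewrite (FE (c0 n : 0 < Im (u +i* c n)) h1).
  - by apply: rinZ; have [] := lG.
  - move=> n u; rewrite ger0_norm ?sqr_ge0 // normcM exprMn; apply: ler_wpM2r; first exact: sqr_ge0.
    by rewrite ler_pXn2r ?nnegrE ?normc_ge0 ?bY // addr_ge0.
have lim := l2cvg_cI (fun n => (lFf (c0 n)).1) lTG lFg cvA.
apply: ccvg_uniq lim _.
apply: (ccvg_le (e := fun n => normc (cI mu (fun u => A n u * FT g u)))) => [n|]; first by rewrite subr0.
apply: sqr_cvg0 => [n|]; first exact: normc_ge0.
apply: (@cvg0_squeeze _ _ (fun n => M ^+ 2 * (2 * pi * N2 mu f) * N2 mu (fun u => FT (wt (c n) g) u - FT g u))); last exact: cvg0_const_mul.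
move=> n; rewrite sqr_ge0 /=.
have [lgn _ _] := FTw lg cg (c0 n).
have [lA nA] := lFf (c0 n); have lB := l2B lgn lFg.
(* The first term integrates to 0; what remains is the effect of damping [g], small in L^2. *)
have e u : A n u * FT g u = W (u +i* c n) - A n u * (FT (wt (c n) g) u - FT g u) by rewrite Wline /A; ring.
rewrite (cI_extR e) cIB; [|exact: iW|exact: cin_l2 lA lB].
rewrite W0 // sub0r normcN; apply: le_trans (cauchy_schwarz lA lB) _.
by apply: ler_wpM2r => //; exact: N2_ge0.
Qed.
End Shift.

(** By inversion the vanishing pairing is $2\pi$ times the integral of the image over a reflected
    interval, and such integrals determine the image on the negative axis. *)
Lemma inner_causal F : inner_extension pN pD F -> causal_op pN pD.
Proof.
case=> dF [M hM] FE _ f lf cf k [G [hG hk]]; have [lk _ _] := hk.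
have claim a b : 0 <= a -> a < b -> cI mu (fun t => cind a b t * k (- t)) = 0.
  move=> a0 ab; have l12g := l12_cind a b; have h := isFT_FT l12g.
  have mk : lmeas (fun t => k t * ((2 * pi)%:C * cind a b (- t))).
    apply: cmeasM (l2_meas lk) _; apply: cmeasM; [exact: cmeas_cst|exact: l2_meas (l2_opp (l2_cind a b))].
  have := isFT_pair hk (isFT_inv h).
  rewrite (boundary_pairing dF hM FE lf cf hG a0 ab) => /esym; rewrite -(cI_opp mk).
  have e t : k (- t) * ((2 * pi)%:C * cind a b (- - t)) = (2 * pi)%:C * (cind a b t * k (- t)) by rewrite opprK; ring.
  rewrite (cI_extR e) cIZ; last by apply: cin_l2; [exact: l2_cind|exact: l2_opp].
  by move/eqP; rewrite mulf_eq0 rc_eq0 gt_eqF ?mulr_gt0 ?pi_gt0 //= => /eqP.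
have lk2 := l2_cpart (l2_opp lk).
have z : \forall t \ae mu, cpart (fun t => k (- t)) t = 0.
  apply: l2_itv_eq lk2 (l20 _) _ => a b ab.
  rewrite [RHS](_ : _ = 0); last by rewrite -[RHS](cI0 mu); apply: cI_extR => t; rewrite mulr0.
  (* Only the positive part of the interval meets the causal part of the reflected image, so [claim]
     applies. *)
  have e t : cind a b t * cpart (fun t => k (- t)) t = cind (Num.max a 0) (Num.max b 0) t * k (- t).
    rewrite /cpart stepE !cindE gt_max le_max.
    by case: (ltP 0 t) => ht; rewrite ?andbT ?andbF ?orbF ?mulr1 ?mulr0 ?mul0r // leNgt ht orbF.
  rewrite (cI_extR e); case: (ltP (Num.max a 0) (Num.max b 0)) => h.
    by apply: claim => //; rewrite le_max lexx orbT.
  rewrite -[RHS](cI0 mu); apply: cI_extR => t; rewrite cindE ifF ?mul0r //.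
  by apply/negP => /andP[h1 h2]; have := lt_le_trans h1 (le_trans h2 h); rewrite ltxx.
have lo := l2_opp lk2.
have N0 : N2 mu (fun t => cpart (fun t => k (- t)) (- t)) = 0.
  rewrite (N2_opp (l2_meas lk2)) (N2_ae (l2_meas lk2) (@cmeas_cst R _ (measurableTypeR R) 0) z) /N2.
  have := rIZ 0 (rin0 mu); rewrite mul0r => e0; rewrite (_ : (fun _ => _) = fun _ : R => (0 : R)); first by rewrite e0 mul0r.
  by apply/funext => t; rewrite normc0 expr0n.
apply: ae_mono (N2_eq0 lo N0) => t; rewrite /cpart opprK stepE => h ht.
by move: h; rewrite oppr_gt0 ht mulr1.
Qed.
End InnerImpliesCausal.

(** * The kernel of the convolution *)

Section BetaIntegral.
Variable R : realType.
Local Notation C := R[i].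
Local Notation mu := (@lebesgue_measure R).
Variables (w : R) (w0 : 0 < w).

Definition gker (y : R) : R := step y * (y `^ (w - 1) * expR (- y)).
(** With $x=e^{-v}$ this is the factor $(1-x)^{w-1}$ of Euler's Beta integral: its transform at $-z$
    is $B(z,w)$. *)
Definition beta (v : R) : R := step v * (1 - expR (- v)) `^ (w - 1).
Definition betaC (v : R) : C := (beta v)%:C.

Lemma rmeas_powR (g : R -> R) a : rmeas g -> rmeas (fun x => g x `^ a).
Proof. by move=> mg; apply: (measurableT_comp (measurable_powR a)). Qed.
Lemma rmeas_expR_comp (g : R -> R) : rmeas g -> rmeas (fun x => expR (g x)).
Proof. by move=> mg; apply: (measurableT_comp (@measurable_expR R)). Qed.
Lemma rmeas_step_comp (g : R -> R) : rmeas g -> rmeas (fun x => step (g x)).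
Proof. by move=> mg; apply: (measurableT_comp (@rmeas_step R)). Qed.

Lemma rmeas_gker : rmeas gker.
Proof.
apply: measurable_funM; first exact: rmeas_step.
apply: measurable_funM; first exact: measurable_powR.
by apply: rmeas_expR_comp; exact: rmeas_opp.
Qed.
Lemma rmeas_beta : rmeas beta.
Proof.
apply: measurable_funM; first exact: rmeas_step.
by apply: rmeas_powR; apply: measurable_funB => //; apply: rmeas_expR_comp; exact: rmeas_opp.
Qed.
Lemma beta_ge0 v : 0 <= beta v.
Proof. by rewrite mulr_ge0 ?powR_ge0 // stepE; case: ifP. Qed.
Lemma GammaR_gker : GammaR w = rI mu gker.
Proof.
rewrite /GammaR Rintegral_rI; last exact: measurable_itv.
congr rI; apply/funext => y; congr (_ * _); rewrite indicE /step indicE //.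
Qed.

Lemma ln_transfer (g f : R -> R) : rmeas f -> (forall x, 0 < x -> g x = expR (- ln x) * f (ln x)) ->
  (forall x, x <= 0 -> g x = 0) -> rI mu f = rI mu g /\ (rin mu f <-> rin mu g).
Proof.
move=> mf h1 h2; have e : (fun x => (if 0 < x then expR (- ln x) else 0) * f (ln x)) = g.
  by apply/funext => x; case: ltP => hx; [rewrite h1|rewrite mul0r h2].
by split; [rewrite (subst_rI (ln_substitutes R) mf) e|rewrite (subst_rin (ln_substitutes R) mf) e].
Qed.

Definition gexp v : R := expR (w * v) * expR (- expR v).
Lemma rmeas_gexp : rmeas gexp.
Proof.
apply: measurable_funM; apply: rmeas_expR_comp; first exact: measurable_funM.
by apply: (measurableT_comp (@oppr_measurable R setT)); exact: measurable_expR.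
Qed.
Lemma gexpC v : (gexp v)%:C = Eg v * cexp (w%:C * v%:C).
Proof. by rewrite /Eg -rcM cexp_real -rcM mulrC. Qed.

Lemma rin_gker : rin mu gker /\ (rI mu gker)%:C = MT (@Eg R) w%:C.
Proof.
have wR : 0 < Re w%:C by [].
have fi : rin mu gexp by have := cin_Re (mtin_Eg wR); rewrite (_ : (fun x => Re _) = gexp) //; apply/funext => v; rewrite -gexpC.
have H x : 0 < x -> gker x = expR (- ln x) * gexp (ln x).
  move=> x0; rewrite /gker /gexp stepE x0 mul1r lnK // mulrA -expRD /powR gt_eqF //; congr (expR _ * _); ring.
have H0 x : x <= 0 -> gker x = 0 by move=> x0; rewrite /gker stepE ltNge x0 mul0r.
have [h1 h2] := ln_transfer rmeas_gexp H H0.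
split; first exact/h2.
by rewrite -h1 -cI_real; apply: cI_extR => v; exact: gexpC.
Qed.

(** The factorization $e^t-e^x=e^t(1-e^{x-t})$ splits the power in the Gamma integrand. After
    $u=e^t-e^x$ the integral over [t] becomes $e^{-e^x}\Gamma(w)$. *)
Lemma gexp_beta x t : gexp t * beta (t - x) = expR (- expR x) * (expR t * gker (expR t - expR x)).
Proof.
rewrite /gker /beta !stepE !subr_gt0 ltr_expR; case: ltP => h; last by rewrite !mul0r !mulr0.
rewrite !mul1r opprB.
have -> : expR t - expR x = expR t * (1 - expR (x - t)) by rewrite mulrBr mulr1 -expRD addrCA subrr addr0.
have b0 : 0 <= 1 - expR (x - t) by rewrite subr_ge0 -[leRHS]expR0 ler_expR subr_le0 ltW.
rewrite powRM ?expR_ge0 // -expRM /gexp.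
have -> : expR t * (1 - expR (x - t)) = expR t - expR x by rewrite mulrBr mulr1 -expRD addrCA subrr addr0.
have e : expR (w * t) * expR (- expR t) = expR (- expR x) * expR t * expR (t * (w - 1)) * expR (- (expR t - expR x)).
  by rewrite -!expRD; congr expR; ring.
by rewrite e; ring.
Qed.

Lemma gexp_beta_int x : rin mu (fun t => gexp t * beta (t - x)) /\
  rI mu (fun t => gexp t * beta (t - x)) = expR (- expR x) * rI mu gker.
Proof.
have [gi _] := rin_gker; pose P t := expR t * gker (expR t - expR x).
have mP : rmeas P.
  apply: measurable_funM; first exact: measurable_expR.
  by apply: (measurableT_comp rmeas_gker); apply: measurable_funB => //; exact: measurable_expR.
have H u : 0 < u -> gker (u + - expR x) = expR (- ln u) * P (ln u).
  by move=> u0; rewrite /P lnK // mulrA expRN lnK // mulVf ?mul1r // gt_eqF.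
have H0 u : u <= 0 -> gker (u + - expR x) = 0.
  move=> u0; rewrite /gker stepE ltNge subr_le0 (le_trans u0) ?expR_ge0 ?mul0r //.
have [h1 h2] := ln_transfer mP H H0.
have iP : rin mu P by apply/h2; exact: rin_shift.
have e : (fun t => gexp t * beta (t - x)) = (fun t => expR (- expR x) * P t) by apply/funext => t; exact: gexp_beta.
by rewrite e; split; [exact: rinZ|rewrite rIZ // h1 rI_shift //; exact: rmeas_gker].
Qed.

(** For $w<1$ the function is unbounded near 0, and its integrability is extracted from Tonelli's
    theorem: the inner integrals of [g] in one order form a Gamma integrand, so almost every section
    in the other order is integrable. *)
Lemma rin_beta (al : R) : 0 < al -> rin mu (fun v => beta v * expR (- al * v)).
Proof.
move=> a0; pose g (z : measurableTypeR R * measurableTypeR R) := gexp z.2 * beta (z.2 - z.1) * expR (al * z.1).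
have ga : 0 < Re al%:C by [].
have mg : measurable_fun setT g.
  apply: measurable_funM.
    apply: measurable_funM; first exact: (measurableT_comp rmeas_gexp (@measurable_snd2 R)).
    exact: (measurableT_comp rmeas_beta (@measurable_subst R)).
  apply: (measurableT_comp (@measurable_expR R)); apply: measurable_funM => //; exact: measurable_fst1.
have i1 x : rin mu (fun y => g (x, y)).
  have := rinZ (expR (al * x)) (gexp_beta_int x).1.
  by rewrite (_ : (fun t => _ * _) = fun y => g (x, y)) //; apply/funext => t; rewrite mulrC.
have ei x : rI mu (fun y => g (x, y)) = rI mu gker * normc (Eg x * cexp (al%:C * x%:C)).
  rewrite normcM_cexp normc_pos ?expR_ge0 //= mulrA [rI mu gker * _]mulrC -(gexp_beta_int x).2 [RHS]mulrC -(rIZ _ (gexp_beta_int x).1).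
  by congr rI; apply/funext => y; rewrite /g mulrC.
have gp := @rin_prod R _ _ _ _ mu mu g mg _ (aeW _ i1) _.
have {}gp : rin (mu \x mu)%E g.
  apply: gp => [z|].
    apply: mulr_ge0 (expR_ge0 _); apply: mulr_ge0 (beta_ge0 _); exact: mulr_ge0 (expR_ge0 _) (expR_ge0 _).
  by rewrite (funext ei); apply: rinZ; apply: cin_norm; exact: mtin_Eg.
have [h _ _] := rin_fubini (rin_swap gp).
(* One good section is enough: after $x=t-v$ it is a positive multiple of the function in
   question. *)
have [t _ ht] := ae_ex (ltr01 : 0 < 1 :> R) h.
have kt : 0 < gexp t by rewrite mulr_gt0 ?expR_gt0.
have := rinZ ((gexp t)^-1 * expR (- (al * t))) (rin_csub t ht).
rewrite (_ : (fun x => _ * _) = fun v => beta v * expR (- al * v)) //.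
apply/funext => v; rewrite /g /= subKr.
have -> : expR (- al * v) = expR (- (al * t)) * expR (al * (t - v)) by rewrite -expRD; congr expR; ring.
by field; rewrite gt_eqF.
Qed.

Lemma mtin_beta z : 0 < Re z -> mtin betaC (- z).
Proof.
move=> z0; have h : mtin betaC (- (Re z)%:C).
  apply: cin_extR (cin_real (rin_beta z0)) => v.
  by rewrite rcM /betaC -cexp_real -rcN -rcM.
by apply: mtin_Re h; rewrite !ReN.
Qed.

(** Euler's relation $\Gamma(z+w)B(z,w)=\Gamma(w)\Gamma(z)$, as the transform of a convolution
    identity: $e^{wt}e^{-e^t}$ convolved with the reflected [beta] is $\Gamma(w)e^{-e^x}$. *)
Lemma Beta_Gamma z : 0 < Re z -> MT (@Eg R) (z + w%:C) * MT betaC (- z) = (GammaR w)%:C * MT (@Eg R) z.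
Proof.
move=> z0; pose kC t := (gexp t)%:C : C; pose bN v := betaC (- v).
have ek : kC = fun t => Eg t * cexp (w%:C * t%:C) by apply/funext => t; exact: gexpC.
have mb : lmeas betaC := mtin_lmeas (mtin_beta z0).
have mbN : lmeas bN := lmeas_comp mb (@rmeas_opp R).
have ib : cin mu (fun v => betaC v * cexp (- z * v%:C)) := mtin_beta z0.
have eb v : betaC (- v) * cexp (- z * (- v)%:C) = bN v * cexp (z * v%:C).
  by congr (_ * cexp _); rewrite rcN; ring.
have ibN : mtin bN z by exact: cin_extR eb (cin_opp ib).
have ik : mtin kC z.
  have h1 : mtin (@Eg R) (w%:C + z) by apply: mtin_Eg; rewrite ReD addr_gt0.
  rewrite ek; exact: (mtin_expM (@Eg R) w%:C z).1 h1.
have mk : lmeas kC := mtin_lmeas ik.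
have [_ h] := MT_cv mk mbN ik ibN.
have -> : MT betaC (- z) = MT bN z by rewrite /MT -(cI_opp (cin_meas ib)); exact: cI_extR.
have -> : MT (@Eg R) (z + w%:C) = MT kC z by rewrite ek MT_expM addrC.
rewrite -h GammaR_gker.
have ec x : cv kC bN x = (rI mu gker)%:C * Eg x.
  have e t : kC t * bN (x - t) = (gexp t * beta (t - x))%:C by rewrite rcM /bN opprB.
  by rewrite /cv (cI_extR e) cI_real (gexp_beta_int x).2 rcM mulrC.
rewrite /MT (cI_extR (fun t => congr1 (fun y => y * _) (ec t))).
rewrite -(cIZ _ (mtin_Eg z0)); apply: cI_extR => t; by rewrite mulrA.
Qed.

Lemma Gamma_w_neq0 : (GammaR w)%:C != 0 :> C.
Proof.
rewrite GammaR_gker rin_gker.2 /MT -(cI_extR gexpC) cI_real rc_eq0 gt_eqF //.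
have wR : 0 < Re w%:C by [].
have fi : rin mu gexp by have := cin_Re (mtin_Eg wR); rewrite (_ : (fun x => Re _) = gexp) //; apply/funext => v; rewrite -gexpC.
pose k := expR (- expR (1 : R)).
have h1 : rI mu (fun t => \1_(`]0, 1]%classic) t * k) = k.
  have dk x : is_derive x (1 : R) (fun t => k * t) k by apply: is_derive_eq; rewrite /GRing.scale /= mulr1.
  have ck : continuous (fun _ : R => k) by move=> x; exact: cst_continuous.
  by rewrite (rI_ftc ltr01 dk ck) mulr1 mulr0 subr0.
have ii1 := rin_itv (R := R) 0 1 false false.
have h2 : rin mu (fun t => \1_(`]0, 1]%classic) t * k).
  by rewrite (_ : (fun t => _) = fun t => k * \1_(`]0, 1]%classic) t); [exact: rinZ|apply/funext => t; rewrite mulrC].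
apply: (@lt_le_trans _ _ k); first exact: expR_gt0.
rewrite -[leLHS]h1; apply: (rI_le h2 fi) => t; rewrite indicE; case: (boolP (t \in _)); rewrite ?mul1r ?mul0r.
  rewrite inE /= in_itv /= => /andP[t0 t1]; rewrite /gexp /k -[leLHS]mul1r; apply: ler_pM => //; rewrite ?expR_ge0 //.
    by rewrite -[leLHS]expR0 ler_expR mulr_ge0 // ltW.
  by rewrite ler_expR lerN2 ler_expR.
by move=> _; rewrite mulr_ge0 ?expR_ge0.
Qed.
End BetaIntegral.

(** * The transform of $g_\omega$ *)

Section LocalFactor.
Variable R : realType.
Local Notation C := R[i].
Local Notation mu := (@lebesgue_measure R).
Variables (w : R) (w0 : 0 < w).
Local Notation beta := (beta w).
Local Notation betaC := (betaC w).

Definition ge (t : R) : R := g_w w (expR (- t)).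
Definition geC (t : R) : C := (ge t)%:C.
(** The inner integrand of $g_\omega$ after $x=e^{-v}$; the exponent $3/2-w$ is $1/2-w$ plus 1 from
    $dx$. [Jr] is its convolution with the step function. *)
Definition bJ (v : R) : R := beta v * expR (- (3/2 - w) * v).
Definition Jr (r : R) : R := rI mu (fun v => bJ v * step (r - v)).

Lemma rmeas_bJ : rmeas bJ.
Proof. by apply: measurable_funM; [exact: rmeas_beta|apply: rmeas_expR_comp; exact: measurable_funM]. Qed.

Lemma g_w_inner t : Rintegral mu `](expR (- t)) ^+ 2, 1[ (fun x => x `^ (2^-1 - w) * (1 - x) `^ (w - 1)) = Jr (2 * t).
Proof.
rewrite Rintegral_rI; last exact: measurable_itv.
pose f v := bJ v * step (2 * t - v).
have mf : rmeas f.
  by apply: measurable_funM; [exact: rmeas_bJ|apply: rmeas_step_comp; exact: rmeas_csub].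
have mfo : rmeas (fun y => f (- y)) by apply: (measurableT_comp mf); exact: rmeas_opp.
rewrite /Jr -/f -(rI_opp mf).
pose G (x : R) : R := \1_(`](expR (- t)) ^+ 2, 1[%classic) x * (x `^ (2^-1 - w) * (1 - x) `^ (w - 1)).
have e2 : expR (- t) ^+ 2 = expR (- (2 * t)) by rewrite -expRM_natl mulrN.
have H x : 0 < x -> G x = expR (- ln x) * f (- ln x).
  move=> x0; rewrite /G /f /bJ /beta !stepE oppr_gt0 subr_gt0 opprK lnK // e2.
  have l1 : (ln x < 0) = (x < 1) by rewrite -{2}(lnK x0) -[X in _ = (_ < X)]expR0 ltr_expR.
  have l2 : (- ln x < 2 * t) = (expR (- (2 * t)) < x) by rewrite -{2}(lnK x0) ltr_expR ltrNl.
  have hm : (x \in `](expR (- (2 * t))), 1[%classic) = (expR (- (2 * t)) < x) && (x < 1).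
    by apply/idP/idP; rewrite inE /= in_itv.
  rewrite l1 l2 indicE hm; case: (_ < x); case: (x < 1); rewrite /= ?mul0r ?mulr0 ?mul0r ?mulr0 //.
  rewrite !mul1r mulr1 mulrCA -expRD mulrC; congr (_ * _).
  by rewrite /powR gt_eqF //; congr expR; lra.
have H0 x : x <= 0 -> G x = 0.
  move=> x0; rewrite /G indicE memNset ?mul0r // /= in_itv /= => /andP[h _].
  by have := lt_le_trans h x0; rewrite ltNge sqr_ge0.
by have [h _] := ln_transfer mfo H H0; rewrite h.
Qed.

Definition gA : R := 2 * pi `^ w / GammaR w.

Lemma geE t : ge t = gA * (expR (- (2 - w) * t) * beta (2 * t) - w * (expR (- (w - 1) * t) * Jr (2 * t))).
Proof.
rewrite /ge /g_w expR_gt0 /= -[X in _ < X]expR0 ltr_expR oppr_lt0.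
case: ifPn => t0; last first.
  have t20 : 2 * t <= 0 by rewrite -leNgt in t0; lra.
  rewrite /beta stepE ltNge t20 /= mul0r mulr0.
  rewrite (_ : Jr _ = 0) ?mulr0 ?subrr ?mulr0 //.
  have := rIZ 0 (rin0 mu); rewrite mul0r => e0; rewrite /Jr (_ : (fun v => _) = fun _ : R => (0 : R)); first by rewrite e0 mul0r.
  apply/funext => v; rewrite /bJ /beta !stepE; case: (ltP 0 v) => hv; last by rewrite !mul0r.
  by rewrite ifF ?mulr0 // subr_gt0; apply/negbTE; rewrite -leNgt; apply: le_trans t20 (ltW hv).
rewrite g_w_inner /gA; congr (_ * (_ - _)).
  rewrite /beta stepE ifT; last by rewrite mulr_gt0.
  rewrite mul1r -expRM_natl mulrN; congr (_ * _).
  by rewrite -expRM; congr expR; ring.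
by rewrite -mulrA; congr (_ * (_ * _)); rewrite -expRM; congr expR; ring.
Qed.

Lemma MT_scale2 (f : R -> C) s : mtin f s ->
  mtin (fun t => f (2 * t)) (2 * s) /\ MT (fun t => f (2 * t)) (2 * s) = 2^-1 * MT f s.
Proof.
move=> hf; have sc := scale_substitutes (ltr0n R 2 : 0 < 2).
have h1 := subst_cI sc (cin_meas hf); have h2 := (subst_cin sc (cin_meas hf)).1 hf.
have e t : 2^-1 * (2%:C * (f (2 * t) * cexp (s * (2 * t)%:C))) = f (2 * t) * cexp (2 * s * t%:C).
  rewrite rcnat mulKf ?pnatr_eq0 //; congr (_ * cexp _).
  by rewrite rcM rcnat; ring.
split; first by apply: cin_extR e _; exact: cinZ.
by rewrite [LHS]/MT -(cI_extR e) cIZ // -h1.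
Qed.

(** The second term of $g_\omega$ is a convolution with the step function, which divides the
    transform by [sg]. Both terms evaluate the transform of [beta] at the same point [- al], which
    is why they combine into one factor. *)
Lemma geC_MT S : w < Re S -> 1 < Re S -> mtin geC (- S) /\
  MT geC (- S) = (gA / 2)%:C * MT betaC (- ((S - w%:C) / 2 + 1)) * (1 - 2 * w%:C / (S + w%:C - 1)).
Proof.
move=> Sw S1; set al := (S - w%:C) / 2 + 1; pose sg := (S + w%:C - 1) / 2.
have al0 : 0 < Re al by rewrite ReD Re_half ReB /= ltr_wpDl // divr_ge0 // subr_ge0 ltW.
have sp : 0 < Re (S + w%:C - 1) by rewrite ReB ReD /= addrAC addr_gt0 // subr_gt0.
have sg0 : 0 < Re sg by rewrite Re_half divr_gt0.
have sgn : sg != 0 by apply/eqP => e; move: sg0; rewrite e ltxx.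
have iB := mtin_beta w0 al0.
pose stC (v : R) : C := (step v)%:C.
pose bC (v : R) : C := betaC v * cexp ((- (3/2 - w))%:C * v%:C).
have ea : (- (3/2 - w))%:C - sg = - al.
  by rewrite /al /sg rcN rcB rcM rcV !rcnat; field.
have ib : mtin bC (- sg) by apply: (mtin_expM _ _ _).1; rewrite ea.
have mb : MT bC (- sg) = MT betaC (- al) by rewrite /bC MT_expM ea.
have [is_ ms] := cexp_step sg0.
have ebJ v : bC v = (bJ v)%:C by rewrite /bC /betaC -rcM cexp_real -rcM.
have [iJ mJ] := MT_cv (mtin_lmeas ib) (lmeas_step R) ib is_.
have eJ r : cv bC stC r = (Jr r)%:C.
  by rewrite /Jr -cI_real; apply: cI_extR => v; rewrite ebJ -rcM.
have [i1 m1] := MT_scale2 iB; have [i2 m2] := MT_scale2 iJ.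
have e t : (gA)%:C * (betaC (2 * t) * cexp (2 * - al * t%:C) - w%:C * (cv bC stC (2 * t) * cexp (2 * - sg * t%:C))) = geC t * cexp (- S * t%:C).
  rewrite /geC geE eJ (rcM gA) rcB (rcM (expR _) (beta _)) (rcM w) (rcM (expR _) (Jr _)) -!cexp_real.
  rewrite (rcM (- (2 - w))) (rcM (- (w - 1))) -/(betaC (2 * t)).
  have -> : cexp (2 * - al * t%:C) = cexp ((- (2 - w))%:C * t%:C) * cexp (- S * t%:C).
    by rewrite -cexpD; congr cexp; rewrite /al rcN rcB rcnat; field.
  have -> : cexp (2 * - sg * t%:C) = cexp ((- (w - 1))%:C * t%:C) * cexp (- S * t%:C).
    by rewrite -cexpD; congr cexp; rewrite /sg rcN rcB; field.
  ring.
have j2 := cinZ w%:C i2.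
split; first by apply: cin_extR e _; apply: cinZ; exact: cinB.
rewrite [LHS]/MT -(cI_extR e) cIZ; last exact: cinB.
rewrite cIB // cIZ // -/(MT (fun t => betaC (2 * t)) (2 * - al)) -/(MT (fun t => cv bC stC (2 * t)) (2 * - sg)) m1 m2 mJ mb.
rewrite [MT _ (- sg)](_ : _ = sg^-1) // rcM rcV rcnat.
have -> : S + w%:C - 1 = 2 * sg by rewrite /sg; field.
by field.
Qed.

(** The transform of $g_\omega$ is the quotient of the archimedean factors of $\xi(S-w)$ and
    $\xi(S+w)$. Euler's relation at $z+1$ gives the Gamma quotient, and
    $1-2w/(S+w-1)=(S-w-1)/(S+w-1)$ the remaining polynomial part. *)
Lemma gam_geC S : w < Re S -> 1 < Re S -> gam (S + w%:C) * MT geC (- S) = gam (S - w%:C).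
Proof.
move=> Sw S1; have [_ ->] := geC_MT Sw S1; set z := (S - w%:C) / 2.
have z0 : 0 < Re z by rewrite Re_half ReB /= divr_gt0 // subr_gt0.
have zw : 0 < Re (z + w%:C) by rewrite ReD /= addr_gt0.
have z1 : 0 < Re (z + 1) by rewrite ReD /= addr_gt0.
have zwn : z + w%:C != 0 by apply/eqP => e; move: zw; rewrite e ltxx.
have e1 : (S + w%:C) / 2 = z + w%:C by rewrite /z; field.
have sn : S + w%:C - 1 != 0.
  have sp : 0 < Re (S + w%:C - 1) by rewrite ReB ReD /= addrAC addr_gt0 // subr_gt0.
  by apply/eqP => e; rewrite e ltxx in sp.
have hB := Beta_Gamma w0 z1; rewrite addrAC in hB.
rewrite (MT_Eg_rec zw) (MT_Eg_rec z0) in hB.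
rewrite /gam -/z e1 (Gamma_MT z0) (Gamma_MT zw).
have gn := Gamma_w_neq0 w0.
have hp : cpow pi (- z) = cpow pi (- (z + w%:C)) * (pi `^ w)%:C.
  by rewrite !cpowE ?pi_gt0 // /powR gt_eqF ?pi_gt0 // -cexp_real -cexpD; congr cexp; rewrite rcM; ring.
rewrite hp /gA; move: hB gn; set B := MT betaC _; set g := (GammaR w)%:C; set p := cpow _ _; set G := MT _ z; set Gw := MT _ (z + w%:C) => hB gn.
have -> : (2 * pi `^ w / GammaR w / 2)%:C = (pi `^ w)%:C / g.
  by rewrite -rcV -rcM; congr (_%:C); field; move: gn; rewrite rc_eq0.
have hB' : Gw * B = g * z * G / (z + w%:C).
  by apply: (mulfI zwn); rewrite mulrA hB [RHS]mulrC divfK // mulrA.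
have eS : S = 2 * z + w%:C by rewrite /z; field.
clearbody B g p G Gw; rewrite eS in sn *.
transitivity (2^-1 * (2 * z + w%:C + w%:C) * (2 * z + w%:C + w%:C - 1) * p * ((pi `^ w)%:C / g) * (1 - 2 * w%:C / (2 * z + w%:C + w%:C - 1)) * (Gw * B)).
  by rewrite -[(2 : C)^-1]/(2^-1); ring.
by rewrite hB'; field; rewrite zwn gn sn.
Qed.
End LocalFactor.

(** * The sum of the Moebius function over divisors *)

Section Moebius.
Local Open Scope nat_scope.

Lemma moebius_prime_mul (p g : nat) : prime p -> 0 < g ->
  moebius (p * g) = if p %| g then 0%R else (- moebius g)%R.
Proof.
move=> pp g0; have p0 := prime_gt0 pp; rewrite /moebius muln_eq0 !gtn_eqF //=.
have mem q : (q \in primes (p * g)) = (q == p) || (q \in primes g).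
  by rewrite primesM // [primes p](primes_prime pp) inE.
case: (boolP (p %| g)) => pg.
  rewrite ifF //; apply/negbTE/allPn; exists p; first by rewrite mem eqxx.
  by rewrite lognM // logn_prime // eqxx add1n eqSS -lt0n logn_gt0 mem_primes pp g0.
have pn : p \notin primes g by rewrite mem_primes pp g0.
have pe : perm_eq (primes (p * g)) (p :: primes g).
  by apply: uniq_perm; rewrite ?primes_uniq //= ?pn ?primes_uniq // => q; rewrite mem inE.
rewrite (perm_size pe) (perm_all _ pe) /= lognM // logn_prime // eqxx /=.
have -> : logn p g = 0 by apply/eqP; rewrite -leqn0 leqNgt logn_gt0.
rewrite /= (_ : all _ (primes g) = all (fun q => logn q g == 1) (primes g)); last first.
  apply: eq_in_all => q hq; rewrite lognM // logn_prime //.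
  by have -> : (q == p) = false by apply/negbTE/eqP => e; move: pn; rewrite -e hq.
by case: ifP => _; rewrite ?oppr0 // exprS mulN1r.
Qed.

Lemma sum_multiples (V : zmodType) (p N : nat) (F : nat -> V) : 0 < p ->
  (\sum_(f < N | (p %| f)%N) F f = \sum_(g < N | (p * g < N)%N) F (p * g)%N)%R.
Proof.
move=> p0; rewrite -(big_mkord (fun f => p %| f) F) -(big_mkord (fun g => p * g < N) (fun g => F (p * g))).
rewrite -big_filter -[RHS]big_filter -(big_map (fun g => p * g) xpredT F); apply: perm_big; apply: uniq_perm.
- by rewrite filter_uniq // iota_uniq.
- rewrite map_inj_uniq ?filter_uniq ?iota_uniq // => x y /eqP; rewrite eqn_pmul2l // => /eqP //.
move=> f; rewrite mem_filter mem_index_iota /=; apply/idP/mapP.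
  case/andP => /dvdnP[g ->] h; exists g; last by rewrite mulnC.
  rewrite mem_filter mem_index_iota /= mulnC h /=; apply: leq_ltn_trans h; exact: leq_pmulr.
by case=> g; rewrite mem_filter => /andP[h _] ->; rewrite dvdn_mulr.
Qed.

(** Terms divisible by the least prime factor [p] of [m] cancel those prime to [p], because
    $\mu(pg)=-\mu(g)$. A bound [N] above [m] gives all divisor sums one index range. *)
Lemma moebius_sum (m N : nat) : 0 < m -> m < N -> (\sum_(f < N | (f %| m)%N) moebius f = (m == 1%N)%:R)%R.
Proof.
move=> m0 mN; have z (f : nat) : (f %| m) -> 0 < f.
  by case: f => // /dvdnP[k]; rewrite muln0 => e; move: m0; rewrite e.
case: (eqVneq m 1%N) => [e1|m1].
  rewrite -(big_mkord (fun f => f %| m) moebius) -big_filter (_ : seq.filter _ _ = [:: 1]) ?big_seq1 //.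
  rewrite e1; case: N mN => [|[|N]]; rewrite e1 // => _.
  rewrite /index_iota subn0 /= (eq_in_filter (a2 := pred0)) ?filter_pred0 // => f.
  by rewrite mem_iota dvdn1 => /andP[h _]; rewrite gtn_eqF.
have m2 : 1 < m by rewrite ltn_neqAle eq_sym m1.
pose p := pdiv m; have pp : prime p := pdiv_prime m2; have pm : p %| m := pdiv_dvd m.
have p0 := prime_gt0 pp.
rewrite (bigID (fun f : 'I_N => (p %| f)%N)) /=.
have -> : (\sum_(f < N | (f %| m)%N && (p %| f)%N) moebius f = \sum_(f < N | (p %| f)%N) (if (f %| m)%N then moebius f else 0))%R.
  by rewrite -big_mkcondr; apply: eq_bigl => f; rewrite andbC.
rewrite (@sum_multiples _ p N (fun f => if f %| m then moebius f else 0%R)) //.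
have -> : (\sum_(g < N | (p * g < N)%N) (if (p * g %| m)%N then moebius (p * g) else 0) =
   \sum_(g < N | (g %| m)%N && ~~ (p %| g)%N) - moebius g)%R.
  rewrite big_mkcond [RHS]big_mkcond; apply: eq_bigr => g _.
  case: (boolP (p * g %| m)) => h1.
    have gm : g %| m by apply: dvdn_trans h1; exact: dvdn_mull.
    rewrite (leq_ltn_trans (dvdn_leq m0 h1) mN) gm /= moebius_prime_mul ?z //.
    by case: (p %| g).
  have -> : (g %| m) && ~~ (p %| g) = false; last by case: ifP.
  apply/negbTE; apply: contra h1 => /andP[gm pg].
  by rewrite Gauss_dvd ?pm // prime_coprime.
by rewrite sumrN addNr.
Qed.
End Moebius.

(** * Dirichlet series and their products *)

Section DirichletSeries.
Variable R : realType.
Local Notation C := R[i].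
Local Notation cnt := (@cntm R).

Lemma big_divisors (V : zmodType) (n N : nat) (F : nat -> V) : (0 < n)%N -> (n < N)%N ->
  \sum_(d <- divisors n) F d = \sum_(d < N | (d %| n)%N) F d.
Proof.
move=> n0 nN; rewrite -(big_mkord (fun d => d %| n)%N F) -[RHS]big_filter; apply: perm_big; apply: uniq_perm.
- exact: divisors_uniq.
- by rewrite filter_uniq // iota_uniq.
move=> d; rewrite mem_filter mem_index_iota -dvdn_divisors //=.
by case: (boolP (d %| n)%N) => //= h; rewrite (leq_ltn_trans (dvdn_leq n0 h) nN).
Qed.

(** Since $c_\omega(d)d^\omega=\sum_{fg=d}\mu(f)g^{2\omega}$, summing over $d\mid n$ leaves $g=n$
    only. This is the coefficient form of $\sum
    c_\omega(n)n^{-S}=\zeta(S-\omega)/\zeta(S+\omega)$. *)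
Lemma c_w_convolution (w : R) n N : (0 < n)%N -> (n < N)%N ->
  \sum_(d < N | (d %| n)%N) c_w w d * d%:R `^ w = n%:R `^ (2 * w).
Proof.
move=> n0 nN; have dp (d : nat) : (d %| n)%N -> (0 < d)%N.
  by case: d => // /dvdnP[k]; rewrite muln0 => e; move: n0; rewrite e.
pose T (f g : nat) : R := (moebius f)%:~R * g%:R `^ (2 * w).
have e d : (d < N)%N -> (d %| n)%N -> c_w w d * d%:R `^ w = \sum_(f < N) \sum_(g < N | (f * g == d)%N) T f g.
  move=> dN dn; have d0 := dp d dn; rewrite /c_w (big_divisors _ d0 dN) mulrAC.
  have -> : d%:R `^ w * d%:R `^ w = d%:R `^ (2 * w) :> R.
    rewrite -powRD; last by apply/implyP => _; rewrite pnatr_eq0 -lt0n.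
    by congr (_ `^ _); ring.
  rewrite mulr_sumr big_mkcond; apply: eq_bigr => f _.
  case: ifPn => [/dvdnP[g eg]|fd]; last first.
    rewrite big_pred0 // => g; apply/negbTE; apply: contra fd => /eqP <-; exact: dvdn_mulr.
  have f0 : (0 < f)%N by case: (posnP f) eg => // ->; rewrite muln0 => ed; move: d0; rewrite ed.
  have gN : (g < N)%N by apply: leq_ltn_trans dN; rewrite eg leq_pmulr.
  rewrite (big_pred1 (Ordinal gN)) /=; last first.
    by move=> h; rewrite eg mulnC eqn_pmul2r // -val_eqE.
  rewrite /T mulrCA; congr (_ * _); rewrite eg natrM powRM // mulrAC -mulrA -powRD; last first.
    by apply/implyP => _; rewrite pnatr_eq0 -lt0n.
  by rewrite addNr powRr0 mulr1.
rewrite (eq_bigr (fun d : 'I_N => \sum_(f < N) \sum_(g < N | (f * g == d)%N) T f g)); last first.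
  by move=> d hd; exact: e.
rewrite exchange_big /=.
have -> : \sum_(f < N) \sum_(d < N | (d %| n)%N) \sum_(g < N | (f * g == d)%N) T f g =
  \sum_(f < N) \sum_(g < N | (f * g %| n)%N) T f g.
  apply: eq_bigr => f _; rewrite (exchange_big_dep (fun g : 'I_N => (f * g %| n)%N)) /=; last first.
    by move=> d g dn /eqP ->.
  apply: eq_bigr => g h.
  have hN : (f * g < N)%N by apply: leq_ltn_trans (dvdn_leq n0 h) nN.
  rewrite (big_pred1 (Ordinal hN)) // => d; rewrite /= -val_eqE /= eq_sym.
  by case: eqP => [->|]; rewrite ?andbF // h.
rewrite (exchange_big_dep (fun g : 'I_N => (g %| n)%N)) /=; last first.
  by move=> f g _ h; apply: dvdn_trans h; exact: dvdn_mull.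
(* For fixed [g] the index [f] runs over the divisors of [n / g], so the Moebius sum singles out
   [g = n]. *)
have eg (g : 'I_N) : (g %| n)%N -> \sum_(f < N | (f * g %| n)%N) T f g = (n %/ g == 1)%N%:R * g%:R `^ (2 * w).
  move=> gn; have g0 := dp g gn; rewrite -mulr_suml; congr (_ * _).
  have q0 : (0 < n %/ g)%N by rewrite divn_gt0 // dvdn_leq.
  have qN : (n %/ g < N)%N by apply: leq_ltn_trans nN; exact: leq_div.
  rewrite -(rmorph_sum (intmul (1 : R))) /=.
  rewrite (eq_bigl (fun f : 'I_N => (f %| n %/ g)%N)) ?moebius_sum //; first by case: (_ == _).
  by move=> f; rewrite dvdn_divRL.
rewrite (eq_bigr _ eg) (bigD1 (Ordinal nN)) //= divnn n0 /= mul1r big1 ?addr0 // => g /andP[gn gne].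
rewrite (_ : (n %/ g == 1)%N = false) ?mul0r //; apply/negbTE; apply: contra gne => /eqP h.
by rewrite -val_eqE /=; move: (divnK gn); rewrite h mul1n => ->.
Qed.
Lemma rI_cnt1 (c : C) m : rI cnt (fun k => normc (if k == m then c else 0)) = normc c.
Proof.
have h : (rI cnt (fun k => normc (if k == m then c else 0)))%:C = (normc c)%:C :> C.
  rewrite -cI_real -[RHS](cI_cnt1 (normc c)%:C m); congr cI; apply/funext => k.
  by case: eqP => _ //; rewrite normc0.
by case: h.
Qed.

(** Indices are shifted by one: [m] stands for the integer [m + 1]. The array [F] puts [b k] at the
    multiple $(j+1)(k+1)$, and both orders of summation agree. *)
Lemma dilate_cnt (b : nat -> C) (j : nat) : cin cnt b ->
  let bj := fun m => if (j.+1 %| m.+1)%N then b (m.+1 %/ j.+1).-1 else 0 in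
  cin cnt bj /\ cI cnt bj = cI cnt b.
Proof.
move=> ib bj.
pose F (k m : nat) : C := if m == (j.+1 * k.+1).-1 then b k else 0.
have e m : cI cnt (fun k => F k m) = bj m.
  rewrite /bj; case: ifPn => [/dvdnP[q qe]|nd].
    have q0 : (0 < q)%N by case: q qe.
    rewrite qe mulnK // -(cI_cnt1 (b q.-1) q.-1); congr cI; apply/funext => k; rewrite /F.
    have -> : (m == (j.+1 * k.+1).-1) = (k == q.-1).
      rewrite -eqSS qe prednK ?muln_gt0 // mulnC eqn_pmul2l // -[q in LHS](prednK q0) eqSS eq_sym //.
    by case: eqP => // ->.
  rewrite -[RHS](cI0 cnt); congr cI; apply/funext => k; rewrite /F ifF //.
  apply/negbTE; apply: contra nd => /eqP ->; rewrite prednK ?muln_gt0 //; exact: dvdn_mulr.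
have iF k : cin cnt (F k) by exact: cin_cnt1.
have hM n : \sum_(k < n) rI cnt (fun m => normc (F k m)) <= rI cnt (fun k => normc (b k)).
  under eq_bigr do rewrite rI_cnt1.
  by apply: (rin_cnt_sum_le (a := fun k => normc (b k))); [exact: cin_norm|move=> k; exact: normc_ge0].
have [_ h1 _ h2] := series_cin iF hM.
have E : (fun m => cI cnt (fun k => F k m)) = bj by apply/funext.
move: h1 h2; rewrite E => h1 ->; split => //.
by congr cI; apply/funext => k; exact: cI_cnt1.
Qed.

(** Row [j] of the double series is [a j] times the dilation of [b] by [j + 1]; summing columns
    first collects the divisors of [m + 1]. *)
Lemma dirichlet_product (a b : nat -> C) : cin cnt a -> cin cnt b ->
  cI cnt a * cI cnt b =
  cI cnt (fun m => \sum_(j < m.+1 | (j.+1 %| m.+1)%N) a j * b (m.+1 %/ j.+1).-1).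
Proof.
move=> ia ib.
pose F (j m : nat) : C := a j * (if (j.+1 %| m.+1)%N then b (m.+1 %/ j.+1).-1 else 0).
have F0 (j k : nat) : (k < j)%N -> F j k = 0 by move=> h; rewrite /F gtnNdvd ?ltnS // mulr0.
have iF j : cin cnt (F j) by apply: cinZ; exact: (dilate_cnt j ib).1.
have eF j : cI cnt (F j) = cI cnt b * a j.
  by rewrite [LHS]cIZ ?(dilate_cnt j ib).2 1?mulrC //; exact: (dilate_cnt j ib).1.
have nF j : rI cnt (fun m => normc (F j m)) = normc (a j) * rI cnt (fun m => normc (b m)).
  have [i1 e1] := dilate_cnt j (cin_real (cin_norm ib)).
  pose g (m : nat) : R := if (j.+1 %| m.+1)%N then normc (b (m.+1 %/ j.+1).-1) else 0.
  have gE m : (if (j.+1 %| m.+1)%N then (normc (b (m.+1 %/ j.+1).-1))%:C else 0) = (g m)%:C.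
    by rewrite /g; case: ifP.
  have i2 : rin cnt g by move: (cin_Re i1); congr (rin _ _); apply/funext => m; rewrite gE.
  have -> : rI cnt (fun m => normc (b m)) = rI cnt g.
    move: e1; rewrite cI_real; under eq_fun do rewrite gE; rewrite cI_real; by case.
  rewrite -rIZ //.
  by congr rI; apply/funext => m; rewrite /F /g normcM; case: ifP; rewrite ?normc0.
have hM n : \sum_(k < n) rI cnt (fun m => normc (F k m)) <= rI cnt (fun k => normc (a k)) * rI cnt (fun m => normc (b m)).
  under eq_bigr do rewrite nF; rewrite -mulr_suml; apply: ler_wpM2r; first by apply: rI_ge0 => m; exact: normc_ge0.
  by apply: (rin_cnt_sum_le (a := fun k => normc (a k))); [exact: cin_norm|move=> k; exact: normc_ge0].
have [_ _ _ h] := series_cin iF hM.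
transitivity (cI cnt (fun j => cI cnt (F j))).
  rewrite (eq_fun eF) mulrC; symmetry; exact: cIZ.
rewrite -h; congr cI; apply/funext => m.
transitivity (\sum_(j < m.+1) F j m); last first.
  by rewrite [RHS]big_mkcond; apply: eq_bigr => j _; rewrite /F; case: ifP; rewrite ?mulr0.
have [_ <-] := cI_cnt_fin (fun j => F j m) m.+1.
congr cI; apply/funext => j; case: ifPn => [_|]; first exact: erefl.
by move=> h1; apply: F0; rewrite ltnNge; exact: h1.
Qed.

End DirichletSeries.

(** * The convolution kernel and its Laplace transform *)

Section EtaKernel.
Variable R : realType.
Local Notation C := R[i].
Local Notation mu := (@lebesgue_measure R).
Local Notation cnt := (@cntm R).
Local Notation PX := (@PX R).

Lemma MT_opp (f : R -> C) s : lmeas f -> (forall t, f (- t) = f t) -> MT f (- s) = MT f s.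
Proof.
move=> mf ef; have h := subst_cI (opp_substitutes R) (cmeasM mf (lmeas_cexp s)).
rewrite /MT [RHS]h; apply: cI_extR => t.
by rewrite mul1r ef (rcN t) mulrN mulNr.
Qed.

Lemma rI_normc_shift (f : R -> C) s (a : R) : mtin f s ->
  rI mu (fun t => normc (f (t + a) * cexp (s * t%:C))) =
  normc (cexp (- s * a%:C)) * rI mu (fun t => normc (f t * cexp (s * t%:C))).
Proof.
move=> hf; have mI : rmeas (fun t => normc (f t * cexp (s * t%:C))) := cmeas_normc (cin_meas hf).
have rI1 := rin_shift a (cin_norm hf); have e1 := rI_shift a mI.
rewrite -e1 -(rIZ _ rI1) normc_cexp_st.
congr rI; apply/funext => t; rewrite !normcM_cexp mulrCA -expRD; congr (_ * expR _).
by rewrite ReN; ring.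
Qed.

Lemma cin_cpow (s : C) : 2 <= Re s -> cin cnt (fun k => cpow k.+1%:R (- s)).
Proof.
move=> hs; apply: (@cin_cnt _ _ 4) => n.
apply: (@le_trans _ _ (\sum_(k < n) 2 * dc k.+1%:R)).
  by apply: ler_sum => k _; exact: normc_cpow_nat.
by rewrite -mulr_sumr; have := sum_dc R n; lra.
Qed.

Lemma PX_zeta (s : C) : 2 <= Re s -> MT PX (s - 2^-1) = gam s * cI cnt (fun k => cpow k.+1%:R (- s)).
Proof.
move=> hs; have [_ h] := phiE_MT hs.
have -> : MT PX (s - 2^-1) = MT (@phiE R) s.
  transitivity (MT (fun t => phiE t * cexp ((2^-1 : C) * t%:C)) (s - 2^-1)).
    by apply: cI_extR => t; rewrite PXE.
  by rewrite MT_expM addrC subrK.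
apply: ccvg_uniq h _; apply: ccvgM; first exact: ccvg_cst.
by apply: ccvg_ext (csum_cvg (cin_cpow hs)) => N; rewrite zeta_partialE.
Qed.

Variables (w : R) (w0 : 0 < w).

(** The divisor sum has at most [n + 1] terms of modulus at most 1. Two further powers for
    summability give the threshold $\Re S\ge w+3$. *)
Lemma c_w_le n : `|c_w w n.+1| <= n.+1%:R `^ (w + 1).
Proof.
have n0 : (0 : R) < n.+1%:R by rewrite ltr0n.
rewrite powRD; last by apply/implyP => _; rewrite gt_eqF.
rewrite powRr1 ?ler0n // /c_w normrM ger0_norm ?powR_ge0 //; apply: ler_wpM2l; first exact: powR_ge0.
rewrite (big_divisors _ (ltn0Sn n) (ltnSn n.+1)) big_mkcond big_ord_recl /= add0r.
apply: le_trans (ler_norm_sum _ _ _) _; have -> : n.+1%:R = \sum_(i < n.+1) 1 :> R by rewrite sumr_const card_ord.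
apply: ler_sum => k _; case: ifP => _; last by rewrite normr0 ler01.
have h1 : `|(moebius (bump 0 k))%:~R| <= 1 :> R.
  rewrite /moebius; case: (_ == 0)%N; first by rewrite normr0.
  case: (all _ _); last by rewrite normr0.
  by rewrite rmorphXn /= rmorphN1 normrX normrN1 expr1n.
rewrite normrM -[leRHS]mulr1; apply: ler_pM => //.
rewrite ger0_norm ?powR_ge0 // /powR gt_eqF ?ltr0n // -[leRHS]expR0 ler_expR mulNr oppr_le0.
by rewrite mulr_ge0 ?ln_ge0 ?ler1n // mulr_ge0 // ltW.
Qed.

Definition cwS (S : C) (k : nat) : C := (c_w w k.+1)%:C * cpow k.+1%:R (- S).

Lemma normc_cwS (S : C) k : w + 3 <= Re S -> normc (cwS S k) <= 2 * dc k.+1%:R.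
Proof.
move=> hS; have h2 : 2 <= Re (S - (w + 1)%:C) by rewrite ReB /=; lra.
apply: le_trans (normc_cpow_nat k h2).
rewrite /cwS normcM normc_real !cpow_nat !normc_cexp_st.
apply: (@le_trans _ _ (k.+1%:R `^ (w + 1) * expR (Re (- S) * ln k.+1%:R))).
  by apply: ler_wpM2r; [exact: expR_ge0|exact: c_w_le].
rewrite /powR gt_eqF ?ltr0n // -expRD ler_expR !ReN ReB /= -mulrDl le_eqVlt; apply/orP; left; apply/eqP.
by congr (_ * _); ring.
Qed.

Lemma cin_cwS (S : C) : w + 3 <= Re S -> cin cnt (cwS S).
Proof.
move=> hS; apply: (@cin_cnt _ _ 4) => n.
apply: (@le_trans _ _ (\sum_(k < n) 2 * dc k.+1%:R)).
  by apply: ler_sum => k _; exact: normc_cwS.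
by rewrite -mulr_sumr; have := sum_dc R n; lra.
Qed.

Lemma dirichlet_c_w (S : C) : w + 3 <= Re S ->
  cI cnt (cwS S) * cI cnt (fun k => cpow k.+1%:R (- (S + w%:C))) =
  cI cnt (fun k => cpow k.+1%:R (- (S - w%:C))).
Proof.
move=> hS; have h2 : 2 <= Re (S + w%:C) by rewrite ReD /=; have := w0; lra.
rewrite dirichlet_product; [|exact: cin_cwS|exact: cin_cpow].
congr cI; apply/funext => m.
have hc := c_w_convolution w (ltn0Sn m) (ltnSn m.+1).
rewrite big_mkcond big_ord_recl /= add0r in hc.
have t j : (j.+1 %| m.+1)%N -> cwS S j * cpow (m.+1 %/ j.+1).-1.+1%:R (- (S + w%:C)) =
   (c_w w j.+1 * j.+1%:R `^ w)%:C * cpow m.+1%:R (- (S + w%:C)).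
  case/dvdnP => [[|q]] // qe.
  have -> : (m.+1 %/ j.+1).-1 = q by rewrite qe mulnK.
  have lm : ln m.+1%:R = ln q.+1%:R + ln j.+1%:R :> R by rewrite qe natrM lnM ?posrE ?ltr0n.
  rewrite /cwS !cpow_nat lm.
  have e : (j.+1%:R `^ w)%:C = cexp (w%:C * (ln j.+1%:R)%:C) :> C.
    by rewrite /powR gt_eqF ?ltr0n // -cexp_real rcM.
  rewrite (rcM (c_w w j.+1)) e -[LHS]mulrA -[RHS]mulrA; congr (_ * _).
  by rewrite -2!cexpD; congr cexp; rewrite rcD; ring.
transitivity (\sum_(j < m.+1 | (j.+1 %| m.+1)%N) (c_w w j.+1 * j.+1%:R `^ w)%:C * cpow m.+1%:R (- (S + w%:C))).
  by apply: eq_bigr => j; exact: t.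
rewrite -mulr_suml big_mkcond /= (_ : \sum_(j < m.+1) _ = (m.+1%:R `^ (2 * w))%:C).
  rewrite !cpow_nat /powR gt_eqF ?ltr0n // -cexp_real -cexpD; congr cexp.
  by rewrite !rcM rcnat; ring.
rewrite -hc rmorph_sum /=; apply: eq_bigr => j _; by case: ifP.
Qed.

Definition eta0 (t : R) : C := (h_w w (expR t) * expR t)%:C.

(** The cut at the integer part in $h_\omega$ is automatic, because [g_w] is 0 on $[1,\infty)$; so
    $h_\omega$ is a full series of translates of [geC], zero for $x\le1$. *)
Lemma eta0E t : cin cnt (fun k => (c_w w k.+1)%:C * geC w (t + - ln k.+1%:R)) /\
  eta0 t = cI cnt (fun k => (c_w w k.+1)%:C * geC w (t + - ln k.+1%:R)).
Proof.
have gk k : geC w (t + - ln k.+1%:R) = (g_w w (k.+1%:R / expR t))%:C.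
  by rewrite /geC /ge opprD opprK expRD lnK ?posrE ?ltr0n // expRN mulrC.
have e k : (c_w w k.+1)%:C * geC w (t + - ln k.+1%:R) = if (k < Num.truncn (expR t))%N then (c_w w k.+1)%:C * geC w (t + - ln k.+1%:R) else 0.
  case: ifPn => //; rewrite truncn_gt_nat -ltNge => h.
  rewrite gk /g_w [X in _ && X](_ : _ = false) ?andbF ?mulr0 //.
  by apply/negbTE; rewrite -leNgt ler_pdivlMr ?expR_gt0 // mul1r ltW.
have [h1 h2] := cI_cnt_fin (fun k => (c_w w k.+1)%:C * geC w (t + - ln k.+1%:R)) (Num.truncn (expR t)).
rewrite (eq_fun e); split => //; rewrite h2 /eta0 /h_w; case: ifPn => t1.
  rewrite mulrAC mulVf ?gt_eqF ?expR_gt0 // mul1r big_add1 /= big_mkord rmorph_sum /=.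
  by apply: eq_bigr => k _; rewrite gk rcM.
rewrite mul0r big1 // => k _; have := ltn_ord k; rewrite truncn_gt_nat => h.
rewrite gk /g_w [X in _ && X](_ : _ = false) ?andbF ?mulr0 //.
apply/negbTE; rewrite -leNgt ler_pdivlMr ?expR_gt0 // mul1r (le_trans (_ : _ <= 1)) ?ler1n //.
by rewrite leNgt.
Qed.

Lemma eta0_MT (S : C) : w + 3 <= Re S -> mtin eta0 (- S) /\ MT eta0 (- S) = cI cnt (cwS S) * MT (geC w) (- S).
Proof.
move=> hS; have Sw : w < Re S by lra.
have S1 : 1 < Re S by have := w0; lra.
have [ig _] := geC_MT w0 Sw S1.
pose F k t : C := (c_w w k.+1)%:C * (geC w (t + - ln k.+1%:R) * cexp (- S * t%:C)).
have hF k := MT_shift (- ln k.+1%:R) ig.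
have iF k : cin mu (F k) by apply: cinZ; exact: (hF k).1.
have eS k : cexp (- - S * (- ln k.+1%:R)%:C) = cpow k.+1%:R (- S).
  by rewrite cpow_nat (rcN (ln _)) opprK mulrN mulNr.
have cF k : cI mu (F k) = cwS S k * MT (geC w) (- S).
  rewrite cIZ; last exact: (hF k).1.
  have [_ h] := hF k; rewrite /cwS -mulrA -eS; congr (_ * _); exact: h.
pose I0 := rI mu (fun t => normc (geC w t * cexp (- S * t%:C))).
have I00 : 0 <= I0 by apply: rI_ge0 => t; exact: normc_ge0.
have nF k : rI mu (fun t => normc (F k t)) = normc (cwS S k) * I0.
  rewrite /cwS normcM -mulrA -eS -(rI_normc_shift (- ln k.+1%:R) ig) -rIZ; last exact: cin_norm (hF k).1.
  by congr rI; apply/funext => t; rewrite /F normcM.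
have bF N : \sum_(k < N) rI mu (fun x => normc (F k x)) <= 4 * I0.
  apply: (@le_trans _ _ (\sum_(k < N) 2 * dc k.+1%:R * I0)).
    by apply: ler_sum => k _; rewrite nF; apply: ler_wpM2r => //; exact: normc_cwS.
  by rewrite -mulr_suml -mulr_sumr; apply: ler_wpM2r => //; have := sum_dc R N; lra.
have [_ h2 h3 h4] := series_cin iF bF.
have e t : cI cnt (fun n => F n t) = eta0 t * cexp (- S * t%:C).
  have [i1 e1] := eta0E t; rewrite e1 -cIZr //.
  by congr cI; apply/funext => k; rewrite /F mulrA.
split; first exact: cin_extR e h2.
transitivity (cI mu (fun t => cI cnt (fun n => F n t))); first by apply: cI_extR => t; rewrite e.
rewrite h4 (eq_fun cF); apply: cIZr; exact: cin_cwS.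
Qed.

Definition eta (t : R) : C := (h_w w (expR t) * expR (t / 2))%:C.
(** An exponential factor shifts the argument of the transform by $\pm w$; evenness of [PX] then
    matches the arguments $1/2\mp w-iz$ of xi. *)
Definition pN (t : R) : C := PX t * cexp (w%:C * t%:C).
Definition pD (t : R) : C := PX t * cexp ((- w)%:C * t%:C).

Lemma etaE t : eta t = eta0 t * cexp ((- 2^-1) * t%:C).
Proof.
have -> : - 2^-1 = (- 2^-1 : R)%:C :> C by rewrite rcN rcV rcnat.
by rewrite -rcM cexp_real /eta0 -rcM -mulrA -expRD; congr (_ * expR _)%:C; field.
Qed.

Lemma causal_eta : causal eta.
Proof.
by move=> t t0; rewrite /eta /h_w ifF ?mul0r // -[X in X < _]expR0 ltr_expR ltNge t0.
Qed.

(** With $S=1/2-s$ one has $\Re S=w+7/2$, inside the region of absolute convergence. Evenness turns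
    the transforms of [pD] and [pN] into xi at $S+w$ and $S-w$; archimedean and Dirichlet factors
    then match separately. *)
Lemma eta_MT (s : C) : Re s = - (w + 3) -> mtin eta s /\ MT pD s * MT eta s = MT pN s.
Proof.
move=> hs; pose S := 2^-1 - s.
have eS : - 2^-1 + s = - S by rewrite /S opprB addrC.
have rS : Re S = w + 3 + 2^-1.
  rewrite /S ReB hs opprK addrC; congr (_ + _).
  by have -> : (2^-1 : C) = (2^-1 : R)%:C by rewrite rcV rcnat.
have hS : w + 3 <= Re S by rewrite rS lerDl.
have [i m] := eta0_MT hS.
have Sw : w < Re S by lra.
have S1 : 1 < Re S by have := w0; lra.
have fe : eta = fun t => eta0 t * cexp ((- 2^-1) * t%:C) by apply/funext; exact: etaE.
split; first by rewrite fe; apply: (mtin_expM _ _ _).1; rewrite eS.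
have mP := (sexp_PX R).1.
have e1 : MT pD s = MT PX (S + w%:C - 2^-1).
  rewrite /pD MT_expM -MT_opp //; last exact: PX_even.
  by congr MT; rewrite /S rcN; ring.
have e2 : MT pN s = MT PX (S - w%:C - 2^-1).
  rewrite /pN MT_expM -MT_opp //; last exact: PX_even.
  by congr MT; rewrite /S; ring.
have e3 : MT eta s = MT eta0 (- S) by rewrite fe (MT_expM eta0 (- 2^-1)) eS.
have h1 : 2 <= Re (S + w%:C) by rewrite ReD /=; have := w0; lra.
have h2 : 2 <= Re (S - w%:C) by rewrite ReB /=; lra.
rewrite e3 m e1 e2 (PX_zeta h1) (PX_zeta h2).
rewrite -(gam_geC w0 Sw S1) -(dirichlet_c_w hS); ring.
Qed.
End EtaKernel.

(** * The Mellin transform *)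

Section LogarithmicChange.
Variable R : realType.
Local Notation C := R[i].
Local Notation mu := (@lebesgue_measure R).
Implicit Types f g h k G : R -> C.
Local Notation D := (`]0, +oo[%classic : set R).

(** The factor $e^{t/2}$ absorbs the Jacobian $dx=e^t\,dt$ and makes this an isometry between the
    two L^2 spaces. *)
Definition lg f (t : R) : C := f (expR t) * (expR (t / 2))%:C.
Definition unlg g (x : R) : C := if 0 < x then g (ln x) * (expR (- (ln x / 2)))%:C else 0.

Lemma lg_unlg g t : lg (unlg g) t = g t.
Proof. by rewrite /lg /unlg expR_gt0 expRK -mulrA -rcM -expRD addNr expR0 mulr1. Qed.
Lemma unlg_lg f x : 0 < x -> unlg (lg f) x = f x.
Proof. by move=> x0; rewrite /lg /unlg x0 lnK // -mulrA -rcM -expRD addrN expR0 mulr1. Qed.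
Lemma lgB f g t : lg (fun x => f x - g x) t = lg f t - lg g t.
Proof. exact: mulrBl. Qed.
Lemma normc_lg f t : normc (lg f t) ^+ 2 = expR t * normc (f (expR t)) ^+ 2.
Proof.
rewrite /lg normcM normc_real ger0_norm ?expR_ge0 // exprMn mulrC; congr (_ * _).
by rewrite -expRM_natl; congr expR; field.
Qed.

Lemma lmeas_unlg g : lmeas g -> lmeas (unlg g).
Proof.
move=> mg; have h1 := subst_lmeas (ln_substitutes R) mg.
have h2 : lmeas (fun x : R => (expR (ln x / 2))%:C).
  by apply: cmeas_real; apply: rmeas_expR_comp; apply: measurable_funM => //; exact: measurable_ln.
apply: lmeas_ext (cmeasM h2 h1) => x; rewrite /unlg; case: ifP => _; last by rewrite mul0r mulr0.
by rewrite mulrA -rcM -expRD mulrC; congr (_ * (expR _)%:C); field.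
Qed.

Lemma lmeas_lg f : measurable_fun D (fun x => Re (f x)) ->
  measurable_fun D (fun x => Im (f x)) -> lmeas (lg f).
Proof.
move=> m1 m2; apply: cmeasM; last first.
  by apply: cmeas_real; apply: rmeas_expR_comp; exact: measurable_funM.
have sub : [set expR t | t in [set: R]] `<=` D.
  by move=> _ [t _ <-]; rewrite /= in_itv /= expR_gt0.
split.
  apply: (@measurable_comp _ _ _ _ _ _ D (fun x => Re (f x)) _ (fun t : R => expR t)) => //.
apply: (@measurable_comp _ _ _ _ _ _ D (fun x => Im (f x)) _ (fun t : R => expR t)) => //.
Qed.

Lemma L2_lgE f : lmeas (lg f) ->
  (\int[mu]_(x in D) (normc (f x) ^+ 2)%:E = \int[mu]_t (normc (lg f t) ^+ 2)%:E)%E.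
Proof.
move=> mf; have [_ _ _ h] := ln_substitutes R.
rewrite (h (fun t => (normc (lg f t) ^+ 2)%:E)); last 2 first.
- apply/measurable_EFinP; apply/measurable_funX/cmeas_normc/mf.
- by move=> t; rewrite lee_fin sqr_ge0.
rewrite integral_mkcond; apply: eq_integral => x _; rewrite patchE.
have -> : (x \in D) = (0 < x) by apply/idP/idP; rewrite inE /= in_itv /= andbT.
case: ltP => hx; last by rewrite mul0e.
have -> : normc (lg f (ln x)) ^+ 2 = x * normc (f x) ^+ 2 by rewrite normc_lg lnK.
by rewrite -EFinM; congr EFin; rewrite [RHS]mulrA expRN lnK // mulVf ?mul1r // gt_eqF.
Qed.

Lemma l2_integral f : lmeas f -> (\int[mu]_t (normc (f t) ^+ 2)%:E < +oo)%E -> l2 mu f.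
Proof.
move=> mf h; split => //; apply/integrableP; split.
  by apply/measurable_EFinP/measurable_funX/cmeas_normc.
have -> : (\int[mu]_t `|(normc (f t) ^+ 2)%:E| = \int[mu]_t (normc (f t) ^+ 2)%:E)%E.
  by apply: eq_integral => t _; rewrite /= ger0_norm // sqr_ge0.
exact: h.
Qed.
Lemma integral_l2 f : l2 mu f -> (\int[mu]_t (normc (f t) ^+ 2)%:E)%E = (N2 mu f)%:E.
Proof. by case=> _ h; exact: rIE. Qed.

Lemma L2on_lg f : L2on D f <-> l2 mu (lg f).
Proof.
split=> [[m1 [m2 h]]|lf].
  have mf := lmeas_lg m1 m2; apply: l2_integral => //; by rewrite -L2_lgE.
have mf := l2_meas lf; have [m1 m2] := lmeas_unlg mf.
have e x : x \in D -> unlg (lg f) x = f x.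
  by rewrite inE /= in_itv /= andbT; exact: unlg_lg.
split; last split.
- apply: (@eq_measurable_fun _ _ _ _ _ (fun x => Re (unlg (lg f) x))); first by move=> x /e ->.
  exact: measurable_funTS.
- apply: (@eq_measurable_fun _ _ _ _ _ (fun x => Im (unlg (lg f) x))); first by move=> x /e ->.
  exact: measurable_funTS.
by rewrite L2_lgE // integral_l2 // ltry.
Qed.

Lemma L2on_setT f : L2on setT f <-> l2 mu f.
Proof.
split=> [[m1 [m2 h]]|lf]; first exact: l2_integral.
by have [m1 m2] := l2_meas lf; split=> //; split=> //; rewrite integral_l2 // ltry.
Qed.

Lemma cvg_EFin0 (u : nat -> R) : ((fun n => (u n)%:E) @ \oo --> (0 : \bar R)%E) <-> (u @ \oo --> (0 : R)).
Proof.
split=> [h|h]; first by have /fine_cvgP[_] := h.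
by apply: cvg_EFin => //; exact: nearW.
Qed.

Lemma L2lim_lg (gN : nat -> R -> C) g : (forall N, l2 mu (lg (gN N))) ->
  L2lim D gN g <-> l2 mu (lg g) /\ l2cvg mu (fun N => lg (gN N)) (lg g).
Proof.
move=> hN; have e : l2 mu (lg g) ->
    (fun N : nat => (\int[mu]_(x in D) ((normc (gN N x - g x)) ^+ 2)%:E)%E) = (fun N => (N2 mu (fun t => lg (gN N) t - lg g t))%:E).
  move=> lg2; apply/funext => N; have l := l2B (hN N) lg2.
  have eB : lg (fun x => gN N x - g x) = fun t => lg (gN N) t - lg g t by apply/funext => t; exact: lgB.
  by rewrite (@L2_lgE (fun x => gN N x - g x)) eB ?integral_l2 //; exact: l2_meas l.
split=> [[/L2on_lg lg2]|[lg2 h]]; first by rewrite (e lg2) => /cvg_EFin0.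
by split; [exact/L2on_lg|rewrite (e lg2); exact/cvg_EFin0].
Qed.

Lemma L2lim_setT (gN : nat -> R -> C) g : (forall N, l2 mu (gN N)) ->
  L2lim setT gN g <-> l2 mu g /\ l2cvg mu gN g.
Proof.
move=> hN.
have e : l2 mu g ->
    (fun N : nat => (\int[mu]_x ((normc (gN N x - g x)) ^+ 2)%:E)%E) = (fun N => (N2 mu (fun t => gN N t - g t))%:E).
  by move=> lg2; apply/funext => N; rewrite integral_l2 //; exact: l2B (hN N) lg2.
split=> [[/L2on_setT lg2]|[lg2 h]]; first by rewrite (e lg2) => /cvg_EFin0.
by split; [exact/L2on_setT|rewrite (e lg2); exact/cvg_EFin0].
Qed.

(** Substitution by [ln] writes the measure of [B] as the integral of a weight, positive on the half
    line, over the image of [B]; so null sets correspond in both directions. *)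
Lemma ae_exp (P : R -> Prop) : (\forall x \ae mu, 0 < x -> P x) <-> (\forall t \ae mu, P (expR t)).
Proof.
have [_ mw w0 hs] := ln_substitutes R; rewrite /= in mw w0 hs.
have hB (B : set R) : measurable B ->
    mu B = (\int[mu]_x ((if 0 < x then expR (- ln x) else 0)%:E * (\1_B (ln x))%:E))%E.
  move=> mB; transitivity (\int[mu]_x (\1_B x)%:E)%E; first by rewrite integral_indic // setIT.
  rewrite hs //.
  by apply/measurable_EFinP; exact: measurable_indic.
have mI (B : set R) : measurable B -> measurable_fun setT (fun x : R => ((if 0 < x then expR (- ln x) else 0)%:E * (\1_B (ln x))%:E)%E).
  move=> mB; apply: emeasurable_funM; first exact/measurable_EFinP.
  by apply/measurable_EFinP; apply: measurableT_comp; [exact: measurable_indic|exact: measurable_ln].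
split=> [[A [mA A0 hA]]|[B [mB B0 hB']]].
  pose B := @expR R @^-1` A; have mB : measurable B by rewrite -[B]setTI; exact: measurable_expR.
  exists B; split=> //; last by move=> t ht; apply: hA => /= h; apply: ht; apply: h; exact: expR_gt0.
  rewrite hB // (ae_eq_integral (cst 0%E)) ?integral0 //; first exact: mI.
  exists A; split=> // x hx; apply: contrapT => nA; apply: hx => _ /=.
  case: ltP => x0; last by rewrite mul0e.
  by rewrite indicE memNset ?mule0 // /B /= lnK.
have : (\int[mu]_x `|((if 0 < x then expR (- ln x) else 0)%:E * (\1_B (ln x))%:E)|)%E = 0%E.
  rewrite -B0 hB //; apply: eq_integral => x _; rewrite gee0_abs // mule_ge0 // ?lee_fin //.
have [h0 _] := ae_eq_integral_abs mu measurableT (mI B mB).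
move/h0; apply: ae_mono => x h x0.
have {h} := h I; rewrite /= x0 => /eqP; rewrite -EFinM eqe mulf_eq0 gt_eqF ?expR_gt0 //= indicE.
move=> e0; apply: contrapT => nP; have hb : B (ln x) by apply: hB'; rewrite /= lnK.
by move: e0; rewrite mem_set // oner_eq0.
Qed.
End LogarithmicChange.

(** * The Mellin transform and its inverse as Fourier transforms *)

Section MellinFourier.
Variable R : realType.
Local Notation C := R[i].
Local Notation mu := (@lebesgue_measure R).
Implicit Types f g h k G H : R -> C.

Definition cutoff (S : nat -> set R) f N (t : R) : C := (\1_(S N) t)%:C * f t.

(** One statement for both truncations: the multiplicative windows of the Mellin transform and the
    symmetric windows of its inverse are bounded and exhaust the line. *)
Lemma cutoff_cvg (S : nat -> set R) f G : (forall N, measurable (S N)) ->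
  (forall N t, S N t -> - N.+1%:R < t <= N.+1%:R) ->
  (forall t, exists N0, forall N, (N0 <= N)%N -> S N t) -> isFT f G ->
  (forall N, l12 (cutoff S f N)) /\ l2cvg mu (fun N => FT (cutoff S f N)) G.
Proof.
move=> mS bS eS hG; have [lf lG _] := hG.
have mF N : lmeas (cutoff S f N).
  by apply: cmeasM (l2_meas lf); apply: cmeas_real; apply: measurable_indic; exact: mS.
have l12F N : l12 (cutoff S f N).
  have [c1 c2] := l12_trunc N lf.
  have le t : normc (cutoff S f N t) <= normc (trunc N f t).
    rewrite /cutoff /trunc !normcM indicE cindE; apply: ler_wpM2r; first exact: normc_ge0.
    case: (boolP (t \in S N)) => h; last by rewrite normc0 normc_ge0.
    by rewrite bS ?normc1 //; apply/set_mem.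
  by split; [exact: (cin_dom (mF N) (cin_norm c1) le)|exact: (l2_dom (mF N) c2 le)].
split=> //.
have cF : l2cvg mu (fun N => cutoff S f N) f.
  apply: l2cvg_dom => // [N t|t].
    by rewrite /cutoff normcM ler_piMl ?normc_ge0 // indicE; case: (_ \in _); rewrite ?normc0 ?normc1 ?ler01.
  have [N0 h] := eS t; apply: (@ccvg_eventually _ _ _ N0) => N hN.
  by rewrite /cutoff indicE mem_set ?mul1r //; exact: h.
apply: (cvg0_squeeze _ (cvg0_const_mul (2 * pi) cF)) => n; rewrite N2_ge0 /=.
exact: isFT_bound (isFTB (isFT_FT (l12F n)) hG).
Qed.

(** For positive [N] this is the interval $|t|<\ln N$; for [N = 0] the convention [0^-1 = 0] makes
    it empty. *)
Definition mcut (N : nat) : set R := @expR R @^-1` `]N%:R^-1, N%:R[.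

Lemma mcutE N t : mcut N t <-> expR (- t) < N%:R /\ expR t < N%:R.
Proof.
rewrite /mcut /= in_itv /= expRN; split=> [/andP[h1 h2]|[h1 h2]].
  have N0 : (0 : R) < N%:R by apply: lt_trans h2; exact: expR_gt0.
  by split=> //; rewrite -[ltRHS]invrK ltf_pV2 // posrE ?invr_gt0 ?expR_gt0.
have N0 : (0 : R) < N%:R by apply: lt_trans h2; exact: expR_gt0.
by rewrite h2 andbT -[ltRHS]invrK ltf_pV2 // posrE ?invr_gt0 ?expR_gt0.
Qed.

Lemma mcut_cvg f G : isFT f G ->
  (forall N, l12 (cutoff mcut f N)) /\ l2cvg mu (fun N => FT (cutoff mcut f N)) G.
Proof.
apply: cutoff_cvg => [N|N t|t].
- by rewrite -[mcut N]setTI; apply: measurable_expR => //; exact: measurable_itv.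
- case/mcutE => h1 h2; have := expR_ge1Dx t; have := expR_ge1Dx (- t); rewrite -natr1.
  by move=> g1 g2; apply/andP; split; lra.
exists (maxn (Num.truncn (expR t)).+1 (Num.truncn (expR (- t))).+1) => N.
rewrite geq_max => /andP[h1 h2]; apply/mcutE.
by split; [apply: lt_le_trans (truncnS_gt (expR (- t))) _|apply: lt_le_trans (truncnS_gt (expR t)) _]; rewrite ler_nat.
Qed.

Lemma imaginaryE (z : C) : 'i * z = ii * z. Proof. by []. Qed.

Lemma mellin_cutoff f N u : lmeas (cutoff mcut (lg f) N) ->
  CInt `]N%:R^-1, N%:R[ (fun x => f x * cpow x (2^-1 + 'i * u%:C) / x%:C) = FT (cutoff mcut (lg f) N) u.
Proof.
move=> mF; set S := `]_, _[%classic; set F := fun x => _.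
have S0 x : S x -> 0 < x.
  by rewrite /S /= in_itv /= => /andP[h _]; apply: le_lt_trans h; rewrite invr_ge0 ler0n.
have -> : CInt S F = CInt `]0, +oo[ (fun x => (\1_S x)%:C * F x).
  rewrite !CInt_cI; [|exact: measurable_itv|exact: measurable_itv].
  apply: cI_extR => x; rewrite [in RHS]indicE; case: (boolP (x \in _)) => hx; first by rewrite mul1r.
  rewrite mul0r indicE memNset ?mul0r // => /S0 x0; move: hx; rewrite notin_setE; apply.
  by rewrite /= in_itv /= x0.
have e t : (expR t)%:C * ((\1_S (expR t))%:C * F (expR t)) = cutoff mcut (lg f) N t * cexp (ii * u%:C * t%:C).
  have -> : \1_S (expR t) = \1_(mcut N) t :> R by [].
  have ne : (expR t)%:C != 0 :> C by rewrite rc_eq0 gt_eqF // expR_gt0.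
  rewrite /cutoff /lg /F cpowE ?expR_gt0 // expRK imaginaryE.
  have -> : cexp (t%:C * (2^-1 + ii * u%:C)) = cexp (t / 2)%:C * cexp (ii * u%:C * t%:C).
    by rewrite -cexpD; congr cexp; rewrite rcM rcV rcnat; ring.
  by rewrite cexp_real; field.
rewrite CInt_exp; first exact: cI_extR e.
by apply: (lmeas_ext (fun t => esym (e t))); apply: cmeasM mF (lmeas_cexp _).
Qed.

(** The truncated Mellin integrals are Fourier transforms of cutoffs, which converge to every
    transform of [lg f]; uniqueness of L^2 limits gives the other direction. *)
Lemma mellin_isFT f G : l2 mu (lg f) -> mellin_L2 f G <-> isFT (lg f) G.
Proof.
move=> lf; have [G' hG'] := isFT_ex lf; have [l12F cF] := mcut_cvg hG'.
have [_ lG' _] := hG'.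
have e : (fun (N : nat) (u : R) => CInt `]N%:R^-1, N%:R[ (fun x => f x * cpow x (2^-1 + 'i * u%:C) / x%:C)) =
  fun N => FT (cutoff mcut (lg f) N).
  apply/funext => N; apply/funext => u; apply: mellin_cutoff; exact: l2_meas (l12F N).2.
have lF N : l2 mu (FT (cutoff mcut (lg f) N)) by have [] := bessel (l12F N).
rewrite /mellin_L2 e; split=> [/(L2lim_setT _ lF)[lG cG]|hG].
  by apply: isFT_ae hG'; [exact: l2_meas lf|exact: l2_meas lG|exact: aeW|exact: l2cvg_uniq lF lG' lG cF cG].
by have [_ lG _] := hG; apply/(L2lim_setT _ lF); split=> //; have [] := mcut_cvg hG.
Qed.

Definition ncut (N : nat) : set R := `](- N%:R), N%:R[%classic.

Lemma ncut_cvg f G : isFT f G ->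
  (forall N, l12 (cutoff ncut f N)) /\ l2cvg mu (fun N => FT (cutoff ncut f N)) G.
Proof.
apply: cutoff_cvg => [N|N t|t]; first exact: measurable_itv.
  by rewrite /ncut /= in_itv /= -natr1 => /andP[h1 h2]; apply/andP; split; lra.
exists (Num.truncn `|t|).+1 => N h; rewrite /ncut /= in_itv /= -ltr_norml.
by apply: lt_le_trans (truncnS_gt `|t|) _; rewrite ler_nat.
Qed.

Lemma inv_mellin_cutoff H N t : l12 (cutoff ncut H N) ->
  lg (fun x => (2 * pi)^-1%:C * CInt `](- N%:R), N%:R[ (fun u => H u * cpow x (- 2^-1 - 'i * u%:C))) t =
  (2 * pi)^-1%:C * FT (cutoff ncut H N) (- t).
Proof.
move=> [iH _]; rewrite /lg CInt_cI; last exact: measurable_itv.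
have i1 := cin_FT (- t) iH.
have e u : cutoff ncut H N u * cexp (ii * (- t)%:C * u%:C) * (expR (- (t / 2)))%:C =
   (\1_`](- N%:R), N%:R[ u)%:C * (H u * cpow (expR t) (- 2^-1 - 'i * u%:C)).
  rewrite cpowE ?expR_gt0 // expRK imaginaryE -cexp_real /cutoff -mulrA -cexpD -mulrA; congr (_ * (_ * cexp _)).
  by rewrite !rcN rcM rcV rcnat; ring.
rewrite -(cI_extR e) cIZr // -mulrA -[X in _ * X]mulrA -rcM -expRD addNr expR0 mulr1 //.
Qed.

(** Transforming the cutoffs of [H] again tends to $2\pi$ times the reflected preimage; the factor
    $(2\pi)^{-1}$ and the sign of the exponent undo both. *)
Lemma inv_mellin_isFT H k : l2 mu H -> inv_mellin_L2 H k <-> isFT (lg k) H.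
Proof.
move=> lH; have [K hK] := isFT_from_FT lH; have [lK _ _] := hK.
pose kN N x : C := (2 * pi)^-1%:C * CInt `](- N%:R), N%:R[ (fun u => H u * cpow x (- 2^-1 - 'i * u%:C)).
have [l12H _] := ncut_cvg (isFT_inv hK).
have e N : lg (kN N) = fun t => (2 * pi)^-1%:C * FT (cutoff ncut H N) (- t).
  by apply/funext => t; apply: inv_mellin_cutoff.
have lN N : l2 mu (lg (kN N)).
  by rewrite e; apply: l2Z; apply: l2_opp; have [] := bessel (l12H N).
have cN K' : isFT K' H -> l2cvg mu (fun N => lg (kN N)) K'.
  move=> hK'; have [_ c] := ncut_cvg (isFT_inv hK').
  have [_ lK' _] := isFT_inv hK'.
  have lD N : l2 mu (fun u => FT (cutoff ncut H N) u - (2 * pi)%:C * K' (- u)).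
    by apply: l2B lK'; have [] := bessel (l12H N).
  apply: (cvg0_squeeze _ (cvg0_const_mul (normc (2 * pi)^-1%:C ^+ 2) c)) => N; rewrite N2_ge0 /=.
  have -> : (fun t => lg (kN N) t - K' t) =
      fun t => (2 * pi)^-1%:C * (fun u => FT (cutoff ncut H N) u - (2 * pi)%:C * K' (- u)) (- t).
    apply/funext => t; rewrite e mulrBr mulrA -rcM mulVf ?mul1r ?opprK //.
    by rewrite mulf_neq0 ?gt_eqF ?pi_gt0.
  rewrite N2Z; last exact: (l2_opp (lD N)).
  by rewrite (N2_opp (l2_meas (lD N))).
have -> : inv_mellin_L2 H k <-> l2 mu (lg k) /\ l2cvg mu (fun N => lg (kN N)) (lg k) by exact: L2lim_lg.
have cK := cN _ hK; split=> [[lk ck]|hk].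
  by apply: isFT_ae hK; [exact: l2_meas lk|exact: l2_meas lH|exact: l2cvg_uniq lN lK lk cK ck|exact: aeW].
by have [lk _ _] := hk; split=> //; exact: cN.
Qed.
End MellinFourier.

(** * The operator of the theorem and its three conditions *)

Section ThetaOperator.
Variable R : realType.
Local Notation C := R[i].
Local Notation mu := (@lebesgue_measure R).
Local Notation PX := (@PX R).
Local Notation D := (`]0, +oo[%classic : set R).
Implicit Types f g h k G H : R -> C.

(* Integrability is not assumed: both sides are [0] when the integral diverges. *)
Lemma rIZ_gt0 (c : R) (g : R -> R) : 0 < c -> rmeas g -> rI mu (fun x => c * g x) = c * rI mu g.
Proof.
move=> c0 mg; rewrite !rI_def; have c0' := ltW c0.
have mE : measurable_fun setT (fun x => (g x)%:E) by exact/measurable_EFinP.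
rewrite integralE [in RHS]integralE.
have -> : (fun x => (c * g x)%:E) = (fun x => (c%:E * (g x)%:E)%E) by apply/funext => x; rewrite EFinM.
rewrite (ge0_funeposM _ c0') (ge0_funenegM _ c0').
rewrite !ge0_integralZl_EFin //; [|exact: measurable_funeneg|exact: measurable_funepos].
have p0 : (0 <= \int[mu]_x (fun x => (g x)%:E)^\+ x)%E by apply: integral_ge0.
have n0 : (0 <= \int[mu]_x (fun x => (g x)%:E)^\- x)%E by apply: integral_ge0.
move: p0 n0; set a := integral _ _ _; set b := integral _ _ _.
move: a b => [a| |] [b| |] //= _ _; rewrite ?gt0_muley ?lte_fin //= ?mulr0 //.
by rewrite mulrBr.
Qed.

Lemma cIZ_gt0 (c : R) f : 0 < c -> lmeas f -> cI mu (fun x => c%:C * f x) = c%:C * cI mu f.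
Proof.
move=> c0 [m1 m2]; apply: complexP.
  rewrite ReMr !cI_ReE -rIZ_gt0 //; congr rI; apply/funext => x; exact: ReMr.
rewrite ImMr !cI_ImE -rIZ_gt0 //; congr rI; apply/funext => x; exact: ImMr.
Qed.

Variables (w : R) (w0 : 0 < w).
Local Notation eta := (eta w).
Local Notation pN := (pN w).
Local Notation pD := (pD w).

Lemma lmeas_eta : lmeas eta.
Proof.
have h : Re (- (w + 3)%:C : C) = - (w + 3) by [].
by have [i _] := eta_MT w0 h; exact: mtin_lmeas i.
Qed.

(** The equality holds at every [t], including points where the integral diverges: the positive
    scalar $e^{-t/2}$ is extracted by [cIZ_gt0], which respects the default value. *)
Lemma lg_hconv f t : lmeas (lg f) -> lg (hconv (h_w w) f) t = cv eta (lg f) t.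
Proof.
move=> mf; rewrite (cvC _ lmeas_eta mf) /lg.
pose c := expR (- (t / 2)); pose F (v : R) : C := lg f v * eta (t - v).
have mF : lmeas F by apply: cmeasM => //; exact: lmeas_comp lmeas_eta (rmeas_csub t).
have e v : c%:C * F v = (expR v)%:C * ((h_w w (expR t / expR v))%:C * f (expR v) / (expR v)%:C).
  have ne : (expR v)%:C != 0 :> C by rewrite rc_eq0 gt_eqF // expR_gt0.
  rewrite /F /lg /eta -expRB (rcM (h_w _ _)).
  have -> : c%:C * (f (expR v) * (expR (v / 2))%:C * ((h_w w (expR (t - v)))%:C * (expR ((t - v) / 2))%:C)) =
     (c * (expR (v / 2) * expR ((t - v) / 2)))%:C * ((h_w w (expR (t - v)))%:C * f (expR v)) by rewrite !rcM; ring.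
  rewrite /c -!expRD (_ : _ + _ = 0) ?expR0 ?mul1r; last by field.
  by field.
rewrite /hconv CInt_exp; last first.
  by apply: (lmeas_ext e); apply: cmeasM mF; exact: cmeas_cst.
rewrite -(cI_extR e) cIZ_gt0 ?expR_gt0 // mulrC mulrA -rcM -expRD addrN expR0 mul1r //.
Qed.

Lemma MT_pN s : MT pN s = MT PX (w%:C + s).
Proof. exact: MT_expM. Qed.
Lemma MT_pD s : MT pD s = MT PX (s - w%:C).
Proof. by rewrite /pD MT_expM rcN addrC. Qed.
Lemma MT_PX_opp s : MT PX (- s) = MT PX s.
Proof. by apply: MT_opp; [exact: (sexp_PX R).1|exact: PX_even]. Qed.

Lemma PX_conj s : MT PX s^*%C = (MT PX s)^*%C.
Proof.
rewrite /MT -cI_conj; last exact: (sexp_mtin s (sexp_PX R)).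
by apply: cI_extR => t; rewrite conjcM cexp_conj conjcM !conjc_real.
Qed.

Lemma sexp_pN : sexp pN. Proof. exact: sexp_expM (sexp_PX R). Qed.
Lemma sexp_pD : sexp pD. Proof. exact: sexp_expM (sexp_PX R). Qed.

Lemma pD_not_ae0 : ~ (\forall t \ae mu, pD t = 0).
Proof.
move=> h; apply: (@PX_not_ae0 R); apply: ae_mono h => t h0.
have /eqP : PX t * cexp ((- w)%:C * t%:C) = 0 by [].
by rewrite mulf_eq0 (negbTE (cexp_neq0 _)) orbF => /eqP.
Qed.

(** [PX] is real and even, and $w+iu$ and $-w+iu$ differ by a sign and a conjugation. *)
Lemma normc_FT_pN_pD u : normc (FT pN u) = normc (FT pD u).
Proof.
rewrite /FT MT_pN MT_pD -normc_conj -PX_conj -MT_PX_opp; congr (normc (MT _ _)).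
by apply: complexP => /=; ring.
Qed.

Variables (xi : C -> C) (hxi : is_riemann_xi xi).

Lemma ThetaNumE z : ThetaNum xi w z = Nm pN z.
Proof.
by rewrite /ThetaNum /Nm (xi_kernel hxi) MT_pN -MT_PX_opp imaginaryE; congr MT; ring.
Qed.
Lemma ThetaDenE z : ThetaDen xi w z = Dn pD z.
Proof.
by rewrite /ThetaDen /Dn (xi_kernel hxi) MT_pD -MT_PX_opp imaginaryE; congr MT; ring.
Qed.

Lemma meromorphic_inner_ext :
  meromorphic_inner (ThetaNum xi w) (ThetaDen xi w) <-> exists F, inner_extension pN pD F.
Proof.
split=> [[F [h1 [h2 [h3 h4]]]]|[F [h1 h2 h3 h4]]]; exists F.
  split=> // [z z0|z z0 Dz]; first exact/holo_cdiff/h1.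
  by rewrite -ThetaNumE -ThetaDenE; apply: h3 => //; rewrite ThetaDenE.
split; first by move=> z z0; exact/cdiff_holo/h1.
split=> //; split=> // z z0; rewrite ThetaDenE ThetaNumE; exact: h3.
Qed.

Lemma ThetaHat_TT f k : l2 mu (lg f) -> ThetaHat xi w f k <-> TT pN pD (lg f) (lg k).
Proof.
move=> lf; have eT G : (fun u => ThetaR xi w u * G u) = (fun u => Th pN pD u * G u).
  by apply/funext => u; rewrite /ThetaR ThetaNumE ThetaDenE.
have lT G : l2 mu G -> l2 mu (fun u => Th pN pD u * G u).
  by move=> lG; have [] := l2_Th sexp_pN sexp_pD normc_FT_pN_pD lG.
split=> [[G [/(mellin_isFT _ lf) hG hk]]|[G [hG hk]]]; exists G; have [_ lG _] := hG; split=> //.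
- by apply/(inv_mellin_isFT _ (lT _ lG)); rewrite -eT.
- exact/(mellin_isFT _ lf).
- by rewrite eT; apply/(inv_mellin_isFT _ (lT _ lG)).
Qed.

Lemma L2_one_infty_lg f : L2_one_infty f -> l2 mu (lg f) /\ causal (lg f).
Proof.
case=> /L2on_lg lf hf; split=> // t t0; rewrite /lg hf ?mul0r //.
by rewrite -expR0 ler_expR.
Qed.
Lemma L2_one_infty_unlg g : l2 mu g -> causal g -> L2_one_infty (unlg g).
Proof.
move=> lg0 cg; split; first by apply/L2on_lg; apply: l2_extR lg0 => t; rewrite lg_unlg.
by move=> x x1; rewrite /unlg; case: ltP => // x0; rewrite cg ?mul0r // ln_le0.
Qed.
Lemma lg_unlg_fun g : lg (unlg g) = g.
Proof. by apply/funext => t; exact: lg_unlg. Qed.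
Lemma lg_eq0 f t : (lg f t = 0) <-> (f (expR t) = 0).
Proof.
split=> [/eqP|h]; last by rewrite /lg h mul0r.
by rewrite mulf_eq0 rc_eq0 (gt_eqF (expR_gt0 _)) orbF => /eqP.
Qed.
Lemma lg_inj f g t : (lg f t = lg g t) <-> (f (expR t) = g (expR t)).
Proof.
split=> [/eqP|h]; last by rewrite /lg h.
by rewrite -subr_eq0 -lgB => /eqP/lg_eq0/eqP; rewrite subr_eq0 => /eqP.
Qed.

Let inner_op : (exists F, inner_extension pN pD F) <-> causal_op pN pD.
Proof.
split=> [[F]|]; first exact: inner_causal sexp_pN sexp_pD pD_not_ae0 normc_FT_pN_pD F.
exact: causal_inner sexp_pN sexp_pD pD_not_ae0 normc_FT_pN_pD.
Qed.

(** The logarithm carries $0<x<1$ to $t<0$, and [unlg] realises every causal function as an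
    admissible [f]. *)
Lemma causal_op_cond2 : causal_op pN pD <-> cond2 xi w.
Proof.
split=> h f.
  move=> /L2_one_infty_lg[lf cf] k /(ThetaHat_TT _ lf) hk.
  have := h _ lf cf _ hk => hae.
  have : \forall x \ae mu, 0 < x -> (x < 1 -> k x = 0).
    apply/ae_exp; apply: ae_mono hae => t ht t1; apply/lg_eq0; apply: ht.
    by rewrite -ltr_expR expR0.
  by apply: ae_mono => x hx /andP[]; exact: hx.
move=> lf cf k hT; have hf := L2_one_infty_unlg lf cf.
have hk : ThetaHat xi w (unlg f) (unlg k) by apply/ThetaHat_TT; rewrite !lg_unlg_fun.
have hae : \forall x \ae mu, 0 < x -> (x < 1 -> unlg k x = 0).
  by apply: ae_mono (h _ hf _ hk) => x hx x0 x1; apply: hx; rewrite x0.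
move/ae_exp: hae; apply: ae_mono => t ht t0; rewrite -(lg_unlg k); apply/lg_eq0; apply: ht.
by rewrite -[ltRHS]expR0 ltr_expR.
Qed.

Let w3_gt0 : 0 < w + 3. Proof. by rewrite addr_gt0. Qed.
Let ieta : mtin eta (- (w + 3)%:C).
Proof. by have [] := eta_MT w0 (erefl : Re (- (w + 3)%:C : C) = - (w + 3)). Qed.
Let factor s : Re s = - (w + 3) -> MT pD s * MT eta s = MT pN s.
Proof. by move=> hs; have [] := eta_MT w0 hs. Qed.

Lemma causal_op_cond1 : causal_op pN pD <-> cond1 xi w.
Proof.
rewrite (causal_iff_conv sexp_pN sexp_pD pD_not_ae0 (causal_eta w) w3_gt0 ieta factor).
split=> h f.
  move=> /L2_one_infty_lg[lf cf] k /(ThetaHat_TT _ lf) hk.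
  apply/ae_exp; apply: ae_mono (h _ lf cf _ hk) => t ht.
  by apply/lg_inj; rewrite ht lg_hconv //; exact: l2_meas lf.
move=> lf cf k hT; have hf := L2_one_infty_unlg lf cf.
have hk : ThetaHat xi w (unlg f) (unlg k) by apply/ThetaHat_TT; rewrite !lg_unlg_fun.
have /ae_exp := h _ hf _ hk; apply: ae_mono => t /lg_inj.
by rewrite lg_unlg lg_hconv lg_unlg_fun //; exact: l2_meas lf.
Qed.

Lemma causal_op_cond3 : causal_op pN pD <-> cond3 w.
Proof.
rewrite (causal_iff_l2 sexp_pN sexp_pD pD_not_ae0 normc_FT_pN_pD (causal_eta w) w3_gt0 ieta factor).
have e f : l2 mu (lg f) -> lg (hconv (h_w w) f) = cv eta (lg f).
  by move=> lf; apply/funext => t; rewrite lg_hconv //; exact: l2_meas lf.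
split=> h f.
  by move=> /L2_one_infty_lg[lf cf]; apply/L2on_lg; rewrite (e _ lf); exact: h.
move=> lf cf; have /L2on_lg := h _ (L2_one_infty_unlg lf cf).
by rewrite e lg_unlg_fun.
Qed.

Lemma meromorphic_inner_causal :
  meromorphic_inner (ThetaNum xi w) (ThetaDen xi w) <-> causal_op pN pD.
Proof. by rewrite meromorphic_inner_ext; exact: inner_op. Qed.

End ThetaOperator.

Theorem theorem2p2 (R : realType) (xi : R[i] -> R[i]) (w : R) :
  is_riemann_xi xi -> 0 < w ->
  (meromorphic_inner (ThetaNum xi w) (ThetaDen xi w) <-> cond1 xi w) /\
  (meromorphic_inner (ThetaNum xi w) (ThetaDen xi w) <-> cond2 xi w) /\
  (meromorphic_inner (ThetaNum xi w) (ThetaDen xi w) <-> cond3 w).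
Proof.
move=> hxi w0; rewrite !(meromorphic_inner_causal w hxi); split; last split.
- exact: causal_op_cond1.
- exact: causal_op_cond2.
- exact: causal_op_cond3.
Qed.
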